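(* Let $d\geq2$ be an integer, $2\leq p<\infty$ and $j\in\{1,\ldots,d\}$. Then for every $f\in L^p(\mathbb{R}^d)$, $$\|R_j^*f\|_{L^p}\leq \left(2+\frac{1}{\sqrt{2}}\right)^{\frac{2}{p}}\|R_jf\|_{L^p}.$$
   Context: For $t>0$ and $j\in\{1,\dots,d\}$ the truncated Riesz transform is $$R_j^tf(x)=\frac{\Gamma\left(\frac{d+1}{2}\right)}{\pi^{\frac{d+1}{2}}}\int_{|x-y|>t}\frac{x_j-y_j}{|x-y|^{d+1}}f(y)\,\mathrm{d}y ,$$ and the maximal truncated Riesz transform is $R_j^*f(x)=\sup_{t>0}|R_j^tf(x)|$. The $j$th Riesz transform is $R_jf(x)=\lim_{t\to0^+}R_j^tf(x)$ for Schwartz functions $f$ on $\mathbb{R}^d$; it satisfies $\|R_jf\|_{L^p}\le C\|f\|_{L^p}$ for $1<p<\infty$ with $C$ independent of $f$, and is extended by density to a bounded operator on $L^p(\mathbb{R}^d)$. Norms are those of $L^p(\mathbb{R}^d)$. *)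

(* Defs.v *)
From HB Require Import structures.
From mathcomp Require Import all_boot all_order all_algebra.
From mathcomp Require Import all_classical all_reals all_analysis.
From mathcomp Require Import complex.
Set Implicit Arguments.
Unset Strict Implicit.
Unset Printing Implicit Defensive.
Import Order.TTheory GRing.Theory Num.Theory.
Import numFieldNormedType.Exports.

Local Open Scope complex_scope.
Local Open Scope classical_set_scope.
Local Open Scope ring_scope.

(* R^n is 'rV[R]_n with the sigma-algebra generated by the coordinates, as the
   library does for tuples; the topology and the derivatives are the library's.
   The norm `|x| of 'rV[R]_n is the sup norm, hence enorm below. *)
Section measurable_rV.
Context {R : realType}.
Variable n : nat.

Let coord (i : 'I_n) (x : 'rV[R]_n) : measurableTypeR R := x ord0 i.

Let rV_set0 : g_sigma_preimage coord set0.
Proof. exact: sigma_algebra0. Qed.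

Let rV_setC A : g_sigma_preimage coord A -> g_sigma_preimage coord (~` A).
Proof. exact: sigma_algebraC. Qed.

Let rV_bigcup (F : _^nat) : (forall i, g_sigma_preimage coord (F i)) ->
  g_sigma_preimage coord (\bigcup_i (F i)).
Proof. exact: sigma_algebra_bigcup. Qed.

HB.instance Definition _ := @isMeasurable.Build default_measure_display
  'rV[R]_n (g_sigma_preimage coord) rV_set0 rV_setC rV_bigcup.

End measurable_rV.

Section rV_coordinates.
Context {R : realType}.
Let RT := measurableTypeR R.

Lemma measurable_rV_coord n (i : 'I_n) :
  measurable_fun [set: 'rV[R]_n] (fun x => x ord0 i : RT).
Proof.
move=> _ Y mY; rewrite setTI; apply: sub_sigma_algebra => /=.
rewrite -bigcup_seq/=; exists i => /=; first by rewrite mem_index_enum.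
by exists Y => //; rewrite setTI.
Qed.

Lemma measurable_fun_rV d (T : measurableType d) n (f : T -> 'rV[R]_n) :
  (forall i, measurable_fun [set: T] (fun t => f t ord0 i : RT)) ->
  measurable_fun [set: T] f.
Proof.
move=> mf _ A mA; rewrite setTI.
have : preimage_set_system [set: T] f
    (g_sigma_preimage (fun (i : 'I_n) (x : 'rV[R]_n) => x ord0 i : RT)) (f @^-1` A).
  by exists A => //; rewrite setTI.
rewrite -g_sigma_preimage_comp; apply: smallest_sub.
  exact: sigma_algebra_measurable.
move=> B; rewrite -bigcup_seq => -[i _ [C mC <-]]; exact: mf.
Qed.

Definition rV_cons n (xv : RT * 'rV[R]_n) : 'rV[R]_n.+1 :=
  row_mx (xv.1%:M : 'rV[R]_1) xv.2.

Definition rV_uncons n (x : 'rV[R]_n.+1) : RT * 'rV[R]_n :=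
  (x ord0 ord0, rsubmx (x : 'rV[R]_(1 + n))).

Lemma rV_cons_ord0 n (xv : RT * 'rV[R]_n) : rV_cons xv ord0 ord0 = xv.1.
Proof.
rewrite /rV_cons (_ : ord0 = lshift n ord0 :> 'I_(1 + n)); last exact: val_inj.
by rewrite [LHS](@row_mxEl R 1 1 n) mxE eqxx mulr1n.
Qed.

Lemma rV_cons_lift n (xv : RT * 'rV[R]_n) i :
  rV_cons xv ord0 (lift ord0 i) = xv.2 ord0 i.
Proof.
rewrite /rV_cons (_ : lift ord0 i = rshift 1 i); last exact: val_inj.
by rewrite (@row_mxEr R 1 1 n).
Qed.

Lemma rV_consK n : cancel (@rV_cons n) (@rV_uncons n).
Proof.
by move=> [x v]; rewrite /rV_uncons rV_cons_ord0 /rV_cons (@row_mxKr R 1 1 n).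
Qed.

Lemma measurable_rV_cons n : measurable_fun setT (@rV_cons n).
Proof.
apply: measurable_fun_rV => i; case: (unliftP ord0 i) => [j|] ->.
  under eq_fun do rewrite rV_cons_lift.
  exact: (measurableT_comp (measurable_rV_coord j) measurable_snd).
by under eq_fun do rewrite rV_cons_ord0; exact: measurable_fst.
Qed.

Lemma measurable_rV_uncons n : measurable_fun setT (@rV_uncons n).
Proof.
apply/measurable_fun_pairP; split => /=; first exact: measurable_rV_coord.
apply: measurable_fun_rV => i /=.
rewrite (_ : (fun _ => _) = fun x : 'rV[R]_n.+1 => x ord0 (rshift 1 i)); last first.
  by apply/funext => x; rewrite /comp/= mxE.
exact: measurable_rV_coord.
Qed.

End rV_coordinates.

Section lebesgue_rV.
Local Open Scope ereal_scope.
Context {R : realType}.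

Section step.
Variables (n : nat) (mu : {sigma_finite_measure set 'rV[R]_n -> \bar R}).

Let prodm : {measure set (measurableTypeR R * 'rV[R]_n)%type -> \bar R} :=
  lebesgue_measure \x mu.

Definition lebesgue_rV_step : set 'rV[R]_n.+1 -> \bar R :=
  pushforward (lebesgue_measure \x mu) (@rV_cons R n).

Let mcons (A : set 'rV[R]_n.+1) : measurable A ->
  measurable (@rV_cons R n @^-1` A).
Proof. by move=> mA; rewrite -[X in measurable X]setTI; exact: measurable_rV_cons. Qed.

Let step0 : lebesgue_rV_step set0 = 0.
Proof. by rewrite /lebesgue_rV_step /pushforward preimage_set0 (measure0 prodm). Qed.

Let step_ge0 A : 0 <= lebesgue_rV_step A.
Proof. exact: (measure_ge0 prodm). Qed.

Let step_sigma_additive : semi_sigma_additive lebesgue_rV_step.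
Proof.
move=> F mF tF mUF; rewrite /lebesgue_rV_step /pushforward preimage_bigcup.
apply: (@measure_semi_sigma_additive _ _ _ prodm).
- by move=> k; exact: mcons.
- apply/trivIsetP => /= i j _ _ ij; rewrite -preimage_setI.
  by move/trivIsetP : tF => /(_ _ _ _ _ ij) ->//; rewrite preimage_set0.
- by rewrite -preimage_bigcup; exact: mcons.
Qed.

HB.instance Definition _ := isMeasure.Build _ _ _ lebesgue_rV_step
  step0 step_ge0 step_sigma_additive.

Let step_sigma_finite : sigma_finite setT lebesgue_rV_step.
Proof.
have [F FT Foo] : sigma_finite setT prodm.
  have /sigma_finiteP[G [GT ndG Goo]] := sigma_finiteT mu.
  have /sigma_finiteP[F [FT ndF Foo]] := sigma_finiteT (@lebesgue_measure R).
  exists (fun k => F k `*` G k) => [|k].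
    apply/esym/seteqP; split => // -[x y] _.
    have [i _ Fix] : (\bigcup_i F i) x by rewrite -FT.
    have [j _ Gjy] : (\bigcup_j G j) y by rewrite -GT.
    exists (maxn i j) => //; split => /=.
    - by move: x Fix; exact/subsetPset/ndF/leq_maxl.
    - by move: y Gjy; exact/subsetPset/ndG/leq_maxr.
  have [mF Fk] := Foo k; have [mG Gk] := Goo k.
  split; first exact: measurableX.
  by rewrite /prodm/= product_measure1E// lte_mul_pinfty// ge0_fin_numE.
exists (fun k => @rV_uncons R n @^-1` F k).
  by rewrite -preimage_bigcup -FT preimage_setT.
move=> k; have [mF Fk] := Foo k; split.
  by rewrite -[X in measurable X]setTI; exact: measurable_rV_uncons.
rewrite /lebesgue_rV_step /pushforward -comp_preimage.
by rewrite (_ : _ \o _ = id)//; apply/funext/rV_consK.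
Qed.

HB.instance Definition _ := Measure_isSigmaFinite.Build _ _ _ lebesgue_rV_step
  step_sigma_finite.

End step.

(* Iterated product of the one-dimensional Lebesgue measure; lebesgue_rV_box
   below characterizes it. *)
Fixpoint lebesgue_rV (n : nat) : {sigma_finite_measure set 'rV[R]_n -> \bar R} :=
  match n with
  | 0 => \d_(0%R : 'rV[R]_0)
  | n'.+1 => lebesgue_rV_step (lebesgue_rV n')
  end.

Lemma lebesgue_rV_box n (A : 'I_n -> set R) :
  (forall i, measurable (A i : set (measurableTypeR R))) ->
  lebesgue_rV n [set x | forall i, A i (x ord0 i)] =
    \prod_(i < n) lebesgue_measure (A i).
Proof.
elim: n => [|n IH] in A * => mA.
  by rewrite big_ord0 /= diracE mem_set// => -[].
rewrite big_ord_recl -IH// /= /lebesgue_rV_step /pushforward.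
have mB : measurable [set v : 'rV[R]_n | forall i, A (lift ord0 i) (v ord0 i)].
  rewrite [X in measurable X](_ : _ = \bigcap_(i : 'I_n)
      ((fun v : 'rV[R]_n => v ord0 i) @^-1` A (lift ord0 i))); last first.
    by apply/seteqP; split => v /= Av; [move=> i _; exact: Av|move=> i; exact: Av].
  apply: fin_bigcap_measurable => [|i _]; first exact: finite_finset.
  rewrite -[X in measurable X]setTI.
  exact: (measurable_rV_coord _ measurableT (mA (lift ord0 i))).
rewrite -(product_measure1E _ _ (mA ord0) mB).
congr ((_ \x _) _); apply/seteqP; split => xv /= => [Axv|[Ax Av] i].
  split; first by have := Axv ord0; rewrite rV_cons_ord0.
  by move=> i; have := Axv (lift ord0 i); rewrite rV_cons_lift.
by case: (unliftP ord0 i) => [j|] ->; rewrite (rV_cons_lift, rV_cons_ord0).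
Qed.

End lebesgue_rV.

Section complex_valued.
Context {R : realType}.

Definition cintegral d (T : measurableType d) (mu : {measure set T -> \bar R})
    (D : set T) (f : T -> R[i]) : R[i] :=
  (\int[mu]_(x in D) complex.Re (f x)) +i* (\int[mu]_(x in D) complex.Im (f x)).

Definition clim {T : Type} (F : set_system T) (f : T -> R[i]) : R[i] :=
  lim (complex.Re (f t) @[t --> F]) +i* lim (complex.Im (f t) @[t --> F]).

Definition cmeasurable d (T : measurableType d) (f : T -> R[i]) : Prop :=
  measurable_fun [set: T] (fun x => complex.Re (f x)) /\
  measurable_fun [set: T] (fun x => complex.Im (f x)).

End complex_valued.

Section Riesz_transform.
Context {R : realType}.

Definition Gamma (s : R) : R :=
  \int[lebesgue_measure]_(x in `]0, +oo[) (x `^ (s - 1) * expR (- x)).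

Variable d : nat.
Local Notation leb := (@lebesgue_rV R d).
Implicit Types (x y : 'rV[R]_d) (f g : 'rV[R]_d -> R[i]) (j : 'I_d) (p t : R).

Definition enorm x : R := Num.sqrt (\sum_(i < d) x ord0 i ^+ 2).

Definition cLnorm p f : \bar R := ('N[leb]_(p%:E)[(fun x => (Normc.normc (f x))%:E)])%E.

Definition in_Lp p f : Prop := cmeasurable f /\ (cLnorm p f < +oo)%E.

Definition cvg_Lp p (fn : nat -> 'rV[R]_d -> R[i]) f : Prop :=
  cLnorm p (fun x => fn n x - f x) @[n --> \oo] --> 0%E.

(* The partial derivative of u along the multi-index listed by s. *)
Definition partials (s : seq 'I_d) (u : 'rV[R]_d -> R) : 'rV[R]_d -> R :=
  foldr (fun i v => 'D_(delta_mx ord0 i) v) u s.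

Definition schwartz_real (u : 'rV[R]_d -> R) : Prop :=
  forall s : seq 'I_d,
    (forall x, differentiable (partials s u) x) /\
    (forall k : nat, exists M : R,
      forall x, enorm x ^+ k * `|partials s u x| <= M).

Definition schwartz f : Prop :=
  schwartz_real (fun x => complex.Re (f x)) /\
  schwartz_real (fun x => complex.Im (f x)).

Definition riesz_trunc j t f x : R[i] :=
  (Gamma (d.+1%:R / 2) / pi `^ (d.+1%:R / 2))%:C *
  cintegral leb [set y | t < enorm (x - y)]
    (fun y => ((x ord0 j - y ord0 j) / enorm (x - y) ^+ d.+1)%:C * f y).

Definition riesz_max j f x : \bar R :=
  ereal_sup [set (Normc.normc (riesz_trunc j t f x))%:E | t in [set t | 0 < t]].

Definition riesz_pv j f x : R[i] := clim 0^'+ (fun t => riesz_trunc j t f x).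

(* g represents the class R_j f, where R_j is the extension by density of
   riesz_pv from Schwartz functions to L^p: the pair (f, g) is the limit in
   L^p x L^p of pairs (h, riesz_pv j h) with h Schwartz.  As R_j is bounded for
   1 < p < +oo, such a g exists for every f in L^p, is unique almost everywhere
   and does not depend on the approximating sequence. *)
Definition riesz_transform p j f g : Prop :=
  in_Lp p f /\ in_Lp p g /\
  exists fn : nat -> 'rV[R]_d -> R[i],
    [/\ forall n, schwartz (fn n),
        cvg_Lp p fn f &
        cvg_Lp p (fun n => riesz_pv j (fn n)) g].

End Riesz_transform.

(* Main.v *)
(* Regard R^d as the hyperplane Z_0 = 0 of R^(d+1) and let E(Z) = Z / |Z|^(d+1).
   On that hyperplane the horizontal components of E are the Riesz kernels;
   E_0 is the Poisson kernel.  Integrating the divergence of Maxwell's stress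
   tensor of two radial fields over the half-space yields a reproducing formula
   for E; over the whole space it yields, for every T > 0, densities r >= 0 of
   mass at most 1 with r * E = m(|.|^2) E, where 0 <= m <= 1 approximates the
   indicator of ]T, +oo[.  The kernels K(w) = c \int r(V) |E_0(w + V)| dV are
   symmetric of mass at most 1, and K * R_j u is a smooth truncation of R_j u, so
   that R_j^* u <= sup_a K_a * |R_j u| for Schwartz u and a countable family
   (K_a).  Because E_0 is odd under reflection in the hyperplane,
   K_a * K_b <= K_a + K_b.
   For such a family write a finite maximum as M = sum_a e_a K_a h with
   e_a >= 0 and sum_a e_a <= 1, and put S = sum_a K_a (e_a M).  Then
   \int M^2 = \int h S and \int S^2 <= 2 \int M S, hence
   \int M^2 <= 4 \int h^2; Jensen's inequality turns the exponent 2 into p >= 2.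
   Hoelder's inequality and Fatou's lemma extend the bound from Schwartz
   functions to L^p, with the constant 4^(1/p) <= (2 + 1/sqrt 2)^(2/p). *)
Require Import Defs.
From HB Require Import structures.
From mathcomp Require Import all_boot all_order all_algebra.
From mathcomp Require Import all_classical all_reals all_analysis.
From mathcomp Require Import complex.
From mathcomp Require Import measurable_realfun ring lra.
Set Implicit Arguments.
Unset Strict Implicit.
Unset Printing Implicit Defensive.
Import Order.TTheory GRing.Theory Num.Theory.
Import numFieldNormedType.Exports.

Local Open Scope classical_set_scope.
Local Open Scope ring_scope.

(** * Affine changes of variables *)

(** Three points shape the proof. (1) The Poisson average of [R_j u] at height a is, up to a
    constant, the convolution of [u] with the horizontal field [E_j] at height a. Averaging over
    points V with weights r replaces [E_j] by the field of the mass distribution r; by Gauss's law a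
    positive radial mass can have a field that is almost 0 near the origin and almost E far away.
    This is how a truncation factors through a positive kernel. (2) The identities between fields
    are instances of one reciprocity, the flux of a stress tensor. It needs bounded differentiable
    fields, so E is softened to Z / (e + |Z|^2)^((n+1)/2), whose divergence is an approximate
    identity as e tends to 0. No sphere area is computed: [kappa] is the mass of this divergence,
    whatever it is. (3) The maximal inequality is a duality argument: S is the adjoint of the
    linearised maximal operator applied to M. The convolution inequality bounds the norm of S by
    twice that of M, whatever the number of kernels, and this 2 is the square root of the 4. *)

Section affine_1d.
Context {R : realType}.
Local Notation mu := (@lebesgue_measure R).
Local Open Scope ereal_scope.

Lemma measurable_affine (l c : R) :
  measurable_fun [set: measurableTypeR R] (fun x : measurableTypeR R => l * x + c : measurableTypeR R)%R.
Proof. by apply: (@measurable_funD _ _ _ _ (fun x => l * x)%R (cst c)) => //; exact: mulrl_measurable. Qed.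

(** Lebesgue measure is determined by its values on the intervals []a, b]], so it is enough to
    compare it there with the pushforward rescaled by [|l|]. A negative slope turns the preimage
    into an interval closed on the left, of the same measure. *)
Lemma lebesgue_measure_affine (l c : R) (A : set (measurableTypeR R)) :
  l != 0%R -> measurable A ->
  mu A = `|l|%:E * mu ((fun x => l * x + c)%R @^-1` A).
Proof.
move=> l0 mA.
have l0' : (0 <= `|l|)%R by [].
pose nl := NngNum l0'.
pose phi : measurableTypeR R -> measurableTypeR R := (fun x => l * x + c)%R.
have mphi : measurable_fun [set: measurableTypeR R] phi by exact: measurable_affine.
pose nu : {measure set (measurableTypeR R) -> \bar R} :=
  mscale nl (measure_function_pushforward__canonical__measure_function_Measure mu mphi).
apply: (@lebesgue_measure_unique _ nu) => // _ [[a b]] _ <-.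
rewrite /nu /= /mscale [nl%:num]/= lebesgue_measure_itv/= lte_fin.
rewrite -[pushforward _ _ _]/(mu (phi @^-1` `]a, b]%classic)).
have [lp|ln] := ltrP 0 l.
  rewrite [X in mu X](_ : _ = [set` `](a - c) / l, (b - c) / l]%R]); last first.
    apply/seteqP; split => x /=; rewrite !in_itv/= /phi ltr_pdivrMr// ler_pdivlMr//
      ltrBlDr lerBrDr mulrC//.
  rewrite lebesgue_measure_itv/= lte_fin ltr_pM2r ?invr_gt0// ltrD2r.
  case: ifPn => // _; last by rewrite mule0.
  rewrite -EFinB -EFinM gtr0_norm//; congr EFin; field.
  exact: lt0r_neq0.
have {}ln : (l < 0)%R by rewrite lt_neqAle l0.
rewrite [X in mu X](_ : _ = [set` `[(b - c) / l, (a - c) / l[%R]); last first.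
  apply/seteqP; split => x /=; rewrite !in_itv/= /phi ler_ndivrMr// ltr_ndivlMr//
    ltrBlDr lerBrDr mulrC andbC//.
rewrite lebesgue_measure_itv/= lte_fin ltr_nM2r ?invr_lt0// ltrD2r.
case: ifPn => // _; last by rewrite mule0.
rewrite -EFinB -EFinM ltr0_norm//; congr EFin; field.
exact: ltr0_neq0.
Qed.

Lemma ge0_integral_affine1 (l c : R) (f : measurableTypeR R -> \bar R) :
  l != 0%R -> measurable_fun setT f -> (forall x, 0 <= f x) ->
  \int[mu]_x f x = `|l|%:E * \int[mu]_x f (l * x + c)%R.
Proof.
move=> l0 mf f0.
have l0' : (0 <= `|l|)%R by [].
pose nl := NngNum l0'.
pose phi : measurableTypeR R -> measurableTypeR R := (fun x => l * x + c)%R.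
have mphi : measurable_fun [set: measurableTypeR R] phi by exact: measurable_affine.
pose nu : {measure set (measurableTypeR R) -> \bar R} :=
  mscale nl (measure_function_pushforward__canonical__measure_function_Measure mu mphi).
transitivity (\int[nu]_x f x).
  by apply: eq_measure_integral => A mA _; exact: lebesgue_measure_affine.
rewrite ge0_integral_mscale//=; congr (_ * _).
by rewrite (ge0_integral_pushforward mphi).
Qed.

End affine_1d.


Section fubini_rV.
Context {R : realType}.
Local Open Scope ereal_scope.
Variable n : nat.

Let prodm : {measure set (measurableTypeR R * 'rV[R]_n)%type -> \bar R} :=
  lebesgue_measure \x (@lebesgue_rV R n).

Lemma measurable_comp_rV_cons (f : 'rV[R]_n.+1 -> \bar R) :
  measurable_fun setT f ->
  measurable_fun setT (fun yz : measurableTypeR R * 'rV[R]_n => f (rV_cons yz)).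
Proof. by move=> mf; apply: (measurableT_comp mf); exact: measurable_rV_cons. Qed.

Lemma ge0_integral_rV_cons (f : 'rV[R]_n.+1 -> \bar R) :
  measurable_fun setT f -> (forall x, 0 <= f x) ->
  \int[lebesgue_rV n.+1]_x f x =
  \int[lebesgue_measure]_y \int[lebesgue_rV n]_z f (rV_cons (y, z)).
Proof.
move=> mf f0.
transitivity (\int[prodm]_x (f \o @rV_cons R n) x).
  rewrite -[setT in RHS](preimage_setT (@rV_cons R n)).
  by rewrite -(ge0_integral_pushforward (@measurable_rV_cons R n)).
by apply: (fubini_tonelli1 (f \o @rV_cons R n)) => [|x]; [exact: measurable_comp_rV_cons|exact: f0].
Qed.

End fubini_rV.

(** Induction on the dimension, splitting off coordinate 0 by Tonelli. Diagonal maps are enough: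
    translations, dilations, point reflections, the mirror image in the hyperplane and the
    stretching of a single coordinate are all of this form. *)
Lemma ge0_integral_affine (R : realType) n (l c : 'I_n -> R) (f : 'rV[R]_n -> \bar R) :
  (forall i, l i != 0) -> measurable_fun setT f -> (forall x, 0 <= f x)%E ->
  (\int[lebesgue_rV n]_x f x = (\prod_i `|l i|)%:E *
    \int[lebesgue_rV n]_x f (\row_i (l i * x ord0 i + c i)%R))%E.
Proof.
elim: n => [|n IH] in l c f * => l0 mf f0.
  rewrite big_ord0 mul1e; apply: eq_integral => x _; congr f.
  by apply/rowP => -[].
have ml k (l' c' : 'I_k -> R) :
    measurable_fun setT (fun x : 'rV[R]_k => \row_i (l' i * x ord0 i + c' i)).
  apply: measurable_fun_rV => i; under eq_fun do rewrite mxE.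
  apply: (measurableT_comp (measurable_affine _ _)).
  exact: measurable_rV_coord.
rewrite ge0_integral_rV_cons//.
rewrite (@ge0_integral_affine1 _ (l ord0) (c ord0))//; last 2 first.
- apply: (@measurable_fun_fubini_tonelli_F _ _ _ _ _ _ (fun yz => f (rV_cons yz))) => //.
  exact: measurable_comp_rV_cons.
- by move=> y; exact: integral_ge0.
rewrite [in RHS]ge0_integral_rV_cons//; last exact: (measurableT_comp mf (ml _ _ _)).
rewrite big_ord_recl EFinM -muleA; congr (_ * _)%E.
rewrite -ge0_integralZl//; last 3 first.
- apply: (@measurable_fun_fubini_tonelli_F _ _ _ _ _ _
    (fun yz => f (\row_i (l i * rV_cons yz ord0 i + c i)))) => //.
  apply: (@measurable_comp_rV_cons _ _ (fun x => f (\row_i (l i * x ord0 i + c i)))).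
  exact: (measurableT_comp mf (ml _ _ _)).
- by move=> y _; exact: integral_ge0.
- by rewrite lee_fin prodr_ge0.
apply: eq_integral => y _.
rewrite (IH (fun i => l (lift ord0 i)) (fun i => c (lift ord0 i)))//; last first.
  apply: (measurableT_comp mf); apply: (measurableT_comp (@measurable_rV_cons _ _)).
  exact: measurable_pair1.
congr (_ * _)%E; apply: eq_integral => z _; congr f.
apply/rowP => i; rewrite [RHS]mxE.
case: (unliftP ord0 i) => [j|] ->; first by rewrite !rV_cons_lift/= mxE.
by rewrite !rV_cons_ord0.
Qed.

Section integral_affine.
Context {R : realType}.
Variable n : nat.
Local Notation leb := (@lebesgue_rV R n).
Implicit Types (f : 'rV[R]_n -> R) (g : 'rV[R]_n -> \bar R).

Lemma measurable_rV_affine (l c : 'I_n -> R) :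
  measurable_fun setT (fun x : 'rV[R]_n => \row_i (l i * x ord0 i + c i)).
Proof.
apply: measurable_fun_rV => i; under eq_fun do rewrite mxE.
apply: (measurableT_comp (measurable_affine _ _)).
exact: measurable_rV_coord.
Qed.

Lemma integrable_affine (l c : 'I_n -> R) g : (forall i, l i != 0) ->
  leb.-integrable setT g ->
  leb.-integrable setT (fun x => g (\row_i (l i * x ord0 i + c i))).
Proof.
move=> l0 /integrableP[mg ig]; apply/integrableP; split.
  exact: (measurableT_comp mg (measurable_rV_affine _ _)).
have lp : (0 < \prod_i `|l i|) by apply: prodr_gt0 => i _; rewrite normr_gt0.
move: ig; rewrite (ge0_integral_affine c l0)//; last exact: measurableT_comp.
set I := (\int[leb]_x _)%E; case: I => [r _|/=|//]; first exact: ltry.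
by rewrite gt0_muley ?lte_fin// ltxx.
Qed.

Lemma integral_affine_rV (l c : 'I_n -> R) g : (forall i, l i != 0) ->
  leb.-integrable setT g ->
  (\int[leb]_x g x = (\prod_i `|l i|)%:E *
    \int[leb]_x g (\row_i (l i * x ord0 i + c i)%R))%E.
Proof.
move=> l0 ig; have mg := measurable_int _ ig.
rewrite integralE (ge0_integral_affine c l0 (measurable_funepos mg))//.
rewrite (ge0_integral_affine c l0 (measurable_funeneg mg))//.
have ia := integrable_affine c l0 ig.
rewrite -muleBr//.
  congr (_ * _)%E; rewrite [RHS]integralE.
  pose phi (x : 'rV[R]_n) := \row_i (l i * x ord0 i + c i).
  rewrite (_ : (fun x => g _) = g \o phi)// (funepos_comp g phi) (funeneg_comp g phi).
  by [].
pose phi (x : 'rV[R]_n) := \row_i (l i * x ord0 i + c i).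
have := integrable_pos_fin_num measurableT ia.
by rewrite (_ : (fun x => g _) = g \o phi)// (funepos_comp g phi); exact: fin_num_adde_defr.
Qed.

Definition rdiag (l c : 'I_n -> R) (x : 'rV[R]_n) := \row_i (l i * x ord0 i + c i).

Lemma Rintegral_affine (l c : 'I_n -> R) f : (forall i, l i != 0) ->
  leb.-integrable setT (EFin \o f) ->
  \int[leb]_x f x = (\prod_i `|l i|) * \int[leb]_x f (rdiag l c x).
Proof.
move=> l0 fi; rewrite /Rintegral (integral_affine_rV c l0 fi) fineM//.
exact: (integrable_fin_num measurableT (integrable_affine c l0 fi)).
Qed.

Lemma rdiag_add (c : 'rV[R]_n) x : rdiag (fun=> 1) (fun i => c ord0 i) x = x + c.
Proof. by apply/rowP => i; rewrite !mxE mul1r. Qed.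

Lemma rdiag_subr (c : 'rV[R]_n) x : rdiag (fun=> -1) (fun i => c ord0 i) x = c - x.
Proof. by apply/rowP => i; rewrite !mxE mulN1r addrC. Qed.

Lemma rdiag_scale (a : R) x : rdiag (fun=> a) (fun=> 0) x = a *: x.
Proof. by apply/rowP => i; rewrite !mxE addr0. Qed.

Lemma measurable_addr_rV (c : 'rV[R]_n) : measurable_fun setT (fun x : 'rV[R]_n => x + c).
Proof. by under eq_fun do rewrite -rdiag_add; exact: measurable_rV_affine. Qed.

Lemma measurable_subl_rV (c : 'rV[R]_n) : measurable_fun setT (fun x : 'rV[R]_n => c - x).
Proof. by under eq_fun do rewrite -rdiag_subr; exact: measurable_rV_affine. Qed.

Lemma measurable_scale_rV (a : R) : measurable_fun setT (fun x : 'rV[R]_n => a *: x).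
Proof. by under eq_fun do rewrite -rdiag_scale; exact: measurable_rV_affine. Qed.

Lemma ge0_integral_addr (c : 'rV[R]_n) g :
  measurable_fun setT g -> (forall x, 0 <= g x)%E ->
  (\int[leb]_x g (x + c)%R = \int[leb]_x g x)%E.
Proof.
move=> mg g0; rewrite [RHS](@ge0_integral_affine _ _ (fun=> 1) (fun i => c ord0 i))//.
rewrite big1 ?mul1e// => [|i _]; last exact: normr1.
by apply: eq_integral => x _; rewrite -rdiag_add.
Qed.

Lemma ge0_integral_subl (c : 'rV[R]_n) g :
  measurable_fun setT g -> (forall x, 0 <= g x)%E ->
  (\int[leb]_x g (c - x)%R = \int[leb]_x g x)%E.
Proof.
move=> mg g0; rewrite [RHS](@ge0_integral_affine _ _ (fun=> -1) (fun i => c ord0 i))//.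
rewrite big1 ?mul1e// => [|i _]; last by rewrite normrN normr1.
by apply: eq_integral => x _; rewrite -rdiag_subr.
Qed.

Lemma ge0_integral_scale (a : R) g : a != 0 ->
  measurable_fun setT g -> (forall x, 0 <= g x)%E ->
  (\int[leb]_x g x = (`|a| ^+ n)%:E * \int[leb]_x g (a *: x)%R)%E.
Proof.
move=> a0 mg g0; rewrite [LHS](@ge0_integral_affine _ _ (fun=> a) (fun=> 0))//.
rewrite prodr_const card_ord; congr (_ * _)%E.
by apply: eq_integral => x _; rewrite -rdiag_scale.
Qed.

Lemma integrable_addr (c : 'rV[R]_n) g : leb.-integrable setT g ->
  leb.-integrable setT (fun x => g (x + c)).
Proof.
move=> ig; under eq_fun do rewrite -rdiag_add.
by apply: integrable_affine => // _; exact: oner_neq0.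
Qed.

Lemma integrable_subl (c : 'rV[R]_n) g : leb.-integrable setT g ->
  leb.-integrable setT (fun x => g (c - x)).
Proof.
move=> ig; under eq_fun do rewrite -rdiag_subr.
by apply: integrable_affine => // _; rewrite oppr_eq0 oner_neq0.
Qed.

Lemma Rintegral_addr (c : 'rV[R]_n) f : leb.-integrable setT (EFin \o f) ->
  \int[leb]_x f (x + c) = \int[leb]_x f x.
Proof.
move=> fi; rewrite [RHS](@Rintegral_affine (fun=> 1) (fun i => c ord0 i))//.
rewrite big1 ?mul1r// => [|i _]; last exact: normr1.
by apply: eq_Rintegral => x _; rewrite rdiag_add.
Qed.

Lemma Rintegral_subl (c : 'rV[R]_n) f : leb.-integrable setT (EFin \o f) ->
  \int[leb]_x f (c - x) = \int[leb]_x f x.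
Proof.
move=> fi; rewrite [RHS](@Rintegral_affine (fun=> -1) (fun i => c ord0 i))//.
rewrite big1 ?mul1r// => [|i _]; last by rewrite normrN normr1.
by apply: eq_Rintegral => x _; rewrite rdiag_subr.
Qed.

Lemma Rintegral_scale (a : R) f : a != 0 -> leb.-integrable setT (EFin \o f) ->
  \int[leb]_x f x = `|a| ^+ n * \int[leb]_x f (a *: x).
Proof.
move=> a0 fi; rewrite [LHS](@Rintegral_affine (fun=> a) (fun=> 0))//.
rewrite prodr_const card_ord; congr (_ * _).
by apply: eq_Rintegral => x _; rewrite rdiag_scale.
Qed.

End integral_affine.

(** * Euclidean norm of row vectors *)

Section enorm_theory.
Context {R : realType}.
Variable n : nat.
Implicit Types x y : 'rV[R]_n.

Definition sqn x : R := \sum_(i < n) x ord0 i ^+ 2.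

Lemma enormE x : enorm x = Num.sqrt (sqn x).
Proof. by []. Qed.

Lemma sqn_ge0 x : 0 <= sqn x.
Proof. by apply: sumr_ge0 => i _; exact: sqr_ge0. Qed.

Lemma enorm_ge0 x : 0 <= enorm x.
Proof. exact: sqrtr_ge0. Qed.

Lemma sqr_enorm x : enorm x ^+ 2 = sqn x.
Proof. by rewrite sqr_sqrtr// sqn_ge0. Qed.

Lemma sqn_scale (a : R) x : sqn (a *: x) = a ^+ 2 * sqn x.
Proof. by rewrite /sqn mulr_sumr; apply: eq_bigr => i _; rewrite mxE exprMn. Qed.

Lemma enorm_scale (a : R) x : enorm (a *: x) = `|a| * enorm x.
Proof. by rewrite enormE sqn_scale sqrtrM ?sqr_ge0// sqrtr_sqr. Qed.

Lemma sqnN x : sqn (- x) = sqn x.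
Proof. by rewrite -scaleN1r sqn_scale sqrrN expr1n mul1r. Qed.

Lemma enormN x : enorm (- x) = enorm x.
Proof. by rewrite enormE sqnN. Qed.

Lemma sqn0 : sqn 0 = 0.
Proof. by rewrite /sqn big1// => i _; rewrite mxE expr0n. Qed.

Lemma sqn_eq0 x : (sqn x == 0) = (x == 0).
Proof.
apply/eqP/eqP => [/eqP|->]; last exact: sqn0.
rewrite psumr_eq0 => [/allP h|i _]; last exact: sqr_ge0.
apply/rowP => i; rewrite mxE; apply/eqP; rewrite -sqrf_eq0.
by apply: h; rewrite mem_index_enum.
Qed.

Lemma sqn_gt0 x : (0 < sqn x) = (x != 0).
Proof. by rewrite lt_neqAle sqn_ge0 andbT eq_sym sqn_eq0. Qed.

Lemma enorm_gt0 x : (0 < enorm x) = (x != 0).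
Proof. by rewrite enormE sqrtr_gt0 sqn_gt0. Qed.

Lemma sqn_add_le x y : sqn (x + y) <= 2 * (sqn x + sqn y).
Proof.
rewrite /sqn -big_split mulr_sumr; apply: ler_sum => i _ /=; rewrite mxE.
have := sqr_ge0 (x ord0 i - y ord0 i); nra.
Qed.

Lemma coord_sqr_le x i : x ord0 i ^+ 2 <= sqn x.
Proof. by rewrite /sqn (bigD1 i)//= lerDl sumr_ge0// => k _; exact: sqr_ge0. Qed.

Lemma coord_le_enorm x i : `|x ord0 i| <= enorm x.
Proof. by rewrite -sqrtr_sqr enormE ler_wsqrtr// coord_sqr_le. Qed.

Lemma measurable_sqn : measurable_fun setT (sqn : 'rV[R]_n -> R).
Proof.
apply: measurable_sum => i.
by apply: (@measurable_funX _ _ _ _ (fun x : 'rV[R]_n => x ord0 i)); exact: measurable_rV_coord.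
Qed.

Lemma measurable_sqrtr : measurable_fun [set: R] Num.sqrt.
Proof. by apply: continuous_measurable_fun => x; exact: sqrt_continuous. Qed.

Lemma measurable_enorm : measurable_fun setT (@enorm R n).
Proof. exact: (measurableT_comp measurable_sqrtr measurable_sqn). Qed.

Lemma lebesgue_rV_ball_lty (r : R) : (@lebesgue_rV R n [set x | (enorm x <= r)%R] < +oo)%E.
Proof.
have ritv : measurable ([set` `[-r, r]%R] : set (measurableTypeR R)) by [].
have mball : measurable [set x : 'rV[R]_n | (enorm x <= r)%R].
  rewrite (_ : mkset _ = setT `&` @enorm R n @^-1` [set` `]-oo, r]%R]).
    exact: measurable_enorm.
  by rewrite setTI; apply/seteqP; split => x /=; rewrite in_itv.
have mbox : measurable [set x : 'rV[R]_n | forall i, [set` `[-r, r]%R] (x ord0 i)].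
  rewrite [X in measurable X](_ : _ = \bigcap_(i : 'I_n)
      ((fun v : 'rV[R]_n => v ord0 i) @^-1` [set` `[-r, r]%R])); last first.
    by apply/seteqP; split => v /= Av; [move=> i _; exact: Av|move=> i; exact: Av].
  apply: fin_bigcap_measurable => [|i _]; first exact: finite_finset.
  by rewrite -[X in measurable X]setTI; exact: (measurable_rV_coord _ measurableT ritv).
apply: (@le_lt_trans _ _ (\prod_(i < n) lebesgue_measure ([set` `[-r, r]%R] : set R))%E).
  rewrite -(lebesgue_rV_box (A := fun=> [set` `[-r, r]%R]))//.
  apply: le_measure; rewrite ?inE// => x /= xr i; rewrite in_itv/= -ler_norml.
  by apply: le_trans xr; exact: coord_le_enorm.
suff /fin_numPlt/andP[] : (\prod_(i < n) lebesgue_measure ([set` `[(- r)%R, r]] : set R))%E \is a fin_num by [].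
apply: (big_ind (fun x : \bar R => x \is a fin_num)) => [//|x y|i _]; first exact: fin_numM.
by rewrite lebesgue_measure_itv/=; case: ifPn.
Qed.

End enorm_theory.

(** * Integrability of homogeneous functions *)

Section geometric_layers.
Context {R : realType}.
Variable n : nat.
Local Notation leb := (@lebesgue_rV R n).

(** Takes the place of polar coordinates. The layer [D m.+1] is covered by the shell [S] and the
    dilate of [D m], and dilating costs a factor [th < 1]. With [a = 2] the layers grow outwards,
    with [a = 2^-1] inwards. *)
Lemma ge0_integral_geometric (phi : 'rV[R]_n -> R) (a th A : R) (S : set 'rV[R]_n)
    (D : nat -> set 'rV[R]_n) :
  0 < a -> 0 <= th < 1 -> measurable_fun setT phi -> (forall x, 0 <= phi x) ->
  measurable S -> (forall m, measurable (D m)) -> nondecreasing_seq D ->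
  D 0%N = set0 -> (forall m, D m.+1 `<=` S `|` [set x | D m (a^-1 *: x)]) ->
  (forall m x, D m x -> a ^+ n * phi (a *: x) <= th * phi x) ->
  (\int[leb]_(x in S) (phi x)%:E <= A%:E)%E ->
  (\int[leb]_(x in \bigcup_m D m) (phi x)%:E <= (A / (1 - th))%:E)%E.
Proof.
move=> a0 /andP[th0 th1] mphi phi0 mS mD ndD D0 Dsub hom SA.
have mE : measurable_fun setT (EFin \o phi) by exact/measurable_EFinP.
have A0 : 0 <= A.
  by rewrite -lee_fin; apply: le_trans SA; apply: integral_ge0 => x _; rewrite lee_fin.
have th10 : 0 < 1 - th by rewrite subr_gt0.
have bnd m : (\int[leb]_(x in D m) (phi x)%:E <= (A / (1 - th))%:E)%E.
  elim: m => [|m IH].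
    by rewrite D0 integral_set0 lee_fin divr_ge0// ltW.
  have mT : measurable [set x | D m (a^-1 *: x)].
    by rewrite -[X in measurable X]setTI; exact: measurable_scale_rV.
  apply: (@le_trans _ _ (\int[leb]_(x in S) (phi x)%:E +
      \int[leb]_(x in [set x | D m (a^-1 *: x)]) (phi x)%:E)%E).
    apply: (@le_trans _ _ (\int[leb]_(x in S `|` [set x | D m (a^-1 *: x)]) (phi x)%:E)%E).
      apply: ge0_subset_integral => //; first exact: measurableU.
      - by apply: measurable_funTS; exact: mE.
      - by move=> x _; rewrite lee_fin.
    rewrite !(integral_mkcond _ (fun x => (phi x)%:E)) -ge0_integralD//; last 4 first.
    - by move=> x _; apply: erestrict_ge0 => y _; rewrite lee_fin.
    - by apply/(measurable_restrictT _ _).1 => //; exact: measurable_funTS.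
    - by move=> x _; apply: erestrict_ge0 => y _; rewrite lee_fin.
    - by apply/(measurable_restrictT _ _).1 => //; exact: measurable_funTS.
    apply: ge0_le_integral => //.
    - by move=> x _; apply: erestrict_ge0 => y _; rewrite lee_fin.
    - apply/(measurable_restrictT _ _).1; [exact: measurableU|exact: measurable_funTS].
    - by apply: emeasurable_funD; apply/(measurable_restrictT _ _).1 => //; exact: measurable_funTS.
    - move=> x _; rewrite /patch in_setU; case: ifPn => /=; last first.
        by rewrite negb_or => /andP[/negbTE-> /negbTE->]; rewrite adde0.
      by move=> /orP[] ->; [rewrite leeDl//|rewrite leeDr//]; case: ifPn => // _; rewrite lee_fin.
  (* The bound is the fixed point of [I = A + th * I], so it is inherited by the next layer. *)
  have -> : A / (1 - th) = A + th * (A / (1 - th)).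
    by field; exact: lt0r_neq0.
  rewrite EFinD; apply: leeD => //.
  rewrite integral_mkcond (@ge0_integral_scale _ _ a)//; last 3 first.
  - exact: lt0r_neq0.
  - by apply/(measurable_restrictT _ _).1 => //; exact: measurable_funTS.
  - by move=> x; apply: erestrict_ge0 => y _; rewrite lee_fin.
  rewrite gtr0_norm// -ge0_integralZl//; last 3 first.
  - apply: (measurableT_comp _ (measurable_scale_rV _)).
    by apply/(measurable_restrictT _ _).1 => //; exact: measurable_funTS.
  - by move=> x _; apply: erestrict_ge0 => y _; rewrite lee_fin.
  - by rewrite lee_fin exprn_ge0// ltW.
  rewrite EFinM; apply: le_trans (lee_wpmul2l _ IH); last by rewrite lee_fin.
  rewrite [X in (_ <= _ * X)%E]integral_mkcond -ge0_integralZl//; last 2 first.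
  - by apply/(measurable_restrictT _ _).1 => //; exact: measurable_funTS.
  - by move=> x _; apply: erestrict_ge0 => y _; rewrite lee_fin.
  apply: ge0_le_integral => //.
  - move=> x _; apply: mule_ge0; first by rewrite lee_fin exprn_ge0// ltW.
    by apply: erestrict_ge0 => y _; rewrite lee_fin.
  - apply: measurable_funeM; apply: (measurableT_comp _ (measurable_scale_rV _)).
    by apply/(measurable_restrictT _ _).1 => //; exact: measurable_funTS.
  - apply: measurable_funeM.
    by apply/(measurable_restrictT _ _).1 => //; exact: measurable_funTS.
  - move=> x _; have sE : a^-1 *: (a *: x) = x.
      by rewrite scalerA mulVf ?scale1r//; exact: lt0r_neq0.
    have [Dx|nDx] := pselect (D m x).
      rewrite /patch/= !mem_set//=; last by rewrite sE.
      by rewrite -!EFinM lee_fin; exact: hom Dx.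
    rewrite /patch/= !memNset//= ?mule0//.
    by rewrite sE.
rewrite integral_mkcond.
have -> : ((EFin \o phi) \_ (\bigcup_m D m)) = (fun x => limn (fun m => ((EFin \o phi) \_ (D m)) x)).
  apply/funext => x; apply/esym/cvg_lim => //.
  rewrite /patch; case: ifPn => [/set_mem[m _ Dm]|nD].
    apply: cvg_near_cst; exists m => // k /= mk; rewrite mem_set//.
    by move: Dm; exact/subsetPset/ndD.
  apply: cvg_near_cst; apply: nearW => k; rewrite memNset// => Dk.
  by move: nD; rewrite notin_setE; apply; exists k.
rewrite monotone_convergence//.
- apply: lime_le; last by apply: nearW => m; rewrite -integral_mkcond; exact: bnd.
  apply: ereal_nondecreasing_is_cvgn => i j ij; rewrite -!integral_mkcond.
  apply: ge0_subset_integral => //; first by apply: measurable_funTS.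
  - by move=> x _; rewrite lee_fin.
  - exact/subsetPset/ndD.
- by move=> m; apply/(measurable_restrictT _ _).1 => //; exact: measurable_funTS.
- by move=> m x _; apply: erestrict_ge0 => y _; rewrite lee_fin.
- move=> x _ i j ij; rewrite /patch.
  case: ifPn => [|_]; last by case: ifPn => // _; rewrite lee_fin.
  rewrite !inE => Di; rewrite mem_set//; move: Di; exact/subsetPset/ndD.
Qed.

Lemma measurable_enorm_le (r : R) : measurable [set x : 'rV[R]_n | enorm x <= r].
Proof.
rewrite (_ : mkset _ = setT `&` @enorm R n @^-1` [set` `]-oo, r]%R]).
  exact: measurable_enorm.
by rewrite setTI; apply/seteqP; split => x /=; rewrite in_itv.
Qed.

Lemma measurable_enorm_lt (r : R) : measurable [set x : 'rV[R]_n | r < enorm x].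
Proof.
rewrite (_ : mkset _ = setT `&` @enorm R n @^-1` [set` `]r, +oo[%R]).
  exact: measurable_enorm.
by rewrite setTI; apply/seteqP; split => x /=; rewrite in_itv/= andbT.
Qed.

Lemma integral_bounded_ball_lty (phi : 'rV[R]_n -> R) (C r : R) (S : set 'rV[R]_n) :
  measurable S -> S `<=` [set x | enorm x <= r] -> measurable_fun setT phi ->
  (forall x, 0 <= phi x) -> (forall x, S x -> phi x <= C) ->
  (\int[leb]_(x in S) (phi x)%:E < +oo)%E.
Proof.
move=> mS Sr mphi phi0 phiC.
apply: (@le_lt_trans _ _ (\int[leb]_(x in S) (`|C|)%:E)%E).
  apply: ge0_le_integral => //.
  - by move=> x _; rewrite lee_fin.
  - by apply/measurable_EFinP; exact: measurable_funTS.
  - by move=> x Sx; rewrite lee_fin (le_trans (phiC _ Sx))// ler_norm.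
rewrite integral_cst//; apply: lte_mul_pinfty => //.
apply: le_lt_trans (lebesgue_rV_ball_lty n r).
by apply: le_measure; rewrite ?inE//; exact: measurable_enorm_le.
Qed.

Lemma homogeneous_tail_lty (phi : 'rV[R]_n -> R) (th C t : R) : 0 < t ->
  0 <= th < 1 -> measurable_fun setT phi -> (forall x, 0 <= phi x) ->
  (forall x, t < enorm x -> 2 ^+ n * phi (2 *: x) <= th * phi x) ->
  (forall x, t < enorm x -> enorm x <= 2 * t -> phi x <= C) ->
  (\int[leb]_(x in [set x | (t < enorm x)%R]) (phi x)%:E < +oo)%E.
Proof.
move=> t0 th01 mphi phi0 hom phiC.
pose S := [set x : 'rV[R]_n | t < enorm x] `&` [set x | enorm x <= 2 * t].
have mS : measurable S.
  by apply: measurableI; [exact: measurable_enorm_lt|exact: measurable_enorm_le].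
pose D m := if m is m'.+1 then [set x : 'rV[R]_n | t < enorm x] `&` [set x | enorm x <= 2 ^+ m * t] else set0.
have SA : (\int[leb]_(x in S) (phi x)%:E < +oo)%E.
  apply: (@integral_bounded_ball_lty _ C (2 * t)) => //; first by move=> x [].
  by move=> x [? ?]; exact: phiC.
have -> : [set x : 'rV[R]_n | t < enorm x] = \bigcup_m D m.
  apply/seteqP; split => [x /= tx|x [[//|m] _ []//]].
  have [m mx] : exists m, enorm x / t <= m.+1%:R.
    exists (Num.truncn (enorm x / t)).
    by rewrite ltW// truncnS_gt//.
  exists m.+1 => //=; split => //=; rewrite -ler_pdivrMr// (le_trans mx)//.
  by rewrite -natrX ler_nat ltnW// ltn_expl.
set I := (\int[leb]_(x in S) (phi x)%:E)%E in SA.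
have Ifin : I \is a fin_num.
  by rewrite ge0_fin_numE//; apply: integral_ge0 => x _; rewrite lee_fin.
apply: le_lt_trans (ltry (fine I / (1 - th))).
apply: (@ge0_integral_geometric phi 2 th (fine I) S D) => //.
- case=> [|m] //=.
  by apply: measurableI; [exact: measurable_enorm_lt|exact: measurable_enorm_le].
- apply/nondecreasing_seqP => -[|m]; apply/subsetPset => //= x [/= h1 h2]; split => //=.
  by rewrite (le_trans h2)// ler_pM2r// ler_eXn2l// ltr1n.
- case=> [|m] x [/= h1 h2]; first by left; split => //=; rewrite -(expr1 2).
  have [h|h] := leP (enorm x) (2 * t); first by left.
  have n2 : enorm (2^-1 *: x) = 2^-1 * enorm x by rewrite enorm_scale gtr0_norm.
  right => /=; rewrite n2; split.
    by rewrite mulrC ltr_pdivlMr// mulrC.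
  by rewrite mulrC ler_pdivrMr// mulrAC -exprSr.
- by case=> [|m] x //= [/= h _]; exact: hom.
- by rewrite fineK.
Qed.

Lemma homogeneous_head_lty (phi : 'rV[R]_n -> R) (th C : R) :
  0 <= th < 1 -> measurable_fun setT phi -> (forall x, 0 <= phi x) ->
  (forall x, 0 < enorm x -> phi (2^-1 *: x) <= th * 2 ^+ n * phi x) ->
  (forall x, 2^-1 < enorm x -> enorm x <= 1 -> phi x <= C) -> phi 0 = 0 ->
  (\int[leb]_(x in [set x | (enorm x <= 1)%R]) (phi x)%:E < +oo)%E.
Proof.
move=> th01 mphi phi0 hom phiC phi00.
pose S := [set x : 'rV[R]_n | 2^-1 < enorm x] `&` [set x | enorm x <= 1].
have mS : measurable S.
  by apply: measurableI; [exact: measurable_enorm_lt|exact: measurable_enorm_le].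
pose D m := [set x : 'rV[R]_n | 2^-1 ^+ m < enorm x] `&` [set x | enorm x <= 1].
have mD m : measurable (D m).
  by apply: measurableI; [exact: measurable_enorm_lt|exact: measurable_enorm_le].
have SA : (\int[leb]_(x in S) (phi x)%:E < +oo)%E.
  apply: (@integral_bounded_ball_lty _ C 1) => //; first by move=> x [].
  by move=> x [? ?]; exact: phiC.
set I := (\int[leb]_(x in S) (phi x)%:E)%E in SA.
have Ifin : I \is a fin_num.
  by rewrite ge0_fin_numE//; apply: integral_ge0 => x _; rewrite lee_fin.
apply: le_lt_trans (ltry (fine I / (1 - th))).
(* The inward layers exhaust the unit ball except for the origin, where [phi] vanishes. *)
have -> : (\int[leb]_(x in [set x | (enorm x <= 1)%R]) (phi x)%:E =
    \int[leb]_(x in \bigcup_m D m) (phi x)%:E)%E.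
  rewrite integral_mkcond [RHS]integral_mkcond; apply: eq_integral => x _.
  rewrite /patch; case: ifPn; case: ifPn => //.
  - rewrite notin_setE inE/= => nD x1.
    have [->|x0] := eqVneq x 0; first by rewrite phi00.
    exfalso; apply: nD.
    have e0 : 0 < enorm x by rewrite enorm_gt0.
    exists (Num.truncn ((enorm x)^-1)) => //; split => //=.
    rewrite exprVn -ltf_pV2 ?posrE ?invr_gt0 ?exprn_gt0// invrK.
    rewrite (@lt_le_trans _ _ (Num.truncn (enorm x)^-1).+1%:R)//; first exact: truncnS_gt.
    by rewrite -natrX ler_nat ltn_expl.
  - by rewrite inE => -[m _ [_ /= x1]]; rewrite notin_setE/= x1.
apply: (@ge0_integral_geometric phi 2^-1 th (fine I) S D) => //.
- apply/nondecreasing_seqP => m; apply/subsetPset => x [/= h1 h2]; split => //=.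
  by rewrite (le_lt_trans _ h1)// exprS ger_pMl ?exprn_gt0// invf_le1// ler1n.
- by rewrite -subset0 => x [/=]; rewrite expr0 => h /(lt_le_trans h); rewrite ltxx.
- move=> m x [/= h1 h2].
  have [h|h] := ltP 2^-1 (enorm x); first by left.
  have n2 : enorm (2 *: x) = 2 * enorm x by rewrite enorm_scale gtr0_norm.
  right; rewrite /D /= !invrK n2; split.
    by rewrite -ltr_pdivrMl// -exprS.
  by rewrite -ler_pdivlMl// mulr1.
- move=> m x [/= h _]; rewrite exprVn mulrC ler_pdivrMr ?exprn_gt0// mulrAC.
  by apply: hom; rewrite (le_lt_trans _ h)// exprn_ge0.
- by rewrite fineK.
Qed.

End geometric_layers.

(** * Integrable real functions and dominated convergence *)

Section real_integrable.
Context d (T : measurableType d) {R : realType} (mu : {measure set T -> \bar R}).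
Implicit Types (f g : T -> R).

Definition intg f := mu.-integrable setT (EFin \o f).

Lemma intg_measurable f : intg f -> measurable_fun setT f.
Proof. by move=> /measurable_int/measurable_EFinP. Qed.

Lemma ge0_intg f : measurable_fun setT f -> (forall x, 0 <= f x) ->
  (\int[mu]_x (f x)%:E < +oo)%E -> intg f.
Proof.
move=> mf f0 fi; apply/integrableP; split; first exact/measurable_EFinP.
by under eq_integral do rewrite /= ger0_norm//.
Qed.

Lemma intg_ge0_lty f : intg f -> (forall x, 0 <= f x) -> (\int[mu]_x (f x)%:E < +oo)%E.
Proof.
move=> /integrableP[_ fi] f0; apply: le_lt_trans fi.
by under [X in (_ <= X)%E]eq_integral do rewrite /= ger0_norm//.
Qed.

Lemma le_intg f g : measurable_fun setT f -> (forall x, `|f x| <= g x) -> intg g -> intg f.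
Proof.
move=> mf fg; apply: le_integrable => //; first exact/measurable_EFinP.
by move=> x _ /=; rewrite lee_fin (le_trans (fg x))// ler_norm.
Qed.

Lemma intgD f g : intg f -> intg g -> intg (fun x => f x + g x).
Proof. by move=> fi gi; exact: (integrableD measurableT fi gi). Qed.

Lemma intgB f g : intg f -> intg g -> intg (fun x => f x - g x).
Proof. by move=> fi gi; exact: (integrableB measurableT fi gi). Qed.

Lemma intgZ (c : R) f : intg f -> intg (fun x => c * f x).
Proof. by move=> fi; exact: (integrableZl measurableT c fi). Qed.

Lemma intg_norm f : intg f -> intg (fun x => `|f x|).
Proof. by move=> fi; exact: (integrable_norm fi). Qed.

Lemma intg_sum (I : finType) (F : I -> T -> R) : (forall i, intg (F i)) ->
  intg (fun x => \sum_i F i x).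
Proof.
move=> Fi; rewrite /intg (_ : _ \o _ = (fun x => \sum_i (EFin \o F i) x)%E).
  by apply: (integrable_sum measurableT) => i _; exact: Fi.
by apply/funext => x /=; rewrite sumEFin.
Qed.

Lemma Rint_intg f : intg f -> ((\int[mu]_x f x)%R)%:E = (\int[mu]_x (f x)%:E)%E.
Proof. by move=> fi; rewrite /Rintegral fineK//; exact: (integrable_fin_num measurableT). Qed.

Lemma Rint_sum (I : finType) (F : I -> T -> R) : (forall i, intg (F i)) ->
  \int[mu]_x (\sum_i F i x) = \sum_i \int[mu]_x F i x.
Proof.
move=> Fi; apply: EFin_inj; rewrite Rint_intg; last exact: intg_sum.
rewrite -sumEFin; under eq_integral do rewrite -sumEFin.
rewrite integral_sum//; first by apply: eq_bigr => i _; rewrite Rint_intg.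
Qed.

Lemma dominated_cvg_Rint (f_ : nat -> T -> R) f g :
  (forall n, measurable_fun setT (f_ n)) ->
  (forall x, f_ ^~ x @ \oo --> f x) -> intg g ->
  (forall n x, `|f_ n x| <= g x) ->
  intg f /\ \int[mu]_x f_ n x @[n --> \oo] --> \int[mu]_x f x.
Proof.
move=> mf_ f_f gi f_g.
have mf : measurable_fun setT f by apply: measurable_fun_cvg mf_ _ => // x _; exact: f_f.
have [] := @dominated_convergence _ _ _ mu setT measurableT (fun n => EFin \o f_ n)
  (EFin \o f) (EFin \o g).
- by move=> n; exact/measurable_EFinP.
- exact/measurable_EFinP.
- by apply: aeW => x _ /=; apply/cvg_EFin; [exact: nearW|exact: f_f].
- exact: gi.
- by apply: aeW => x n _ /=; rewrite lee_fin.
move=> fi _ cvgi; split => //.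
by apply/fine_cvg; rewrite fineK//; exact: (integrable_fin_num measurableT).
Qed.

End real_integrable.

Section intg_rV.
Context {R : realType}.
Variable n : nat.
Implicit Types (f : 'rV[R]_n -> R) (c : 'rV[R]_n).

Lemma intg_addr c f : intg (@lebesgue_rV R n) f -> intg (@lebesgue_rV R n) (fun x => f (x + c)).
Proof. exact: integrable_addr. Qed.

Lemma intg_subl c f : intg (@lebesgue_rV R n) f -> intg (@lebesgue_rV R n) (fun x => f (c - x)).
Proof. exact: integrable_subl. Qed.

End intg_rV.

(** * Decaying weights *)

Section weights.
Context {R : realType}.
Variable n : nat.
Local Notation leb := (@lebesgue_rV R n).

(** The reciprocal of the Japanese bracket, comparable to 1/|x| at infinity and bounded at the
    origin; its powers supply the integrable majorants of the flux arguments. *)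
Definition jw (x : 'rV[R]_n) : R := (Num.sqrt (1 + sqn x))^-1.

Lemma jw_gt0 x : 0 < jw x.
Proof. by rewrite invr_gt0 sqrtr_gt0 ltr_wpDr// sqn_ge0. Qed.

Lemma jw_ge0 x : 0 <= jw x. Proof. exact/ltW/jw_gt0. Qed.

Lemma jw_le1 x : jw x <= 1.
Proof.
rewrite invf_le1 ?sqrtr_gt0 ?ltr_wpDr ?sqn_ge0//.
by rewrite -[leLHS]sqrtr1 ler_wsqrtr// lerDl sqn_ge0.
Qed.

Lemma jwX_le1 x k : jw x ^+ k <= 1.
Proof. by rewrite exprn_ile1 ?jw_ge0 ?jw_le1. Qed.

Lemma sqr_jw x : jw x ^+ 2 = (1 + sqn x)^-1.
Proof. by rewrite exprVn sqr_sqrtr// addr_ge0// sqn_ge0. Qed.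

Lemma measurable_jw : measurable_fun setT jw.
Proof.
rewrite (_ : jw = (fun s : R => (Num.sqrt s) `^ (-1)) \o (fun x => 1 + sqn x)); last first.
  by apply/funext => x /=; rewrite powR_inv1// sqrtr_ge0.
apply: (@measurableT_comp _ _ _ _ _ _ (fun s : R => (Num.sqrt s) `^ (-1))).
  exact: (measurableT_comp (measurable_powR _) measurable_sqrtr).
by apply: measurable_funD => //; exact: measurable_sqn.
Qed.

Lemma measurable_enormV : measurable_fun setT (fun x : 'rV[R]_n => (enorm x)^-1).
Proof.
rewrite (_ : (fun _ => _) = (fun s : R => s `^ (-1)) \o @enorm R n); last first.
  by apply/funext => x /=; rewrite powR_inv1// enorm_ge0.
by apply: measurableT_comp; [exact: measurable_powR|exact: measurable_enorm].
Qed.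

Lemma jw_le_enormV x : x != 0 -> jw x <= (enorm x)^-1.
Proof.
move=> x0; rewrite lef_pV2 ?posrE ?enorm_gt0// ?sqrtr_gt0 ?ltr_wpDr ?sqn_ge0//.
by rewrite enormE ler_wsqrtr// lerDr.
Qed.

Lemma ge0_integral_split_ball (f : 'rV[R]_n -> \bar R) (t : R) :
  measurable_fun setT f -> (forall x, 0 <= f x)%E ->
  (\int[leb]_x f x = \int[leb]_(x in [set x | (enorm x <= t)%R]) f x +
     \int[leb]_(x in [set x | (t < enorm x)%R]) f x)%E.
Proof.
move=> mf f0.
have <- : [set x : 'rV[R]_n | enorm x <= t] `|` [set x | t < enorm x] = setT.
  by apply/seteqP; split => // x _ /=; apply/orP; case: leP.
rewrite ge0_integral_setU//=.
- exact: measurable_enorm_le.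
- exact: measurable_enorm_lt.
- exact: measurable_funTS.
- by apply/disj_setPS => x [/= xt /lt_geF]; rewrite xt.
Qed.

Lemma intg_jwX k : (n < k)%N -> intg leb (fun x => jw x ^+ k).
Proof.
move=> nk; have mjw : measurable_fun setT (fun x => jw x ^+ k).
  by apply: measurable_funX; exact: measurable_jw.
apply: ge0_intg => //; first by move=> x; rewrite exprn_ge0// jw_ge0.
have j0 x : (0 <= (jw x ^+ k)%:E)%E by rewrite lee_fin exprn_ge0// jw_ge0.
rewrite (ge0_integral_split_ball 1)//; last exact/measurable_EFinP.
apply: lte_add_pinfty.
  apply: (@integral_bounded_ball_lty _ _ _ 1 1) => //; first exact: measurable_enorm_le.
  by move=> x _; exact: jwX_le1.
apply: (@le_lt_trans _ _ (\int[leb]_(x in [set x | (1 < enorm x)%R]) ((enorm x)^-1 ^+ k)%:E)%E).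
  apply: ge0_le_integral => //; first exact: measurable_enorm_lt.
  - by apply: measurable_funTS; exact/measurable_EFinP.
  - apply: measurable_funTS; apply/measurable_EFinP; apply: measurable_funX.
    exact: measurable_enormV.
  - move=> x /= x1; rewrite lee_fin lerXn2r ?nnegrE ?jw_ge0 ?invr_ge0 ?enorm_ge0//.
    by rewrite jw_le_enormV// -enorm_gt0 (lt_trans ltr01).
apply: (@homogeneous_tail_lty _ _ _ 2^-1 1) => //.
- by rewrite invr_ge0 ler0n/= invf_lt1// ltr1n.
- by apply: measurable_funX; exact: measurable_enormV.
- by move=> x; rewrite exprn_ge0// invr_ge0 enorm_ge0.
(* Doubling multiplies the layer integral by 2^(n - k), at most 1/2 because [n < k]. *)
- move=> x x1; rewrite enorm_scale gtr0_norm// invfM exprMn mulrA.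
  rewrite ler_wpM2r ?exprn_ge0 ?invr_ge0 ?enorm_ge0// -(subnK nk) addnS exprS exprD.
  have -> (a : R) : 2 ^+ n * (2^-1 * (a * 2^-1 ^+ n)) = 2^-1 * a.
    by rewrite exprVn; field; rewrite expf_neq0.
  rewrite ler_piMr ?invr_ge0//.
  by rewrite exprn_ile1 ?invr_ge0// invf_le1// ler1n.
- move=> x x1 _; rewrite exprn_ile1 ?invr_ge0 ?enorm_ge0// invf_le1 ?(ltW x1)//.
  by rewrite (lt_trans ltr01).
Qed.

(** The size |x|^-n of the Riesz kernel is not integrable at infinity, but its powers of exponent
    [q > 1] are: a dilation by 2 multiplies the integral by 2^(n - nq) < 1. The exponent will be the
    conjugate of p. *)
Lemma enormV_powR_tail_lty (t q : R) : 0 < t -> 1 < q -> (0 < n)%N ->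
  (\int[leb]_(x in [set x | (t < enorm x)%R]) (((enorm x)^-1 ^+ n) `^ q)%:E < +oo)%E.
Proof.
move=> t0 q1 n0.
apply: (@homogeneous_tail_lty _ _ _ (2 ^+ n / (2 ^+ n) `^ q) ((t^-1 ^+ n) `^ q)) => //.
- rewrite divr_ge0 ?exprn_ge0 ?powR_ge0//= ltr_pdivrMr ?powR_gt0 ?exprn_gt0// mul1r.
  rewrite -{1}(powRr1 (exprn_ge0 n (ler0n _ 2))) /powR gt_eqF ?exprn_gt0// ltr_expR.
  rewrite ltr_pM2r// ln_gt0//.
  by rewrite exprn_egt1// ?ltr1n// -lt0n.
- apply: (@measurableT_comp _ _ _ _ _ _ (fun s : R => s `^ q)); first exact: measurable_powR.
  by apply: measurable_funX; exact: measurable_enormV.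
- by move=> x; exact: powR_ge0.
- move=> x tx; rewrite enorm_scale gtr0_norm// invfM exprMn powRM ?exprn_ge0 ?invr_ge0 ?enorm_ge0//.
  have -> : (2^-1 ^+ n) `^ q = ((2 ^+ n) `^ q)^-1 :> R.
    by rewrite exprVn -[X in X `^ _]powR_inv1 ?exprn_ge0// -powRrM mulN1r powRN.
  by rewrite mulrA.
- move=> x tx _; apply: ge0_ler_powR; rewrite ?nnegrE ?exprn_ge0 ?invr_ge0 ?enorm_ge0//.
  + by rewrite (le_trans ler01)// ltW.
  + exact: ltW.
  + rewrite lerXn2r ?nnegrE ?invr_ge0 ?enorm_ge0 ?ltW// ltf_pV2 ?posrE//.
    exact: (lt_trans t0).
Qed.

End weights.

(** * Riesz potential of order one in dimension n + 1 *)

Section riesz_potential.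
Context {R : realType}.
Variable n : nat.
Hypothesis n0 : (0 < n)%N.
Local Notation leb := (@lebesgue_rV R n.+1).

Lemma enormV_head_lty :
  (\int[leb]_(x in [set x | (enorm x <= 1)%R]) ((enorm x)^-1 ^+ n)%:E < +oo)%E.
Proof.
apply: (@homogeneous_head_lty _ _ _ 2^-1 (2 ^+ n)) => //.
- by rewrite invr_ge0 ler0n/= invf_lt1// ltr1n.
- by apply: measurable_funX; exact: measurable_enormV.
- by move=> x; rewrite exprn_ge0// invr_ge0 enorm_ge0.
- move=> x x0; rewrite enorm_scale gtr0_norm ?invr_gt0// invfM invrK exprMn.
  by rewrite exprS mulrA mulVf// mul1r.
- move=> x x2 _; rewrite lerXn2r ?nnegrE ?invr_ge0 ?enorm_ge0//.
  by rewrite -[leRHS]invrK lef_pV2 ?posrE ?invr_gt0// ?(ltW x2)// (lt_trans _ x2)// invr_gt0.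
- by rewrite enormE sqn0 sqrtr0 invr0 expr0n eqn0Ngt n0.
Qed.

Definition head_const : R :=
  fine (\int[leb]_(x in [set x | (enorm x <= 1)%R]) ((enorm x)^-1 ^+ n)%:E)%E.

(** Uniform in [X]: within distance 1 of [X] the density is at most [M] and the kernel is
    integrable; beyond that distance the kernel is at most 1. *)
Lemma intg_riesz_potential (f : 'rV[R]_n.+1 -> R) (M : R) X :
  intg leb f -> (forall x, 0 <= f x <= M) ->
  intg leb (fun V => f V * (enorm (X - V))^-1 ^+ n) /\
  \int[leb]_V (f V * (enorm (X - V))^-1 ^+ n) <= M * head_const + \int[leb]_V f V.
Proof.
move=> fi f0M.
have mf := intg_measurable fi.
have f0 x : 0 <= f x by have /andP[] := f0M x.
have fM x : f x <= M by have /andP[] := f0M x.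
have M0 : 0 <= M by exact: le_trans (f0 0) (fM 0).
have mN : measurable_fun setT (fun V : 'rV[R]_n.+1 => (enorm (X - V))^-1 ^+ n).
  apply: measurable_funX.
  exact: (measurableT_comp (@measurable_enormV _ _) (measurable_subl_rV X)).
have mF : measurable_fun setT (fun V : 'rV[R]_n.+1 => f V * (enorm (X - V))^-1 ^+ n).
  exact: measurable_funM.
have F0 V : 0 <= f V * (enorm (X - V))^-1 ^+ n.
  by rewrite mulr_ge0// exprn_ge0// invr_ge0 enorm_ge0.
have hfin : (\int[leb]_(x in [set x | (enorm x <= 1)%R]) ((enorm x)^-1 ^+ n)%:E)%E = head_const%:E.
  rewrite /head_const fineK// ge0_fin_numE ?enormV_head_lty//.
  by apply: integral_ge0 => x _; rewrite lee_fin exprn_ge0// invr_ge0 enorm_ge0.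
have key : (\int[leb]_V (f V * (enorm (X - V))^-1 ^+ n)%:E <=
    (M * head_const + \int[leb]_V f V)%:E)%E.
  rewrite -(@ge0_integral_subl _ _ X); last 2 first.
  - exact/measurable_EFinP.
  - by move=> V; rewrite lee_fin.
  under eq_integral do rewrite opprB addrCA subrr addr0.
  have mG : measurable_fun setT (fun V : 'rV[R]_n.+1 => f (X - V) * (enorm V)^-1 ^+ n).
    apply: measurable_funM; first exact: (measurableT_comp mf (measurable_subl_rV X)).
    by apply: measurable_funX; exact: measurable_enormV.
  rewrite (ge0_integral_split_ball 1); last 2 first.
  - exact/measurable_EFinP.
  - by move=> V; rewrite lee_fin mulr_ge0// exprn_ge0// invr_ge0 enorm_ge0.
  rewrite EFinD; apply: leeD.
    rewrite EFinM -hfin -ge0_integralZl//; last 3 first.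
    - exact: measurable_enorm_le.
    - apply/measurable_EFinP; apply: measurable_funTS; apply: measurable_funX; exact: measurable_enormV.
    - by move=> x _; rewrite lee_fin exprn_ge0// invr_ge0 enorm_ge0.
    apply: ge0_le_integral => //.
    - exact: measurable_enorm_le.
    - by move=> V _; rewrite lee_fin mulr_ge0// exprn_ge0// invr_ge0 enorm_ge0.
    - by apply/measurable_EFinP; exact: measurable_funTS.
    - apply: measurable_funeM; apply/measurable_EFinP; apply: measurable_funTS.
      by apply: measurable_funX; exact: measurable_enormV.
    - by move=> V _; rewrite -EFinM lee_fin ler_wpM2r// exprn_ge0// invr_ge0 enorm_ge0.
  rewrite Rint_intg//.
  have mfX : measurable_fun setT (fun V : 'rV[R]_n.+1 => f (X - V)).
    exact: (measurableT_comp mf (measurable_subl_rV X)).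
  rewrite -(@ge0_integral_subl _ _ X (EFin \o f)); last 2 first.
  - exact/measurable_EFinP.
  - by move=> V /=; rewrite lee_fin.
  apply: (@le_trans _ _ (\int[leb]_(x in [set x | (1 < enorm x)%R]) (f (X - x)%R)%:E)%E).
    apply: ge0_le_integral => //.
    - exact: measurable_enorm_lt.
    - by move=> V _; rewrite lee_fin mulr_ge0// exprn_ge0// invr_ge0 enorm_ge0.
    - by apply/measurable_EFinP; exact: measurable_funTS.
    - by apply/measurable_EFinP; exact: measurable_funTS.
    - move=> V /= V1; rewrite lee_fin ler_piMr//.
      by rewrite exprn_ile1 ?invr_ge0 ?enorm_ge0// invf_le1 ?(ltW V1)// (lt_trans ltr01).
  apply: ge0_subset_integral => //; first exact: measurable_enorm_lt.
  - exact/measurable_EFinP.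
  - by move=> V _; rewrite lee_fin.
have Fi : intg leb (fun V => f V * (enorm (X - V))^-1 ^+ n).
  by apply: ge0_intg => //; exact: le_lt_trans key (ltry _).
by split => //; rewrite -lee_fin Rint_intg.
Qed.

End riesz_potential.

(** * Flux through the space and the half-space *)

Section line_derivative.
Context {R : realType}.

Lemma is_derive_seq (f : R -> R) (df : R) : is_derive (0 : R) 1 f df ->
  (m.+1%:R * (f m.+1%:R^-1 - f 0)) @[m --> \oo] --> df.
Proof.
move=> [dv dE].
have : h^-1 *: ((f \o shift 0) (h *: (1 : R)) - f 0) @[h --> 0^'] --> df.
  by rewrite -dE; exact: dv.
move=> cf.
have c0 : (fun m : nat => m.+1%:R^-1 : R) @ \oo --> (0 : R)^'.
  move=> A /= [e e0 eA].
  have : (fun m : nat => m.+1%:R^-1 : R) @ \oo --> (0 : R) by exact: cvg_harmonic.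
  move=> /cvgrPdist_lt/(_ e e0) [N _ Nh]; exists N => // m /= Nm.
  apply: eA; first by exact: Nh.
  by rewrite /= invr_eq0.
have := cvg_comp _ _ c0 cf; apply: cvg_trans; apply: near_eq_cvg.
by apply: nearW => m /=; rewrite invrK /GRing.scale/= addr0 mulr1.
Qed.

Lemma is_derive_shift (f : R -> R) (th df : R) :
  is_derive (0 : R) 1 (fun h => f (th + h)) df -> is_derive th 1 f df.
Proof.
move=> fd; rewrite (_ : f = (fun h => f (th + h)) \o (fun h => h - th)); last first.
  by apply/funext => h /=; rewrite addrC subrK.
rewrite -[df]mulr1; apply: is_derive1_comp; first by rewrite subrr.
by have := @is_deriveB R R R id (cst th) th 1 1 0; rewrite subr0; apply.
Qed.

Lemma is_derive_MVT (f df : R -> R) (a b : R) : a <= b ->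
  (forall th, a <= th <= b -> is_derive th 1 f (df th)) ->
  exists2 c, a <= c <= b & f b - f a = df c * (b - a).
Proof.
move=> ab fd; have [||c cab cE] := @MVT_segment R f df a b ab.
- by move=> x; rewrite in_itv/= => /andP[ac cb]; apply: fd; rewrite !ltW.
- apply: derivable_within_continuous => x; rewrite in_itv/= => xab.
  by have [] := fd _ xab.
- by exists c => //; move: cab; rewrite in_itv.
Qed.

End line_derivative.

Section flux.
Context {R : realType}.
Variable n : nat.
Local Notation leb := (@lebesgue_rV R n).
Implicit Types (F W : 'rV[R]_n -> R) (e : 'rV[R]_n).

(* Translation invariance makes the integral of every difference quotient of [F] vanish. *)
Lemma integral_derivative_eq0 F F' W (c : R) e :
  measurable_fun setT F -> measurable_fun setT F' -> intg leb W ->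
  (forall Z, `|F Z| <= W Z) -> (forall Z, `|F' Z| <= W Z) ->
  (forall Z th, 0 <= th <= 1 -> W (Z + th *: e) <= c * W Z) ->
  (forall Z, is_derive (0 : R) 1 (fun h => F (Z + h *: e)) (F' Z)) ->
  \int[leb]_Z F' Z = 0.
Proof.
move=> mF mF' Wi FW F'W Wc Fd.
have Fi : intg leb F by exact: le_intg mF FW Wi.
pose Q (m : nat) Z := m.+1%:R * (F (Z + m.+1%:R^-1 *: e) - F Z).
have Q0 m : \int[leb]_Z Q m Z = 0.
  rewrite /Q RintegralZl//; last exact: (intgB (intg_addr _ Fi) Fi).
  rewrite RintegralB//; last exact: (intg_addr _ Fi).
  by rewrite Rintegral_addr// subrr mulr0.
have [|||_] := @dominated_cvg_Rint _ _ _ leb Q F' (fun Z => c * W Z) _ _ (intgZ c Wi).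
- move=> m; apply: measurable_funM => //; apply: measurable_funB => //.
  exact: (measurableT_comp mF (measurable_addr_rV _)).
- move=> Z; have := is_derive_seq (Fd Z); rewrite /Q.
  by under eq_fun do rewrite scale0r addr0.
(* By the mean value theorem the quotient is a value of [F'] at some [Z + th *: e] with
   [0 <= th <= 1], so [c * W] dominates all quotients. *)
- move=> m Z; rewrite /Q.
  have m0 : 0 <= m.+1%:R^-1 :> R by rewrite invr_ge0.
  have [|th /andP[th0 th1] /=] := @is_derive_MVT R (fun h => F (Z + h *: e)) (fun h => F' (Z + h *: e)) 0 m.+1%:R^-1 m0.
  + move=> th _; apply: is_derive_shift.
    have := Fd (Z + th *: e); congr is_derive; apply/funext => h.
    by rewrite scalerDl addrA.
  rewrite scale0r addr0 => ->; rewrite subr0 mulrCA mulfV// mulr1 (le_trans (F'W _))//.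
  apply: Wc; rewrite th0/= (le_trans th1)// invf_le1// ler1n//.
by under eq_cvg do rewrite Q0; move=> /(cvg_lim (@norm_hausdorff _ _)) <-; rewrite lim_cst.
Qed.

(** Steps of length at most 1 change the weight by a bounded factor only, which is what the flux
    lemmas ask of their majorant [W]. *)
Lemma jw_near (x y : 'rV[R]_n) : sqn (x - y) <= 1 -> jw x <= 2 * jw y.
Proof.
move=> xy1; rewrite -(@ler_pXn2r _ 2)// ?nnegrE ?mulr_ge0 ?jw_ge0// exprMn !sqr_jw.
rewrite -[leLHS]mul1r ler_pdivrMr ?ltr_wpDr ?sqn_ge0// mulrAC ler_pdivlMr ?ltr_wpDr ?sqn_ge0// mul1r.
have := sqn_add_le (y - x) x; rewrite subrK -opprB sqnN => h.
have := sqn_ge0 x; lra.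
Qed.

Lemma jwX_near (x y : 'rV[R]_n) k : sqn (x - y) <= 1 -> jw x ^+ k <= 2 ^+ k * jw y ^+ k.
Proof.
move=> xy1; rewrite -exprMn lerXn2r ?nnegrE ?mulr_ge0 ?jw_ge0//; exact: jw_near.
Qed.

End flux.

Section half_space_flux.
Context {R : realType}.
Variable n : nat.
Local Notation leb := (@lebesgue_rV R n).
Local Notation leb1 := (@lebesgue_rV R n.+1).

Definition hd (Z : 'rV[R]_n.+1) : R := Z ord0 ord0.
Definition tl (Z : 'rV[R]_n.+1) : 'rV[R]_n := (rV_uncons Z).2.
Definition pl (z : 'rV[R]_n) : 'rV[R]_n.+1 := rV_cons (0, z).

Lemma hd_cons y z : hd (rV_cons (y, z)) = y.
Proof. by rewrite /hd rV_cons_ord0. Qed.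

Lemma tl_cons y z : tl (rV_cons (y, z)) = z.
Proof. by rewrite /tl rV_consK. Qed.

Lemma measurable_hd : measurable_fun setT hd.
Proof. exact: measurable_rV_coord. Qed.

Lemma measurable_tl : measurable_fun setT tl.
Proof. exact: (measurableT_comp measurable_snd (@measurable_rV_uncons R n)). Qed.

Lemma measurable_pl : measurable_fun setT pl.
Proof. by apply: (measurableT_comp (@measurable_rV_cons R n)); exact: measurable_pair1. Qed.

(** Multiplying by the indicator of a layer of unit thickness turns an integral over the hyperplane
    into one over the space, so that surface and volume integrals can be compared in a single
    measure space. *)
Definition slab (Z : 'rV[R]_n.+1) : R := \1_[set y : R | 0 < y <= 1] (hd Z).

Lemma measurable_slab : measurable_fun setT slab.
Proof.
apply: (measurableT_comp _ measurable_hd); apply: measurable_indic.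
rewrite (_ : mkset _ = [set` `]0, 1]%R]); first exact: measurable_itv.
by apply/seteqP; split => x /=; rewrite in_itv.
Qed.

Lemma ge0_integral_slab (h : 'rV[R]_n -> R) : measurable_fun setT h ->
  (forall z, 0 <= h z) ->
  (\int[leb1]_Z (slab Z * h (tl Z))%:E = \int[leb]_z (h z)%:E)%E.
Proof.
move=> mh h0; rewrite ge0_integral_rV_cons; last 2 first.
- apply/measurable_EFinP; apply: measurable_funM; first exact: measurable_slab.
  exact: (measurableT_comp mh measurable_tl).
- by move=> Z; rewrite lee_fin mulr_ge0.
have inner (y : measurableTypeR R) : (\int[leb]_z (slab (rV_cons (y, z)) * h (tl (rV_cons (y, z))))%:E =
    ((EFin \o \1_[set y : R | (0 < y <= 1)%R]) y) * \int[leb]_z (h z)%:E)%E.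
  under eq_integral do rewrite /slab hd_cons tl_cons EFinM.
  rewrite ge0_integralZl//; first exact/measurable_EFinP.
  by move=> z _; rewrite lee_fin.
under eq_integral do rewrite inner.
rewrite (_ : mkset _ = [set` `]0, 1]%R]); last first.
  by apply/seteqP; split => x /=; rewrite in_itv.
transitivity (\int[lebesgue_measure]_(x in [set` `]0%R, 1%R]]) \int[leb]_x0 (h x0)%:E)%E.
  rewrite [RHS]integral_mkcond; apply: eq_integral => y _; rewrite /patch /= indicE.
  by case: ifPn => _; rewrite ?mul1e ?mul0e.
rewrite integral_cst//= lebesgue_measure_itv/= lte_fin ltr01 -EFinB subr0 mule1 //.
Qed.

Lemma integral_slab (h : 'rV[R]_n -> R) : intg leb h ->
  \int[leb1]_Z (slab Z * h (tl Z)) = \int[leb]_z h z.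
Proof.
move=> hi; have mh := intg_measurable hi.
have P g : intg leb g -> (forall z, 0 <= g z) ->
    intg leb1 (fun Z => slab Z * g (tl Z)) /\
    \int[leb1]_Z (slab Z * g (tl Z)) = \int[leb]_z g z.
  move=> gi g0; have mg := intg_measurable gi.
  have E := ge0_integral_slab mg g0.
  split; last by rewrite /Rintegral E.
  apply: ge0_intg.
  - apply: measurable_funM; first exact: measurable_slab.
    exact: (measurableT_comp mg measurable_tl).
  - by move=> Z; rewrite mulr_ge0// /slab indicE.
  - by rewrite E; exact: intg_ge0_lty.
have [pi pE] := P _ (integrable_funrpos measurableT hi) (funrpos_ge0 h).
have [ni nE] := P _ (integrable_funrneg measurableT hi) (funrneg_ge0 h).
rewrite -[in RHS](funrposBneg h) [RHS]RintegralB//; last 2 first.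
- exact: integrable_funrpos.
- exact: integrable_funrneg.
rewrite -pE -nE -RintegralB//; apply: eq_Rintegral => Z _.
by rewrite -mulrBr -[in LHS](funrposBneg h).
Qed.

End half_space_flux.

Section cons_coordinates.
Context {R : realType}.
Variable n : nat.
Implicit Types (Z : 'rV[R]_n.+1) (z : 'rV[R]_n).

Lemma tlE Z j : tl Z ord0 j = Z ord0 (lift ord0 j).
Proof. by rewrite /tl/= mxE; congr (Z _ _); exact: val_inj. Qed.

Lemma rV_cons_eta Z : rV_cons (hd Z, tl Z) = Z.
Proof.
apply/rowP => i; case: (unliftP ord0 i) => [j|] ->.
  by rewrite rV_cons_lift/= tlE.
by rewrite rV_cons_ord0.
Qed.

Lemma sqn_cons (y : R) z : sqn (rV_cons (y, z)) = y ^+ 2 + sqn z.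
Proof.
rewrite /sqn big_ord_recl rV_cons_ord0; congr (_ + _).
by apply: eq_bigr => i _; rewrite rV_cons_lift.
Qed.

Lemma sqn_hd_tl Z : sqn Z = hd Z ^+ 2 + sqn (tl Z).
Proof. by rewrite -{1}(rV_cons_eta Z) sqn_cons. Qed.

Lemma rV_consD (y y' : R) z z' : rV_cons (y, z) + rV_cons (y', z') = rV_cons (y + y', z + z').
Proof.
apply/rowP => i; rewrite mxE; case: (unliftP ord0 i) => [j|] ->.
  by rewrite !rV_cons_lift/= mxE.
by rewrite !rV_cons_ord0.
Qed.

Lemma rV_consN (y : R) z : - rV_cons (y, z) = rV_cons (- y, - z).
Proof.
apply/rowP => i; rewrite mxE; case: (unliftP ord0 i) => [j|] ->.
  by rewrite !rV_cons_lift/= mxE.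
by rewrite !rV_cons_ord0.
Qed.

Lemma rV_consB (y y' : R) z z' : rV_cons (y, z) - rV_cons (y', z') = rV_cons (y - y', z - z').
Proof. by rewrite rV_consN rV_consD. Qed.

Definition e_ (i : 'I_n.+1) : 'rV[R]_n.+1 := delta_mx ord0 i.

Lemma e_E i j : e_ i ord0 j = (j == i)%:R.
Proof. by rewrite mxE eqxx. Qed.

Lemma sqn_e i : sqn (e_ i) = 1.
Proof.
rewrite /sqn (bigD1 i)//= e_E eqxx expr1n big1 ?addr0// => j ji.
by rewrite e_E (negbTE ji) expr0n.
Qed.

Lemma e_ord0_cons (h y : R) z : rV_cons (y, z) + h *: e_ ord0 = rV_cons (y + h, z).
Proof.
have -> : h *: e_ ord0 = rV_cons (h, 0 : 'rV[R]_n).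
  apply/rowP => i; rewrite mxE e_E; case: (unliftP ord0 i) => [j|] ->.
    have /negbTE -> : lift ord0 j != ord0 by rewrite eq_sym neq_lift.
    by rewrite rV_cons_lift mxE mulr0.
  by rewrite rV_cons_ord0 eqxx mulr1.
by rewrite rV_consD addr0.
Qed.

Lemma hd_add Z Z' : hd (Z + Z') = hd Z + hd Z'.
Proof. by rewrite /hd mxE. Qed.

Lemma hd_scale_e (h : R) i : hd (h *: e_ i) = h * (ord0 == i)%:R.
Proof. by rewrite /hd mxE e_E. Qed.

End cons_coordinates.

Section half_space_flux_normal.
Context {R : realType}.
Variable n : nat.
Local Notation leb := (@lebesgue_rV R n).
Local Notation leb1 := (@lebesgue_rV R n.+1).
Implicit Types (Z : 'rV[R]_n.+1).

Definition upI (Z : 'rV[R]_n.+1) : R := \1_[set y : R | 0 < y] (hd Z).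

Lemma upIE Z : upI Z = (0 < hd Z)%R%:R.
Proof. by rewrite /upI indicE mem_setE. Qed.

Lemma measurable_upI : measurable_fun setT upI.
Proof.
apply: (measurableT_comp _ (@measurable_hd R n)); apply: measurable_indic.
rewrite (_ : mkset _ = [set` `]0, +oo[%R]); first exact: measurable_itv.
by apply/seteqP; split => x /=; rewrite in_itv/= andbT.
Qed.

Lemma upI_ge0 Z : 0 <= upI Z. Proof. by rewrite upIE. Qed.

Lemma upI_le1 Z : upI Z <= 1. Proof. by rewrite upIE; case: (_ < _). Qed.

(** The fundamental theorem of calculus in the direction normal to the hyperplane. The difference
    quotient of step h integrates over the half-space to -1/h times the integral of [S] over the
    layer [0 < hd Z <= h]; stretching that layer to unit thickness puts all steps on the same slab,
    where dominated convergence applies. *)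
Lemma half_space_flux (S S' W : 'rV[R]_n.+1 -> R) (c : R) :
  measurable_fun setT S -> measurable_fun setT S' -> intg leb1 W ->
  (forall Z, 0 <= hd Z -> `|S Z| <= W Z) -> (forall Z, 0 <= hd Z -> `|S' Z| <= W Z) ->
  (forall Z, 0 <= W Z) -> 0 <= c ->
  (forall Z Z', sqn (Z - Z') <= 1 -> W Z <= c * W Z') ->
  (forall Z, 0 <= hd Z -> is_derive (0 : R) 1 (fun h => S (Z + h *: e_ ord0)) (S' Z)) ->
  intg leb (fun z => S (pl z)) /\
  \int[leb1]_Z (upI Z * S' Z) = - \int[leb]_z S (pl z).
Proof.
move=> mS mS' Wi SW S'W W0 c0 Wc Sd.
have mpl : measurable_fun setT (fun z => S (pl z)) by exact: (measurableT_comp mS (@measurable_pl R n)).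
have slabP Z : slab Z = (0 < hd Z <= 1)%R%:R by rewrite /slab indicE mem_setE.
have slab01 Z : 0 <= slab Z by rewrite slabP.
have near_slab (t : R) Y : 0 <= t <= 1 -> 0 < hd Y <= 1 ->
    sqn (rV_cons (t * hd Y, tl Y) - Y) <= 1.
  move=> /andP[t0 t1] /andP[y0 y1]; rewrite -[X in _ - X]rV_cons_eta rV_consB subrr sqn_cons sqn0 addr0.
  rewrite -[X in _ - X]mul1r -mulrBl -sqrrN -mulNr opprB expr_le1//; last first.
    by rewrite mulr_ge0// ?subr_ge0// ltW.
  by rewrite mulr_ile1// ?subr_ge0// ?lerBlDr ?lerDl// ltW.
have plE Y : pl (tl Y) = rV_cons (0 * hd Y, tl Y) by rewrite mul0r.
have bslab (t : R) Y : 0 <= t <= 1 -> `|slab Y * S (rV_cons (t * hd Y, tl Y))| <= c * W Y.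
  move=> t01; rewrite normrM (ger0_norm (slab01 _)) slabP.
  have [/andP[y0 y1]|_] := boolP (0 < hd Y <= 1); last by rewrite mul0r mulr_ge0.
  rewrite mul1r (le_trans (SW _ _))//.
    by rewrite hd_cons mulr_ge0// ?(ltW y0)//; case/andP: t01.
  by apply: Wc; apply: near_slab => //; rewrite y0.
(* [S] is dominated in the volume only; but points of the slab lie within distance 1 of their feet
   on the hyperplane, so [c * W] also dominates the restriction of [S]. *)
have ispl : intg leb (fun z => S (pl z)).
  apply/integrableP; split; first exact/measurable_EFinP.
  under eq_integral do rewrite /=.
  rewrite -ge0_integral_slab//; last exact: measurableT_comp.
  apply: le_lt_trans (intg_ge0_lty (intgZ c Wi) _); last by move=> Z; rewrite mulr_ge0.
  apply: ge0_le_integral => //.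
  - by move=> Z _; rewrite lee_fin mulr_ge0.
  - apply/measurable_EFinP; apply: measurable_funM; first exact: measurable_slab.
    apply: measurableT_comp => //; exact: (measurableT_comp mpl (@measurable_tl R n)).
  - by apply/measurable_EFinP; exact: intg_measurable (intgZ c Wi).
  - move=> Z _; rewrite lee_fin -{1}(ger0_norm (slab01 Z)) -normrM plE.
    by apply: bslab; rewrite lexx ler01.
split => //.
pose Q (m : nat) Z := upI Z * (m.+1%:R * (S (Z + m.+1%:R^-1 *: e_ ord0) - S Z)).
pose P (m : nat) Y := slab Y * S (rV_cons (m.+1%:R^-1 * hd Y, tl Y)).
have m01 (m : nat) : 0 <= (m.+1%:R^-1 : R) <= 1.
  by rewrite invr_ge0 ler0n/= invf_le1// ler1n.
have mP m : measurable_fun setT (P m).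
  apply: measurable_funM; first exact: measurable_slab.
  apply: (measurableT_comp mS); apply: (measurableT_comp (@measurable_rV_cons R n)).
  apply/measurable_fun_pairP; split; last exact: measurable_tl.
  rewrite (_ : _ \o _ = (fun y : measurableTypeR R => m.+1%:R^-1 * y + 0) \o (fun Z : 'rV[R]_n.+1 => Z ord0 ord0)); last first.
    by apply/funext => Z /=; rewrite addr0.
  exact: (measurableT_comp (measurable_affine _ _) (measurable_rV_coord _)).
have uS : intg leb1 (fun Z => upI Z * S Z).
  apply: le_intg Wi; first by apply: measurable_funM => //; exact: measurable_upI.
  move=> Z; rewrite upIE; have [h|_] := ltrP 0 (hd Z); last by rewrite mul0r normr0.
  by rewrite mul1r; exact/SW/ltW.
have QP m : \int[leb1]_Z Q m Z = - \int[leb1]_Y P m Y.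
  have mp : 0 < m.+1%:R^-1 :> R by rewrite invr_gt0.
  pose B Z : R := \1_[set y : R | m.+1%:R^-1 < y] (hd Z).
  have BE Z : B Z = (m.+1%:R^-1 < hd Z)%R%:R by rewrite /B indicE mem_setE.
  have mB : measurable_fun setT B.
    apply: (measurableT_comp _ (@measurable_hd R n)); apply: measurable_indic.
    rewrite (_ : mkset _ = [set` `]m.+1%:R^-1, +oo[%R]); first exact: measurable_itv.
    by apply/seteqP; split => x /=; rewrite in_itv/= andbT.
  have BS : intg leb1 (fun Z => B Z * S Z).
    apply: le_intg Wi; first by apply: measurable_funM.
    move=> Z; rewrite BE; have [h|_] := ltrP m.+1%:R^-1 (hd Z); last first.
      by rewrite mul0r normr0.
    by rewrite mul1r; apply: SW; rewrite ltW// (lt_trans mp).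
  have hdE Z : hd (Z + m.+1%:R^-1 *: e_ ord0) = hd Z + m.+1%:R^-1.
    by rewrite hd_add hd_scale_e eqxx mulr1.
  have BZ Z : upI Z = B (Z + m.+1%:R^-1 *: e_ ord0) by rewrite BE upIE hdE ltrDr.
  have -> : \int[leb1]_Z Q m Z = m.+1%:R * (\int[leb1]_Z (B Z * S Z) - \int[leb1]_Z (upI Z * S Z)).
    rewrite -(Rintegral_addr (m.+1%:R^-1 *: e_ ord0) BS) -RintegralB//; last exact: (intg_addr _ BS).
    rewrite -RintegralZl//; last exact: (intgB (intg_addr _ BS) uS).
    apply: eq_Rintegral => Z _; rewrite /Q mulrCA; congr (_ * _).
    by rewrite mulrBr BZ.
  pose F Z := upI Z * S Z - B Z * S Z.
  have Fi : intg leb1 F by exact: intgB.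
  have -> : \int[leb1]_Z (B Z * S Z) - \int[leb1]_Z (upI Z * S Z) = - \int[leb1]_Z F Z.
    by rewrite RintegralB// opprB.
  (* Only the height is rescaled; the Jacobian of this map cancels the factor [m.+1%:R] of the
     difference quotient. *)
  pose l (i : 'I_n.+1) : R := if i == ord0 then m.+1%:R^-1 else 1.
  rewrite (@Rintegral_affine _ _ l (fun=> 0) _ _ Fi); last first.
    by move=> i; rewrite /l; case: ifPn => _; rewrite ?invr_eq0 ?oner_neq0.
  have -> : \prod_i `|l i| = m.+1%:R^-1.
    rewrite big_ord_recl /l eqxx big1 ?mulr1 ?gtr0_norm// => i _.
    have /negbTE -> : lift ord0 i != ord0 by rewrite eq_sym neq_lift.
    exact: normr1.
  rewrite mulrN mulrA mulfV// mul1r; congr (- _); apply: eq_Rintegral => Y _.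
  have -> : rdiag l (fun=> 0) Y = rV_cons (m.+1%:R^-1 * hd Y, tl Y).
    apply/rowP => i; rewrite mxE addr0; case: (unliftP ord0 i) => [j|] ->.
      have /negbTE lj : lift ord0 j != ord0 by rewrite eq_sym neq_lift.
      by rewrite rV_cons_lift/= tlE /l lj mul1r.
    by rewrite rV_cons_ord0 /l eqxx.
  rewrite /F /P -mulrBl; congr (_ * _); rewrite upIE BE slabP hd_cons.
  rewrite pmulr_rgt0// -[X in X < _ * _]mulr1 ltr_pM2l//.
  have [y0|y0] := ltrP 0 (hd Y); have [y1|y1] := ltrP 1 (hd Y); rewrite /= ?subrr ?subr0//.
  by have := lt_le_trans y1 y0; rewrite ltr10.
have [|||_ cQ] := @dominated_cvg_Rint _ _ _ leb1 Q (fun Z => upI Z * S' Z) (fun Z => c * W Z) _ _ (intgZ c Wi).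
- move=> m; apply: measurable_funM; first exact: measurable_upI.
  apply: measurable_funM => //; apply: measurable_funB => //.
  exact: (measurableT_comp mS (measurable_addr_rV _)).
- move=> Z; rewrite /Q upIE; have [h|_] := ltrP 0 (hd Z); last first.
    by under eq_fun do rewrite mul0r; rewrite mul0r; exact: cvg_cst.
  under eq_fun do rewrite mul1r; rewrite mul1r.
  have := is_derive_seq (Sd Z (ltW h)).
  by under eq_fun do rewrite scale0r addr0.
- move=> m Z; rewrite /Q upIE; have [h|_] := ltrP 0 (hd Z); last first.
    by rewrite mul0r normr0 mulr_ge0.
  rewrite mul1r; have /andP[m0 m1] := m01 m.
  have [|th /andP[th0 th1] /=] := @is_derive_MVT R (fun h => S (Z + h *: e_ ord0))
      (fun h => S' (Z + h *: e_ ord0)) 0 m.+1%:R^-1 m0.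
    move=> th /andP[th0 _]; apply: is_derive_shift.
    have := Sd (Z + th *: e_ ord0); rewrite hd_add hd_scale_e eqxx mulr1.
    move=> /(_ (addr_ge0 (ltW h) th0)); congr is_derive; apply/funext => k.
    by rewrite scalerDl addrA.
  rewrite scale0r addr0 => ->; rewrite subr0 mulrCA mulfV// mulr1.
  rewrite (le_trans (S'W _ _))//.
    by rewrite hd_add hd_scale_e eqxx mulr1 addr_ge0// ltW.
  apply: Wc; rewrite addrAC subrr add0r sqn_scale sqn_e mulr1 expr_le1//.
  exact: le_trans th1 m1.
have [|||_ cP] := @dominated_cvg_Rint _ _ _ leb1 P (fun Y => slab Y * S (pl (tl Y))) (fun Z => c * W Z) _ _ (intgZ c Wi).
- exact: mP.
- move=> Y; apply: cvgM; first exact: cvg_cst.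
  have := Sd (pl (tl Y)); rewrite hd_cons => /(_ (lexx _)) [dv _].
  have dc : {for (0 : R), continuous (fun h : R => S (pl (tl Y) + h *: e_ ord0))}.
    by apply: differentiable_continuous; exact/derivable1_diffP.
  have h0 : (fun m : nat => m.+1%:R^-1 * hd Y) @ \oo --> (0 : R).
    by rewrite -[0 in X in _ --> X](mul0r (hd Y)); apply: cvgM; [exact: cvg_harmonic|exact: cvg_cst].
  have := cvg_comp _ _ h0 dc; rewrite scale0r addr0.
  by under eq_fun do rewrite /= /pl e_ord0_cons add0r.
- by move=> m Y; apply: bslab; exact: m01.
move: cQ; under eq_cvg do rewrite QP.
move=> cQ.
have cP' : (fun m => - \int[leb1]_Y P m Y) @ \oo --> - \int[leb]_z S (pl z).
  by rewrite -(integral_slab ispl); exact: (cvgN cP).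
exact: (cvg_unique _ cQ cP').
Qed.

End half_space_flux_normal.

(** * Stress tensor of two radial fields *)

Section pointwise_derivatives.
Context {R : realType}.
Implicit Types (f g : R -> R) (x df dg : R).

Lemma is_derive_mul f g x df dg : is_derive x 1 f df -> is_derive x 1 g dg ->
  is_derive x 1 (fun t => f t * g t) (df * g x + f x * dg).
Proof.
by move=> fd gd; have := is_deriveM fd gd; rewrite addrC /GRing.scale/= (mulrC (g x)).
Qed.

Lemma is_derive_add f g x df dg : is_derive x 1 f df -> is_derive x 1 g dg ->
  is_derive x 1 (fun t => f t + g t) (df + dg).
Proof. by move=> fd gd; exact: is_deriveD fd gd. Qed.

Lemma is_derive_sub f g x df dg : is_derive x 1 f df -> is_derive x 1 g dg ->
  is_derive x 1 (fun t => f t - g t) (df - dg).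
Proof. by move=> fd gd; exact: is_deriveB fd gd. Qed.

Lemma is_derive_sumf n (F : 'I_n -> R -> R) x (dF : 'I_n -> R) :
  (forall i, is_derive x 1 (F i) (dF i)) ->
  is_derive x 1 (fun t => \sum_i F i t) (\sum_i dF i).
Proof.
move=> Fd; have := @is_derive_sum R R R n F x 1 dF Fd.
by rewrite (_ : \sum_(i < n) F i = fun t => \sum_i F i t)//; apply/funext => t; rewrite fct_sumE.
Qed.

Lemma is_derive_const (a x : R) : is_derive x 1 (fun=> a) 0.
Proof. exact: is_derive_cst. Qed.

Lemma is_derive_var (x : R) : is_derive x 1 (fun t => t) 1.
Proof. exact: is_derive_id. Qed.

Lemma is_derive_affine (a b x : R) : is_derive x 1 (fun t => a + t * b) b.
Proof.
have := is_derive_add (is_derive_const a x) (is_derive_mul (is_derive_var x) (is_derive_const b x)).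
by rewrite mulr0 addr0 add0r mul1r.
Qed.

End pointwise_derivatives.

Section radial_fields.
Context {R : realType}.
Variable n : nat.
Implicit Types (a b : R -> R) (C Z : 'rV[R]_n.+1).

(** The field (Z - C) a(|Z - C|^2). A profile in the squared distance keeps the field differentiable
    at its centre. *)
Definition rad a C Z (i : 'I_n.+1) : R := (Z - C) ord0 i * a (sqn (Z - C)).

Definition drad a (a' : R -> R) C Z (i j : 'I_n.+1) : R :=
  (i == j)%:R * a (sqn (Z - C)) + 2 * (Z - C) ord0 i * (Z - C) ord0 j * a' (sqn (Z - C)).

(** The divergence of the field, that is, the Laplacian of its potential. *)
Definition lapl a (a' : R -> R) C Z : R :=
  n.+1%:R * a (sqn (Z - C)) + 2 * sqn (Z - C) * a' (sqn (Z - C)).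

(** Radial fields are gradients; this is the vanishing of their curl, on which the divergence
    formula for the stress tensor rests. *)
Lemma drad_sym a a' C Z i j : drad a a' C Z i j = drad a a' C Z j i.
Proof. by rewrite /drad eq_sym -!mulrA (mulrCA ((Z - C) ord0 i)). Qed.

Lemma sum_drad a a' C Z : \sum_i drad a a' C Z i i = lapl a a' C Z.
Proof.
rewrite /drad big_split/=; congr (_ + _).
  by under eq_bigr do rewrite eqxx mul1r; rewrite sumr_const card_ord (mulr_natl _ n.+1).
rewrite /sqn mulr_sumr mulr_suml; apply: eq_bigr => i _.
by rewrite expr2 !mulrA.
Qed.

Lemma sqn_line Z i (t : R) : sqn (Z + t *: e_ i) = sqn Z + t * (2 * Z ord0 i + t).
Proof.
rewrite /sqn (bigD1 i)//= [in RHS](bigD1 i)//= -addrA [X in _ = _ + X]addrC addrA.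
congr (_ + _); first by rewrite !mxE !eqxx /=; ring.
by apply: eq_bigr => k ki; rewrite !mxE eqxx (negbTE ki) mulr0 addr0.
Qed.

Lemma is_derive_rad a a' C Z i j :
  is_derive (sqn (Z - C)) 1 a (a' (sqn (Z - C))) ->
  is_derive (0 : R) 1 (fun t => rad a C (Z + t *: e_ i) j) (drad a a' C Z i j).
Proof.
move=> ad; set W := Z - C.
have ZE t : Z + t *: e_ i - C = W + t *: e_ i by rewrite addrAC.
have -> : (fun t => rad a C (Z + t *: e_ i) j) =
    (fun t => (W ord0 j + t * (i == j)%:R) * a (sqn W + t * (2 * W ord0 i + t))).
  by apply/funext => t; rewrite /rad ZE sqn_line !mxE eqxx eq_sym.
have sd : is_derive (0 : R) 1 (fun t => sqn W + t * (2 * W ord0 i + t)) (2 * W ord0 i).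
  have := is_derive_add (is_derive_const (sqn W) 0)
    (is_derive_mul (is_derive_var 0)
      (is_derive_add (is_derive_const (2 * W ord0 i) 0) (is_derive_var 0))).
  by rewrite add0r mul0r addr0 mul1r addr0.
have ad' : is_derive ((fun t => sqn W + t * (2 * W ord0 i + t)) 0) 1 a (a' (sqn W)).
  by rewrite mul0r addr0.
have := is_derive_mul (is_derive_affine (W ord0 j) (i == j)%:R 0) 
  (@is_derive1_comp R a (fun t => sqn W + t * (2 * W ord0 i + t)) 0 _ _ ad' sd).
rewrite /= !mul0r !addr0; congr is_derive; rewrite /drad -/W; ring.
Qed.

End radial_fields.

Section stress_tensor.
Context {R : realType}.
Variable n : nat.
Variables (u w : 'rV[R]_n.+1 -> 'I_n.+1 -> R).
Variables (du dw : 'rV[R]_n.+1 -> 'I_n.+1 -> 'I_n.+1 -> R).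

(* Maxwell's stress tensor of the gradient fields [u] and [w]; its divergence is
   [u * div w + w * div u]. *)
Definition stress (i j : 'I_n.+1) Z : R :=
  u Z j * w Z i + u Z i * w Z j - (i == j)%:R * \sum_l u Z l * w Z l.

Definition dstress (i j : 'I_n.+1) Z : R :=
  du Z i j * w Z i + u Z j * dw Z i i + (du Z i i * w Z j + u Z i * dw Z i j) -
  (i == j)%:R * \sum_l (du Z i l * w Z l + u Z l * dw Z i l).

(** As the curls vanish, the derivative of the trace term cancels the mixed products
    [du Z i j * w Z i] and [u Z i * dw Z i j]. *)
Lemma sum_dstress j Z : (forall i k, du Z i k = du Z k i) -> (forall i k, dw Z i k = dw Z k i) ->
  \sum_i dstress i j Z = u Z j * (\sum_i dw Z i i) + (\sum_i du Z i i) * w Z j.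
Proof.
move=> su sw; rewrite /dstress sumrB [X in _ - X](bigD1 j)//= eqxx mul1r.
rewrite [X in _ - (_ + X)]big1 ?addr0; last first.
  by move=> i /negbTE ->; rewrite mul0r.
rewrite -sumrB mulr_sumr mulr_suml -big_split/=; apply: eq_bigr => i _.
rewrite (su j i) (sw j i); ring.
Qed.

Lemma is_derive_stress i j Z :
  (forall k, is_derive (0 : R) 1 (fun t => u (Z + t *: e_ i) k) (du Z i k)) ->
  (forall k, is_derive (0 : R) 1 (fun t => w (Z + t *: e_ i) k) (dw Z i k)) ->
  is_derive (0 : R) 1 (fun t => stress i j (Z + t *: e_ i)) (dstress i j Z).
Proof.
move=> ud wd; rewrite /stress.
have uw k l := is_derive_mul (ud k) (wd l).
have sd := is_derive_sumf (fun l => uw l l).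
have := is_derive_sub (is_derive_add (uw j i) (uw i j))
  (is_derive_mul (is_derive_const (i == j)%:R 0) sd).
rewrite /= scale0r !addr0 mul0r add0r; congr is_derive.
Qed.

Lemma stress_bound (A B : R) i j Z : 0 <= A -> 0 <= B ->
  (forall k, `|u Z k| <= A) -> (forall k, `|w Z k| <= B) ->
  `|stress i j Z| <= (n.+1%:R + 2) * (A * B).
Proof.
move=> A0 B0 uA wB.
have uw k l : `|u Z k * w Z l| <= A * B by rewrite normrM ler_pM.
rewrite /stress (le_trans (ler_normB _ _))// addrC mulrDl lerD//; last first.
  by rewrite (le_trans (ler_normD _ _))// mulr_natl mulr2n lerD.
rewrite normrM -[leRHS]mul1r ler_pM//; first by case: (_ == _); rewrite ?normr0 ?normr1.
rewrite (le_trans (ler_norm_sum _ _ _))// (le_trans (ler_sum _ (fun l _ => uw l l)))//.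
by rewrite sumr_const card_ord (mulr_natl _ n.+1).
Qed.

Lemma dstress_bound (A B : R) i j Z : 0 <= A -> 0 <= B ->
  (forall k, `|u Z k| <= A) -> (forall k, `|w Z k| <= B) ->
  (forall k l, `|du Z k l| <= 3 * A) -> (forall k l, `|dw Z k l| <= 3 * B) ->
  `|dstress i j Z| <= (n.+1%:R + 2) * (6 * (A * B)).
Proof.
move=> A0 B0 uA wB duA dwB.
have uw k l k' l' m m' : `|du Z k l * w Z m + u Z m' * dw Z k' l'| <= 6 * (A * B).
  rewrite (le_trans (ler_normD _ _))// !normrM.
  have h1 : `|du Z k l| * `|w Z m| <= 3 * A * B by rewrite ler_pM.
  have h2 : `|u Z m'| * `|dw Z k' l'| <= A * (3 * B) by rewrite ler_pM.
  by apply: le_trans (lerD h1 h2) _; rewrite le_eqVlt; apply/orP; left; apply/eqP; ring.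
have AB0 : 0 <= A * B by rewrite mulr_ge0.
rewrite /dstress (le_trans (ler_normB _ _))// addrC mulrDl lerD//; last first.
  by rewrite (le_trans (ler_normD _ _))// mulr_natl mulr2n lerD.
rewrite normrM -[leRHS]mul1r ler_pM//; first by case: (_ == _); rewrite ?normr0 ?normr1.
rewrite (le_trans (ler_norm_sum _ _ _))// (le_trans (ler_sum _ (fun l _ => uw i l i l l l)))//.
by rewrite sumr_const card_ord (mulr_natl _ n.+1).
Qed.

End stress_tensor.

Section stress_flux.
Context {R : realType}.
Variable n : nat.
Hypothesis n2 : (2 <= n)%N.
Local Notation leb := (@lebesgue_rV R n).
Local Notation leb1 := (@lebesgue_rV R n.+1).

(** Decay like that of Newton's field: [rad a] is of order |Z|^-n and its derivatives are no larger.
    The threshold [s0] on the squared distance is 0 for softened fields; a positive value admits the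
    singular field on a half-space that stays away from its pole. *)
Definition radial_ok (a a' : R -> R) (s0 K : R) : Prop :=
  [/\ 0 <= K, measurable_fun setT a, measurable_fun setT a' &
    forall s, s0 <= s -> [/\ is_derive s 1 a (a' s),
      `|a s| <= K * (Num.sqrt (1 + s))^-1 ^+ n.+1 &
      `|a' s| <= K * (Num.sqrt (1 + s))^-1 ^+ n.+3 ]].

Lemma coord_jw_le1 (Z : 'rV[R]_n.+1) k : `|Z ord0 k| * jw Z <= 1.
Proof.
rewrite /jw ler_pdivrMr ?sqrtr_gt0 ?ltr_wpDr ?sqn_ge0// mul1r.
rewrite (le_trans (coord_le_enorm _ _))// enormE ler_wsqrtr// lerDr.
exact: ler01.
Qed.

Section one_field.
Variables (a a' : R -> R) (s0 K : R) (C : 'rV[R]_n.+1).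
Hypothesis ok : radial_ok a a' s0 K.

Lemma radial_ok_ge0 : 0 <= K. Proof. by case: ok. Qed.

Lemma measurable_sqnB : measurable_fun setT (fun Z : 'rV[R]_n.+1 => sqn (Z - C)).
Proof. exact: (measurableT_comp (@measurable_sqn R n.+1) (measurable_addr_rV (- C))). Qed.

Lemma measurable_coordB k : measurable_fun setT (fun Z : 'rV[R]_n.+1 => (Z - C) ord0 k : R).
Proof. exact: (measurableT_comp (measurable_rV_coord k) (measurable_addr_rV (- C))). Qed.

Lemma measurable_rad k : measurable_fun setT (fun Z => rad a C Z k).
Proof.
case: ok => _ ma _ _; apply: measurable_funM; first exact: measurable_coordB.
exact: (measurableT_comp ma measurable_sqnB).
Qed.

Lemma measurable_drad k l : measurable_fun setT (fun Z => drad a a' C Z k l).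
Proof.
case: ok => _ ma ma' _; apply: measurable_funD.
  by apply: measurable_funM => //; exact: (measurableT_comp ma measurable_sqnB).
apply: measurable_funM; last exact: (measurableT_comp ma' measurable_sqnB).
apply: measurable_funM; last exact: measurable_coordB.
by apply: measurable_funM => //; exact: measurable_coordB.
Qed.

Lemma rad_bound Z k : s0 <= sqn (Z - C) -> `|rad a C Z k| <= K * jw (Z - C) ^+ n.
Proof.
case: ok => K0 _ _ h /h[_ aK _]; rewrite /rad normrM.
rewrite (le_trans (ler_wpM2l (normr_ge0 _) aK))// -/(jw _) exprSr mulrCA -[leRHS]mulr1.
rewrite -mulrA ler_wpM2l// mulrCA ler_wpM2l ?exprn_ge0 ?jw_ge0//.
by rewrite mulrC; apply: le_trans (coord_jw_le1 _ k); rewrite mulrC.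
Qed.

Lemma drad_bound Z k l : s0 <= sqn (Z - C) -> `|drad a a' C Z k l| <= 3 * (K * jw (Z - C) ^+ n).
Proof.
case: ok => K0 _ _ h /h[_ aK a'K]; rewrite /drad.
set W := Z - C in aK a'K *.
have j01 : 0 <= jw W <= 1 by rewrite jw_ge0 jw_le1.
have aK' : `|a (sqn W)| <= K * jw W ^+ n.
  rewrite (le_trans aK)// ler_wpM2l// -/(jw _) exprSr ler_piMr ?exprn_ge0 ?jw_ge0//.
  exact: jw_le1.
rewrite (le_trans (ler_normD _ _))//.
have -> : 3 * (K * jw W ^+ n) = K * jw W ^+ n + 2 * (K * jw W ^+ n) by ring.
apply: lerD.
  rewrite normrM (le_trans _ aK')//.
  by case: (_ == _); rewrite ?normr0 ?normr1 ?mul1r ?mul0r.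
rewrite !normrM gtr0_norm// -!mulrA ler_wpM2l//.
rewrite mulrA (le_trans (ler_wpM2l (mulr_ge0 (normr_ge0 _) (normr_ge0 _)) a'K))// -/(jw _).
rewrite mulrCA ler_wpM2l//.
have -> : `|W ord0 k| * `|W ord0 l| * jw W ^+ n.+3 =
  jw W ^+ n * (((`|W ord0 k| * jw W) * (`|W ord0 l| * jw W)) * jw W) by rewrite !exprS; ring.
have [j0 j1] := andP j01.
rewrite ler_piMr ?exprn_ge0//; apply: mulr_ile1 => //; first by rewrite !mulr_ge0.
by apply: mulr_ile1; rewrite ?mulr_ge0 ?coord_jw_le1.
Qed.

Lemma measurable_lapl : measurable_fun setT (lapl a a' C).
Proof.
rewrite (_ : lapl a a' C = fun Z => \sum_i drad a a' C Z i i).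
  by apply: measurable_sum => i; exact: measurable_drad.
by apply/funext => Z; rewrite sum_drad.
Qed.

End one_field.

Section two_fields.
Variables (a1 a1' a2 a2' : R -> R) (s1 K1 s2 K2 : R) (C1 C2 : 'rV[R]_n.+1).
Hypothesis ok1 : radial_ok a1 a1' s1 K1.
Hypothesis ok2 : radial_ok a2 a2' s2 K2.

Let T := stress (rad a1 C1) (rad a2 C2).
Let dT := dstress (rad a1 C1) (rad a2 C2) (drad a1 a1' C1) (drad a2 a2' C2).
(** Two fields of order |Z|^-n have a stress of order |Z|^-2n, integrable at infinity in dimension n
    + 1 because [2 <= n]. The product of the weights at the two centres is majorised by the sum of
    their squares, so that each centre can be treated separately. *)
Let W (Z : 'rV[R]_n.+1) : R :=
  (n.+1%:R + 2) * (6 * (K1 * K2)) * (jw (Z - C1) ^+ (n + n) + jw (Z - C2) ^+ (n + n)).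

Let c0 : 0 <= (n.+1%:R + 2) * (6 * (K1 * K2)).
Proof. by rewrite !mulr_ge0// ?addr_ge0// (radial_ok_ge0 ok1, radial_ok_ge0 ok2). Qed.

Let W_ge0 Z : 0 <= W Z.
Proof. by rewrite mulr_ge0// addr_ge0// exprn_ge0// jw_ge0. Qed.

Let W_intg : intg leb1 W.
Proof.
apply: intgZ; apply: intgD; apply: (intg_addr _ (f := fun Z => jw Z ^+ (n + n)));
  by apply: intg_jwX; rewrite -addn1 ltn_add2l.
Qed.

Let W_near Z Z' : sqn (Z - Z') <= 1 -> W Z <= 2 ^+ (n + n) * W Z'.
Proof.
move=> ZZ'; rewrite /W [leRHS]mulrCA ler_wpM2l// mulrDr.
by apply: lerD; apply: jwX_near; rewrite opprB addrA subrK.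
Qed.

Let prod_W Z : (n.+1%:R + 2) * (6 * ((K1 * jw (Z - C1) ^+ n) * (K2 * jw (Z - C2) ^+ n))) <= W Z.
Proof.
set p := jw (Z - C1) ^+ n; set q := jw (Z - C2) ^+ n.
have -> : (n.+1%:R + 2) * (6 * (K1 * p * (K2 * q))) = ((n.+1%:R + 2) * (6 * (K1 * K2))) * (p * q).
  by ring.
rewrite /W ler_wpM2l// !exprD -/p -/q; have := sqr_ge0 (p - q); have := sqr_ge0 (p + q); nra.
Qed.

Let TW i j Z : s1 <= sqn (Z - C1) -> s2 <= sqn (Z - C2) -> `|T i j Z| <= W Z.
Proof.
move=> h1 h2; apply: le_trans (prod_W Z).
have A0 : 0 <= K1 * jw (Z - C1) ^+ n by rewrite mulr_ge0 ?exprn_ge0 ?jw_ge0// (radial_ok_ge0 ok1).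
have B0 : 0 <= K2 * jw (Z - C2) ^+ n by rewrite mulr_ge0 ?exprn_ge0 ?jw_ge0// (radial_ok_ge0 ok2).
apply: le_trans (stress_bound i j A0 B0 _ _) _.
- by move=> k; exact: (rad_bound ok1).
- by move=> k; exact: (rad_bound ok2).
- by rewrite ler_wpM2l ?addr_ge0//; have := mulr_ge0 A0 B0; lra.
Qed.

Let dTW i j Z : s1 <= sqn (Z - C1) -> s2 <= sqn (Z - C2) -> `|dT i j Z| <= W Z.
Proof.
move=> h1 h2; apply: le_trans (prod_W Z).
apply: dstress_bound.
- by rewrite mulr_ge0 ?exprn_ge0 ?jw_ge0// (radial_ok_ge0 ok1).
- by rewrite mulr_ge0 ?exprn_ge0 ?jw_ge0// (radial_ok_ge0 ok2).
- by move=> k; exact: (rad_bound ok1).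
- by move=> k; exact: (rad_bound ok2).
- by move=> k l; exact: (drad_bound ok1).
- by move=> k l; exact: (drad_bound ok2).
Qed.

Let mT i j : measurable_fun setT (T i j).
Proof.
have m1 k := measurable_rad C1 ok1 k; have m2 k := measurable_rad C2 ok2 k.
apply: measurable_funB.
  by apply: measurable_funD; apply: measurable_funM.
by apply: measurable_funM => //; apply: measurable_sum => l; exact: measurable_funM.
Qed.

Let mdT i j : measurable_fun setT (dT i j).
Proof.
have m1 k := measurable_rad C1 ok1 k; have m2 k := measurable_rad C2 ok2 k.
have d1 k l := measurable_drad C1 ok1 k l; have d2 k l := measurable_drad C2 ok2 k l.
apply: measurable_funB.
  by apply: measurable_funD; apply: measurable_funD; apply: measurable_funM.
apply: measurable_funM => //; apply: measurable_sum => l.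
by apply: measurable_funD; apply: measurable_funM.
Qed.

Let Td i j Z : s1 <= sqn (Z - C1) -> s2 <= sqn (Z - C2) ->
  is_derive (0 : R) 1 (fun t => T i j (Z + t *: e_ i)) (dT i j Z).
Proof.
move=> h1 h2; apply: is_derive_stress => k; apply: is_derive_rad.
  by case: ok1 => _ _ _ /(_ _ h1)[].
by case: ok2 => _ _ _ /(_ _ h2)[].
Qed.

Let sum_dT j Z : \sum_i dT i j Z =
  rad a1 C1 Z j * lapl a2 a2' C2 Z + lapl a1 a1' C1 Z * rad a2 C2 Z j.
Proof.
by rewrite sum_dstress => [|i k|i k]; rewrite ?sum_drad// drad_sym.
Qed.

Theorem stress_full j : s1 <= 0 -> s2 <= 0 ->
  \int[leb1]_Z (rad a1 C1 Z j * lapl a2 a2' C2 Z + lapl a1 a1' C1 Z * rad a2 C2 Z j) = 0.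
Proof.
move=> s10 s20.
have h1 Z : s1 <= sqn (Z - C1) by rewrite (le_trans s10)// sqn_ge0.
have h2 Z : s2 <= sqn (Z - C2) by rewrite (le_trans s20)// sqn_ge0.
under eq_Rintegral do rewrite -sum_dT.
rewrite Rint_sum; last by move=> i; apply: (le_intg _ _ W_intg) => // Z; exact: dTW.
apply: big1 => i _.
apply: (@integral_derivative_eq0 _ _ (T i j) _ W (2 ^+ (n + n)) (e_ i)) => //.
- by move=> Z; exact: TW.
- by move=> Z; exact: dTW.
- move=> Z th /andP[th0 th1]; apply: W_near.
  by rewrite addrAC subrr add0r sqn_scale sqn_e mulr1 expr_le1.
- by move=> Z; exact: Td.
Qed.

Theorem stress_half j :
  (forall Z, 0 <= hd Z -> s1 <= sqn (Z - C1)) -> (forall Z, 0 <= hd Z -> s2 <= sqn (Z - C2)) ->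
  intg leb (fun z => stress (rad a1 C1) (rad a2 C2) ord0 j (pl z)) /\
  \int[leb1]_Z (upI Z * (rad a1 C1 Z j * lapl a2 a2' C2 Z + lapl a1 a1' C1 Z * rad a2 C2 Z j)) =
  - \int[leb]_z stress (rad a1 C1) (rad a2 C2) ord0 j (pl z).
Proof.
move=> h1 h2.
have [Ti Te] := @half_space_flux _ _ (T ord0 j) (dT ord0 j) W (2 ^+ (n + n))
  (mT _ _) (mdT _ _) W_intg (fun Z hZ => TW _ _ (h1 Z hZ) (h2 Z hZ))
  (fun Z hZ => dTW _ _ (h1 Z hZ) (h2 Z hZ)) W_ge0 (exprn_ge0 _ (ler0n _ 2)) W_near
  (fun Z hZ => Td _ _ (h1 Z hZ) (h2 Z hZ)).
split => //; rewrite -Te.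
under eq_Rintegral do rewrite -sum_dT mulr_sumr.
have updT i Z : `|upI Z * dT i j Z| <= W Z.
  rewrite upIE; have [h|_] := ltrP 0 (hd Z); last by rewrite mul0r normr0.
  by rewrite mul1r; apply: dTW; [apply: h1|apply: h2]; exact: ltW.
have mudT i : measurable_fun setT (fun Z => upI Z * dT i j Z).
  by apply: measurable_funM => //; exact: measurable_upI.
rewrite Rint_sum; last by move=> i; exact: (le_intg _ _ W_intg).
(* Along tangential directions [upI] is constant, so translation invariance still makes those terms
   vanish; only the normal flux is left. *)
rewrite (bigD1 ord0)//= big1 ?addr0// => i i0.
have hdE Z t : hd (Z + t *: e_ i) = hd Z.
  by rewrite hd_add hd_scale_e eq_sym (negbTE i0) mulr0 addr0.
apply: (@integral_derivative_eq0 _ _ (fun Z => upI Z * T i j Z) _ W (2 ^+ (n + n)) (e_ i)) => //.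
- by apply: measurable_funM => //; exact: measurable_upI.
- move=> Z; rewrite upIE; have [h|_] := ltrP 0 (hd Z); last by rewrite mul0r normr0.
  by rewrite mul1r; apply: TW; [apply: h1|apply: h2]; exact: ltW.
- move=> Z th /andP[th0 th1]; apply: W_near.
  by rewrite addrAC subrr add0r sqn_scale sqn_e mulr1 expr_le1.
- move=> Z; rewrite upIE.
  rewrite (_ : (fun h => _) = fun h => (0 < hd Z)%R%:R * T i j (Z + h *: e_ i)); last first.
    by apply/funext => h; rewrite upIE hdE.
  have [h|_] := ltrP 0 (hd Z).
    by under eq_fun do rewrite mul1r; rewrite mul1r; apply: Td; [apply: h1|apply: h2]; exact: ltW.
  by under eq_fun do rewrite mul0r; rewrite mul0r; exact: is_derive_const.
Qed.

End two_fields.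

End stress_flux.

(** * Mollified fields and the reproducing formula *)

Section kernels.
Context {R : realType}.
Variable n : nat.
Local Notation N := n.+1.

(** The profile (e + s)^(-N/2) of Newton's field in R^N, softened at length scale sqrt e; [e = 0]
    gives the singular field. *)
Definition pw (e s : R) : R := (Num.sqrt (e + s))^-1 ^+ N.
Definition pw' (e s : R) : R := - (N%:R / 2) * (Num.sqrt (e + s))^-1 ^+ N.+2.

Lemma pw_ge0 (e s : R) : 0 <= pw e s.
Proof. by rewrite exprn_ge0// invr_ge0 sqrtr_ge0. Qed.

Lemma is_derive_pw (e s : R) : 0 < e + s -> is_derive s 1 (pw e) (pw' e s).
Proof.
move=> es0; have q0 : 0 < Num.sqrt (e + s) by rewrite sqrtr_gt0.
have dl : is_derive s 1 (fun t => e + t) 1.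
  by have := is_derive_add (is_derive_const e s) (is_derive_var s); rewrite add0r.
have dsq := @is_derive1_comp R Num.sqrt (fun t => e + t) s _ _ (is_derive1_sqrt es0) dl.
have dv : is_derive s 1 (fun t => (Num.sqrt (e + t))^-1) (- (Num.sqrt (e + s)) ^- 2 * ((2 * Num.sqrt (e + s))^-1 * 1)).
  by apply: is_deriveV dsq; rewrite /= gt_eqF.
have := @is_deriveX R R (fun t => (Num.sqrt (e + t))^-1) N s 1 _ dv.
rewrite /pw (_ : (fun t => (Num.sqrt (e + t))^-1) ^+ N = fun t => (Num.sqrt (e + t))^-1 ^+ N); last first.
  by apply/funext => t; rewrite fctE.
congr is_derive; rewrite /pw' /GRing.scale/= -exprVn !exprS.
have -> : (2 * Num.sqrt (e + s))^-1 = 2^-1 * (Num.sqrt (e + s))^-1 by rewrite invfM.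
by rewrite -mulr_natl; ring.
Qed.

Lemma measurable_pw e : measurable_fun setT (pw e).
Proof.
apply: measurable_funX.
rewrite (_ : (fun _ => _) = (fun s : R => s `^ (-1)) \o (fun s => Num.sqrt (e + s))); last first.
  by apply/funext => x /=; rewrite powR_inv1// sqrtr_ge0.
apply: measurableT_comp; first exact: measurable_powR.
by apply: measurableT_comp; [exact: measurable_sqrtr|exact: measurable_funD].
Qed.

Lemma measurable_pw' e : measurable_fun setT (pw' e).
Proof.
apply: measurable_funM => //; apply: measurable_funX.
rewrite (_ : (fun _ => _) = (fun s : R => s `^ (-1)) \o (fun s => Num.sqrt (e + s))); last first.
  by apply/funext => x /=; rewrite powR_inv1// sqrtr_ge0.
apply: measurableT_comp; first exact: measurable_powR.
by apply: measurableT_comp; [exact: measurable_sqrtr|exact: measurable_funD].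
Qed.

Lemma sqrtV_le (m e s : R) : 0 < m -> 0 <= s -> m * (1 + s) <= e + s ->
  (Num.sqrt (e + s))^-1 <= (Num.sqrt m)^-1 * (Num.sqrt (1 + s))^-1.
Proof.
move=> m0 s0 me; have s1 : 0 < 1 + s by rewrite ltr_wpDr.
have h : 0 < m * (1 + s) by rewrite mulr_gt0.
have -> : (Num.sqrt m)^-1 * (Num.sqrt (1 + s))^-1 = (Num.sqrt (m * (1 + s)))^-1.
  by rewrite sqrtrM ?ltW// invfM.
rewrite lef_pV2 ?posrE ?sqrtr_gt0//; first exact: ler_wsqrtr.
exact: lt_le_trans h me.
Qed.

(** The comparison [m * (1 + s) <= e + s] reduces every softening to the weight (1 + s)^(-1/2). For
    a softened field [m] is the minimum of 1 and [e], from 0 on; for the singular field it is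
    [b / (1 + b)], from [b] on. *)
Lemma pw_radial_ok (m e s0 : R) : 0 <= s0 -> 0 < m ->
  (forall s, s0 <= s -> m * (1 + s) <= e + s) ->
  exists K, radial_ok n (pw e) (pw' e) s0 K.
Proof.
move=> s00 m0 me; pose q := (Num.sqrt m)^-1.
have q0 : 0 <= q by rewrite invr_ge0 sqrtr_ge0.
exists (q ^+ N + N%:R / 2 * q ^+ N.+2).
have A0 : 0 <= q ^+ N by rewrite exprn_ge0.
have B0 : 0 <= N%:R / 2 * q ^+ N.+2 by rewrite mulr_ge0 ?exprn_ge0// divr_ge0.
split; [by rewrite addr_ge0|exact: measurable_pw|exact: measurable_pw'|].
move=> s ss; have sge0 := le_trans s00 ss.
have s1 : 0 < 1 + s by rewrite ltr_wpDr.
have h := sqrtV_le m0 sge0 (me _ ss).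
have j0 : 0 <= (Num.sqrt (1 + s))^-1 by rewrite invr_ge0 sqrtr_ge0.
have hk k : (Num.sqrt (e + s))^-1 ^+ k <= q ^+ k * (Num.sqrt (1 + s))^-1 ^+ k.
  by rewrite -exprMn lerXn2r ?nnegrE ?mulr_ge0 ?invr_ge0 ?sqrtr_ge0.
split.
- by apply: is_derive_pw; apply: lt_le_trans (me _ ss); rewrite mulr_gt0.
- rewrite ger0_norm ?pw_ge0// (le_trans (hk N))// mulrDl lerDl mulr_ge0// exprn_ge0//.
- rewrite /pw' mulNr normrN ger0_norm; last first.
    by rewrite mulr_ge0// ?divr_ge0// exprn_ge0// invr_ge0 sqrtr_ge0.
  rewrite (@le_trans _ _ (N%:R / 2 * (q ^+ N.+2 * (Num.sqrt (1 + s))^-1 ^+ N.+2)))//.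
    by rewrite ler_wpM2l// divr_ge0.
  by rewrite mulrA ler_wpM2r ?exprn_ge0// lerDr.
Qed.

Lemma pw_radial_ok_pos (e : R) : 0 < e -> exists K, radial_ok n (pw e) (pw' e) 0 K.
Proof.
move=> e0; apply: (@pw_radial_ok (Num.min 1 e)) => //; first by rewrite lt_min ltr01.
move=> s s0; rewrite mulrDr mulr1 lerD//; first by rewrite ge_min lexx orbT.
by rewrite ler_piMl// ge_min lexx.
Qed.

Lemma pw_radial_ok_0 (b : R) : 0 < b -> exists K, radial_ok n (pw 0) (pw' 0) b K.
Proof.
move=> b0; have b1 : 0 < 1 + b by rewrite ltr_wpDr// ltW.
apply: (@pw_radial_ok (b / (1 + b))) => //; [exact: ltW|by rewrite divr_gt0|].
move=> s bs; rewrite add0r mulrAC ler_pdivrMr// mulrDr mulr1 mulrDr mulr1 mulrC lerD2r.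
exact: bs.
Qed.

Implicit Types Z C X : 'rV[R]_n.+1.

Lemma lapl_pw (e : R) C Z : 0 < e + sqn (Z - C) ->
  lapl (pw e) (pw' e) C Z = N%:R * e * (Num.sqrt (e + sqn (Z - C)))^-1 ^+ N.+2.
Proof.
move=> es; rewrite /lapl /pw /pw'; set s := sqn _ in es *; set r := (Num.sqrt _)^-1.
have rE : r ^+ 2 * (e + s) = 1.
  by rewrite exprVn sqr_sqrtr ?ltW// mulVf// gt_eqF.
rewrite (_ : r ^+ N = r ^+ N.+2 * (e + s)); first by field.
by rewrite -addn2 exprD -mulrA rE mulr1.
Qed.

(** The divergence of the softened field ([mollifierE]). It concentrates at the origin as [e] tends
    to 0, while [mollifier_scale] keeps its mass constant. *)
Definition mollifier (e : R) Z : R := N%:R * e * (Num.sqrt (e + sqn Z))^-1 ^+ N.+2.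

(** By the divergence theorem, the area of the unit sphere of R^N: the limit of the flux of the
    softened field through large spheres. *)
Definition kappa : R := \int[@lebesgue_rV R N]_Z mollifier 1 Z.

Lemma mollifierE (e : R) C Z : 0 < e -> lapl (pw e) (pw' e) C Z = mollifier e (Z - C).
Proof. by move=> e0; rewrite lapl_pw// ltr_wpDr// sqn_ge0. Qed.

Lemma mollifier1 Z : mollifier 1 Z = N%:R * jw Z ^+ N.+2.
Proof. by rewrite /mollifier mulr1. Qed.

Lemma intg_mollifier1 : intg (@lebesgue_rV R N) (mollifier 1).
Proof.
rewrite (_ : mollifier 1 = fun Z => N%:R * jw Z ^+ N.+2); last first.
  by apply/funext => Z; rewrite mollifier1.
by apply: intgZ; exact: intg_jwX.
Qed.

Lemma mollifier_scale (r : R) Z : 0 < r -> r ^+ N * mollifier (r ^+ 2) (r *: Z) = mollifier 1 Z.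
Proof.
move=> r0; rewrite /mollifier sqn_scale -[X in Num.sqrt (X + _)]mulr1 -mulrDr.
rewrite sqrtrM ?sqr_ge0// sqrtr_sqr gtr0_norm// invfM exprMn mulr1.
have -> : r^-1 ^+ N.+2 = r^-1 ^+ N * r^-1 ^+ 2 by rewrite -exprD addn2.
rewrite !exprVn; field.
by rewrite !expf_neq0 ?gt_eqF// sqrtr_gt0 ltr_wpDr ?sqn_ge0.
Qed.

Lemma measurable_mollifier e : measurable_fun setT (mollifier e).
Proof.
apply: measurable_funM => //; apply: measurable_funX.
rewrite (_ : (fun _ => _) = (fun s : R => s `^ (-1)) \o (fun s => Num.sqrt (e + s)) \o @sqn R N); last first.
  by apply/funext => x /=; rewrite powR_inv1// sqrtr_ge0.
apply: measurableT_comp; last exact: measurable_sqn.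
apply: measurableT_comp; first exact: measurable_powR.
by apply: measurableT_comp; [exact: measurable_sqrtr|exact: measurable_funD].
Qed.

Lemma mollifier_ge0 (e : R) Z : 0 <= e -> 0 <= mollifier e Z.
Proof. by move=> e0; rewrite /mollifier mulr_ge0 ?exprn_ge0 ?invr_ge0 ?sqrtr_ge0// mulr_ge0. Qed.

Definition hrm (m : nat) : R := m.+1%:R^-1.

Lemma hrm_gt0 m : 0 < hrm m. Proof. by rewrite invr_gt0. Qed.

Lemma cvg_hrm : hrm m @[m --> \oo] --> 0.
Proof. exact: cvg_harmonic. Qed.

(** An approximate identity for bounded functions that may be discontinuous: convergence is asked
    for only along [hrm m *: Z + X], at the one point [X]. This admits fields cut off at the
    hyperplane, which jump there. *)
Lemma mollifier_cvg (F : 'rV[R]_N -> R) (M : R) X :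
  measurable_fun setT F -> (forall Z, `|F Z| <= M) ->
  (forall Z, F (hrm m *: Z + X) @[m --> \oo] --> F X) ->
  \int[@lebesgue_rV R N]_V (mollifier (hrm m ^+ 2) (V - X) * F V) @[m --> \oo] --> kappa * F X.
Proof.
move=> mF FM cF.
have M0 : 0 <= M by exact: le_trans (normr_ge0 _) (FM 0).
have mFm m : measurable_fun setT (fun Z => F (hrm m *: Z + X)).
  apply: (measurableT_comp (measurableT_comp mF (measurable_addr_rV X))).
  exact: measurable_scale_rV.
have [|||di dc] := @dominated_cvg_Rint _ _ _ (@lebesgue_rV R N)
  (fun m Z => mollifier 1 Z * F (hrm m *: Z + X)) (fun Z => mollifier 1 Z * F X)
  (fun Z => M * mollifier 1 Z) _ _ (intgZ M intg_mollifier1).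
- by move=> m; apply: measurable_funM => //; exact: measurable_mollifier.
- by move=> Z; apply: cvgM; [exact: cvg_cst|exact: cF].
- by move=> m Z; rewrite normrM (ger0_norm (mollifier_ge0 Z ler01)) mulrC ler_wpM2r ?mollifier_ge0.
move: dc; rewrite RintegralZr//; last exact: intg_mollifier1.
rewrite -/kappa => dc.
suff E m : \int[@lebesgue_rV R N]_V (mollifier (hrm m ^+ 2) (V - X) * F V) =
    \int[@lebesgue_rV R N]_Z (mollifier 1 Z * F (hrm m *: Z + X)).
  by under eq_fun do rewrite E.
have h0 := hrm_gt0 m.
(* The substitution V = X + [hrm m] Z; its Jacobian is absorbed by the scaling of the mollifier. *)
pose G Z := mollifier (hrm m ^+ 2) Z * F (Z + X).
have GE Z : hrm m ^+ N * G (hrm m *: Z) = mollifier 1 Z * F (hrm m *: Z + X).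
  by rewrite /G mulrA mollifier_scale.
have Gi : intg (@lebesgue_rV R N) G.
  have : intg (@lebesgue_rV R N) (fun Z => hrm m ^+ N * G (hrm m *: Z)).
    apply: le_intg (intgZ M intg_mollifier1).
      by under eq_fun do rewrite GE; apply: measurable_funM => //; exact: measurable_mollifier.
    by move=> Z; rewrite GE normrM (ger0_norm (mollifier_ge0 Z ler01)) mulrC ler_wpM2r ?mollifier_ge0.
  move=> /(intgZ (hrm m ^+ N)^-1).
  under eq_fun do rewrite mulrA mulVf ?mul1r ?expf_neq0 ?gt_eqF//.
  move=> /(@integrable_affine _ _ (fun=> (hrm m)^-1) (fun=> 0) _ (fun=> invr_neq0 (lt0r_neq0 h0))).
  rewrite /intg; congr (integrable _ _ _); apply/funext => Z /=; congr (EFin (G _)).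
  by apply/rowP => i; rewrite !mxE addr0 mulrA mulfV ?mul1r// gt_eqF.
transitivity (\int[@lebesgue_rV R N]_Z G Z); last first.
  rewrite (Rintegral_scale (lt0r_neq0 h0) Gi) gtr0_norm// -RintegralZl//.
    by apply: eq_Rintegral => Z _; rewrite GE.
  have := @integrable_affine _ _ (fun=> hrm m) (fun=> 0) _ (fun=> lt0r_neq0 h0) Gi.
  rewrite /intg; congr (integrable _ _ _); apply/funext => Z /=; congr (EFin (G _)).
  by apply/rowP => i; rewrite !mxE addr0.
rewrite -(Rintegral_addr (- X) Gi); apply: eq_Rintegral => V _.
by rewrite /G subrK.
Qed.

End kernels.

Section poisson.
Context {R : realType}.
Variable n : nat.
Hypothesis n2 : (2 <= n)%N.
Local Notation N := n.+1.
Local Notation leb := (@lebesgue_rV R n).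
Local Notation leb1 := (@lebesgue_rV R n.+1).
Implicit Types Z X A B V : 'rV[R]_n.+1.

Lemma kappa_gt0 : 0 < kappa n :> R.
Proof.
pose box := [set x : 'rV[R]_N | forall i, `[0, 1]%classic (x ord0 i)].
have mbox : measurable box.
  rewrite [X in measurable X](_ : _ = \bigcap_(i : 'I_N)
      ((fun v : 'rV[R]_N => v ord0 i) @^-1` `[0, 1]%classic)); last first.
    by apply/seteqP; split => v /= Av; [move=> i _; exact: Av|move=> i; exact: Av].
  apply: fin_bigcap_measurable => [|i _]; first exact: finite_finset.
  rewrite -[X in measurable X]setTI.
  by apply: (measurable_rV_coord _ measurableT); exact: measurable_itv.
have box1 : leb1 box = 1%E.
  rewrite (@lebesgue_rV_box R N (fun=> `[0, 1]%classic)); last by move=> i; exact: measurable_itv.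
  rewrite big1// => i _.
  by rewrite lebesgue_measure_itv/= lte_fin ltr01 oppr0 adde0.
pose c : R := N%:R * (Num.sqrt (1 + N%:R))^-1 ^+ N.+2.
have c0 : 0 < c by rewrite mulr_gt0// exprn_gt0// invr_gt0 sqrtr_gt0 ltr_wpDr.
have := @ge0_subset_integral _ _ R leb1 _ _ mbox measurableT (fun Z => (mollifier 1 Z)%:E).
have mm : measurable_fun [set: 'rV[R]_N] (fun Z => (mollifier 1 Z)%:E).
  by apply/measurable_EFinP; exact: measurable_mollifier.
move=> /(_ mm (fun Z _ => mollifier_ge0 Z ler01) (fun _ _ => I)).
rewrite -(Rint_intg (@intg_mollifier1 R n)) -/(kappa n) => h.
rewrite -lte_fin; apply: lt_le_trans h.
apply: (@lt_le_trans _ _ (\int[leb1]_(x in box) c%:E)%E).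
  by rewrite integral_cst//= box1 mule1 lte_fin.
apply: ge0_le_integral => //=.
- by move=> x _; rewrite lee_fin ltW.
- exact: measurable_funTS.
move=> Z bZ; rewrite lee_fin mollifier1 ler_wpM2l//.
rewrite lerXn2r ?nnegrE ?jw_ge0 ?invr_ge0 ?sqrtr_ge0// /jw.
rewrite lef_pV2 ?posrE ?sqrtr_gt0 ?ltr_wpDr ?sqn_ge0// ler_wsqrtr// lerD2l /sqn.
rewrite -[X in _ <= X%:R]card_ord -sum1_card natr_sum ler_sum// => i _.
have := bZ i; rewrite /= in_itv/= => /andP[z0 z1].
by rewrite expr_le1.
Qed.

Lemma cvg_sqn_line Z X : sqn (hrm m *: Z + X) @[m --> \oo] --> sqn X.
Proof.
have E m : sqn (hrm m *: Z + X) = sqn X + hrm m * (2 * (\sum_i Z ord0 i * X ord0 i) + hrm m * sqn Z).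
  rewrite /sqn !mulr_sumr -!big_split/= mulr_sumr -big_split/=.
  by apply: eq_bigr => i _; rewrite !mxE; ring.
rewrite (_ : (fun m => sqn (hrm m *: Z + X)) = (fun m => sqn X + hrm m * (2 * (\sum_i Z ord0 i * X ord0 i) + hrm m * sqn Z))); last exact/funext.
rewrite -[X in _ --> X]addr0; apply: cvgD; first exact: cvg_cst.
rewrite -[X in _ --> X](mul0r (2 * (\sum_i Z ord0 i * X ord0 i) + 0 * sqn Z)).
apply: cvgM; first exact: cvg_hrm.
apply: cvgD; first exact: cvg_cst.
by apply: cvgM; [exact: cvg_hrm|exact: cvg_cst].
Qed.

Lemma cvg_coord_line Z X k : (hrm m *: Z + X) ord0 k @[m --> \oo] --> X ord0 k.
Proof.
rewrite (_ : (fun m => (hrm m *: Z + X) ord0 k) = fun m => hrm m * Z ord0 k + X ord0 k); last first.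
  by apply/funext => m; rewrite !mxE.
rewrite -[X in _ --> X]add0r; apply: cvgD; last exact: cvg_cst.
rewrite -[X in _ --> X](mul0r (Z ord0 k)).
by apply: cvgM; [exact: cvg_hrm|exact: cvg_cst].
Qed.

Lemma cvg_rad_line (a : R -> R) B Z X k : {for sqn (X - B), continuous a} ->
  rad a B (hrm m *: Z + X) k @[m --> \oo] --> rad a B X k.
Proof.
move=> ca; rewrite /rad; under eq_fun do rewrite -addrA.
apply: cvgM; first exact: cvg_coord_line.
by apply: (@cvg_comp _ _ _ (fun m => sqn (hrm m *: Z + (X - B))) a _ _ _ _ ca); exact: cvg_sqn_line.
Qed.

Lemma is_derive_continuous_at (f : R -> R) (x df : R) : is_derive x 1 f df -> {for x, continuous f}.
Proof. by move=> [dd _]; apply/differentiable_continuous/derivable1_diffP. Qed.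

(* The field [Z / |Z|^(n+1)] ([pw n 0 s] is [s^(-(n+1)/2)], with the junk value 0 at [s = 0]):
   for [hd Z > 0], [2 / kappa n] times component 0 is the Poisson kernel, and on the plane
   [hd Z = 0] component [lift ord0 j] is the [j]th Riesz kernel up to its constant. *)
Definition Ek (j : 'I_n.+1) Z : R := Z ord0 j * pw n 0 (sqn Z).

Lemma EkE B j Z : rad (pw n 0) B Z j = Ek j (Z - B). Proof. by []. Qed.

Lemma EkN j Z : Ek j (- Z) = - Ek j Z.
Proof. by rewrite /Ek sqnN mxE mulNr. Qed.

Lemma measurable_Ek j : measurable_fun setT (Ek j).
Proof.
have [K ok] := pw_radial_ok_0 n (ltr01 : 0 < 1 :> R).
rewrite (_ : Ek j = fun Z => rad (pw n 0) 0 Z j); first exact: (measurable_rad 0 ok).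
by apply/funext => Z; rewrite EkE subr0.
Qed.

Lemma pw_anti (e s : R) : 0 <= e -> 0 < s -> pw n e s <= pw n 0 s.
Proof.
move=> e0 s0; rewrite /pw lerXn2r ?nnegrE ?invr_ge0 ?sqrtr_ge0//.
by rewrite lef_pV2 ?posrE ?sqrtr_gt0 ?add0r ?ltr_wpDl// ler_wsqrtr// lerDr.
Qed.

Lemma sqnB_hd_le Z B : 0 <= hd Z -> hd B < 0 -> hd B ^+ 2 <= sqn (Z - B).
Proof.
move=> Z0 B0; rewrite sqn_hd_tl; apply: ler_wpDr; first exact: sqn_ge0.
have -> : hd (Z - B) = hd Z - hd B by rewrite /hd !mxE.
by nra.
Qed.

(** Method of images. Softened fields centred at [A] and at its mirror image [A'] are paired with
    the field of the pole [B], which is divergence-free on the half-space. On the hyperplane the two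
    softened fields have equal tangential and opposite normal components, so the difference of the
    two fluxes is explicit. In the volume the source at [A] picks up [Ek j (A - B)], and the source
    at [A'], outside the half-space, picks up 0. *)
Lemma poisson_reproduction A B (j : 'I_n.+1) : 0 < hd A -> hd B < 0 ->
  intg leb (fun z => pw n 0 (sqn (A - pl z)) * Ek j (pl z - B)) /\
  kappa n * Ek j (A - B) =
  2 * hd A * \int[leb]_z (pw n 0 (sqn (A - pl z)) * Ek j (pl z - B)).
Proof.
move=> A0 B0; pose A' : 'rV[R]_n.+1 := rV_cons (- hd A, tl A).
have b20 : 0 < hd B ^+ 2 by rewrite exprn_even_gt0//= lt_eqF.
have [K2 ok2] := pw_radial_ok_0 n b20.
have K20 := radial_ok_ge0 ok2.
pose F Z : R := upI Z * Ek j (Z - B).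
have mF : measurable_fun setT F.
  apply: measurable_funM; first exact: measurable_upI.
  exact: (measurable_rad B ok2).
have EB Z : 0 <= hd Z -> `|Ek j (Z - B)| <= K2.
  move=> Z0; have := rad_bound ok2 j (sqnB_hd_le Z0 B0); rewrite EkE => /le_trans; apply.
  by rewrite -[leRHS]mulr1 ler_wpM2l// jwX_le1.
have FM Z : `|F Z| <= K2.
  rewrite /F upIE; case: (ltrP 0 (hd Z)) => Z0; last by rewrite mul0r normr0.
  by rewrite mul1r EB// ltW.
have hdl m Z X : hd (hrm m *: Z + X) = (hrm m *: Z + X) ord0 ord0 by [].
have cFA Z : F (hrm m *: Z + A) @[m --> \oo] --> F A.
  have c1 : Ek j (hrm m *: Z + A - B) @[m --> \oo] --> F A.
    rewrite /F upIE A0 mul1r; apply: cvg_rad_line.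
    apply: (@is_derive_continuous_at _ _ (pw' n 0 (sqn (A - B)))); apply: is_derive_pw.
    by rewrite add0r (lt_le_trans b20)// sqnB_hd_le// ltW.
  apply: cvg_trans c1; apply: near_eq_cvg.
  have /cvgr_gt/(_ _ A0) := @cvg_coord_line Z A ord0.
  by apply: filterS => m h; rewrite /F upIE hdl h mul1r.
have hA' : hd A' = - hd A by rewrite hd_cons.
have cFA' Z : F (hrm m *: Z + A') @[m --> \oo] --> F A'.
  have A'0 : A' ord0 ord0 < 0 by rewrite -/(hd A') hA' oppr_lt0.
  have F0 Y : hd Y <= 0 -> F Y = 0 by rewrite /F upIE leNgt => /negbTE ->; rewrite mul0r.
  have c1 : (fun=> 0 : R) (m : nat) @[m --> \oo] --> (0 : R) by exact: cvg_cst.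
  rewrite F0 ?ltW//; apply: cvg_trans c1; apply: near_eq_cvg.
  have /cvgr_lt/(_ _ A'0) := @cvg_coord_line Z A' ord0.
  by apply: filterS => m h; rewrite F0// hdl ltW.
have lA := mollifier_cvg mF FM cFA.
have lA' := mollifier_cvg mF FM cFA'.
have FA' : F A' = 0 by rewrite /F upIE hA' oppr_gt0 ltNge ltW// mul0r.
have FA : F A = Ek j (A - B) by rewrite /F upIE A0 mul1r.
have sA z : sqn (A - pl z) = hd A ^+ 2 + sqn (tl A - z).
  by rewrite -{1}(rV_cons_eta A) /pl rV_consB sqn_cons subr0.
have sA' z : sqn (A' - pl z) = hd A ^+ 2 + sqn (tl A - z).
  by rewrite /A' /pl rV_consB sqn_cons subr0 sqrrN.
have sBC Z Y : sqn (Z - Y) = sqn (Y - Z) by rewrite -sqnN opprB.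
(* The field of [B] has no divergence on the half-space, so the volume term reduces to the average
   of [F] by the mollifier at [C]. *)
have sth m C :
  intg leb (fun z => stress (rad (pw n (hrm m ^+ 2)) C) (rad (pw n 0) B) ord0 j (pl z)) /\
  \int[leb1]_V (mollifier (hrm m ^+ 2) (V - C) * F V) =
  - \int[leb]_z stress (rad (pw n (hrm m ^+ 2)) C) (rad (pw n 0) B) ord0 j (pl z).
  have e0 : 0 < hrm m ^+ 2 :> R by rewrite exprn_gt0// hrm_gt0.
  have [K1 ok1] := pw_radial_ok_pos n e0.
  have [||ii <-] := @stress_half R n n2 _ _ _ _ _ _ _ _ C B ok1 ok2 j.
  - by move=> Z _; exact: sqn_ge0.
  - by move=> Z Z0; exact: sqnB_hd_le.
  split => //; apply: eq_Rintegral => Z _; rewrite /F upIE.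
  case: (ltrP 0 (hd Z)) => Z0; last by rewrite !mul0r mulr0.
  have l0 : lapl (pw n 0) (pw' n 0) B Z = 0.
    by rewrite lapl_pw ?mulr0 ?mul0r// add0r (lt_le_trans b20)// sqnB_hd_le// ltW.
  by rewrite l0 mulr0 add0r !mul1r mollifierE.
have a20 : 0 < hd A ^+ 2 by rewrite exprn_gt0.
pose G m z := 2 * hd A * (pw n (hrm m ^+ 2) (sqn (A - pl z)) * Ek j (pl z - B)).
have stE m z : stress (rad (pw n (hrm m ^+ 2)) A') (rad (pw n 0) B) ord0 j (pl z) -
    stress (rad (pw n (hrm m ^+ 2)) A) (rad (pw n 0) B) ord0 j (pl z) = G m z.
  rewrite /stress /G -EkE; set e := hrm m ^+ 2; set w := rad (pw n 0) B (pl z).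
  set P := pw n e (sqn (A - pl z)).
  have u0 : rad (pw n e) A (pl z) ord0 = - hd A * P.
    by rewrite /rad sBC -/P; congr (_ * _); rewrite -[LHS]/(hd _) -{1}(rV_cons_eta A) /pl rV_consB hd_cons sub0r.
  have u0' : rad (pw n e) A' (pl z) ord0 = hd A * P.
    rewrite /rad sBC sA' -sA -/P; congr (_ * _).
    by rewrite -[LHS]/(hd _) /A' /pl rV_consB hd_cons sub0r opprK.
  have uk k : rad (pw n e) A' (pl z) (lift ord0 k) = rad (pw n e) A (pl z) (lift ord0 k).
    rewrite /rad [sqn (_ - A')]sBC sA' -sA [in RHS]sBC; congr (_ * _).
    rewrite mxE [in RHS]mxE; congr (_ + _); rewrite mxE [in RHS]mxE; congr (- _).
    by rewrite -(tlE A' k) -(tlE A k) tl_cons.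
  rewrite !big_ord_recl u0 u0'; under eq_bigr do rewrite uk.
  set S := \sum_(i < n) _.
  (* For [j = ord0] the normal product is counted twice and the trace term removes one copy, so
     normal and tangential components obey the same formula. *)
  by case: (unliftP ord0 j) => [k ->|->] /=; rewrite ?uk ?u0 ?u0' ?eqxx ?(negbTE (neq_lift _ _)) ?mul0r ?subr0; ring.
have [K1 ok1] := pw_radial_ok_0 n a20.
have K10 := radial_ok_ge0 ok1.
have GE m : \int[leb]_z G m z =
    \int[leb1]_V (mollifier (hrm m ^+ 2) (V - A) * F V) - \int[leb1]_V (mollifier (hrm m ^+ 2) (V - A') * F V).
  have [iA ->] := sth m A; have [iA' ->] := sth m A'.
  rewrite opprK addrC -RintegralB//.
  by apply: eq_Rintegral => z _; rewrite stE.
have GK z : `|pw n 0 (sqn (A - pl z))| <= K1 * jw (z - tl A) ^+ n.+1.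
  case: ok1 => _ _ _ /(_ (sqn (A - pl z))) [].
    by rewrite sA lerDl sqn_ge0.
  move=> _ /le_trans + _; apply; rewrite ler_wpM2l// lerXn2r ?nnegrE ?jw_ge0 ?invr_ge0 ?sqrtr_ge0//.
  rewrite /jw lef_pV2 ?posrE ?sqrtr_gt0 ?ltr_wpDr ?sqn_ge0// ler_wsqrtr// lerD2l.
  by rewrite sA -sqnN opprB lerDr sqr_ge0.
have hdpl (z : 'rV[R]_n) : hd (pl z) = 0 :> R by rewrite hd_cons.
have mpl C : measurable_fun setT (fun z : 'rV[R]_n => sqn (C - pl z)).
  apply: (measurableT_comp (@measurable_sqn R n.+1)).
  exact: (measurableT_comp (measurable_subl_rV C) (@measurable_pl R n)).
have mE : measurable_fun setT (fun z => Ek j (pl z - B)).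
  exact: (measurableT_comp (measurableT_comp (measurable_Ek j) (measurable_addr_rV (- B))) (@measurable_pl R n)).
pose q z := 2 * hd A * (K1 * K2) * jw (z - tl A) ^+ n.+1.
have iq : intg leb q by apply: intgZ; exact: (@intg_addr R n (- tl A) (fun z => jw z ^+ n.+1) (intg_jwX (ltnSn n))).
have [|||iG cG] := @dominated_cvg_Rint _ _ _ leb G
  (fun z => 2 * hd A * (pw n 0 (sqn (A - pl z)) * Ek j (pl z - B))) q _ _ iq.
- move=> m; apply: measurable_funM => //; apply: measurable_funM => //.
  by apply: measurableT_comp; [exact: measurable_pw|exact: mpl].
- move=> z; apply: cvgM; first exact: cvg_cst.
  apply: cvgM; last exact: cvg_cst.
  have cs : hrm m ^+ 2 + sqn (A - pl z) @[m --> \oo] --> 0 + sqn (A - pl z).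
    apply: cvgD; last exact: cvg_cst.
    rewrite -[X in _ --> X](expr0n R 2); apply: cvgM; exact: cvg_hrm.
  have c0 : {for 0 + sqn (A - pl z), continuous (pw n (0 : R))}.
    apply: is_derive_continuous_at; apply: is_derive_pw.
    by rewrite !add0r sA ltr_wpDr ?sqn_ge0.
  have pwE m : pw n (hrm m ^+ 2) (sqn (A - pl z)) = pw n 0 (hrm m ^+ 2 + sqn (A - pl z)).
    by rewrite /pw add0r.
  under eq_fun do rewrite pwE.
  by have := @cvg_comp _ _ _ (fun m => hrm m ^+ 2 + sqn (A - pl z)) (pw n 0) _ _ _ cs c0; rewrite add0r.
- move=> m z; have hA2 : 0 <= 2 * hd A by rewrite mulr_ge0// ltW.
  rewrite /G /q normrM (ger0_norm hA2) -mulrA ler_wpM2l//.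
  rewrite normrM (@le_trans _ _ (`|pw n 0 (sqn (A - pl z))| * K2))//.
    apply: ler_pM => //; last by rewrite EB// hdpl.
    rewrite !ger0_norm ?pw_ge0// pw_anti ?sqr_ge0// sA ltr_wpDr ?sqn_ge0//.
  by rewrite mulrAC ler_wpM2r.
have cA0 : 2 * hd A != 0 by rewrite mulf_neq0// gt_eqF.
have iE : intg leb (fun z => pw n 0 (sqn (A - pl z)) * Ek j (pl z - B)).
  have := intgZ (2 * hd A)^-1 iG.
  by under eq_fun do rewrite mulrA mulVf// mul1r.
split => //; rewrite -RintegralZl//.
have cL : \int[leb]_z G m z @[m --> \oo] --> kappa n * Ek j (A - B).
  have -> : kappa n * Ek j (A - B) = kappa n * F A - kappa n * F A'.
    by rewrite FA FA' mulr0 subr0.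
  by under eq_fun do rewrite GE; apply: cvgB.
by rewrite -(cvg_lim (@Rhausdorff R) cL) -(cvg_lim (@Rhausdorff R) cG).
Qed.

End poisson.

(** * Densities whose potential is a cut-off Newtonian field *)

Section newton.
Context {R : realType}.
Variable n : nat.
Hypothesis n2 : (2 <= n)%N.
Local Notation N := n.+1.
Local Notation leb := (@lebesgue_rV R n).
Local Notation leb1 := (@lebesgue_rV R n.+1).
Implicit Types (Z X A B V : 'rV[R]_n.+1) (s : R).

Lemma measurable_invr : measurable_fun setT (fun x : R => x^-1).
Proof.
rewrite (_ : (fun _ => _) = fun x : R => x * (x ^+ 2) `^ (-1)); last first.
  apply/funext => x; rewrite powR_inv1 ?sqr_ge0//.
  by have [->|x0] := eqVneq x 0; [rewrite invr0 mul0r|field].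
apply: measurable_funM => //.
apply: (@measurableT_comp _ _ _ _ _ _ (fun x : R => x `^ (-1)) _ (fun x : R => x ^+ 2)).
  exact: measurable_powR.
exact: measurable_funX.
Qed.

Lemma Ek_le j Z : `|Ek j Z| <= (enorm Z)^-1 ^+ n.
Proof.
have [->|Z0] := eqVneq Z 0; first by rewrite /Ek mxE mul0r normr0 exprn_ge0// invr_ge0 enorm_ge0.
rewrite /Ek /pw add0r -enormE normrM (ger0_norm (exprn_ge0 _ _)) ?invr_ge0 ?enorm_ge0//.
rewrite exprS mulrA ler_piMl ?exprn_ge0 ?invr_ge0 ?enorm_ge0//.
by rewrite ler_pdivrMr ?enorm_gt0// mul1r coord_le_enorm.
Qed.

Lemma cvg_pw (s : R) : 0 < s -> pw n (hrm m ^+ 2) s @[m --> \oo] --> pw n 0 s.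
Proof.
move=> s0.
have cs : hrm m ^+ 2 + s @[m --> \oo] --> 0 + s.
  apply: cvgD; last exact: cvg_cst.
  rewrite -[X in _ --> X](expr0n R 2); apply: cvgM; exact: cvg_hrm.
have c0 : {for 0 + s, continuous (pw n (0 : R))}.
  apply: (is_derive_continuous_at (df := pw' n 0 (0 + s))); apply: is_derive_pw.
  by rewrite !add0r.
have pwE m : pw n (hrm m ^+ 2) s = pw n 0 (hrm m ^+ 2 + s) by rewrite /pw add0r.
under eq_fun do rewrite pwE.
by have := @cvg_comp _ _ _ (fun m => hrm m ^+ 2 + s) (pw n 0) _ _ _ cs c0; rewrite add0r.
Qed.

Section cutoff.
Variables (k : nat) (T : R).
Hypothesis T0 : 0 < T.
Let m := T ^+ k.+1.
Let m0 : 0 < m. Proof. exact: exprn_gt0. Qed.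

(** A rational cut-off at squared distance [T] that steepens to a jump as [k] grows. That it
    increases makes the density [rho0] non-negative. *)
Definition chi (s : R) : R := s ^+ k.+1 / (T ^+ k.+1 + s ^+ k.+1).
Definition chi' (s : R) : R := k.+1%:R * s ^+ k * T ^+ k.+1 / (T ^+ k.+1 + s ^+ k.+1) ^+ 2.

Let ms (s : R) : 0 <= s -> 0 < m + s ^+ k.+1.
Proof. by move=> s0; rewrite ltr_wpDr// exprn_ge0. Qed.

Lemma chi_ge0 s : 0 <= s -> 0 <= chi s.
Proof. by move=> s0; rewrite divr_ge0 ?exprn_ge0// ltW// ms. Qed.

Lemma chi_le1 s : 0 <= s -> chi s <= 1.
Proof. by move=> s0; rewrite ler_pdivrMr ?ms// mul1r lerDr ltW. Qed.

Lemma chi'_ge0 s : 0 <= s -> 0 <= chi' s.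
Proof. by move=> s0; rewrite divr_ge0 ?exprn_ge0 ?(ltW (ms s0))// !mulr_ge0// ?exprn_ge0// ltW. Qed.

Lemma is_derive_chi s : 0 <= s -> is_derive s 1 chi (chi' s).
Proof.
move=> s0; have q0 := ms s0.
have dn : is_derive s 1 (fun t : R => t ^+ k.+1) (k.+1%:R * s ^+ k).
  have := @is_deriveX R R id k.+1 s 1 _ (is_derive_id s 1).
  rewrite (_ : id ^+ k.+1 = fun t : R => t ^+ k.+1); last by apply/funext => t; rewrite fctE.
  by rewrite /GRing.scale/= mulr1.
have dd := is_derive_add (is_derive_const m s) dn.
have dv : is_derive s 1 (fun t => (m + t ^+ k.+1)^-1) (- (m + s ^+ k.+1) ^- 2 * (0 + k.+1%:R * s ^+ k)).
  by apply: is_deriveV dd; rewrite /= gt_eqF.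
have := is_derive_mul dn dv; congr is_derive; rewrite /chi' -/m; field.
by rewrite gt_eqF.
Qed.

(** One constant for two regimes: for [s <= 1] the summand [2 / m] pays through [m], for [s > 1] the
    summand 2 pays through [s ^+ k.+1]. *)
Let C : R := 2 / m + 2.
Let C0 : 0 <= C. Proof. by rewrite addr_ge0// divr_ge0// ltW. Qed.

Let oneS_le s : 0 <= s -> 1 + s <= C * (m + s ^+ k.+1).
Proof.
move=> s0; rewrite /C mulrDl.
have -> : 2 / m * (m + s ^+ k.+1) = 2 + 2 / m * s ^+ k.+1 by field; rewrite gt_eqF.
have sk : 0 <= s ^+ k.+1 by rewrite exprn_ge0.
have a0 : 0 <= 2 / m * s ^+ k.+1 by rewrite mulr_ge0// divr_ge0// ltW.
have [s1|s1] := leP s 1; first by have := ltW m0; nra.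
have : s <= s ^+ k.+1 by rewrite -[leLHS]expr1 ler_weXn2l// ltW.
by have := ltW m0; nra.
Qed.

Let expk_le s : 0 <= s -> s ^+ k <= C * (m + s ^+ k.+1).
Proof.
move=> s0; rewrite /C mulrDl.
have -> : 2 / m * (m + s ^+ k.+1) = 2 + 2 / m * s ^+ k.+1 by field; rewrite gt_eqF.
have sk : 0 <= s ^+ k.+1 by rewrite exprn_ge0.
have a0 : 0 <= 2 / m * s ^+ k.+1 by rewrite mulr_ge0// divr_ge0// ltW.
have [s1|s1] := leP s 1.
  have : s ^+ k <= 1 by rewrite exprn_ile1.
  by have := ltW m0; nra.
have : s ^+ k <= s ^+ k.+1 by rewrite ler_weXn2l// ltW.
by have := ltW m0; nra.
Qed.

(** Majorises both [k.+1%:R * m * C ^+ 2], which bounds [chi'], and [k.+1%:R * m * C], which bounds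
    [s * chi' s]. *)
Let D : R := k.+1%:R * m * C * (1 + C).
Let D0 : 0 <= D. Proof. by apply: mulr_ge0; [apply: mulr_ge0 => //; apply: mulr_ge0 => //; exact: ltW|exact: addr_ge0]. Qed.

Let chi'D s : 0 <= s -> chi' s <= D * (1 + s)^-1.
Proof.
move=> s0; have q0 := ms s0; rewrite ler_pdivlMr ?ltr_wpDr// /chi' -/m mulrAC.
rewrite ler_pdivrMr ?exprn_gt0// /D.
have h1 := oneS_le s0; have h2 := expk_le s0.
have h : s ^+ k * (1 + s) <= (C * (m + s ^+ k.+1)) * (C * (m + s ^+ k.+1)).
  by apply: ler_pM => //; rewrite ?exprn_ge0// addr_ge0.
rewrite (_ : k.+1%:R * s ^+ k * m * (1 + s) = k.+1%:R * m * (s ^+ k * (1 + s))); last by ring.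
rewrite (_ : k.+1%:R * m * C * (1 + C) * (m + s ^+ k.+1) ^+ 2 = k.+1%:R * m * (C * (1 + C) * (m + s ^+ k.+1) ^+ 2)); last by ring.
rewrite ler_wpM2l ?mulr_ge0// ?(ltW m0)//; apply: (le_trans h).
have : 0 <= C * (m + s ^+ k.+1) ^+ 2 by rewrite mulr_ge0// sqr_ge0.
nra.
Qed.

Let schi'D s : 0 <= s -> s * chi' s <= D * (1 + s)^-1.
Proof.
move=> s0; have q0 := ms s0; rewrite ler_pdivlMr ?ltr_wpDr// /chi' -/m mulrAC mulrA.
rewrite ler_pdivrMr ?exprn_gt0// /D.
have h1 := oneS_le s0.
have h : s ^+ k.+1 * (1 + s) <= (m + s ^+ k.+1) * (C * (m + s ^+ k.+1)).
  by apply: ler_pM => //; rewrite ?exprn_ge0// ?addr_ge0// lerDr ltW.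
rewrite (_ : s * (1 + s) * (k.+1%:R * s ^+ k * m) = k.+1%:R * m * (s ^+ k.+1 * (1 + s))); last by rewrite exprS; ring.
rewrite (_ : k.+1%:R * m * C * (1 + C) * (m + s ^+ k.+1) ^+ 2 = k.+1%:R * m * (C * (1 + C) * (m + s ^+ k.+1) ^+ 2)); last by ring.
rewrite ler_wpM2l ?mulr_ge0// ?(ltW m0)//; apply: (le_trans h).
have : 0 <= C * C * (m + s ^+ k.+1) ^+ 2 by rewrite mulr_ge0 ?sqr_ge0 ?mulr_ge0.
nra.
Qed.

Local Notation eta := (hrm k : R).
Let hk0 : 0 < eta := hrm_gt0 k.
(** Profile of the damped field: [pw n eta] softens the pole, [chi] removes the core. Both are
    driven by the same [k], so that a single limit produces the sharp truncation. *)
Definition nW (s : R) : R := pw n eta s * chi s.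
Definition nW' (s : R) : R := pw' n eta s * chi s + pw n eta s * chi' s.

Let sqr_r (s : R) : 0 <= s -> (Num.sqrt (1 + s))^-1 ^+ 2 = (1 + s)^-1.
Proof. by move=> s0; rewrite exprVn sqr_sqrtr// ltW// ltr_wpDr. Qed.

Lemma measurable_chi : measurable_fun setT chi.
Proof.
apply: (@measurable_funM _ _ _ _ (fun s : R => s ^+ k.+1) (fun s : R => (T ^+ k.+1 + s ^+ k.+1)^-1)); first exact: measurable_funX.
by apply: (measurableT_comp measurable_invr); apply: measurable_funD => //; exact: measurable_funX.
Qed.

Lemma measurable_chi' : measurable_fun setT chi'.
Proof.
apply: (@measurable_funM _ _ _ _ (fun s : R => k.+1%:R * s ^+ k * T ^+ k.+1) (fun s : R => ((T ^+ k.+1 + s ^+ k.+1) ^+ 2)^-1)).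
  by apply: measurable_funM => //; apply: measurable_funM => //; exact: measurable_funX.
by apply: (measurableT_comp measurable_invr); apply: measurable_funX; apply: measurable_funD => //; exact: measurable_funX.
Qed.

Lemma nW_radial_ok : exists K, radial_ok n nW nW' 0 K.
Proof.
have [K ok] := pw_radial_ok_pos n hk0; have K0 := radial_ok_ge0 ok.
case: ok => _ m1 m2 b; exists (K + K * D); split.
- by rewrite addr_ge0// mulr_ge0.
- by apply: measurable_funM => //; exact: measurable_chi.
- apply: measurable_funD; apply: measurable_funM => //; [exact: measurable_chi|exact: measurable_chi'].
move=> s s0; have [d1 b1 b2] := b _ s0.
have c0 := chi_ge0 s0; have c1 := chi_le1 s0; have c'0 := chi'_ge0 s0.
set r := (Num.sqrt (1 + s))^-1 in b1 b2 *.
have r0 : 0 <= r by rewrite invr_ge0 sqrtr_ge0.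
split.
- exact: (is_derive_mul d1 (is_derive_chi s0)).
- rewrite normrM (ger0_norm c0) (@le_trans _ _ (K * r ^+ N))//.
    by rewrite -[leRHS]mulr1; apply: ler_pM.
  by rewrite ler_wpM2r ?exprn_ge0// lerDl mulr_ge0.
- rewrite (le_trans (ler_normD _ _))// mulrDl; apply: lerD.
    by rewrite normrM (ger0_norm c0) -[leRHS]mulr1; apply: ler_pM.
  rewrite normrM (ger0_norm c'0).
  rewrite -mulrA (_ : D * r ^+ n.+3 = r ^+ n.+1 * (D * (1 + s)^-1)); last first.
    by rewrite -sqr_r// -/r -(addn2 n.+1) exprD; ring.
  by rewrite [leRHS]mulrA; exact: (ler_pM (normr_ge0 _) c'0 b1 (chi'D s0)).
Qed.

(** Gauss's law: up to the factor [kappa n], the density that generates a field is the divergence of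
    that field. *)
Definition rho0 V : R := lapl nW nW' 0 V.

Lemma rho0E V : rho0 V = chi (sqn V) * mollifier eta V + 2 * (sqn V * chi' (sqn V)) * pw n eta (sqn V).
Proof.
have := mollifierE 0 V hk0; rewrite /rho0 /lapl subr0 /nW /nW' => <-.
by ring.
Qed.

Lemma rho0_ge0 V : 0 <= rho0 V.
Proof.
rewrite rho0E addr_ge0// mulr_ge0 ?pw_ge0 ?chi_ge0 ?sqn_ge0//.
  by rewrite mollifier_ge0// ltW// hrm_gt0.
by rewrite mulr_ge0// mulr_ge0 ?chi'_ge0 ?sqn_ge0.
Qed.

(** One power is given away: both terms of [rho0E] are of order [jw V ^+ n.+3], and the exponent
    [n.+2] already exceeds the dimension. *)
Lemma rho0_bound : exists2 K, 0 <= K & forall V, rho0 V <= K * jw V ^+ n.+2.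
Proof.
have [K ok] := pw_radial_ok_pos n hk0; have K0 := radial_ok_ge0 ok.
case: ok => _ m1 m2 b; have e0 := ltW hk0.
have DK : 0 <= 2 * eta * K + 2 * (D * K).
  by apply: addr_ge0; apply: mulr_ge0 => //; apply: mulr_ge0.
exists (2 * eta * K + 2 * (D * K)) => //.
move=> V; have s0 := sqn_ge0 V; have [_ b1 b2] := b _ s0.
have c0 := chi_ge0 s0; have c1 := chi_le1 s0; have c'0 := chi'_ge0 s0.
have j3 : jw V ^+ n.+3 <= jw V ^+ n.+2 by rewrite exprS ler_piMl ?exprn_ge0 ?jw_le1// jw_ge0.
rewrite (@le_trans _ _ ((2 * eta * K + 2 * (D * K)) * jw V ^+ n.+3))//; last first.
  by rewrite ler_wpM2l.
rewrite rho0E [leRHS]mulrDl; apply: lerD.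
  have mE : mollifier eta V = 2 * eta * - pw' n eta (sqn V).
    by rewrite /mollifier /pw'; field.
  rewrite (@le_trans _ _ (mollifier eta V))//.
    by rewrite ler_piMl// mollifier_ge0.
  rewrite mE -[leRHS]mulrA ler_wpM2l ?mulr_ge0//; apply: le_trans b2.
  by rewrite -normrN ler_norm.
have -> : 2 * (D * K) * jw V ^+ n.+3 = 2 * (D * (1 + sqn V)^-1) * (K * jw V ^+ n.+1).
  by rewrite -sqr_r// -/(jw V) -(addn2 n.+1) exprD; ring.
apply: ler_pM; [by apply: mulr_ge0 => //; exact: mulr_ge0|exact: pw_ge0| |].
  by rewrite ler_wpM2l// schi'D.
by apply: le_trans b1; rewrite ler_norm.
Qed.

Lemma measurable_rho0 : measurable_fun setT rho0.
Proof. by have [K ok] := nW_radial_ok; exact: (measurable_lapl 0 ok). Qed.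

Lemma intg_rho0 : intg leb1 rho0.
Proof.
have [K K0 h] := rho0_bound.
apply: (le_intg measurable_rho0 _ (intgZ K (intg_jwX (ltnSn n.+1)))) => V.
by rewrite ger0_norm ?rho0_ge0.
Qed.

Lemma rho0N V : rho0 (- V) = rho0 V.
Proof. by rewrite !rho0E /mollifier sqnN. Qed.

Lemma rho0_riesz_intg X : intg leb1 (fun V => rho0 V * (enorm (X - V))^-1 ^+ n).
Proof.
have [K K0 h] := rho0_bound.
have n0 : (0 < n)%N by exact: ltn_trans n2.
have [] // := @intg_riesz_potential R n n0 rho0 K X intg_rho0.
move=> V; rewrite rho0_ge0/= (le_trans (h V))// -[leRHS]mulr1 ler_wpM2l//.
exact: jwX_le1.
Qed.

(** Reciprocity over the whole space between the damped field and the softened field centred at [X]: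
    averaging the former by the mollifier equals integrating [rho0] against the latter. The
    softening is then removed on both sides, on one by [mollifier_cvg], on the other by domination
    with the Riesz potential of [rho0]. *)
Lemma newton0 X (j : 'I_n.+1) :
  intg leb1 (fun V => rho0 V * Ek j (X - V)) /\
  \int[leb1]_V (rho0 V * Ek j (X - V)) = kappa n * rad nW 0 X j.
Proof.
have [K ok] := nW_radial_ok; have K0 := radial_ok_ge0 ok.
pose F V := rad nW 0 V j.
have mF : measurable_fun setT F by exact: (measurable_rad 0 ok).
have FM Z : `|F Z| <= K.
  have /le_trans := rad_bound ok j (sqn_ge0 (Z - 0)); apply.
  by rewrite -[leRHS]mulr1 ler_wpM2l// jwX_le1.
have cF Z : F (hrm i *: Z + X) @[i --> \oo] --> F X.
  apply: cvg_rad_line; case: ok => _ _ _ /(_ _ (sqn_ge0 (X - 0)))[dd _ _].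
  exact: is_derive_continuous_at dd.
have lF := mollifier_cvg mF FM cF.
pose G i V := rho0 V * ((X - V) ord0 j * pw n (hrm i ^+ 2) (sqn (X - V))).
have mcoord : measurable_fun setT (fun V => (X - V) ord0 j : R).
  exact: (measurableT_comp (measurable_rV_coord j) (measurable_subl_rV X)).
have msq : measurable_fun setT (fun V => sqn (X - V)).
  exact: (measurableT_comp (@measurable_sqn R n.+1) (measurable_subl_rV X)).
have mG i : measurable_fun setT (G i).
  apply: measurable_funM; first exact: measurable_rho0.
  by apply: measurable_funM => //; apply: measurableT_comp => //; exact: measurable_pw.
have Gle i V : `|G i V| <= rho0 V * (enorm (X - V))^-1 ^+ n.
  rewrite normrM (ger0_norm (rho0_ge0 V)) ler_wpM2l ?rho0_ge0//.
  apply: le_trans (Ek_le j (X - V)); rewrite /Ek !normrM.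
  have [->|x0] := eqVneq (X - V) 0; first by rewrite mxE normr0 !mul0r.
  by rewrite ler_wpM2l// !ger0_norm ?pw_ge0// pw_anti ?sqr_ge0// sqn_gt0.
have [||iG cG] := @dominated_cvg_Rint _ _ _ leb1 G (fun V => rho0 V * Ek j (X - V))
  _ mG _ (rho0_riesz_intg X) _ => //.
  move=> V; apply: cvgM; first exact: cvg_cst.
  have [->|x0] := eqVneq (X - V) 0.
    by rewrite /Ek mxE mul0r; under eq_fun do rewrite mul0r; exact: cvg_cst.
  by apply: cvgM; [exact: cvg_cst|apply: cvg_pw; rewrite sqn_gt0].
split => //.
have GE i : \int[leb1]_V G i V = \int[leb1]_V (mollifier (hrm i ^+ 2) (V - X) * F V).
  have e0 : 0 < hrm i ^+ 2 :> R by rewrite exprn_gt0// hrm_gt0.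
  have [K1 ok1] := pw_radial_ok_pos n e0; have K10 := radial_ok_ge0 ok1.
  have st := @stress_full R n n2 _ _ _ _ _ _ _ _ X 0 ok1 ok j (lexx _) (lexx _).
  have iG' : intg leb1 (G i) by exact: le_intg (mG i) (Gle i) (rho0_riesz_intg X).
  have mm : measurable_fun setT (fun V => mollifier (hrm i ^+ 2) (V - X)).
    apply: (@measurableT_comp _ _ _ _ _ _ (mollifier (hrm i ^+ 2)) _ (fun V => V - X)).
      exact: measurable_mollifier.
    exact: (measurable_addr_rV (- X)).
  have iM : intg leb1 (fun V => mollifier (hrm i ^+ 2) (V - X) * F V).
    have ij : intg leb1 (fun V => jw (V - X) ^+ n.+3).
      by apply: (@intg_addr R _ (- X) (fun V => jw V ^+ n.+3)); exact: intg_jwX.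
    apply: (le_intg _ _ (intgZ (2 * hrm i ^+ 2 * K1 * K) ij)).
      by apply: measurable_funM.
    move=> V; rewrite normrM -mulrA (mulrC K) mulrA; apply: ler_pM => //.
    rewrite ger0_norm ?mollifier_ge0 ?(ltW e0)//.
    case: ok1 => _ _ _ /(_ _ (sqn_ge0 (V - X)))[_ _ h2].
    have -> : mollifier (hrm i ^+ 2) (V - X) = 2 * hrm i ^+ 2 * - pw' n (hrm i ^+ 2) (sqn (V - X)).
      by rewrite /mollifier /pw'; field.
    rewrite -[leRHS]mulrA; apply: ler_wpM2l; first by rewrite mulr_ge0// ltW.
    apply: le_trans h2.
    by rewrite -normrN ler_norm.
  apply/eqP; rewrite -subr_eq0 -oppr_eq0 opprB -RintegralB//; apply/eqP; rewrite -[RHS]st.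
  apply: eq_Rintegral => V _; rewrite /G mollifierE// -/(rho0 V) /rad.
  have -> : sqn (V - X) = sqn (X - V) by rewrite -sqnN opprB.
  have -> : (V - X) ord0 j = - (X - V) ord0 j by rewrite !mxE opprB.
  by rewrite /F /rad; ring.
have cL : \int[leb1]_V G i V @[i --> \oo] --> kappa n * F X.
  by under eq_fun do rewrite GE.
by rewrite -(cvg_lim (@Rhausdorff R) cL) -(cvg_lim (@Rhausdorff R) cG).
Qed.

(** The ratio of the damped field to [Ek]. By Gauss's law it is the mass of [rho] within squared
    distance [s]. *)
Definition nm (s : R) : R := Num.sqrt s ^+ n.+1 * nW s.

Lemma nm_ge0 s : 0 <= s -> 0 <= nm s.
Proof. by move=> s0; apply: mulr_ge0; [rewrite exprn_ge0 ?sqrtr_ge0|apply: mulr_ge0; [exact: pw_ge0|exact: chi_ge0]]. Qed.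

Lemma nm_le1 s : 0 <= s -> nm s <= 1.
Proof.
move=> s0; rewrite /nm /nW mulrA.
rewrite -[leRHS]mulr1; apply: ler_pM; rewrite ?chi_ge0 ?chi_le1//.
  by rewrite mulr_ge0 ?exprn_ge0 ?sqrtr_ge0 ?pw_ge0.
rewrite /pw -exprMn exprn_ile1 ?mulr_ge0 ?invr_ge0 ?sqrtr_ge0//.
rewrite ler_pdivrMr ?mul1r ?sqrtr_gt0 ?ltr_pwDl ?hrm_gt0//.
by rewrite ler_wsqrtr// lerDr ltW// hrm_gt0.
Qed.

Lemma rad_nW X j : rad nW 0 X j = nm (sqn X) * Ek j X.
Proof.
rewrite /rad subr0 /nm /Ek; have [->|X0] := eqVneq X 0; first by rewrite mxE !mul0r mulr0.
set r := Num.sqrt (sqn X); have r0 : r != 0 by rewrite gt_eqF// sqrtr_gt0 sqn_gt0.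
have -> : pw n 0 (sqn X) = (r ^+ n.+1)^-1 by rewrite /pw add0r exprVn.
by set q := nW _; field; rewrite expf_neq0.
Qed.

Definition rho V : R := rho0 V / kappa n.

Lemma rho_ge0 V : 0 <= rho V.
Proof. by rewrite divr_ge0 ?rho0_ge0// ltW// kappa_gt0. Qed.

Lemma rhoN V : rho (- V) = rho V. Proof. by rewrite /rho rho0N. Qed.

Lemma intg_rho : intg leb1 rho.
Proof.
have := intgZ (kappa n)^-1 intg_rho0.
by under eq_fun do rewrite mulrC.
Qed.

Lemma newton X (j : 'I_n.+1) :
  intg leb1 (fun V => rho V * Ek j (X - V)) /\
  \int[leb1]_V (rho V * Ek j (X - V)) = nm (sqn X) * Ek j X.
Proof.
have [i0 e0] := newton0 X j.
have E V : rho V * Ek j (X - V) = (kappa n)^-1 * (rho0 V * Ek j (X - V)).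
  by rewrite /rho mulrAC mulrC.
split; first by under eq_fun do rewrite E; exact: intgZ.
under eq_Rintegral do rewrite E.
by rewrite RintegralZl// e0 mulrA mulVf ?mul1r ?rad_nW// gt_eqF// kappa_gt0.
Qed.

End cutoff.
End newton.

(** * Poisson kernel *)

Section ge0_integral_scaling.
Context d (T : measurableType d) {R : realType} (mu : {measure set T -> \bar R}).
Local Open Scope ereal_scope.
Variable f : T -> \bar R.
Hypotheses (mf : measurable_fun setT f) (f0 : forall x, 0 <= f x).

Lemma ge0_intZl (k : \bar R) : 0 <= k -> \int[mu]_x (k * f x) = k * \int[mu]_x f x.
Proof. by move=> k0; rewrite ge0_integralZl. Qed.

Lemma ge0_intZr (k : \bar R) : 0 <= k -> \int[mu]_x (f x * k) = \int[mu]_x f x * k.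
Proof. by move=> k0; rewrite ge0_integralZr. Qed.

End ge0_integral_scaling.

Section tonelli.
Context {R : realType}.
Local Open Scope ereal_scope.
Variables p q : nat.

Lemma tonelli_rV (f : 'rV[R]_p -> 'rV[R]_q -> \bar R) :
  measurable_fun setT (fun xy : 'rV[R]_p * 'rV[R]_q => f xy.1 xy.2) ->
  (forall x y, 0 <= f x y) ->
  \int[lebesgue_rV p]_x \int[lebesgue_rV q]_y f x y =
  \int[lebesgue_rV q]_y \int[lebesgue_rV p]_x f x y.
Proof.
move=> mf f0.
exact: (@fubini_tonelli _ _ _ _ _ (lebesgue_rV p) (lebesgue_rV q) (fun xy => f xy.1 xy.2) mf (fun xy => f0 _ _)).
Qed.

Lemma measurable_tonelli (f : 'rV[R]_p -> 'rV[R]_q -> \bar R) :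
  measurable_fun setT (fun xy : 'rV[R]_p * 'rV[R]_q => f xy.1 xy.2) ->
  (forall x y, 0 <= f x y) ->
  measurable_fun setT (fun x => \int[lebesgue_rV q]_y f x y).
Proof.
move=> mf f0.
exact: (@measurable_fun_fubini_tonelli_F _ _ _ _ _ (lebesgue_rV q) (fun xy => f xy.1 xy.2) mf (fun xy => f0 _ _)).
Qed.

End tonelli.

Section joint_measurability.
Context {R : realType} d (S : measurableType d).

Lemma measurable_fun_addrV n (f g : S -> 'rV[R]_n) : measurable_fun setT f ->
  measurable_fun setT g -> measurable_fun setT (fun s => f s + g s).
Proof.
move=> mf mg; apply: measurable_fun_rV => i.
rewrite (_ : (fun _ => _) = fun s => (f s) ord0 i + (g s) ord0 i); last first.
  by apply/funext => s; rewrite mxE.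
by apply: measurable_funD; exact: (measurableT_comp (measurable_rV_coord i)).
Qed.

Lemma measurable_fun_subrV n (f g : S -> 'rV[R]_n) : measurable_fun setT f ->
  measurable_fun setT g -> measurable_fun setT (fun s => f s - g s).
Proof.
move=> mf mg; apply: measurable_fun_rV => i.
rewrite (_ : (fun _ => _) = fun s => (f s) ord0 i - (g s) ord0 i); last first.
  by apply/funext => s; rewrite !mxE.
by apply: measurable_funB; exact: (measurableT_comp (measurable_rV_coord i)).
Qed.

Lemma measurable_fun_cons n (h : S -> measurableTypeR R) (g : S -> 'rV[R]_n) :
  measurable_fun setT h -> measurable_fun setT g ->
  measurable_fun setT (fun s => rV_cons (h s, g s)).
Proof.
move=> mh mg; apply: (measurableT_comp (@measurable_rV_cons R n)).
by apply/measurable_fun_pairP.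
Qed.

Lemma measurable_fun_pl n (g : S -> 'rV[R]_n) :
  measurable_fun setT g -> measurable_fun setT (fun s => pl (g s)).
Proof. by move=> mg; apply: measurable_fun_cons. Qed.

End joint_measurability.

Section poisson_kernel.
Context {R : realType}.
Variable n : nat.
Hypothesis n2 : (2 <= n)%N.
Local Notation leb := (@lebesgue_rV R n).
Local Notation leb1 := (@lebesgue_rV R n.+1).
Implicit Types (Z X A B V U : 'rV[R]_n.+1) (x w z : 'rV[R]_n) (y a b : R).

(** Up to the factor [2 / kappa n], the Poisson kernel at height [|hd Z|]. On the hyperplane it is
    0, not a point mass, which turns several identities below into inequalities. *)
Definition PK Z : R := `|Ek ord0 Z|.

Lemma PK_ge0 Z : 0 <= PK Z. Proof. exact: normr_ge0. Qed.

Lemma measurable_PK : measurable_fun setT PK.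
Proof. by apply: measurableT_comp => //; exact: measurable_Ek. Qed.

Lemma PKE Z : PK Z = `|hd Z| * pw n 0 (sqn Z).
Proof. by rewrite /PK /Ek normrM (ger0_norm (pw_ge0 _ _ _)). Qed.

Lemma PK_cons y x : PK (rV_cons (y, x)) = `|y| * pw n 0 (y ^+ 2 + sqn x).
Proof. by rewrite PKE hd_cons sqn_cons. Qed.

Lemma PKN Z : PK (- Z) = PK Z. Proof. by rewrite /PK EkN normrN. Qed.

Lemma PK_le Z : PK Z <= (enorm Z)^-1 ^+ n. Proof. exact: Ek_le. Qed.

Lemma PK_norm_hd y x : PK (rV_cons (`|y|, x)) = PK (rV_cons (y, x)).
Proof. by rewrite !PK_cons normr_id real_normK// num_real. Qed.

Lemma measurable_PK_comp d (S : measurableType d) (f : S -> 'rV[R]_n.+1) :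
  measurable_fun setT f -> measurable_fun setT (fun s => (PK (f s))%:E).
Proof. by move=> mf; apply/measurable_EFinP; exact: (measurableT_comp measurable_PK mf). Qed.

(** The normal component of [poisson_reproduction], with the pole at depth [b]. *)
Lemma poisson_semigroup a b x : 0 < a -> 0 < b ->
  (\int[leb]_z (PK (rV_cons (a, x - z)) * PK (rV_cons (b, z)))%:E =
  (kappa n / 2 * PK (rV_cons ((a + b)%R, x)))%:E)%E.
Proof.
move=> a0 b0; pose A : 'rV[R]_n.+1 := rV_cons (a, x); pose B : 'rV[R]_n.+1 := rV_cons (- b, 0).
have hA : 0 < hd A by rewrite hd_cons.
have hB : hd B < 0 by rewrite hd_cons oppr_lt0.
have [i e] := poisson_reproduction n2 ord0 hA hB.
have E z : PK (rV_cons (a, x - z)) * PK (rV_cons (b, z)) = a * (pw n 0 (sqn (A - pl z)) * Ek ord0 (pl z - B)).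
  rewrite !PK_cons /A /B /pl !rV_consB subr0 sqn_cons sub0r opprK subr0.
  rewrite /Ek rV_cons_ord0/= sqn_cons !gtr0_norm//.
  by rewrite mulrA.
under eq_integral do rewrite E.
rewrite -Rint_intg; last exact: intgZ.
rewrite RintegralZl//; congr (_%:E).
have -> : PK (rV_cons (a + b, x)) = Ek ord0 (A - B).
  by rewrite PK_cons /A /B rV_consB opprK subr0 /Ek rV_cons_ord0 sqn_cons/= gtr0_norm// addr_gt0.
by move: e; rewrite hd_cons => e; rewrite mulrAC e; field.
Qed.

Definition poisson_int : \bar R := (\int[leb]_z (PK (rV_cons (1%R, z)))%:E)%E.

Lemma measurable_PK_slice y : measurable_fun setT (fun z => (PK (rV_cons (y, z)))%:E).
Proof. by apply: measurable_PK_comp; apply: measurable_fun_cons. Qed.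

Lemma poisson_int_scale y : y != 0 -> (\int[leb]_z (PK (rV_cons (y, z)))%:E = poisson_int)%E.
Proof.
move=> y0; have ny : 0 < `|y| by rewrite normr_gt0.
rewrite (ge0_integral_scale (lt0r_neq0 ny) (measurable_PK_slice y)); last first.
  by move=> z; rewrite lee_fin PK_ge0.
have mz : measurable_fun setT (fun z => (PK (rV_cons (y, `|y| *: z)))%:E).
  by apply: measurable_PK_comp; apply: measurable_fun_cons => //; exact: measurable_scale_rV.
rewrite normr_id -(ge0_intZl _ mz) ?lee_fin ?exprn_ge0//; last by move=> z; rewrite lee_fin PK_ge0.
apply: eq_integral => z _; rewrite -EFinM; congr (_%:E).
rewrite !PK_cons normr1 mul1r expr1n sqn_scale real_normK ?num_real//.
rewrite -[X in pw n 0 (X + _)]mulr1 -mulrDr /pw !add0r sqrtrM ?sqr_ge0// sqrtr_sqr invfM exprMn.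
by rewrite !mulrA -exprSr -exprMn mulfV ?gt_eqF// expr1n mul1r.
Qed.

(** Integrating the semigroup identity gives I * I = [kappa n / 2] * I for the mass I, which is the
    same at all heights; so I is determined once it is not 0. *)
Lemma poisson_intE : poisson_int = (kappa n / 2)%:E.
Proof.
have k0 := @kappa_gt0 R n.
have I0 : (0 <= poisson_int)%E by apply: integral_ge0 => z _; rewrite lee_fin PK_ge0.
have : (\int[leb]_x \int[leb]_z (PK (rV_cons (1%R, (x - z)%R)) * PK (rV_cons (1%R, z)))%:E =
       (kappa n / 2)%:E * poisson_int)%E.
  under eq_integral do rewrite poisson_semigroup//.
  under eq_integral do rewrite EFinM.
  have c0 : (0 <= (kappa n / 2)%:E :> \bar R)%E by rewrite lee_fin divr_ge0// ltW.
  have P0 z : (0 <= (PK (rV_cons ((1 + 1)%R, z)))%:E :> \bar R)%E by rewrite lee_fin PK_ge0.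
  rewrite (ge0_intZl leb (measurable_PK_slice (1 + 1)%R) P0 c0).
  by rewrite poisson_int_scale// gt_eqF// addr_gt0.
have mF : measurable_fun setT (fun xz : 'rV[R]_n * 'rV[R]_n =>
    (PK (rV_cons (1%R, (xz.1 - xz.2)%R)) * PK (rV_cons (1%R, xz.2)))%:E).
  under eq_fun do rewrite EFinM.
  apply: emeasurable_funM; apply: measurable_PK_comp; apply: measurable_fun_cons => //.
  exact: measurable_fun_subrV.
rewrite (@tonelli_rV R n n (fun x z => (PK (rV_cons (1%R, (x - z)%R)) * PK (rV_cons (1%R, z)))%:E))//; last first.
  by move=> x y; rewrite lee_fin mulr_ge0 ?PK_ge0.
have E z : (\int[leb]_x (PK (rV_cons (1%R, (x - z)%R)) * PK (rV_cons (1%R, z)))%:E =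
    poisson_int * (PK (rV_cons (1%R, z)))%:E)%E.
  under eq_integral do rewrite EFinM.
  have mz : measurable_fun setT (fun x => (PK (rV_cons (1%R, (x - z)%R)))%:E).
    by apply: measurable_PK_comp; apply: measurable_fun_cons => //; exact: measurable_fun_subrV.
  have P0 x : (0 <= (PK (rV_cons (1%R, (x - z)%R)))%:E :> \bar R)%E by rewrite lee_fin PK_ge0.
  rewrite (ge0_intZr leb mz P0); last by rewrite lee_fin PK_ge0.
  congr (_ * _)%E; apply: (@ge0_integral_addr R n (- z) (fun x => (PK (rV_cons (1%R, x)))%:E)).
    exact: measurable_PK_slice.
  by move=> x; rewrite lee_fin PK_ge0.
under eq_integral do rewrite E.
rewrite (ge0_intZl _ (measurable_PK_slice _))//; last by move=> z; rewrite lee_fin PK_ge0.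
rewrite -/poisson_int => h.
have pw1 z : PK (rV_cons (1%R, z)) = jw z ^+ n.+1.
  by rewrite PK_cons normr1 mul1r expr1n /pw add0r.
have iP : intg leb (fun z => PK (rV_cons (1%R, z))).
  by under eq_fun do rewrite pw1; exact: intg_jwX.
have := Rint_intg iP; rewrite -/poisson_int.
set I := (\int[leb]_x _)%R => IE.
(* The kernel at height 1 is at most 1; if its mass vanished, so would its convolution with itself,
   whose value at the origin is positive by the semigroup identity. *)
have I1 : 0 < I.
  have I1 : 0 <= I by rewrite -lee_fin IE.
  rewrite lt0r I1 andbT; apply/negP => /eqP I10.
  have := @poisson_semigroup 1 1 0 ltr01 ltr01.
  apply/eqP; rewrite lt_eqF//.
  apply: (@le_lt_trans _ _ (\int[leb]_z (PK (rV_cons (1%R, z)))%:E)%E).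
    apply: ge0_le_integral => //.
    - by move=> x _; rewrite lee_fin mulr_ge0 ?PK_ge0.
    - under eq_fun do rewrite EFinM.
      by apply: emeasurable_funM; apply: measurable_PK_comp; apply: measurable_fun_cons => //; exact: measurable_fun_subrV.
    - exact: measurable_PK_slice.
    move=> z _; rewrite lee_fin ler_piMl ?PK_ge0// pw1 jwX_le1//.
  rewrite -/poisson_int -IE I10 lte_fin mulr_gt0 ?divr_gt0// PK_cons sqn0 addr0.
  rewrite mulr_gt0 ?normr_gt0 ?gt_eqF ?addr_gt0// /pw add0r exprn_gt0// invr_gt0 sqrtr_gt0 exprn_gt0// addr_gt0//.
move: h; rewrite -IE -!EFinM => -[] h; congr (_%:E).
by apply: (mulIf (lt0r_neq0 I1)).
Qed.

Lemma int_PK y : (\int[leb]_z (PK (rV_cons (y, z)))%:E <= (kappa n / 2)%:E)%E.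
Proof.
have [->|y0] := eqVneq y 0; last by rewrite poisson_int_scale// poisson_intE.
under eq_integral do rewrite PK_cons normr0 mul0r.
by rewrite integral0 lee_fin divr_ge0// ltW// kappa_gt0.
Qed.

Lemma int_PK_neq0 y : y != 0 -> (\int[leb]_z (PK (rV_cons (y, z)))%:E = (kappa n / 2)%:E)%E.
Proof. by move=> y0; rewrite poisson_int_scale// poisson_intE. Qed.

End poisson_kernel.

(** * Reflection in the hyperplane *)

Section reflections.
Context {R : realType}.
Variable n : nat.
Local Notation leb1 := (@lebesgue_rV R n.+1).
Implicit Types (V : 'rV[R]_n.+1).

Definition star V : 'rV[R]_n.+1 := rV_cons (- hd V, tl V).
(** Folds the space onto the closed upper half-space; Poisson kernels seen from the hyperplane are
    unchanged ([PK_pl_plus]). *)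
Definition plus V : 'rV[R]_n.+1 := rV_cons (`|hd V|, tl V).

Lemma star_rdiag V : star V = rdiag (fun i : 'I_n.+1 => if i == ord0 then -1 else 1) (fun=> 0) V.
Proof.
apply/rowP => i; rewrite /rdiag [RHS]mxE addr0; case: (unliftP ord0 i) => [k|] ->.
  by rewrite rV_cons_lift/= tlE mul1r.
by rewrite rV_cons_ord0/= mulN1r.
Qed.

Lemma sqn_star V : sqn (star V) = sqn V.
Proof. by rewrite sqn_cons sqrrN -sqn_hd_tl. Qed.

Lemma measurable_star : measurable_fun setT star.
Proof.
rewrite (_ : star = rdiag (fun i : 'I_n.+1 => if i == ord0 then -1 else 1) (fun=> 0)).
  exact: measurable_rV_affine.
by apply/funext => V; rewrite star_rdiag.
Qed.

Lemma measurable_plus : measurable_fun setT plus.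
Proof.
apply: measurable_fun_cons; last exact: measurable_tl.
by apply: measurableT_comp => //; exact: measurable_hd.
Qed.

Lemma ge0_integral_star (f : 'rV[R]_n.+1 -> \bar R) : measurable_fun setT f ->
  (forall V, 0 <= f V)%E -> (\int[leb1]_V f (star V) = \int[leb1]_V f V)%E.
Proof.
move=> mf f0; pose l (i : 'I_n.+1) : R := if i == ord0 then -1 else 1.
have l0 i : l i != 0 by rewrite /l; case: ifP; rewrite ?oppr_eq0 oner_eq0.
rewrite [in RHS](ge0_integral_affine (fun=> 0) l0 mf f0).
rewrite big1 ?mul1e; last by move=> i _; rewrite /l; case: ifP; rewrite ?normrN normr1.
by apply: eq_integral => V _; rewrite star_rdiag.
Qed.

Lemma Rintegral_star (f : 'rV[R]_n.+1 -> R) : intg leb1 f ->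
  intg leb1 (fun V => f (star V)) /\ \int[leb1]_V f (star V) = \int[leb1]_V f V.
Proof.
move=> fi; pose l (i : 'I_n.+1) : R := if i == ord0 then -1 else 1.
have l0 i : l i != 0 by rewrite /l; case: ifP; rewrite ?oppr_eq0 oner_eq0.
split.
  have := integrable_affine (fun=> 0) l0 fi.
  rewrite /intg; congr (integrable _ _ _); apply/funext => V /=; congr (EFin (f _)).
  by rewrite star_rdiag.
rewrite [in RHS](Rintegral_affine (fun=> 0) l0 fi).
rewrite big1 ?mul1r; last by move=> i _; rewrite /l; case: ifP; rewrite ?normrN normr1.
by apply: eq_Rintegral => V _; rewrite star_rdiag.
Qed.

Lemma plusP V : (0 <= hd V /\ plus V = V) \/ (hd V <= 0 /\ plus V = star V).
Proof.
rewrite /plus /star; have [h|h] := leP 0 (hd V); [left|right].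
  by split => //; rewrite ger0_norm// rV_cons_eta.
by rewrite ltW// ltr0_norm.
Qed.

End reflections.

(** * Mass distributions with a damped Newtonian field *)

Section newtonian.
Context {R : realType}.
Variable n : nat.
Hypothesis n2 : (2 <= n)%N.
Local Notation leb := (@lebesgue_rV R n).
Local Notation leb1 := (@lebesgue_rV R n.+1).
Implicit Types (X V U Z : 'rV[R]_n.+1) (w z x : 'rV[R]_n) (r : 'rV[R]_n.+1 -> R).

(* [r] is a mass distribution whose field is that of a unit point mass at the origin, damped by
   the factor [m]. *)
Definition newtonian r (m : R -> R) : Prop :=
  [/\ intg leb1 r, exists M, forall V, 0 <= r V <= M,
      forall V, r (- V) = r V /\ r (star V) = r V,
      forall s, 0 <= s -> 0 <= m s <= 1 &
      forall X j, \int[leb1]_V (r V * Ek j (X - V)) = m (sqn X) * Ek j X].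

Lemma rho_newtonian k (T : R) : 0 < T -> newtonian (rho k T) (nm n k T).
Proof.
move=> T0; split.
- exact: intg_rho.
- have [K K0 h] := @rho0_bound R n k T T0.
  exists (K / kappa n) => V; rewrite rho_ge0// ler_pdivrMr ?kappa_gt0// divfK ?gt_eqF ?kappa_gt0//=.
  by rewrite (le_trans (h V))// -[leRHS]mulr1 ler_wpM2l// jwX_le1.
- by move=> V; split; [exact: rhoN|rewrite /rho !rho0E /mollifier sqn_star].
- by move=> s s0; rewrite nm_ge0// nm_le1.
- by move=> X j; have [_ ->] := newton n2 k T0 X j.
Qed.

Section one_density.
Variables (r : 'rV[R]_n.+1 -> R) (m : R -> R).
Hypothesis rN : newtonian r m.

Lemma newtonian_ge0 V : 0 <= r V.
Proof. by case: rN => _ [M /(_ V)/andP[]]. Qed.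

Lemma newtonian_intg : intg leb1 r. Proof. by case: rN. Qed.

Lemma measurable_newtonian : measurable_fun setT r.
Proof. exact: intg_measurable newtonian_intg. Qed.

Lemma newtonian_opp V : r (- V) = r V. Proof. by case: rN => _ _ /(_ V)[]. Qed.

Lemma newtonian_star V : r (star V) = r V. Proof. by case: rN => _ _ /(_ V)[]. Qed.

Lemma newtonian_riesz : exists C, forall X,
  intg leb1 (fun V => r V * (enorm (X - V))^-1 ^+ n) /\
  \int[leb1]_V (r V * (enorm (X - V))^-1 ^+ n) <= C.
Proof.
have [ri [M h] _ _ _] := rN; exists (M * @head_const R n + \int[leb1]_V r V) => X.
have n0 : (0 < n)%N by exact: ltn_trans n2.
exact: (@intg_riesz_potential R n n0 r M X ri h).
Qed.

Lemma newtonian_PK_intg X : intg leb1 (fun V => r V * (enorm (X + V))^-1 ^+ n).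
Proof.
have [C /(_ (- X))[i _]] := newtonian_riesz.
by under eq_fun do rewrite -enormN opprD.
Qed.

Lemma newtonian_Ek_intg X j : intg leb1 (fun V => r V * Ek j (X + V)).
Proof.
apply: le_intg (newtonian_PK_intg X).
  apply: measurable_funM; first exact: measurable_newtonian.
  apply: (measurableT_comp (measurable_Ek j)).
  by apply: measurable_fun_addrV.
by move=> V; rewrite normrM ger0_norm ?newtonian_ge0// ler_wpM2l ?newtonian_ge0// Ek_le.
Qed.

Lemma newtonian_add X j : \int[leb1]_V (r V * Ek j (X + V)) = m (sqn X) * Ek j X.
Proof.
case: rN => _ _ _ _ <-.
rewrite -(Rintegral_subl 0 (newtonian_Ek_intg X j)); apply: eq_Rintegral => V _.
by rewrite sub0r newtonian_opp.
Qed.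

Lemma newtonian_add_star X j :
  intg leb1 (fun V => r V * Ek j (X + star V)) /\
  \int[leb1]_V (r V * Ek j (X + star V)) = m (sqn X) * Ek j X.
Proof.
have [i e] := Rintegral_star (newtonian_Ek_intg X j).
rewrite -newtonian_add -e; split.
  by under eq_fun do rewrite -[r _]newtonian_star.
by apply: eq_Rintegral => V _; rewrite newtonian_star.
Qed.

Lemma newtonian_m s : 0 <= s -> 0 <= m s <= 1.
Proof. by case: rN => _ _ _ + _; apply. Qed.

Lemma newtonian_riesz_E : exists C : R, forall X,
  (\int[leb1]_V (r V * PK (X + V))%:E <= C%:E)%E.
Proof.
have [C h] := newtonian_riesz; exists C => X; have [i e] := h (- X).
apply: (@le_trans _ _ (\int[leb1]_V (r V * (enorm (- X - V))^-1 ^+ n)%:E)%E); last first.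
  by rewrite -Rint_intg// lee_fin.
apply: ge0_le_integral => //.
- by move=> V _; rewrite lee_fin mulr_ge0 ?newtonian_ge0 ?PK_ge0.
- apply/measurable_EFinP; apply: measurable_funM; first exact: measurable_newtonian.
  by apply: (measurableT_comp (@measurable_PK R n)); exact: measurable_fun_addrV.
- by apply/measurable_EFinP; exact: intg_measurable i.
- by move=> V _; rewrite lee_fin ler_wpM2l ?newtonian_ge0// -opprD enormN PK_le.
Qed.

(** Vertical flux through the plane at height i + 1. A unit mass below sends [kappa n / 2] upwards,
    a unit mass above sends as much downwards, and the total is at most the flux [kappa n / 2] of a
    unit mass at the origin, because the damping factor is at most 1. So the mass below is at most 1
    plus the mass above, and the latter vanishes as the plane rises. *)
Lemma newtonian_mass : (\int[leb1]_V (r V)%:E <= 1)%E.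
Proof.
have k0 := @kappa_gt0 R n; have k20 : 0 < kappa n / 2 :> R by rewrite divr_gt0.
have r0 := newtonian_ge0; have ri := newtonian_intg; have mr := measurable_newtonian.
pose Y i : 'rV[R]_n.+1 := rV_cons (i.+1%:R, 0).
pose u i V := upI (Y i - V).
have mu i : measurable_fun setT (u i).
  apply: (measurableT_comp (@measurable_upI R n)); exact: measurable_subl_rV.
have uE i V : u i V = (hd V < i.+1%:R)%R%:R.
  rewrite /u upIE; congr (nat_of_bool _)%:R; rewrite /hd mxE [(- V) _ _]mxE rV_cons_ord0/=.
  by rewrite subr_gt0.
have u01 i V : 0 <= u i V <= 1 by rewrite upI_ge0 upI_le1.
have v01 i V : 0 <= 1 - u i V <= 1.
  by have /andP[a b] := u01 i V; rewrite subr_ge0 b/= gerBl.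
have iu i : intg leb1 (fun V => r V * u i V).
  apply: le_intg ri; first exact: measurable_funM.
  by move=> V; have /andP[a b] := u01 i V; rewrite ger0_norm ?mulr_ge0// ler_piMr.
have iv i : intg leb1 (fun V => r V * (1 - u i V)).
  apply: le_intg ri; first by apply: measurable_funM => //; exact: measurable_funB.
  by move=> V; have /andP[a b] := v01 i V; rewrite ger0_norm ?mulr_ge0// ler_piMr.
have key i : \int[leb1]_V (r V * u i V) <= 1 + \int[leb1]_V (r V * (1 - u i V)).
  have y0 : 0 < i.+1%:R :> R by rewrite ltr0n.
  pose X x : 'rV[R]_n.+1 := rV_cons (i.+1%:R, x).
  have hX x V : hd (X x - V) = i.+1%:R - hd V by rewrite /hd mxE [(- V) _ _]mxE rV_cons_ord0.
  (* The vertical field at a point of the plane: contributions from below minus those from above are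
     at most [PK (X x)]. The latter are moved to the right to keep all integrands non-negative. *)
  have nt x : (\int[leb1]_V (r V * u i V * PK (X x - V))%:E <=
      (PK (X x))%:E + \int[leb1]_V (r V * (1 - u i V) * PK (X x - V))%:E)%E.
    have ip : intg leb1 (fun V => r V * PK (X x - V)).
      have [C /(_ (X x))[ii _]] := newtonian_riesz.
      apply: le_intg ii.
        apply: measurable_funM => //; apply: (measurableT_comp (@measurable_PK R n)).
        exact: measurable_subl_rV.
      by move=> V; rewrite ger0_norm ?mulr_ge0 ?PK_ge0// ler_wpM2l// PK_le.
    have mPX : measurable_fun setT (fun V => PK (X x - V)).
      apply: (measurableT_comp (@measurable_PK R n)); exact: measurable_subl_rV.
    have i1 : intg leb1 (fun V => r V * u i V * PK (X x - V)).
      apply: le_intg ip; first by apply: measurable_funM => //; exact: measurable_funM.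
      move=> V; have /andP[a b] := u01 i V.
      by rewrite ger0_norm ?mulr_ge0 ?PK_ge0// ler_wpM2r ?PK_ge0// ler_piMr.
    have i2 : intg leb1 (fun V => r V * (1 - u i V) * PK (X x - V)).
      apply: le_intg ip.
        by apply: measurable_funM => //; apply: measurable_funM => //; exact: measurable_funB.
      move=> V; have /andP[a b] := v01 i V.
      by rewrite ger0_norm ?mulr_ge0 ?PK_ge0// ler_wpM2r ?PK_ge0// ler_piMr.
    rewrite -!Rint_intg// -EFinD lee_fin -lerBlDr -RintegralB//.
    apply: (@le_trans _ _ (m (sqn (X x)) * Ek ord0 (X x))).
      case: (rN) => _ _ _ _ <-; rewrite le_eqVlt; apply/orP; left; apply/eqP.
      apply: eq_Rintegral => V _.
      rewrite uE PKE hX /Ek -[(X x - V) ord0 ord0]/(hd (X x - V)) hX.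
      case: ltP => h.
        by rewrite ger0_norm ?subr_ge0 ?ltW//= mulr1n; ring.
      by rewrite ler0_norm ?subr_le0//= mulr0n; ring.
    have /andP[a b] := newtonian_m (sqn_ge0 (X x)).
    have eX : Ek ord0 (X x) = PK (X x).
      by rewrite PKE /Ek -[X x ord0 ord0]/(hd _) hd_cons gtr0_norm.
    by rewrite eX ler_piMl ?PK_ge0.
  have mXV : measurable_fun setT (fun p : 'rV[R]_n * 'rV[R]_n.+1 => X p.1 - p.2).
    by apply: measurable_fun_subrV => //; apply: measurable_fun_cons.
  have ti (g : 'rV[R]_n.+1 -> R) : measurable_fun setT g -> (forall V, 0 <= g V) ->
     (\int[leb]_x \int[leb1]_V (g V * PK (X x - V))%:E =
      \int[leb1]_V ((g V)%:E * \int[leb]_x (PK (rV_cons ((i.+1%:R - hd V)%R, x)))%:E))%E.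
    move=> mg g0.
    rewrite (@tonelli_rV R n n.+1 (fun x V => (g V * PK (X x - V))%:E)).
    - apply: eq_integral => V _; under eq_integral do rewrite EFinM.
      rewrite (ge0_intZl leb); last 3 first.
      + apply: measurable_PK_comp.
        by apply: measurable_fun_subrV => //; apply: measurable_fun_cons.
      + by move=> x; rewrite lee_fin PK_ge0.
      + by rewrite lee_fin.
      congr (_ * _)%E.
      rewrite -(@ge0_integral_addr R n (- tl V) (fun x => (PK (rV_cons ((i.+1%:R - hd V)%R, x)))%:E)).
      + apply: eq_integral => x _; congr (EFin (PK _)).
        by rewrite -{1}(rV_cons_eta V) rV_consB.
      + exact: measurable_PK_slice.
      + by move=> x; rewrite lee_fin PK_ge0.
    - under eq_fun do rewrite EFinM.
      apply: emeasurable_funM; last exact: measurable_PK_comp.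
      by apply/measurable_EFinP; exact: (measurableT_comp mg).
    - by move=> x V; rewrite lee_fin mulr_ge0 ?PK_ge0.
  have mP1 : measurable_fun setT (fun x => (PK (X x))%:E).
    by apply: measurable_PK_comp; apply: measurable_fun_cons.
  have mT (g : 'rV[R]_n.+1 -> R) : measurable_fun setT g -> (forall V, 0 <= g V) ->
      measurable_fun setT (fun x => \int[leb1]_V (g V * PK (X x - V))%:E)%E.
    move=> mg g0; apply: (@measurable_tonelli R n n.+1 (fun x V => (g V * PK (X x - V))%:E)).
      under eq_fun do rewrite EFinM.
      apply: emeasurable_funM; last exact: measurable_PK_comp.
      by apply/measurable_EFinP; exact: (measurableT_comp mg).
    by move=> x V; rewrite lee_fin mulr_ge0 ?PK_ge0.
  have gu V : 0 <= r V * u i V by have /andP[a b] := u01 i V; rewrite mulr_ge0.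
  have gv V : 0 <= r V * (1 - u i V) by have /andP[a b] := v01 i V; rewrite mulr_ge0.
  have mgu := intg_measurable (iu i); have mgv := intg_measurable (iv i).
  have : (\int[leb]_x \int[leb1]_V (r V * u i V * PK (X x - V))%:E <=
     \int[leb]_x (PK (X x))%:E + \int[leb]_x \int[leb1]_V (r V * (1 - u i V) * PK (X x - V))%:E)%E.
    rewrite -ge0_integralD//; last 3 first.
    - by move=> x _; rewrite lee_fin PK_ge0.
    - by move=> x _; apply: integral_ge0 => V _; rewrite lee_fin mulr_ge0 ?PK_ge0.
    - exact: (mT (fun V => r V * (1 - u i V))).
    apply: ge0_le_integral => //.
    - by move=> x _; apply: integral_ge0 => V _; rewrite lee_fin mulr_ge0 ?PK_ge0.
    - exact: (mT (fun V => r V * u i V)).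
    - apply: emeasurable_funD => //; exact: (mT (fun V => r V * (1 - u i V))).
  rewrite (ti (fun V => r V * u i V))// (ti (fun V => r V * (1 - u i V)))//.
  rewrite int_PK_neq0 ?gt_eqF// => h.
  have e1 : (\int[leb1]_V ((r V * u i V)%:E * \int[leb]_x (PK (rV_cons ((i.+1%:R - hd V)%R, x)))%:E) =
      (kappa n / 2 * \int[leb1]_V (r V * u i V))%:E)%E.
    rewrite EFinM Rint_intg// -(ge0_intZl leb1); last 3 first.
    - by apply/measurable_EFinP.
    - by move=> V; rewrite lee_fin.
    - by rewrite lee_fin ltW.
    apply: eq_integral => V _; rewrite muleC.
    have [a|a] := ltP (hd V) i.+1%:R; first by rewrite int_PK_neq0// gt_eqF// subr_gt0.
    by rewrite uE ltNge a mulr0 !mule0.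
  (* Only an inequality: masses on the plane itself contribute 0. *)
  have e2 : (\int[leb1]_V ((r V * (1 - u i V))%:E * \int[leb]_x (PK (rV_cons ((i.+1%:R - hd V)%R, x)))%:E) <=
      (kappa n / 2 * \int[leb1]_V (r V * (1 - u i V)))%:E)%E.
    rewrite EFinM Rint_intg// -(ge0_intZl leb1); last 3 first.
    - by apply/measurable_EFinP.
    - by move=> V; rewrite lee_fin.
    - by rewrite lee_fin ltW.
    have mQ : measurable_fun setT (fun V => \int[leb]_x (PK (rV_cons ((i.+1%:R - hd V)%R, x)))%:E)%E.
      apply: (@measurable_tonelli R n.+1 n (fun V x => (PK (rV_cons ((i.+1%:R - hd V)%R, x)))%:E)).
        apply: measurable_PK_comp; apply: measurable_fun_cons => //.
        apply: measurable_funB => //; exact: (measurableT_comp (@measurable_hd R n)).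
      by move=> V x; rewrite lee_fin PK_ge0.
    have Q0 V : (0 <= \int[leb]_x (PK (rV_cons ((i.+1%:R - hd V)%R, x)))%:E)%E.
      by apply: integral_ge0 => x _; rewrite lee_fin PK_ge0.
    apply: ge0_le_integral => //.
    - by move=> V _; rewrite mule_ge0// lee_fin.
    - by apply: emeasurable_funM => //; apply/measurable_EFinP.
    - by apply: emeasurable_funM => //; apply/measurable_EFinP.
    by move=> V _; rewrite muleC lee_wpmul2r ?lee_fin// int_PK.
  rewrite e1 in h; have := le_trans h (leeD2l _ e2).
  rewrite -EFinD lee_fin -{2}(mulr1 (kappa n / 2)) -mulrDr ler_pM2l//.
have c1 : \int[leb1]_V (r V * u i V) @[i --> \oo] --> \int[leb1]_V r V.
  have [|||_ //] := @dominated_cvg_Rint _ _ _ leb1 (fun i V => r V * u i V) r r _ _ ri.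
  - by move=> i; exact: measurable_funM.
  - move=> V; rewrite -[X in _ --> X]mulr1; apply: cvgM; first exact: cvg_cst.
    have c1 : (fun=> 1 : R) (i : nat) @[i --> \oo] --> (1 : R) by exact: cvg_cst.
    apply: cvg_trans c1; apply: near_eq_cvg.
    exists (Num.bound `|hd V|) => // i /= hi; rewrite uE (@lt_le_trans _ _ (Num.bound `|hd V|)%:R)//.
      exact: le_lt_trans (ler_norm _) (archi_boundP (normr_ge0 _)).
    by rewrite ler_nat ltnW.
  - by move=> i V; have /andP[a b] := u01 i V; rewrite ger0_norm ?mulr_ge0// ler_piMr.
have c2 : \int[leb1]_V (r V * (1 - u i V)) @[i --> \oo] --> (0 : R).
  have E i : \int[leb1]_V (r V * (1 - u i V)) = \int[leb1]_V r V - \int[leb1]_V (r V * u i V).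
    have <- := RintegralB measurableT ri (iu i).
    by under eq_Rintegral do rewrite mulrBr mulr1.
  under eq_fun do rewrite E; rewrite -(subrr (\int[leb1]_V r V)).
  by apply: cvgB => //; exact: cvg_cst.
rewrite -Rint_intg// lee_fin.
have c3 : 1 + \int[leb1]_V (r V * (1 - u i V)) @[i --> \oo] --> (1 + 0 : R).
  by apply: cvgD => //; exact: cvg_cst.
rewrite -[leRHS]addr0; apply: (ler_cvg_to c1 c3); exact: nearW.
Qed.

End one_density.
End newtonian.

(** * Convolution of the kernels *)

Lemma measurable_flip d1 d2 d3 (T1 : measurableType d1) (T2 : measurableType d2)
    (T3 : measurableType d3) (F : T1 -> T2 -> T3) :
  measurable_fun setT (fun p : T1 * T2 => F p.1 p.2) ->
  measurable_fun setT (fun p : T2 * T1 => F p.2 p.1).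
Proof.
move=> mF; apply: (measurableT_comp mF (g := fun p : T2 * T1 => (p.2, p.1))).
by apply/measurable_fun_pairP; split; [exact: measurable_snd|exact: measurable_fst].
Qed.

Section kern.
Context {R : realType}.
Variable n : nat.
Hypothesis n2 : (2 <= n)%N.
Local Notation leb := (@lebesgue_rV R n).
Local Notation leb1 := (@lebesgue_rV R n.+1).
Implicit Types (X V U Z : 'rV[R]_n.+1) (w z x : 'rV[R]_n) (r : 'rV[R]_n.+1 -> R).

(** A superposition, with weights [r V], of translated Poisson kernels of heights [|hd V|]; the
    factor [2 / kappa n] gives each of them unit mass. *)
Definition kern r w : R := 2 / kappa n * \int[leb1]_V (r V * PK (pl w + V)).

Let c0 : 0 < 2 / kappa n :> R. Proof. by rewrite divr_gt0// kappa_gt0. Qed.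

Section one.
Variables (r : 'rV[R]_n.+1 -> R) (m : R -> R).
Hypothesis rN : newtonian r m.
Let r0 := newtonian_ge0 rN.
Let mr := measurable_newtonian rN.

Lemma newtonian_intg_PK X : intg leb1 (fun V => r V * PK (X + V)).
Proof.
apply: le_intg (newtonian_PK_intg n2 rN X).
  apply: measurable_funM; first exact: mr.
  by apply: (measurableT_comp (@measurable_PK R n)); exact: measurable_fun_addrV.
by move=> V; rewrite ger0_norm ?mulr_ge0 ?PK_ge0// ler_wpM2l// PK_le.
Qed.

Lemma kernE w : ((kern r w)%:E = (2 / kappa n)%:E * \int[leb1]_V (r V * PK (pl w + V))%:E)%E.
Proof. by rewrite /kern EFinM Rint_intg//; exact: newtonian_intg_PK. Qed.

Lemma kern_ge0 w : 0 <= kern r w.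
Proof.
rewrite mulr_ge0 ?(ltW c0)//; apply: Rintegral_ge0 => V _.
by rewrite mulr_ge0 ?PK_ge0.
Qed.

Let mker : measurable_fun setT (fun p : 'rV[R]_n * 'rV[R]_n.+1 => (r p.2 * PK (pl p.1 + p.2))%:E).
Proof.
under eq_fun do rewrite EFinM.
apply: emeasurable_funM; first by apply/measurable_EFinP; exact: (measurableT_comp mr).
apply: measurable_PK_comp; apply: measurable_fun_addrV => //.
exact: measurable_fun_pl.
Qed.

Let ker0 w V : (0 <= (r V * PK (pl w + V))%:E)%E.
Proof. by rewrite lee_fin mulr_ge0 ?PK_ge0. Qed.

Lemma measurable_kern : measurable_fun setT (kern r).
Proof.
apply/measurable_EFinP.
rewrite (_ : EFin \o kern r = fun w => (2 / kappa n)%:E * \int[leb1]_V (r V * PK (pl w + V))%:E)%E; last first.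
  by apply/funext => w /=; rewrite kernE.
apply: emeasurable_funM => //.
exact: (@measurable_tonelli R n n.+1 (fun w V => (r V * PK (pl w + V))%:E)).
Qed.

Lemma kernN w : kern r (- w) = kern r w.
Proof.
rewrite /kern; apply: (congr1 (fun t => 2 / kappa n * t)).
have e := Rintegral_subl 0 (newtonian_intg_PK (pl (- w))).
apply: (etrans (esym e)).
apply: eq_Rintegral => V _; rewrite sub0r (newtonian_opp rN); congr (_ * _).
have -> : pl (- w) = - pl w by rewrite /pl rV_consN oppr0.
by rewrite -opprD PKN.
Qed.

Lemma kern_mass : (\int[leb]_w (kern r w)%:E <= 1)%E.
Proof.
under eq_integral do rewrite kernE.
have mF : measurable_fun setT (fun w => \int[leb1]_V (r V * PK (pl w + V))%:E)%E.
  exact: (@measurable_tonelli R n n.+1 (fun w V => (r V * PK (pl w + V))%:E)).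
rewrite (ge0_intZl leb mF); last 2 first.
- by move=> w; exact: integral_ge0.
- by rewrite lee_fin ltW.
rewrite (@tonelli_rV R n n.+1 (fun w V => (r V * PK (pl w + V))%:E))//.
apply: (@le_trans _ _ ((2 / kappa n)%:E * \int[leb1]_V ((r V)%:E * (kappa n / 2)%:E))%E); last first.
  rewrite (ge0_intZr leb1); last 3 first.
  - by apply/measurable_EFinP.
  - by move=> V; rewrite lee_fin.
  - by rewrite lee_fin divr_ge0// ltW// kappa_gt0.
  rewrite muleCA -EFinM (_ : _ * _ = 1); last first.
    by have := @kappa_gt0 R n => k0; field; rewrite gt_eqF.
  by rewrite mule1; exact: newtonian_mass rN.
rewrite lee_pmul2l//; apply: ge0_le_integral => //.
- by move=> V _; exact: integral_ge0.
- apply: (@measurable_tonelli R n.+1 n (fun V w => (r V * PK (pl w + V))%:E)) => //.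
  under eq_fun do rewrite EFinM.
  apply: emeasurable_funM; first by apply/measurable_EFinP; exact: (measurableT_comp mr).
  by apply: measurable_PK_comp; apply: measurable_fun_addrV => //; exact: measurable_fun_pl.
- by apply: emeasurable_funM => //; apply/measurable_EFinP.
move=> V _; under eq_integral do rewrite EFinM.
rewrite (ge0_intZl leb); last 3 first.
- by apply: measurable_PK_comp; apply: measurable_fun_addrV => //; exact: measurable_fun_pl.
- by move=> x; rewrite lee_fin PK_ge0.
- by rewrite lee_fin.
rewrite lee_wpmul2l ?lee_fin//; apply: le_trans (int_PK n2 (hd V)).
rewrite -(@ge0_integral_addr R n (tl V) (fun x => (PK (rV_cons (hd V, x)))%:E)).
- apply: ge0_le_integral => //=.
  + by move=> x _; rewrite lee_fin PK_ge0.
  + by apply: measurable_PK_comp; apply: measurable_fun_addrV => //; exact: measurable_fun_pl.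
  + by apply: measurable_PK_comp; apply: measurable_fun_cons => //; exact: measurable_fun_addrV.
  + by move=> x _; rewrite -{1}(rV_cons_eta V) /pl rV_consD add0r.
- exact: measurable_PK_slice.
- by move=> x; rewrite lee_fin PK_ge0.
Qed.

End one.

Lemma starK V : star (star V) = V.
Proof. by rewrite /star hd_cons tl_cons opprK rV_cons_eta. Qed.

Lemma starD V U : star (V + U) = star V + star U.
Proof.
rewrite /star rV_consD hd_add opprD; congr (rV_cons (_, _)).
by apply/rowP => i; rewrite [RHS]mxE !tlE mxE.
Qed.

Lemma star_pl w : star (pl w) = pl w :> 'rV[R]_n.+1.
Proof. by rewrite /star hd_cons tl_cons oppr0. Qed.

Lemma Ek_star Z : Ek ord0 (star Z) = - Ek ord0 Z.
Proof. by rewrite /Ek sqn_star rV_cons_ord0/= mulNr. Qed.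

Lemma PK_star Z : PK (star Z) = PK Z.
Proof. by rewrite /PK Ek_star normrN. Qed.

Lemma Ek_hd_ge0 Z : 0 <= hd Z -> Ek ord0 Z = PK Z.
Proof. by move=> h; rewrite PKE ger0_norm. Qed.

Lemma PK_pl_plus w V : PK (pl w + plus V) = PK (pl w + V).
Proof.
by have [[_ ->//]|[_ ->]] := plusP V; rewrite -PK_star starD star_pl starK.
Qed.

Lemma hd_plus_ge0 V : 0 <= hd (plus V).
Proof. by rewrite hd_cons. Qed.

(* Odd under exchanging [V] and [U], so that it cancels once the bounds obtained by integrating
   first in [U] and first in [V] are added up. *)
Definition mix w V U : R := Ek ord0 (pl w + plus V + star (plus U)).

Lemma mix_swap w V U : mix w U V = - mix w V U.
Proof.
rewrite /mix -Ek_star !starD starK star_pl; congr (Ek _ _).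
by rewrite addrAC.
Qed.

Definition posr (t : R) : R := Num.max t 0.

Definition dbl ra rb (F : 'rV[R]_n.+1 -> 'rV[R]_n.+1 -> R) : \bar R :=
  (\int[leb1]_V ((ra V)%:E * \int[leb1]_U (rb U * F V U)%:E))%E.

Section two.
Variables (ra rb : 'rV[R]_n.+1 -> R) (ma mb : R -> R).
Hypotheses (raN : newtonian ra ma) (rbN : newtonian rb mb).

(** An equality, by the semigroup property at the heights [|hd V|] and [|hd U|], unless one of the
    points lies on the hyperplane; then the left side is 0. *)
Lemma poisson_plus_le w V U :
  (\int[leb]_z (PK (pl (w - z) + V) * PK (pl z + U))%:E <=
   (kappa n / 2 * PK (pl w + plus V + plus U))%:E)%E.
Proof.
have PKp z Z : PK (pl z + Z) = PK (rV_cons (`|hd Z|, z + tl Z)).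
  by rewrite PK_norm_hd -{1}(rV_cons_eta Z) /pl rV_consD add0r.
have [V0|V0] := eqVneq (hd V) 0.
  under eq_integral do rewrite PKp PK_cons normr_id V0 normr0 !mul0r.
  by rewrite integral0 lee_fin mulr_ge0 ?PK_ge0// divr_ge0// ltW// kappa_gt0.
have [U0|U0] := eqVneq (hd U) 0.
  under eq_integral do rewrite [PK (pl _ + U)]PKp PK_cons normr_id U0 normr0 mul0r mulr0.
  by rewrite integral0 lee_fin mulr_ge0 ?PK_ge0// divr_ge0// ltW// kappa_gt0.
have -> : PK (pl w + plus V + plus U) = PK (rV_cons (`|hd V| + `|hd U|, w + tl V + tl U)).
  by rewrite /pl /plus !rV_consD add0r.
rewrite -(poisson_semigroup n2) ?normr_gt0//.
rewrite -(@ge0_integral_addr R n (tl U) (fun z => (PK (rV_cons (`|hd V|, w + tl V + tl U - z)) * PK (rV_cons (`|hd U|, z)))%:E)).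
- rewrite le_eqVlt; apply/orP; left; apply/eqP; apply: eq_integral => z _.
  rewrite !PKp; congr (PK (rV_cons (_, _)) * _)%:E.
  by rewrite opprD addrACA subrr addr0 addrAC.
- under eq_fun do rewrite EFinM; apply: emeasurable_funM; apply: measurable_PK_comp; apply: measurable_fun_cons => //.
  exact: measurable_fun_subrV.
- by move=> z; rewrite lee_fin mulr_ge0 ?PK_ge0.
Qed.

Let ra0 := newtonian_ge0 raN.
Let rb0 := newtonian_ge0 rbN.
Let mra := measurable_newtonian raN.
Let mrb := measurable_newtonian rbN.

Lemma measurable_mix w : measurable_fun setT (fun p : 'rV[R]_n.+1 * 'rV[R]_n.+1 => mix w p.1 p.2).
Proof.
apply: (measurableT_comp (@measurable_Ek R n ord0)); apply: measurable_fun_addrV.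
  apply: measurable_fun_addrV => //.
  exact: (measurableT_comp (@measurable_plus R n)).
by apply: (measurableT_comp (@measurable_star R n)); exact: (measurableT_comp (@measurable_plus R n)).
Qed.

Lemma measurable_PKpp w : measurable_fun setT
  (fun p : 'rV[R]_n.+1 * 'rV[R]_n.+1 => PK (pl w + plus p.1 + plus p.2)).
Proof.
apply: (measurableT_comp (@measurable_PK R n)); apply: measurable_fun_addrV.
  by apply: measurable_fun_addrV => //; exact: (measurableT_comp (@measurable_plus R n)).
exact: (measurableT_comp (@measurable_plus R n)).
Qed.

Lemma posr_ge0 t : 0 <= posr t. Proof. by rewrite le_max lexx orbT. Qed.

Lemma posr_le t : posr t <= `|t|.
Proof. by rewrite ge_max ler_norm normr_ge0. Qed.

Let posB t : posr t - posr (- t) = t.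
Proof.
rewrite /posr; have [h|h] := leP 0 t.
  by rewrite (max_idPr _) ?subr0// oppr_le0.
by rewrite (max_idPl _) ?sub0r ?opprK// oppr_ge0 ltW.
Qed.

(** [U] and [star U] are [plus U] and [star (plus U)] in some order, so the values of [Ek ord0] at
    [X + U] and [X + star U] are one [PK] and one [mix]. *)
Let pairE w V U : (PK (pl w + plus V + plus U) = Ek ord0 (pl w + plus V + U) /\
    mix w V U = Ek ord0 (pl w + plus V + star U)) \/
  (PK (pl w + plus V + plus U) = Ek ord0 (pl w + plus V + star U) /\
    mix w V U = Ek ord0 (pl w + plus V + U)).
Proof.
have h : 0 <= hd (pl w + plus V + plus U).
  by rewrite !hd_add hd_cons add0r addr_ge0// hd_plus_ge0.
move: h; rewrite /mix; have [[_ ->]|[_ ->]] := plusP U => h; [left|right].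
  by rewrite Ek_hd_ge0.
by rewrite Ek_hd_ge0 ?starK.
Qed.

(** The field of [rb] at [X] and that of its mirror image coincide, and their sum is at most
    [2 * PK X]. By [pairE] the sum is also the integral of [PK] plus that of [mix]; the negative
    part of [mix] is moved to the right. *)
Let newton_pair w V :
  (\int[leb1]_U (rb U * PK (pl w + plus V + plus U))%:E + \int[leb1]_U (rb U * posr (mix w V U))%:E <=
   (2 * PK (pl w + V))%:E + \int[leb1]_U (rb U * posr (- mix w V U))%:E)%E.
Proof.
pose X := pl w + plus V; have i1 := newtonian_Ek_intg n2 rbN X ord0.
have [i2 e2] := newtonian_add_star n2 rbN X ord0.
have e1 := newtonian_add n2 rbN X ord0.
have iS := intgD (intg_norm i1) (intg_norm i2).
have mP : measurable_fun setT (fun U => PK (X + plus U)).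
  exact: (measurableT_comp (measurable_PKpp w) (measurable_pair1 V)).
have mM : measurable_fun setT (mix w V).
  exact: (measurableT_comp (measurable_mix w) (measurable_pair1 V)).
have dom (F : 'rV[R]_n.+1 -> R) : measurable_fun setT F ->
   (forall U, 0 <= F U <= `|Ek ord0 (X + U)| + `|Ek ord0 (X + star U)|) ->
   intg leb1 (fun U => rb U * F U).
  move=> mF hF; apply: le_intg iS; first exact: measurable_funM.
  move=> U; have /andP[a b] := hF U; rewrite ger0_norm ?mulr_ge0//.
  have E Z : `|rb U * Ek ord0 Z| = rb U * `|Ek ord0 Z| by rewrite normrM ger0_norm.
  by rewrite !E -mulrDr ler_wpM2l.
have j1 : intg leb1 (fun U => rb U * PK (X + plus U)).
  apply: dom => // U; rewrite PK_ge0/=.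
  have := ler_norm (PK (X + plus U)).
  by have [[-> _]|[-> _]] := pairE w V U => /le_trans; apply; rewrite ?lerDl ?lerDr.
have j2 : intg leb1 (fun U => rb U * posr (mix w V U)).
  apply: dom; first exact: measurable_maxr.
  move=> U; rewrite posr_ge0/= (le_trans (posr_le _))//.
  by have [[_ ->]|[_ ->]] := pairE w V U; rewrite ?lerDl ?lerDr.
have j3 : intg leb1 (fun U => rb U * posr (- mix w V U)).
  apply: dom; first by apply: measurable_maxr => //; exact: measurable_funN.
  move=> U; rewrite posr_ge0/= (le_trans (posr_le _))// normrN.
  by have [[_ ->]|[_ ->]] := pairE w V U; rewrite ?lerDl ?lerDr.
rewrite -!Rint_intg// -!EFinD lee_fin -lerBlDr.
rewrite -(RintegralD measurableT j1 j2) -(RintegralB measurableT (intgD j1 j2) j3).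
have -> : \int[leb1]_U (rb U * PK (pl w + plus V + plus U) + rb U * posr (mix w V U) - rb U * posr (- mix w V U)) =
    \int[leb1]_U (rb U * Ek ord0 (X + U) + rb U * Ek ord0 (X + star U)).
  apply: eq_Rintegral => U _; rewrite -addrA -mulrBr posB.
  by have [[-> ->]|[-> ->]] := pairE w V U => //; rewrite addrC.
rewrite (RintegralD measurableT i1 i2) e1 e2.
rewrite -[leLHS]mulr2n -[leLHS]mulr_natl ler_wpM2l//.
have /andP[a b] := newtonian_m rbN (sqn_ge0 X).
rewrite Ek_hd_ge0; last by rewrite hd_add hd_cons add0r hd_plus_ge0.
by rewrite PK_pl_plus ler_piMl ?PK_ge0.
Qed.

Let mdbl (F : 'rV[R]_n.+1 -> 'rV[R]_n.+1 -> R) :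
  measurable_fun setT (fun p : 'rV[R]_n.+1 * 'rV[R]_n.+1 => F p.1 p.2) ->
  (forall V U, 0 <= F V U) ->
  measurable_fun setT (fun V => \int[leb1]_U (rb U * F V U)%:E)%E.
Proof.
move=> mF F0; apply: (@measurable_tonelli R n.+1 n.+1 (fun V U => (rb U * F V U)%:E)).
  apply/measurable_EFinP; apply: measurable_funM => //; exact: (measurableT_comp mrb).
by move=> V U; rewrite lee_fin mulr_ge0.
Qed.

Lemma dblP w : (dbl ra rb (fun V U => PK (pl w + plus V + plus U)) + dbl ra rb (fun V U => posr (mix w V U)) <=
  2%:E * \int[leb1]_V (ra V * PK (pl w + V))%:E + dbl ra rb (fun V U => posr (- mix w V U)))%E.
Proof.
have mp : measurable_fun setT (fun p : 'rV[R]_n.+1 * 'rV[R]_n.+1 => posr (mix w p.1 p.2)).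
  by apply: measurable_maxr => //; exact: measurable_mix.
have mq : measurable_fun setT (fun p : 'rV[R]_n.+1 * 'rV[R]_n.+1 => posr (- mix w p.1 p.2)).
  by apply: measurable_maxr => //; apply: measurable_funN; exact: measurable_mix.
have m1 := @mdbl (fun V U => PK (pl w + plus V + plus U)) (measurable_PKpp w) (fun V U => PK_ge0 _).
have m2 := @mdbl (fun V U => posr (mix w V U)) mp (fun V U => posr_ge0 _).
have m3 := @mdbl (fun V U => posr (- mix w V U)) mq (fun V U => posr_ge0 _).
have mra' : measurable_fun setT (fun V => (ra V)%:E) by apply/measurable_EFinP.
have mg : measurable_fun setT (fun V => (ra V * PK (pl w + V))%:E).
  by apply/measurable_EFinP; exact: intg_measurable (newtonian_intg_PK raN _).
have I0 (F : 'rV[R]_n.+1 -> 'rV[R]_n.+1 -> R) V : (forall V U, 0 <= F V U) ->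
    (0 <= \int[leb1]_U (rb U * F V U)%:E)%E.
  by move=> F0; apply: integral_ge0 => U _; rewrite lee_fin mulr_ge0.
have J0 (F : 'rV[R]_n.+1 -> 'rV[R]_n.+1 -> R) V : (forall V U, 0 <= F V U) ->
    (0 <= (ra V)%:E * \int[leb1]_U (rb U * F V U)%:E)%E.
  by move=> F0; rewrite mule_ge0 ?lee_fin ?I0.
have g0 V : (0 <= (ra V * PK (pl w + V))%:E)%E by rewrite lee_fin mulr_ge0 ?PK_ge0.
rewrite /dbl -ge0_integralD//; last 4 first.
- by move=> V _; apply: (J0 (fun V U => PK (pl w + plus V + plus U))) => *; rewrite PK_ge0.
- exact: emeasurable_funM.
- by move=> V _; apply: (J0 (fun V U => posr (mix w V U))) => *; exact: posr_ge0.
- exact: emeasurable_funM.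
have k0 : (0 <= 2%:E :> \bar R)%E by rewrite lee_fin.
rewrite -(ge0_intZl leb1 mg g0 k0) -ge0_integralD//; last 4 first.
- by move=> V _; rewrite mule_ge0.
- exact: emeasurable_funM.
- by move=> V _; apply: (J0 (fun V U => posr (- mix w V U))) => *; exact: posr_ge0.
- exact: emeasurable_funM.
apply: ge0_le_integral => //.
- move=> V _; rewrite adde_ge0//; last by apply: (J0 (fun V U => posr (mix w V U))) => *; exact: posr_ge0.
  by apply: (J0 (fun V U => PK (pl w + plus V + plus U))) => *; rewrite PK_ge0.
- by apply: emeasurable_funD; exact: emeasurable_funM.
- by apply: emeasurable_funD; exact: emeasurable_funM.
move=> V _; have h1 := I0 (fun V U => PK (pl w + plus V + plus U)) V (fun V U => PK_ge0 _).
have h2 := I0 (fun V U => posr (mix w V U)) V (fun V U => posr_ge0 _).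
have h3 := I0 (fun V U => posr (- mix w V U)) V (fun V U => posr_ge0 _).
rewrite EFinM muleCA -EFinM.
have h4 : (0 <= (2 * PK (pl w + V))%:E)%E by rewrite lee_fin mulr_ge0 ?PK_ge0.
rewrite -(@ge0_muleDr _ (ra V)%:E _ _ h1 h2) -(@ge0_muleDr _ (ra V)%:E _ _ h4 h3).
by rewrite lee_wpmul2l ?lee_fin.
Qed.

(** Finiteness of the [mix] terms is what allows them to be cancelled later. The inner integral is
    bounded uniformly in [V] by potentials of [rb], and [ra] has finite mass. *)
Lemma dbl_lty w : (dbl ra rb (fun V U => `|mix w V U|%R) < +oo)%E.
Proof.
have [C hC] := newtonian_riesz_E n2 rbN.
have C0 : 0 <= C.
  rewrite -lee_fin; apply: le_trans (hC 0); apply: integral_ge0 => V _.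
  by rewrite lee_fin mulr_ge0 ?PK_ge0.
have mPX X : measurable_fun setT (fun U => (rb U * PK (X + U))%:E).
  by apply/measurable_EFinP; exact: intg_measurable (newtonian_intg_PK rbN _).
have PX0 X U : (0 <= (rb U * PK (X + U))%:E)%E by rewrite lee_fin mulr_ge0 ?PK_ge0.
have mPs X : measurable_fun setT (fun U => (rb U * PK (X + star U))%:E).
  apply/measurable_EFinP; apply: measurable_funM => //.
  apply: (measurableT_comp (@measurable_PK R n)); apply: measurable_fun_addrV => //.
  exact: measurable_star.
have hCs X : (\int[leb1]_U (rb U * PK (X + star U))%:E <= C%:E)%E.
  apply: le_trans (hC X); rewrite -(ge0_integral_star (mPX X))//.
  under eq_integral do rewrite -(newtonian_star rbN).
  exact: lexx.
have mM : measurable_fun setT (fun p : 'rV[R]_n.+1 * 'rV[R]_n.+1 => `|mix w p.1 p.2|).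
  by apply: measurableT_comp => //; exact: measurable_mix.
have m1 := @mdbl (fun V U => `|mix w V U|) mM (fun V U => normr_ge0 _).
apply: (@le_lt_trans _ _ (\int[leb1]_V ((ra V)%:E * (C + C)%:E))%E); last first.
  rewrite (ge0_intZr leb1); last 3 first.
  - by apply/measurable_EFinP.
  - by move=> V; rewrite lee_fin.
  - by rewrite lee_fin addr_ge0.
  rewrite -Rint_intg; last exact: newtonian_intg raN.
  by rewrite -EFinM ltry.
apply: ge0_le_integral => //.
- move=> V _; rewrite mule_ge0 ?lee_fin//; apply: integral_ge0 => U _.
  by rewrite lee_fin mulr_ge0.
- by apply: emeasurable_funM => //; apply/measurable_EFinP.
- by apply: emeasurable_funM => //; apply/measurable_EFinP.
move=> V _; rewrite lee_wpmul2l ?lee_fin// EFinD.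
apply: le_trans (leeD (hC (pl w + plus V)) (hCs (pl w + plus V))).
rewrite -ge0_integralD//; last by move=> U _; rewrite lee_fin mulr_ge0 ?PK_ge0.
apply: ge0_le_integral => //.
- by move=> U _; rewrite lee_fin mulr_ge0.
- apply/measurable_EFinP; apply: measurable_funM => //.
  exact: (measurableT_comp mM (measurable_pair1 V)).
- exact: emeasurable_funD.
move=> U _; rewrite -EFinD lee_fin -mulrDr ler_wpM2l//.
by have [[_ ->]|[_ ->]] := pairE w V U; rewrite /PK ?lerDl ?lerDr.
Qed.

Lemma dblE (F : 'rV[R]_n.+1 -> 'rV[R]_n.+1 -> R) :
  measurable_fun setT (fun p : 'rV[R]_n.+1 * 'rV[R]_n.+1 => F p.1 p.2) ->
  (forall V U, 0 <= F V U) ->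
  dbl ra rb F = (\int[leb1]_V \int[leb1]_U (ra V * (rb U * F V U))%:E)%E.
Proof.
move=> mF F0; apply: eq_integral => V _; under [RHS]eq_integral do rewrite EFinM.
rewrite (ge0_intZl leb1)//.
- apply/measurable_EFinP; apply: measurable_funM => //.
  exact: (measurableT_comp mF (measurable_pair1 V)).
- by move=> U; rewrite lee_fin mulr_ge0.
- by rewrite lee_fin.
Qed.

Lemma dbl_le (F G : 'rV[R]_n.+1 -> 'rV[R]_n.+1 -> R) :
  measurable_fun setT (fun p : 'rV[R]_n.+1 * 'rV[R]_n.+1 => F p.1 p.2) ->
  measurable_fun setT (fun p : 'rV[R]_n.+1 * 'rV[R]_n.+1 => G p.1 p.2) ->
  (forall V U, 0 <= F V U <= G V U) -> (dbl ra rb F <= dbl ra rb G)%E.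
Proof.
move=> mF mG FG; have F0 V U : 0 <= F V U by have /andP[] := FG V U.
have G0 V U : 0 <= G V U by have /andP[] := FG V U; exact: le_trans.
apply: ge0_le_integral => //.
- move=> V _; rewrite mule_ge0 ?lee_fin//; apply: integral_ge0 => U _.
  by rewrite lee_fin mulr_ge0.
- by apply: emeasurable_funM; [apply/measurable_EFinP|exact: mdbl].
- by apply: emeasurable_funM; [apply/measurable_EFinP|exact: mdbl].
move=> V _; rewrite lee_wpmul2l ?lee_fin//; apply: ge0_le_integral => //.
- by move=> U _; rewrite lee_fin mulr_ge0.
- apply/measurable_EFinP; apply: measurable_funM => //.
  exact: (measurableT_comp mF (measurable_pair1 V)).
- apply/measurable_EFinP; apply: measurable_funM => //.
  exact: (measurableT_comp mG (measurable_pair1 V)).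
by move=> U _; rewrite lee_fin ler_wpM2l//; have /andP[] := FG V U.
Qed.

End two.

Section convolution.
Variables (ra rb : 'rV[R]_n.+1 -> R) (ma mb : R -> R).
Hypotheses (raN : newtonian ra ma) (rbN : newtonian rb mb).
Let ra0 := newtonian_ge0 raN.
Let rb0 := newtonian_ge0 rbN.
Let mra := measurable_newtonian raN.
Let mrb := measurable_newtonian rbN.

Lemma dbl_swap (F : 'rV[R]_n.+1 -> 'rV[R]_n.+1 -> R) :
  measurable_fun setT (fun p : 'rV[R]_n.+1 * 'rV[R]_n.+1 => F p.1 p.2) ->
  (forall V U, 0 <= F V U) -> dbl rb ra (fun U V => F V U) = dbl ra rb F.
Proof.
move=> mF F0.
have mF' : measurable_fun setT (fun p : 'rV[R]_n.+1 * 'rV[R]_n.+1 => F p.2 p.1).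
  exact: measurable_flip mF.
rewrite (dblE raN rbN mF F0) (dblE rbN raN mF' (fun U V => F0 V U)).
rewrite (@tonelli_rV R n.+1 n.+1 (fun V U => (ra V * (rb U * F V U))%:E)).
- by apply: eq_integral => U _; apply: eq_integral => V _; rewrite mulrCA.
- apply/measurable_EFinP; apply: measurable_funM; first exact: (measurableT_comp mra).
  by apply: measurable_funM => //; exact: (measurableT_comp mrb).
- by move=> V U; rewrite lee_fin !mulr_ge0.
Qed.

(** Let I be the left side, a and b the two integrals on the right, p and q the integrals of the
    positive and negative parts of [mix]. Then [dblP] reads I + p <= 2 a + q. Exchanging the two
    densities exchanges p and q by [mix_swap], so I + q <= 2 b + p; the sum of the two is the
    claim. *)
Lemma dbl_plus_le w : (dbl ra rb (fun V U => PK (pl w + plus V + plus U)) <=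
  \int[leb1]_V (ra V * PK (pl w + V))%:E + \int[leb1]_V (rb V * PK (pl w + V))%:E)%E.
Proof.
have mm := measurable_mix w.
have mp : measurable_fun setT (fun p : 'rV[R]_n.+1 * 'rV[R]_n.+1 => posr (mix w p.1 p.2)).
  by apply: measurable_maxr.
have mq : measurable_fun setT (fun p : 'rV[R]_n.+1 * 'rV[R]_n.+1 => posr (- mix w p.1 p.2)).
  by apply: measurable_maxr => //; apply: measurable_funN.
have mn : measurable_fun setT (fun p : 'rV[R]_n.+1 * 'rV[R]_n.+1 => `|mix w p.1 p.2|).
  exact: measurableT_comp.
have h1 := dblP raN rbN w; have h2 := dblP rbN raN w; move: h2.
have -> : (fun V U => posr (mix w V U)) = (fun V U => posr (- mix w U V)).
  by apply/funext => V; apply/funext => U; rewrite -mix_swap.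
have -> : (fun V U => posr (- mix w V U)) = (fun V U => posr (mix w U V)).
  by apply/funext => V; apply/funext => U; rewrite -mix_swap.
rewrite (@dbl_swap (fun V U => posr (mix w V U)) mp (fun V U => posr_ge0 _)).
rewrite (@dbl_swap (fun V U => posr (- mix w V U)) mq (fun V U => posr_ge0 _)).
have -> : dbl rb ra (fun V U => PK (pl w + plus V + plus U)) = dbl ra rb (fun V U => PK (pl w + plus V + plus U)).
  rewrite -(@dbl_swap (fun V U => PK (pl w + plus V + plus U)) (measurable_PKpp w) (fun V U => PK_ge0 _)).
  by congr (dbl _ _ _); apply/funext => V; apply/funext => U; rewrite addrAC.
move: h1.
have hl : (dbl ra rb (fun V U => posr (mix w V U)) < +oo)%E.
  apply: le_lt_trans (dbl_lty raN rbN w); apply: (dbl_le raN rbN) => // V U.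
  by rewrite posr_ge0 posr_le.
have hr : (dbl ra rb (fun V U => posr (- mix w V U)) < +oo)%E.
  apply: le_lt_trans (dbl_lty raN rbN w); apply: (dbl_le raN rbN) => // V U.
  by rewrite posr_ge0 -[X in _ <= X]normrN posr_le.
have pos_dbl (F : 'rV[R]_n.+1 -> 'rV[R]_n.+1 -> R) : (forall V U, 0 <= F V U) -> (0 <= dbl ra rb F)%E.
  move=> F0; apply: integral_ge0 => V _; rewrite mule_ge0 ?lee_fin//.
  by apply: integral_ge0 => U _; rewrite lee_fin mulr_ge0.
have := pos_dbl (fun V U => posr (mix w V U)) (fun V U => posr_ge0 _).
have := pos_dbl (fun V U => posr (- mix w V U)) (fun V U => posr_ge0 _).
have := pos_dbl (fun V U => PK (pl w + plus V + plus U)) (fun V U => PK_ge0 _).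
move: hl hr; set p := dbl ra rb (fun V U => posr (mix w V U)).
set q := dbl ra rb (fun V U => posr (- mix w V U)).
set I := dbl ra rb _.
rewrite -(Rint_intg (newtonian_intg_PK raN _)) -(Rint_intg (newtonian_intg_PK rbN _)).
move: p q I => [p| |] [q| |] [I| |] //=; rewrite -!EFinM -!EFinD !lee_fin => _ _ _ _ _ h1 h2.
lra.
Qed.

Lemma kern_conv w :
  (\int[leb]_z (kern ra (w - z) * kern rb z)%:E <= (kern ra w + kern rb w)%:E)%E.
Proof.
pose h z V := ra V * PK (pl (w - z) + V).
pose g z := (\int[leb1]_U (rb U * PK (pl z + U))%:E)%E.
have c00 : (0 <= (2 / kappa n)%:E :> \bar R)%E by rewrite lee_fin ltW.
have h0 z V : 0 <= h z V by rewrite mulr_ge0 ?PK_ge0.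
have g0 z : (0 <= g z)%E by apply: integral_ge0 => U _; rewrite lee_fin mulr_ge0 ?PK_ge0.
have mPz dS (S : measurableType dS) (f : S -> 'rV[R]_n) (v : S -> 'rV[R]_n.+1) :
    measurable_fun setT f -> measurable_fun setT v -> measurable_fun setT (fun s => PK (pl (f s) + v s)).
  move=> mf mv; apply: (measurableT_comp (@measurable_PK R n)).
  by apply: measurable_fun_addrV => //; exact: measurable_fun_pl.
have mg : measurable_fun setT g.
  apply: (@measurable_tonelli R n n.+1 (fun z U => (rb U * PK (pl z + U))%:E)).
    apply/measurable_EFinP; apply: measurable_funM; first exact: (measurableT_comp mrb).
    exact: mPz.
  by move=> z U; rewrite lee_fin mulr_ge0 ?PK_ge0.
have mh : measurable_fun setT (fun zV : 'rV[R]_n * 'rV[R]_n.+1 => h zV.1 zV.2).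
  apply: measurable_funM; first exact: (measurableT_comp mra).
  by apply: mPz => //; exact: measurable_fun_subrV.
have E z : (kern ra (w - z) * kern rb z)%:E =
   ((2 / kappa n)%:E * ((2 / kappa n)%:E * \int[leb1]_V ((h z V)%:E * g z)))%E.
  have mhz : measurable_fun setT (fun V => (h z V)%:E).
    by apply/measurable_EFinP; exact: (measurableT_comp mh (measurable_pair1 z)).
  have hz0 V : (0 <= (h z V)%:E)%E by rewrite lee_fin.
  have e := ge0_intZr leb1 mhz hz0 (g0 z).
  rewrite EFinM; apply: (etrans (f_equal2 (fun a b => a * b)%E (kernE raN (w - z)) (kernE rbN z))).
  by rewrite -/(g z) -muleA [X in (_ * X)%E]muleCA -e.
have mhg : measurable_fun setT (fun zV : 'rV[R]_n * 'rV[R]_n.+1 => ((h zV.1 zV.2)%:E * g zV.1)%E).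
  by apply: emeasurable_funM; [apply/measurable_EFinP|exact: (measurableT_comp mg)].
have hg0 z V : (0 <= (h z V)%:E * g z)%E by rewrite mule_ge0 ?lee_fin.
have mI : measurable_fun setT (fun z => \int[leb1]_V ((h z V)%:E * g z))%E.
  exact: (@measurable_tonelli R n n.+1 (fun z V => ((h z V)%:E * g z)%E)).
have I0 z : (0 <= \int[leb1]_V ((h z V)%:E * g z))%E by exact: integral_ge0.
under eq_integral do rewrite E.
rewrite (ge0_intZl leb)//; last 2 first.
- exact: emeasurable_funM.
- by move=> z; rewrite mule_ge0.
rewrite (ge0_intZl leb)// (@tonelli_rV R n n.+1 (fun z V => ((h z V)%:E * g z)%E))//.
have mPP : measurable_fun setT (fun p : 'rV[R]_n.+1 * 'rV[R]_n.+1 =>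
    kappa n / 2 * PK (pl w + plus p.1 + plus p.2)).
  by apply: measurable_funM => //; exact: measurable_PKpp.
have PP0 V U : 0 <= kappa n / 2 * PK (pl w + plus V + plus U).
  by rewrite mulr_ge0 ?PK_ge0// divr_ge0// ltW// kappa_gt0.
(* Tonelli's theorem brings the integral over [z] inside, where [poisson_plus_le] applies to each
   pair of points [V], [U]. *)
have key : (\int[leb1]_V \int[leb]_z ((h z V)%:E * g z) <=
   dbl ra rb (fun V U => kappa n / 2 * PK (pl w + plus V + plus U))%R)%E.
  rewrite (dblE raN rbN)//; apply: ge0_le_integral => //.
  - by move=> V _; exact: integral_ge0.
  - apply: (@measurable_tonelli R n.+1 n (fun V z => ((h z V)%:E * g z)%E)) => //.
    exact: (measurable_flip (F := fun z V => ((h z V)%:E * g z)%E)).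
  - apply: (@measurable_tonelli R n.+1 n.+1 (fun V U => (ra V * (rb U * (kappa n / 2 * PK (pl w + plus V + plus U))))%:E)).
      apply/measurable_EFinP; apply: measurable_funM; first exact: (measurableT_comp mra).
      by apply: measurable_funM => //; exact: (measurableT_comp mrb).
    by move=> V U; rewrite lee_fin mulr_ge0// mulr_ge0.
  move=> V _.
  pose F z U := (ra V * (rb U * (PK (pl (w - z) + V) * PK (pl z + U))))%:E.
  have mF : measurable_fun setT (fun zU : 'rV[R]_n * 'rV[R]_n.+1 => F zU.1 zU.2).
    apply/measurable_EFinP; apply: measurable_funM => //; apply: measurable_funM.
      exact: (measurableT_comp mrb).
    by apply: measurable_funM; apply: mPz => //; exact: measurable_fun_subrV.
  have F0 z U : (0 <= F z U)%E by rewrite lee_fin mulr_ge0// mulr_ge0// mulr_ge0 ?PK_ge0.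
  have -> : (\int[leb]_z ((h z V)%:E * g z) = \int[leb]_z \int[leb1]_U F z U)%E.
    apply: eq_integral => z _; rewrite /g -(ge0_intZl leb1)//.
    - apply: eq_integral => U _; rewrite -EFinM; congr (_%:E); rewrite /h; ring.
    - apply/measurable_EFinP; apply: measurable_funM => //; exact: mPz.
    - by move=> U; rewrite lee_fin mulr_ge0 ?PK_ge0.
    - by rewrite lee_fin.
  rewrite (@tonelli_rV R n n.+1 F)//; apply: ge0_le_integral => //.
  - by move=> U _; exact: integral_ge0.
  - apply: (@measurable_tonelli R n.+1 n (fun U z => F z U)) => //.
    exact: measurable_flip mF.
  - apply/measurable_EFinP; apply: measurable_funM => //; apply: measurable_funM => //.
    exact: (measurableT_comp mPP (measurable_pair1 V)).
  move=> U _.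
  have -> : (\int[leb]_z F z U = (ra V * rb U)%:E * \int[leb]_z (PK (pl (w - z) + V) * PK (pl z + U))%:E)%E.
    rewrite -(ge0_intZl leb).
    - by apply: eq_integral => z _; rewrite /F -EFinM; congr (_%:E); ring.
    - apply/measurable_EFinP; apply: measurable_funM; apply: mPz => //; exact: measurable_fun_subrV.
    - by move=> z; rewrite lee_fin mulr_ge0 ?PK_ge0.
    - by rewrite lee_fin mulr_ge0.
  have -> : (ra V * (rb U * (kappa n / 2 * PK (pl w + plus V + plus U))))%:E =
      ((ra V * rb U)%:E * (kappa n / 2 * PK (pl w + plus V + plus U))%:E)%E.
    by rewrite -EFinM; congr (_%:E); ring.
  by apply: lee_wpmul2l; [rewrite lee_fin mulr_ge0|exact: poisson_plus_le].
have e2 : (dbl ra rb (fun V U => kappa n / 2 * PK (pl w + plus V + plus U))%R =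
    (kappa n / 2)%:E * dbl ra rb (fun V U => PK (pl w + plus V + plus U)))%E.
  rewrite (dblE raN rbN (F := fun V U => kappa n / 2 * PK (pl w + plus V + plus U)) mPP PP0).
  rewrite (dblE raN rbN (F := fun V U => PK (pl w + plus V + plus U)) (measurable_PKpp w) (fun V U => PK_ge0 _)).
  have mQ : measurable_fun setT (fun p : 'rV[R]_n.+1 * 'rV[R]_n.+1 => (ra p.1 * (rb p.2 * PK (pl w + plus p.1 + plus p.2)))%:E).
    apply/measurable_EFinP; apply: measurable_funM; first exact: (measurableT_comp mra).
    apply: measurable_funM; first exact: (measurableT_comp mrb).
    exact: measurable_PKpp.
  have Q0 V U : (0 <= (ra V * (rb U * PK (pl w + plus V + plus U)))%:E)%E.
    by rewrite lee_fin mulr_ge0// mulr_ge0 ?PK_ge0.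
  have k20 : (0 <= (kappa n / 2)%:E :> \bar R)%E by rewrite lee_fin divr_ge0// ltW// kappa_gt0.
  rewrite -(ge0_intZl leb1)//; last 2 first.
  - exact: (@measurable_tonelli R n.+1 n.+1 (fun V U => (ra V * (rb U * PK (pl w + plus V + plus U)))%:E)).
  - by move=> V; exact: integral_ge0.
  apply: eq_integral => V _; rewrite -(ge0_intZl leb1)//.
  - by apply: eq_integral => U _; rewrite -EFinM; congr (_%:E); ring.
  - exact: (measurableT_comp mQ (measurable_pair1 V)).
rewrite e2 in key.
apply: (le_trans (lee_wpmul2l c00 (lee_wpmul2l c00 key))).
(* Of the two factors [2 / kappa n], one is consumed by the constant of the semigroup identity, the
   other normalises the result. *)
rewrite [X in (_ * X)%E]muleA -EFinM.
have -> : 2 / kappa n * (kappa n / 2) = 1 :> R.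
  by have k0 := @kappa_gt0 R n; field; rewrite gt_eqF.
rewrite mul1e EFinD (kernE raN) (kernE rbN) -ge0_muleDr.
- by rewrite lee_wpmul2l// dbl_plus_le.
- by apply: integral_ge0 => U _; rewrite lee_fin mulr_ge0 ?PK_ge0.
- by apply: integral_ge0 => U _; rewrite lee_fin mulr_ge0 ?PK_ge0.
Qed.

End convolution.
End kern.

(** * Maximal inequality for symmetric Markov kernels *)

Section maximal.
Context d (T : measurableType d) {R : realType} (mu : {sigma_finite_measure set T -> \bar R}).
Implicit Types (f g h : T -> R) (K L : T -> T -> R).

(** On these functions [op] is a convergent integral, never a default value, and they are stable
    under the sums, products, maxima and powers formed below. *)
Definition bdd f : Prop := measurable_fun setT f /\ exists C, forall x, 0 <= f x <= C.

Lemma bdd_measurable f : bdd f -> measurable_fun setT f. Proof. by case. Qed.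

Lemma bdd_ge0 f x : bdd f -> 0 <= f x. Proof. by move=> [_ [C /(_ x)/andP[]]]. Qed.

Lemma bddM f g : bdd f -> bdd g -> bdd (fun x => f x * g x).
Proof.
move=> [mf [C hC]] [mg [D hD]]; split; first exact: measurable_funM.
exists (C * D) => x; have /andP[a b] := hC x; have /andP[a' b'] := hD x.
by rewrite mulr_ge0//= ler_pM.
Qed.

Lemma bddD f g : bdd f -> bdd g -> bdd (fun x => f x + g x).
Proof.
move=> [mf [C hC]] [mg [D hD]]; split; first exact: measurable_funD.
exists (C + D) => x; have /andP[a b] := hC x; have /andP[a' b'] := hD x.
by rewrite addr_ge0//= lerD.
Qed.

Lemma bdd_max f g : bdd f -> bdd g -> bdd (fun x => Num.max (f x) (g x)).
Proof.
move=> [mf [C hC]] [mg [D hD]]; split; first exact: measurable_maxr.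
exists (Num.max C D) => x; have /andP[a b] := hC x; have /andP[a' b'] := hD x.
by rewrite le_max a/= ge_max !le_max b b' orbT.
Qed.

Lemma bdd_cst (c : R) : 0 <= c -> bdd (fun=> c).
Proof. by move=> c0; split => //; exists c => x; rewrite c0 lexx. Qed.

Lemma bdd_sum (F : nat -> T -> R) n : (forall i, bdd (F i)) -> bdd (fun x => \sum_(i < n) F i x).
Proof.
move=> bF; elim: n => [|n IH].
  by under eq_fun do rewrite big_ord0; exact: bdd_cst.
by under eq_fun do rewrite big_ord_recr/=; exact: bddD.
Qed.

Lemma bdd_powR f (q : R) : 0 <= q -> bdd f -> bdd (fun x => f x `^ q).
Proof.
move=> q0 [mf [C hC]]; split.
  by apply: (measurableT_comp (@measurable_powR R q)).
exists (C `^ q) => x; have /andP[a b] := hC x.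
by rewrite powR_ge0/= ge0_ler_powR// nnegrE (le_trans a b).
Qed.

(** Symmetric and sub-Markovian: the mass may be less than 1, as for the kernels of the densities
    above. *)
Definition markov_kernel K : Prop :=
  [/\ measurable_fun setT (fun p : T * T => K p.1 p.2), forall x y, 0 <= K x y,
      forall x y, K x y = K y x & forall x, (\int[mu]_y (K x y)%:E <= 1)%E].

Definition op K f x : R := \int[mu]_y (K x y * f y).

Section one_kernel.
Variable K : T -> T -> R.
Hypothesis HK : markov_kernel K.

Lemma markov_ge0 x y : 0 <= K x y. Proof. by case: HK. Qed.

Lemma measurable_markov_slice x : measurable_fun setT (K x).
Proof. by case: HK => mK _ _ _; exact: (measurableT_comp mK (measurable_pair1 x)). Qed.

Lemma markov_intg x : intg mu (K x).
Proof.
apply: ge0_intg; [exact: measurable_markov_slice|exact: markov_ge0|].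
by case: HK => _ _ _ /(_ x)/le_lt_trans; apply; rewrite ltry.
Qed.

Lemma op_intg f x : bdd f -> intg mu (fun y => K x y * f y).
Proof.
move=> [mf [C hC]]; apply: (le_intg _ _ (intgZ C (markov_intg x))).
  by apply: measurable_funM => //; exact: measurable_markov_slice.
move=> y; have /andP[a b] := hC y.
by rewrite ger0_norm ?mulr_ge0 ?markov_ge0// mulrC ler_wpM2r ?markov_ge0.
Qed.

Lemma opE f x : bdd f -> ((op K f x)%:E = \int[mu]_y (K x y * f y)%:E)%E.
Proof. by move=> bf; rewrite /op Rint_intg//; exact: op_intg. Qed.

Lemma markov_mass x : \int[mu]_y K x y <= 1.
Proof. by rewrite -lee_fin Rint_intg; [case: HK|exact: markov_intg]. Qed.

Lemma op_le f g x : bdd f -> bdd g -> (forall y, f y <= g y) -> op K f x <= op K g x.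
Proof.
move=> bf bg fg; apply: le_Rintegral => //; [exact: op_intg|exact: op_intg|].
by move=> y _; rewrite ler_wpM2l// markov_ge0.
Qed.

Lemma op_ge0 f x : bdd f -> 0 <= op K f x.
Proof. by move=> bf; apply: Rintegral_ge0 => y _; rewrite mulr_ge0 ?markov_ge0// bdd_ge0. Qed.

Lemma op_cst_le (c : R) x : 0 <= c -> op K (fun=> c) x <= c.
Proof.
move=> c0; rewrite /op RintegralZr//; last exact: markov_intg.
by rewrite ler_piMl// markov_mass.
Qed.

Let mKf f : bdd f -> measurable_fun setT (fun p : T * T => (K p.1 p.2 * f p.2)%:E).
Proof.
move=> [mf _]; apply/measurable_EFinP; apply: measurable_funM; first by case: HK.
exact: (measurableT_comp mf).
Qed.

Lemma bdd_op f : bdd f -> bdd (op K f).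
Proof.
move=> bf; split.
  apply/measurable_EFinP.
  rewrite (_ : EFin \o op K f = fun x => \int[mu]_y (K x y * f y)%:E)%E; last first.
    by apply/funext => x /=; rewrite opE.
  apply: (@measurable_fun_fubini_tonelli_F _ _ _ _ _ mu (fun p => (K p.1 p.2 * f p.2)%:E)).
    exact: mKf.
  by move=> p; rewrite lee_fin mulr_ge0 ?markov_ge0// bdd_ge0.
have [mf [C hC]] := bf; exists (Num.max C 0) => x; rewrite op_ge0//=.
have C0 : 0 <= Num.max C 0 by rewrite le_max lexx orbT.
apply: (le_trans _ (op_cst_le x C0)); apply: op_le => //; first exact: bdd_cst.
by move=> y; rewrite le_max; have /andP[_ ->] := hC y.
Qed.

Lemma opD f g x : bdd f -> bdd g -> op K (fun y => f y + g y) x = op K f x + op K g x.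
Proof.
move=> bf bg; rewrite /op -RintegralD//; [|exact: op_intg|exact: op_intg].
by apply: eq_Rintegral => y _; rewrite mulrDr.
Qed.

Lemma op_sum (F : nat -> T -> R) n x : (forall i, bdd (F i)) ->
  op K (fun y => \sum_(i < n) F i y) x = \sum_(i < n) op K (F i) x.
Proof.
move=> bF; elim: n => [|n IH].
  rewrite big_ord0 /op; under eq_Rintegral do rewrite big_ord0 mulr0.
  by rewrite Rintegral_cst// mul0r.
rewrite big_ord_recr/= -IH -opD//; last exact: bdd_sum.
by congr op; apply/funext => y; rewrite big_ord_recr.
Qed.

Lemma op_adjoint f g : bdd f -> bdd g ->
  (\int[mu]_x (op K f x * g x)%:E = \int[mu]_x (f x * op K g x)%:E)%E.
Proof.
move=> bf bg; have [mf _] := bf; have [mg _] := bg.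
pose F x y := (g x * (K x y * f y))%:E.
have mF : measurable_fun setT (fun p : T * T => F p.1 p.2).
  apply/measurable_EFinP; apply: measurable_funM; first exact: (measurableT_comp mg).
  by apply/measurable_EFinP; exact: mKf.
have F0 x y : (0 <= F x y)%E.
  by rewrite lee_fin mulr_ge0 ?(bdd_ge0 _ bg)// mulr_ge0 ?markov_ge0 ?(bdd_ge0 _ bf).
transitivity (\int[mu]_x \int[mu]_y F x y)%E.
  apply: eq_integral => x _; rewrite mulrC EFinM opE// -ge0_intZl//.
  - apply/measurable_EFinP; apply: measurable_funM => //; exact: measurable_markov_slice.
  - by move=> y; rewrite lee_fin mulr_ge0 ?markov_ge0 ?(bdd_ge0 _ bf).
  - by rewrite lee_fin (bdd_ge0 _ bg).
rewrite (@fubini_tonelli _ _ _ _ _ mu mu (fun p => F p.1 p.2) mF (fun p => F0 _ _)).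
apply: eq_integral => y _; rewrite EFinM opE// -ge0_intZl//.
- apply: eq_integral => x _; rewrite /F -EFinM; congr (_%:E).
  by case: HK => _ _ /(_ x y) -> _; ring.
- apply/measurable_EFinP; apply: measurable_funM => //; exact: measurable_markov_slice.
- by move=> x; rewrite lee_fin mulr_ge0 ?markov_ge0 ?(bdd_ge0 _ bg).
- by rewrite lee_fin (bdd_ge0 _ bf).
Qed.

(* Young's inequality [q s^(q-1) t <= t^q + (q-1) s^q], averaged at [s = op K f x] *)
Lemma op_jensen f (q : R) x : 1 <= q -> bdd f -> op K f x `^ q <= op K (fun y => f y `^ q) x.
Proof.
move=> q1 bf; have q0 : 0 < q by exact: lt_le_trans q1.
set s := op K f x; have s0 : 0 <= s by exact: op_ge0.
have [->|q1'] := eqVneq q 1.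
  by rewrite powRr1// le_eqVlt; apply/orP; left; apply/eqP; congr op; apply/funext => y; rewrite powRr1// bdd_ge0.
have q2 : 1 < q by rewrite lt_neqAle eq_sym q1'.
have bq := bdd_powR (ltW q0) bf.
have young t : 0 <= t -> q * s `^ (q - 1) * t <= t `^ q + (q - 1) * s `^ q.
  move=> t0.
  have p0 : 0 < q / (q - 1) by rewrite divr_gt0// subr_gt0.
  have pq : q^-1 + (q / (q - 1))^-1 = 1.
    by rewrite invf_div; field; rewrite gt_eqF.
  have := @conjugate_powR R t (s `^ (q - 1)) q (q / (q - 1)) t0 (powR_ge0 _ _) q0 p0 pq.
  rewrite -powRrM (_ : (q - 1) * (q / (q - 1)) = q); last first.
    by field; rewrite subr_eq0.
  move=> /(ler_wpM2l (ltW q0)) h.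
  rewrite (_ : q * s `^ (q - 1) * t = q * (t * s `^ (q - 1))); last by ring.
  apply: (le_trans h); rewrite le_eqVlt; apply/orP; left; apply/eqP.
  by field; rewrite subr_eq0 q1' gt_eqF.
have : q * s `^ (q - 1) * s <= op K (fun y => f y `^ q + (q - 1) * s `^ q) x.
  have -> : q * s `^ (q - 1) * s = op K (fun y => q * s `^ (q - 1) * f y) x.
    rewrite /s /op -RintegralZl//; last exact: op_intg.
    by apply: eq_Rintegral => y _; ring.
  apply: op_le; first by apply: bddM => //; apply: bdd_cst; rewrite mulr_ge0 ?powR_ge0 ?(ltW q0).
    by apply: bddD => //; apply: bdd_cst; rewrite mulr_ge0 ?powR_ge0 ?subr_ge0.
  by move=> y; apply: young; exact: bdd_ge0.
have c0 : 0 <= (q - 1) * s `^ q by rewrite mulr_ge0 ?powR_ge0 ?subr_ge0.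
rewrite opD//; last exact: bdd_cst.
move=> h; have := le_trans h (lerD (lexx _) (op_cst_le x c0)).
have -> : q * s `^ (q - 1) * s = q * s `^ q.
  have [s00|s00] := eqVneq s 0; first by rewrite s00 mulr0 powR0 ?gt_eqF// mulr0.
  by rewrite -mulrA -[X in _ * (_ * X)]powRr1// -powRD ?subrK// s00 implybT.
by rewrite -lerBlDr (_ : q * s `^ q - (q - 1) * s `^ q = s `^ q); last ring.
Qed.

(** Contraction of L^2: Jensen's inequality takes the square inside, and symmetry moves the kernel
    onto the constant 1, whose image is at most 1. *)
Lemma op_sqr f : bdd f -> (\int[mu]_x (op K f x ^+ 2)%:E <= \int[mu]_x (f x ^+ 2)%:E)%E.
Proof.
move=> bf; have bf2 : bdd (fun y => f y ^+ 2) by exact: bddM.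
have bo := bdd_op bf; have b1 := bdd_cst ler01.
apply: (@le_trans _ _ (\int[mu]_x (op K (fun y => f y ^+ 2) x * 1)%:E)%E).
  apply: ge0_le_integral => //.
  - by move=> x _; rewrite lee_fin sqr_ge0.
  - by apply/measurable_EFinP; apply: measurable_funX; exact: bdd_measurable.
  - apply/measurable_EFinP; apply: measurable_funM => //; apply: bdd_measurable; exact: bdd_op.
  move=> x _; rewrite lee_fin mulr1.
  have := op_jensen x (ler1n R 2) bf; rewrite powR_mulrn ?op_ge0//.
  congr (_ <= _); congr op; apply/funext => y; rewrite powR_mulrn// bdd_ge0//.
rewrite op_adjoint//; apply: ge0_le_integral => //.
- by move=> x _; rewrite lee_fin mulr_ge0 ?sqr_ge0 ?op_ge0.
- apply/measurable_EFinP; apply: measurable_funM; [exact: bdd_measurable bf2|apply: bdd_measurable; exact: bdd_op].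
- by apply/measurable_EFinP; exact: bdd_measurable bf2.
by move=> x _; rewrite lee_fin ler_piMr ?sqr_ge0// op_cst_le.
Qed.

End one_kernel.

Lemma op_comp K L f x : markov_kernel K -> markov_kernel L -> bdd f ->
  (forall x y, (\int[mu]_z (K x z * L z y)%:E <= (K x y + L x y)%:E)%E) ->
  op K (op L f) x <= op K f x + op L f x.
Proof.
move=> HK HL bf KL; have [mf _] := bf.
rewrite -lee_fin EFinD (opE HK)//; last exact: bdd_op.
rewrite (opE HK)// (opE HL)//.
pose F z y := (K x z * (L z y * f y))%:E.
have mF : measurable_fun setT (fun p : T * T => F p.1 p.2).
  apply/measurable_EFinP; apply: measurable_funM.
    exact: (measurableT_comp (measurable_markov_slice HK x)).
  by apply: measurable_funM; [case: HL|exact: (measurableT_comp mf)].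
have F0 z y : (0 <= F z y)%E.
  by rewrite lee_fin mulr_ge0 ?(markov_ge0 HK)// mulr_ge0 ?(markov_ge0 HL) ?(bdd_ge0 _ bf).
have -> : (\int[mu]_y (K x y * op L f y)%:E = \int[mu]_z \int[mu]_y F z y)%E.
  apply: eq_integral => z _; rewrite EFinM (opE HL)// -ge0_intZl//.
  - apply/measurable_EFinP; apply: measurable_funM => //; exact: measurable_markov_slice.
  - by move=> y; rewrite lee_fin mulr_ge0 ?(markov_ge0 HL) ?(bdd_ge0 _ bf).
  - by rewrite lee_fin (markov_ge0 HK).
rewrite (@fubini_tonelli _ _ _ _ _ mu mu (fun p => F p.1 p.2) mF (fun p => F0 _ _)).
have m1 : measurable_fun setT (fun y => (K x y * f y)%:E).
  by apply/measurable_EFinP; apply: measurable_funM => //; exact: measurable_markov_slice.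
have m2 : measurable_fun setT (fun y => (L x y * f y)%:E).
  by apply/measurable_EFinP; apply: measurable_funM => //; exact: measurable_markov_slice.
rewrite -ge0_integralD//; last 2 first.
- by move=> y _; rewrite lee_fin mulr_ge0 ?(markov_ge0 HK) ?(bdd_ge0 _ bf).
- by move=> y _; rewrite lee_fin mulr_ge0 ?(markov_ge0 HL) ?(bdd_ge0 _ bf).
apply: ge0_le_integral => //.
- by move=> y _; exact: integral_ge0.
- exact: (@measurable_fun_fubini_tonelli_G _ _ _ _ _ mu (fun p => F p.1 p.2) mF (fun p => F0 _ _)).
- exact: emeasurable_funD.
move=> y _; rewrite -EFinD -mulrDl mulrC EFinM.
have -> : (\int[mu]_z F z y = (f y)%:E * \int[mu]_z (K x z * L z y)%:E)%E.
  rewrite -ge0_intZl//.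
  - by apply: eq_integral => z _; rewrite -EFinM; congr (_%:E); ring.
  - apply/measurable_EFinP; apply: measurable_funM; first exact: measurable_markov_slice.
    rewrite (_ : (fun z => L z y) = L y); first exact: measurable_markov_slice.
    by apply/funext => z; case: HL => _ _ ->.
  - by move=> z; rewrite lee_fin mulr_ge0 ?(markov_ge0 HK) ?(markov_ge0 HL).
  - by rewrite lee_fin (bdd_ge0 _ bf).
by rewrite lee_wpmul2l ?lee_fin ?(bdd_ge0 _ bf).
Qed.

Fixpoint run_max (a : nat -> R) n : R :=
  if n is m.+1 then Num.max (run_max a m) (a m) else 0.

(** The proof takes for [e i] the indicator of the set where index [i] realises the maximum, an
    earlier index winning ties. All of them vanish where the maximum is the initial value 0, so the
    sum may fall below 1. *)
Lemma linearize_max (A : nat -> T -> R) N : (forall i, bdd (A i)) ->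
  exists e : nat -> T -> R, [/\ forall i, bdd (e i), forall i x, e i x <= 1,
    forall x, \sum_(i < N) e i x <= 1 &
    forall x, run_max (A^~ x) N = \sum_(i < N) e i x * A i x].
Proof.
move=> bA; elim: N => [|N [e [be ele e1 eM]]].
  exists (fun _ _ => 0); split => [i|i x|x|x]; rewrite /= ?big_ord0//.
  exact: bdd_cst.
have bM : bdd (fun x => run_max (A^~ x) N).
  under eq_fun do rewrite eM.
  by apply: (bdd_sum (F := fun i x => e i x * A i x)) => i; exact: bddM.
pose D := [set x | run_max (A^~ x) N < A N x].
have mD : measurable D.
  have := @measurable_fun_ltr _ _ R setT _ _ (bdd_measurable bM) (bdd_measurable (bA N)).
  move=> /(_ measurableT [set true] I); rewrite setTI.
  by rewrite (_ : _ @^-1` [set true] = D)//.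
have bI (E : set T) : measurable E -> bdd (\1_E : T -> R).
  move=> mE; split; first exact: measurable_indic.
  by exists 1 => x; rewrite indicE; case: (x \in E); rewrite /= ?mulr1n ?mulr0n ?lexx ?ler01.
have bD := bI _ mD; have bDc := bI _ (measurableC mD).
exists (fun i x => if (i < N)%N then e i x * \1_(~` D) x else \1_D x); split.
- by move=> i; case: (i < N)%N => //; exact: bddM.
- move=> i x; rewrite !indicE; case: ifP => _; last by case: (x \in D); rewrite ?mulr1n ?mulr0n.
  by case: (x \in ~` D); rewrite ?mulr1n ?mulr0n ?mulr1 ?mulr0.
- move=> x; rewrite big_ord_recr/= ltnn.
  under eq_bigr do rewrite ltn_ord.
  rewrite -mulr_suml !indicE in_setC; case: (x \in D) => /=; rewrite ?mulr0 ?add0r// mulr1 addr0//.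
- move=> x; rewrite big_ord_recr/= ltnn.
  under [in RHS]eq_bigr do rewrite ltn_ord.
  rewrite eM; have [xD|xD] := boolP (x \in D).
    have h : run_max (A^~ x) N < A N x by move: xD; rewrite inE.
    rewrite -eM (max_idPr (ltW h)) !indicE in_setC xD/= mul1r.
    by rewrite big1 ?add0r// => i _; rewrite mulr0 mul0r.
  have h : A N x <= run_max (A^~ x) N.
    by rewrite leNgt; apply: contra xD => h; rewrite inE.
  rewrite -eM (max_idPl h) !indicE in_setC (negbTE xD)/= mul0r addr0 eM.
  by apply: eq_bigr => i _; rewrite mulr1.
Qed.

Local Notation sq f := (\int[mu]_x (f x ^+ 2)%:E)%E.

Lemma bdd_sq_le f g : bdd f -> bdd g -> (forall x, f x <= g x) -> (sq f <= sq g)%E.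
Proof.
move=> bf bg fg; apply: ge0_le_integral => //.
- by move=> x _; rewrite lee_fin sqr_ge0.
- by apply/measurable_EFinP; apply: measurable_funX; exact: bdd_measurable.
- by apply/measurable_EFinP; apply: measurable_funX; exact: bdd_measurable.
by move=> x _; rewrite lee_fin lerXn2r ?nnegrE ?bdd_ge0.
Qed.

Lemma bdd_sqD_lty f g : bdd f -> bdd g -> (sq f < +oo -> sq g < +oo ->
  sq (fun x => f x + g x)%R < +oo)%E.
Proof.
move=> bf bg hf hg.
have i1 : intg mu (fun x => f x ^+ 2).
  apply: ge0_intg => //; last by move=> x; exact: sqr_ge0.
  by apply: measurable_funX; exact: bdd_measurable.
have i2 : intg mu (fun x => g x ^+ 2).
  apply: ge0_intg => //; last by move=> x; exact: sqr_ge0.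
  by apply: measurable_funX; exact: bdd_measurable.
apply: intg_ge0_lty; last by move=> x; exact: sqr_ge0.
apply: (le_intg _ _ (intgD (intgZ 2 i1) (intgZ 2 i2))).
  by apply: measurable_funX; apply: measurable_funD; exact: bdd_measurable.
move=> x; rewrite ger0_norm ?sqr_ge0//.
by have := sqr_ge0 (f x - g x); nra.
Qed.

Lemma bdd_sq_sum_lty (F : nat -> T -> R) N : (forall i, bdd (F i)) ->
  (forall i, sq (F i) < +oo)%E -> (sq (fun x => \sum_(i < N) F i x)%R < +oo)%E.
Proof.
move=> bF hF; elim: N => [|N IH].
  by under eq_integral do rewrite big_ord0 expr0n/=; rewrite integral0.
under eq_integral do rewrite big_ord_recr/=.
by apply: bdd_sqD_lty => //; exact: bdd_sum.
Qed.

Lemma bdd_integral_sum (F : nat -> T -> R) N : (forall i, bdd (F i)) ->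
  (\int[mu]_x (\sum_(i < N) F i x)%:E = \sum_(i < N) \int[mu]_x (F i x)%:E)%E.
Proof.
move=> bF; under eq_integral do rewrite -sumEFin.
rewrite ge0_integral_sum//.
- by move=> i; apply/measurable_EFinP; exact: bdd_measurable.
- by move=> i x _; rewrite lee_fin bdd_ge0.
Qed.

Section family.
Variables (K : nat -> T -> T -> R) (N : nat).
Hypothesis HK : forall i, markov_kernel (K i).
Hypothesis KK : forall i j x y,
  (\int[mu]_z (K i x z * K j z y)%:E <= (K i x y + K j x y)%:E)%E.

Lemma maximal_sq h : bdd h ->
  (\int[mu]_x ((run_max (fun i => op (K i) h x) N) ^+ 2)%:E <= 4%:E * sq h)%E.
Proof.
move=> bh; pose A i := op (K i) h.
have bA i : bdd (A i) by exact: bdd_op.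
have [e [be ele e1 eM]] := linearize_max N bA.
pose M x := run_max (A^~ x) N.
have bM : bdd M.
  rewrite (_ : M = fun x => \sum_(i < N) e i x * A i x); last exact/funext.
  by apply: (bdd_sum (F := fun i x => e i x * A i x)) => i; exact: bddM.
rewrite -/(sq M).
have [->|Hoo] := eqVneq (sq h) +oo%E; first by rewrite gt0_muley ?lte_fin// leey.
have {}Hoo : (sq h < +oo)%E by rewrite lt_neqAle Hoo leey.
pose phi i x := e i x * M x.
have bphi i : bdd (phi i) by exact: bddM.
pose P i := op (K i) (phi i).
have bP i : bdd (P i) by exact: bdd_op.
pose S x := \sum_(i < N) P i x.
have bS : bdd S by exact: bdd_sum.
have sumphi x : \sum_(i < N) phi i x <= M x.
  by rewrite -mulr_suml ler_piMl// bdd_ge0.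
(* Finiteness of [sq M] and [sq S], from the L^2 contraction of finitely many operators, makes the
   absorptions at the end legitimate. The bounds behind it depend on [N] and are not kept. *)
have Moo : (sq M < +oo)%E.
  rewrite (_ : M = fun x => \sum_(i < N) e i x * A i x); last exact/funext.
  apply: (bdd_sq_sum_lty (F := fun i x => e i x * A i x)) => i; first exact: bddM.
  apply: le_lt_trans Hoo; apply: le_trans (op_sqr (HK i) bh).
  apply: bdd_sq_le; [exact: bddM|exact: bA|].
  by move=> x; rewrite ler_piMl//; exact: bdd_ge0 (bA i).
have Soo : (sq S < +oo)%E.
  apply: bdd_sq_sum_lty => // i; apply: le_lt_trans Moo.
  apply: (le_trans (op_sqr (HK i) (bphi i))); apply: bdd_sq_le => // x.
  by rewrite ler_piMl ?bdd_ge0.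
have I1 : (sq M = \int[mu]_x (h x * S x)%:E)%E.
  transitivity (\int[mu]_x (\sum_(i < N) A i x * phi i x)%:E)%E.
    apply: eq_integral => x _; congr (_%:E); rewrite /phi expr2 {1}/M eM mulr_suml.
    by apply: eq_bigr => i _; ring.
  rewrite (bdd_integral_sum (F := fun i x => A i x * phi i x)); last by move=> i; exact: bddM.
  under eq_bigr do rewrite (op_adjoint (HK _) bh (bphi _)).
  rewrite -(bdd_integral_sum (F := fun i x => h x * P i x)); last by move=> i; exact: bddM.
  by apply: eq_integral => x _; rewrite -mulr_sumr.
have I2 : (sq S <= \int[mu]_x (M x * S x + M x * S x)%:E)%E.
  (* [op (K i) S] is a sum of compositions [op (K i) (op (K j) (phi j))]. The convolution inequality
     splits each into [op (K i) (phi j) + P j], and the [phi j] add up to at most [M]. *)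
  have KS i x : op (K i) S x <= op (K i) M x + S x.
    rewrite (op_sum (HK i))//.
    apply: (@le_trans _ _ (\sum_(j < N) (op (K i) (phi j) x + P j x))).
      by apply: ler_sum => j _; exact: op_comp.
    rewrite big_split/= lerD2r -(op_sum (HK i))//.
    by apply: op_le => //; exact: bdd_sum.
  have -> : (sq S = \int[mu]_x (\sum_(i < N) P i x * S x)%:E)%E.
    by apply: eq_integral => x _; rewrite -mulr_suml.
  rewrite (bdd_integral_sum (F := fun i x => P i x * S x)); last by move=> i; exact: bddM.
  under eq_bigr do rewrite (op_adjoint (HK _) (bphi _) bS).
  apply: (@le_trans _ _ (\sum_(i < N) \int[mu]_x (phi i x * (op (K i) M x + S x))%:E)%E).
    apply: lee_sum => i _; apply: ge0_le_integral => //.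
    - by move=> x _; rewrite lee_fin mulr_ge0 ?bdd_ge0//; exact: bdd_op.
    - apply/measurable_EFinP; apply: bdd_measurable; apply: bddM => //; exact: bdd_op.
    - apply/measurable_EFinP; apply: bdd_measurable; apply: bddM => //; apply: bddD => //; exact: bdd_op.
    - by move=> x _; rewrite lee_fin ler_wpM2l ?bdd_ge0.
  have E i : (\int[mu]_x (phi i x * (op (K i) M x + S x))%:E =
      \int[mu]_x (P i x * M x + phi i x * S x)%:E)%E.
    under eq_integral do rewrite mulrDr EFinD.
    under [RHS]eq_integral do rewrite EFinD.
    have b1 := bddM (bphi i) (bdd_op (HK i) bM); have b2 := bddM (bphi i) bS.
    have b3 := bddM (bP i) bM; have bo := bdd_op (HK i) bM.
    rewrite !ge0_integralD//; try (by move=> x _; rewrite lee_fin mulr_ge0 ?bdd_ge0);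
      try (by apply/measurable_EFinP; exact: bdd_measurable).
    by rewrite op_adjoint.
  under eq_bigr do rewrite E.
  rewrite -(bdd_integral_sum (F := fun i x => P i x * M x + phi i x * S x)); last first.
    by move=> i; apply: bddD; exact: bddM.
  apply: ge0_le_integral => //.
  - by move=> x _; rewrite lee_fin sumr_ge0// => i _; rewrite addr_ge0// mulr_ge0 ?bdd_ge0.
  - apply/measurable_EFinP; apply: bdd_measurable.
    by apply: (bdd_sum (F := fun i x => P i x * M x + phi i x * S x)) => i; apply: bddD; exact: bddM.
  - by apply/measurable_EFinP; apply: bdd_measurable; apply: bddD; exact: bddM.
  move=> x _; rewrite lee_fin big_split/= -!mulr_suml mulrC lerD2l.
  by rewrite ler_wpM2r ?(bdd_ge0 _ bS)// ler_piMl// (bdd_ge0 _ bM).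
have int2 f : bdd f -> (sq f < +oo)%E -> intg mu (fun x => f x ^+ 2).
  move=> bf hf; apply: ge0_intg => //; last by move=> x; exact: sqr_ge0.
  by apply: measurable_funX; exact: bdd_measurable.
have iM := int2 M bM Moo; have iS := int2 S bS Soo; have ih := int2 h bh Hoo.
(* In place of Cauchy-Schwarz: 2 M S <= 2 M^2 + S^2 / 2 here, and h S <= 2 h^2 + S^2 / 8 below.
   Equality holds for S = 2 M = 4 h, so the weights lose nothing in the constant 4. *)
have J1 : \int[mu]_x (S x ^+ 2) <= 2 * \int[mu]_x (M x ^+ 2) + 2^-1 * \int[mu]_x (S x ^+ 2).
  rewrite -lee_fin (Rint_intg iS); apply: (le_trans I2).
  rewrite -!RintegralZl// -(RintegralD measurableT (intgZ 2 iM) (intgZ 2^-1 iS)).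
  rewrite (Rint_intg (intgD (intgZ 2 iM) (intgZ 2^-1 iS))); apply: ge0_le_integral => //.
  - by move=> x _; rewrite lee_fin addr_ge0 ?mulr_ge0 ?bdd_ge0.
  - by apply/measurable_EFinP; apply: bdd_measurable; apply: bddD; exact: bddM.
  - by apply/measurable_EFinP; exact: intg_measurable (intgD (intgZ 2 iM) (intgZ 2^-1 iS)).
  move=> x _; rewrite lee_fin.
  by have := sqr_ge0 (2 * M x - S x); nra.
have J2 : \int[mu]_x (M x ^+ 2) <= 2 * \int[mu]_x (h x ^+ 2) + 8^-1 * \int[mu]_x (S x ^+ 2).
  rewrite -lee_fin (Rint_intg iM) I1.
  rewrite -!RintegralZl// -(RintegralD measurableT (intgZ 2 ih) (intgZ 8^-1 iS)).
  rewrite (Rint_intg (intgD (intgZ 2 ih) (intgZ 8^-1 iS))); apply: ge0_le_integral => //.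
  - by move=> x _; rewrite lee_fin ?mulr_ge0 ?bdd_ge0.
  - by apply/measurable_EFinP; apply: bdd_measurable; exact: bddM.
  - by apply/measurable_EFinP; exact: intg_measurable (intgD (intgZ 2 ih) (intgZ 8^-1 iS)).
  move=> x _; rewrite lee_fin.
  by have := sqr_ge0 (4 * h x - S x); nra.
rewrite -(Rint_intg iM) -(Rint_intg ih) -EFinM lee_fin.
by move: J1 J2; set a := \int[mu]_x _; set b := \int[mu]_x _; set c := \int[mu]_x _; lra.
Qed.

Lemma bdd_run_max f : bdd f -> bdd (fun x => run_max (fun i => op (K i) f x) N).
Proof.
move=> bf; elim: N => [|m IH]; first exact: bdd_cst.
by apply: bdd_max => //; exact: bdd_op.
Qed.

(** For [q = p / 2] one has (K g)^q <= K (g^q), so the p-th power of the maximum for [g] is below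
    the square of the maximum for [g^q]. *)
Lemma maximal_Lp g (p : R) : 2 <= p -> bdd g ->
  (\int[mu]_x ((run_max (fun i => op (K i) g x) N) `^ p)%:E <=
   4%:E * \int[mu]_x (g x `^ p)%:E)%E.
Proof.
move=> p2 bg; pose q := p / 2.
have q1 : 1 <= q by rewrite /q ler_pdivlMr// mul1r.
have q0 : 0 <= q by exact: le_trans q1.
have bq := bdd_powR q0 bg.
have pE t : t `^ p = (t `^ q) ^+ 2.
  by rewrite -powR_mulrn ?powR_ge0// -powRrM /q divfK.
under [in leRHS]eq_integral do rewrite pE.
apply: le_trans (maximal_sq bq).
apply: ge0_le_integral => //.
- by move=> x _; rewrite lee_fin powR_ge0.
- apply/measurable_EFinP; apply: (bdd_measurable (bdd_powR _ (bdd_run_max bg))).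
  by rewrite (le_trans _ p2).
- by apply/measurable_EFinP; apply: measurable_funX; exact: bdd_measurable (bdd_run_max bq).
move=> x _; rewrite lee_fin pE lerXn2r ?nnegrE ?powR_ge0//; first exact: bdd_ge0 (bdd_run_max bq).
elim: N => [|m IH] /=; first by rewrite powR0// gt_eqF// (lt_le_trans ltr01).
have [h|h] := leP (run_max (fun i => op (K i) g x) m) (op (K m) g x).
  by rewrite le_max (op_jensen (HK m) x q1 bg) orbT.
by rewrite le_max IH.
Qed.

End family.
End maximal.

(** * Principal values *)

Section continuous_measurable.
Context {R : realType}.
Variable n : nat.

Let grid (m : nat) (x : 'rV[R]_n) : 'rV[int]_n := \row_i Num.floor (m.+1%:R * x ord0 i).
Let node (m : nat) (z : 'rV[int]_n) : 'rV[R]_n := \row_i ((z ord0 i)%:~R / m.+1%:R).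

Let node_grid m (x : 'rV[R]_n) (i : 'I_n) : `|x ord0 i - node m (grid m x) ord0 i| <= hrm m.
Proof.
have m0 : 0 < m.+1%:R :> R by rewrite ltr0n.
rewrite !mxE; have /andP[a b] := floor_itv (m.+1%:R * x ord0 i).
rewrite -{1}(mulfK (lt0r_neq0 m0) (x ord0 i)) -mulrBl normrM ger0_norm; last first.
  by rewrite subr_ge0 [leRHS]mulrC.
rewrite normfV (ger0_norm (ltW m0)) ler_pdivrMr// /hrm mulVf ?gt_eqF//.
by rewrite lerBlDr [leLHS]mulrC (le_trans (ltW b))// intrD addrC.
Qed.

(** The sigma-algebra is generated by the coordinates, so open sets are not measurable by
    definition. But [u] is the pointwise limit of its values at the nodes of grids of mesh 1/(m+1),
    and such an approximant takes countably many values, each on a union of boxes. *)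
Lemma continuous_measurable_rV (u : 'rV[R]_n -> R) : continuous u -> measurable_fun setT u.
Proof.
move=> cu; apply: (@measurable_fun_cvg _ _ _ setT (fun m x => u (node m (grid m x)))).
  move=> m _ Y mY; rewrite setTI.
  rewrite (_ : _ @^-1` Y = \bigcup_(z : 'rV[int]_n) (if `[< Y (u (node m z)) >] then grid m @^-1` [set z] else set0)); last first.
    apply/seteqP; split => x /=; first by move=> h; exists (grid m x) => //; case: asboolP.
    by move=> [z _]; case: asboolP => // h /= zE; rewrite zE.
  apply: countable_bigcupT_measurable => [|z]; first exact: countableP.
  case: asboolP => // _.
  rewrite (_ : _ @^-1` _ = \bigcap_(i : 'I_n) ((fun x : 'rV[R]_n => m.+1%:R * x ord0 i) @^-1`
      `[(z ord0 i)%:~R, (z ord0 i + 1)%:~R[%classic)); last first.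
    apply/seteqP; split => x /=.
      by move=> <- i _; rewrite /= in_itv/= !mxE floor_itv.
    move=> h; apply/rowP => i; rewrite mxE; have := h i I; rewrite /= in_itv/= => hi.
    exact: floor_def.
  apply: fin_bigcap_measurable => [|i _]; first exact: finite_finset.
  rewrite -[X in measurable X]setTI.
  have mi : measurable_fun setT (fun x : 'rV[R]_n => m.+1%:R * x ord0 i : measurableTypeR R).
    by apply: measurable_funM => //; exact: measurable_rV_coord.
  by apply: mi => //; exact: measurable_itv.
move=> x _ A /(cu x)/nbhs_ballP[e /= e0 he].
have /cvgrPdist_lt/(_ _ e0) := @cvg_hrm R.
apply: filterS => m hm; apply: he; split => // i j; rewrite (ord1 i).
apply: (le_lt_trans (node_grid m x j)).
by move: hm; rewrite sub0r normrN gtr0_norm// hrm_gt0.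
Qed.

Lemma is_derive_line (u : 'rV[R]_n -> R) x w (t : R) : differentiable u (x + t *: w) ->
  is_derive t 1 (fun s => u (x + s *: w)) ('d u (x + t *: w) w).
Proof.
move=> du; pose f s := u (x + s *: w).
have E : (fun h : R => h^-1 *: ((f \o shift t) (h *: (1 : R)) - f t)) =
    (fun h : R => h^-1 *: ((u \o shift (x + t *: w)) (h *: w) - u (x + t *: w))).
  apply/funext => h; rewrite /f/= (_ : h *: (1 : R) = h); last exact: mulr1.
  by congr (_ *: (u _ - _)); rewrite scalerDl addrCA.
split; first by rewrite /derivable E; exact: diff_derivable.
by rewrite -deriveE// /derive E.
Qed.

(** What the singular integrals use of the real and imaginary parts of a Schwartz function. The
    Lipschitz condition is stated for symmetric differences, since an odd kernel sees only those. *)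
Definition nice (u : 'rV[R]_n -> R) : Prop :=
  [/\ intg (@lebesgue_rV R n) u, exists C, forall x, `|u x| <= C &
      exists2 L, 0 <= L & forall x w, `|u (x - w) - u (x + w)| <= L * enorm w].

Lemma schwartz_nice (u : 'rV[R]_n -> R) : schwartz_real u -> nice u.
Proof.
move=> su; have [du bu] := su [::]; rewrite /partials/= in du bu.
have mu : measurable_fun setT u.
  by apply: continuous_measurable_rV => x; exact: differentiable_continuous.
have ub : exists C, forall x, `|u x| <= C.
  by have [M hM] := bu 0%N; exists M => x; have := hM x; rewrite expr0 mul1r.
split => //.
(* The even weight |x|^(2(n+1)) is a power of [sqn x]; it yields decay (1 + |x|^2)^-(n+1), more than
   enough in dimension n. *)
- have [M0 h0] := bu 0%N; have [M1 h1] := bu (n.+1 * 2)%N.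
  apply: (le_intg mu _ (intgZ (2 ^+ n.+1 * (M0 + M1)) (intg_jwX (k := n.+1 * 2) _))); last first.
    by rewrite (leq_trans (ltnSn n))// leq_pmulr.
  move=> x; rewrite mulnC exprM sqr_jw exprVn ler_pdivlMr ?exprn_gt0 ?ltr_wpDr ?sqn_ge0//.
  apply: (@le_trans _ _ (`|u x| * (2 ^+ n.+1 * (1 + sqn x ^+ n.+1)))).
    rewrite ler_wpM2l//; have s0 := sqn_ge0 x.
    have [s1|s1] := leP (sqn x) 1.
      apply: (@le_trans _ _ (2 ^+ n.+1)).
        by rewrite lerXn2r ?nnegrE ?addr_ge0// (_ : 2 = 1 + 1)// lerD2l.
      by rewrite ler_peMr ?exprn_ge0// lerDl exprn_ge0.
    apply: (@le_trans _ _ ((2 * sqn x) ^+ n.+1)).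
      by rewrite lerXn2r ?nnegrE ?addr_ge0 ?mulr_ge0// mulr_natl mulr2n lerD2r ltW.
    by rewrite exprMn ler_wpM2l ?exprn_ge0// lerDr.
  rewrite mulrCA ler_wpM2l ?exprn_ge0// mulrDr mulr1 lerD//.
    by have := h0 x; rewrite expr0 mul1r.
  by have := h1 x; rewrite mulnC exprM sqr_enorm mulrC.
- have hD (i : 'I_n) : exists M, forall x, `|'D_(delta_mx ord0 i) u x| <= M.
    have [_ bi] := su [:: i]; have [M hM] := bi 0%N.
    by exists M => x; have := hM x; rewrite expr0 mul1r.
  have [M hM] := choice hD.
  have M0 i : 0 <= M i by exact: le_trans (normr_ge0 _) (hM i 0).
  (* The 2 is the length of the parameter interval from -1 to 1 on the segment from [x - w] to
     [x + w]. *)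
  pose L := 2 * \sum_i M i.
  exists L; first by rewrite mulr_ge0// sumr_ge0.
  move=> x w; pose f s := u (x + s *: w).
  have -> : u (x - w) - u (x + w) = - (f 1 - f (-1)).
    by rewrite /f scale1r scaleN1r opprB.
  have [c _ ->] := @is_derive_MVT R f (fun t => 'd u (x + t *: w) w) (-1) 1 (le_trans (lerN10 R) ler01)
    (fun th _ => is_derive_line (du _)).
  rewrite normrN normrM opprK (_ : 1 + 1 = 2)// (ger0_norm (ler0n R 2)) mulrC /L -mulrA ler_wpM2l//.
  move: (x + c *: w) => y; rewrite {1}(row_sum_delta w) linear_sum mulr_suml (le_trans (ler_norm_sum _ _ _))//.
  apply: ler_sum => i _; rewrite linearZ/= normrM mulrC.
  by apply: ler_pM => //; [rewrite -deriveE//; exact: hM|exact: coord_le_enorm].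
Qed.

End continuous_measurable.

(** * Fubini's theorem for real integrals, and the hyperplane as a null set *)

Section fubini_real.
Context {R : realType} d1 d2 (T1 : measurableType d1) (T2 : measurableType d2).
Variables (m1 : {sigma_finite_measure set T1 -> \bar R}) (m2 : {sigma_finite_measure set T2 -> \bar R}).
Variable f : T1 -> T2 -> R.
Hypothesis mf : measurable_fun setT (fun p : T1 * T2 => f p.1 p.2).

Lemma measurable_Rint : measurable_fun setT (fun x => \int[m2]_y f x y).
Proof.
rewrite /Rintegral; apply: measurableT_comp => //.
under eq_fun do rewrite integralE.
have mp : measurable_fun setT (fun p : T1 * T2 => ((EFin \o f p.1)^\+ p.2)%E).
  have /measurable_EFinP/measurable_funepos := mf.
  by apply: eq_measurable_fun => p _; rewrite !funeposE.
have mn : measurable_fun setT (fun p : T1 * T2 => ((EFin \o f p.1)^\- p.2)%E).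
  have /measurable_EFinP/measurable_funeneg := mf.
  by apply: eq_measurable_fun => p _; rewrite !funenegE.
apply: emeasurable_funB.
  exact: (@measurable_fun_fubini_tonelli_F _ _ _ _ _ m2 (fun p => ((EFin \o f p.1)^\+ p.2)%E)).
exact: (@measurable_fun_fubini_tonelli_F _ _ _ _ _ m2 (fun p => ((EFin \o f p.1)^\- p.2)%E)).
Qed.

Hypotheses (f1 : forall x, intg m2 (f x)) (f2 : forall y, intg m1 (f^~ y)).
Variable B : T1 -> R.
Hypotheses (iB : intg m1 B) (fB : forall x, \int[m2]_y `|f x y| <= B x).

Lemma intg_Rint : intg m1 (fun x => \int[m2]_y f x y).
Proof.
apply: (le_intg measurable_Rint _ iB) => x; apply: le_trans (fB x).
by apply: le_normr_Rintegral => //; exact: f1.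
Qed.

Lemma fubini_Rint : \int[m1]_x (\int[m2]_y f x y) = \int[m2]_y (\int[m1]_x f x y).
Proof.
have ip : (m1 \x m2)%E.-integrable setT (fun p => (f p.1 p.2)%:E).
  apply/integrable12ltyP; first exact/measurable_EFinP.
  apply: le_lt_trans (intg_ge0_lty (intg_norm iB) (fun=> normr_ge0 _)).
  apply: ge0_le_integral => //.
  - by move=> x _; apply: integral_ge0.
  - apply: (@measurable_fun_fubini_tonelli_F _ _ _ _ _ m2 (fun p => `|(f p.1 p.2)%:E|%E)) => //.
    by apply: measurableT_comp => //; exact/measurable_EFinP.
  - by apply/measurable_EFinP; apply: measurableT_comp => //; exact: intg_measurable iB.
  move=> x _; apply: (@le_trans _ _ (B x)%:E); last by rewrite lee_fin ler_norm.
  have -> : (\int[m2]_y `|(f x y)%:E| = \int[m2]_y (`|f x y|%R)%:E)%E by [].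
  rewrite -Rint_intg; last exact: intg_norm.
  by rewrite lee_fin.
have := Fubini ip; rewrite /= => h.
rewrite /Rintegral; congr fine.
transitivity (\int[m1]_x \int[m2]_y (f x y)%:E)%E.
  by apply: eq_integral => x _; rewrite -Rint_intg.
rewrite h; apply: eq_integral => y _; rewrite -Rint_intg//; exact: f2.
Qed.

End fubini_real.

Section null_plane.
Context {R : realType}.
Variable n : nat.
Local Notation leb1 := (@lebesgue_rV R n.+1).

Lemma null_hd0 : leb1 [set V | hd V = 0] = 0%E.
Proof.
pose A (i : 'I_n.+1) : set R := if i == ord0 then [set 0] else setT.
have -> : [set V : 'rV[R]_n.+1 | hd V = 0] = [set V | forall i, A i (V ord0 i)].
  apply/seteqP; split => V /=; last by move=> /(_ ord0); rewrite /A eqxx.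
  by move=> h i; rewrite /A; case: eqP => // ->.
rewrite lebesgue_rV_box; last by move=> i; rewrite /A; case: ifP => _ //; exact: measurable_set1.
by rewrite big_ord_recl /A eqxx lebesgue_measure_set1 mul0e.
Qed.

Lemma measurable_hd0 : measurable [set V : 'rV[R]_n.+1 | hd V = 0].
Proof.
have := @measurable_hd R n measurableT [set 0] (@measurable_set1 R 0).
by rewrite setTI.
Qed.

(** For [V] on the hyperplane the horizontal field, seen from the hyperplane, has a singularity of
    order n, not integrable in dimension n. Removing this null set makes every slice in the Fubini
    arguments below integrable. *)
Lemma Rintegral_hd_neq0 (g : 'rV[R]_n.+1 -> R) : intg leb1 g ->
  \int[leb1]_V ((hd V != 0)%R%:R * g V) = \int[leb1]_V g V.
Proof.
move=> ig; rewrite /Rintegral; congr fine.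
have mg := intg_measurable ig.
have mi : measurable_fun setT (fun V : 'rV[R]_n.+1 => (hd V != 0)%R%:R : R).
  rewrite (_ : (fun _ => _) = \1_(~` [set V : 'rV[R]_n.+1 | hd V = 0])).
    exact: measurable_indic (measurableC measurable_hd0).
  apply/funext => V; rewrite indicE; congr (nat_of_bool _)%:R.
  by apply/idP/idP; [move=> h; rewrite in_setC notin_setE /=; exact/eqP|rewrite in_setC notin_setE/= => /eqP].
apply: ae_eq_integral => //.
- by apply/measurable_EFinP; exact: measurable_funM.
- exact/measurable_EFinP.
exists [set V | hd V = 0]; split; [exact: measurable_hd0|exact: null_hd0|].
move=> V /= h; apply: contrapT => h0; apply: h => _.
by have /eqP/negbTE -> := h0; rewrite mul1r.
Qed.

End null_plane.

(** * Conjugate Poisson integrals and their boundary values *)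

Section conjugate_poisson.
Context {R : realType}.
Variable n : nat.
Hypothesis n2 : (2 <= n)%N.
Variable j : 'I_n.
Local Notation leb := (@lebesgue_rV R n).
Local Notation leb1 := (@lebesgue_rV R n.+1).
Local Notation jj := (lift ord0 j : 'I_n.+1).
Implicit Types (x w z v : 'rV[R]_n) (u : 'rV[R]_n -> R).

(** Up to a constant, the conjugate Poisson kernel at height [b]; for [b = 0] the Riesz kernel, with
    value 0 at the origin. *)
Definition Eb (b : R) w : R := Ek jj (rV_cons (b, w)).

Lemma EbE b w : Eb b w = w ord0 j * pw n 0 (b ^+ 2 + sqn w).
Proof. by rewrite /Eb /Ek rV_cons_lift sqn_cons. Qed.

Lemma EbN b w : Eb b (- w) = - Eb b w.
Proof. by rewrite !EbE sqnN mxE mulNr. Qed.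

Lemma Eb_norm b w : Eb `|b| w = Eb b w.
Proof. by rewrite !EbE real_normK// num_real. Qed.

Lemma Eb0_le w : `|Eb 0 w| <= (enorm w)^-1 ^+ n.
Proof.
apply: (le_trans (Ek_le _ _)); rewrite enormE sqn_cons expr0n add0r -enormE.
exact: lexx.
Qed.

Lemma Eb_le0 b w : `|Eb b w| <= `|Eb 0 w|.
Proof.
rewrite !EbE !normrM expr0n add0r.
have [->|w0] := eqVneq w 0; first by rewrite mxE normr0 !mul0r.
rewrite ler_wpM2l// !ger0_norm ?pw_ge0//.
rewrite (_ : pw n 0 (b ^+ 2 + sqn w) = pw n (b ^+ 2) (sqn w)); last by rewrite /pw add0r.
by rewrite pw_anti ?sqr_ge0// sqn_gt0.
Qed.

Lemma Eb_le b w : b != 0 -> `|Eb b w| <= `|b|^-1 ^+ n.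
Proof.
move=> b0; apply: (le_trans (Ek_le _ _)).
rewrite lerXn2r ?nnegrE ?invr_ge0 ?enorm_ge0//.
rewrite lef_pV2 ?posrE ?normr_gt0//; last first.
  by rewrite enormE sqrtr_gt0 sqn_cons ltr_pwDl ?sqn_ge0// exprn_even_gt0//= b0.
by rewrite enormE sqn_cons -[leLHS]ger0_norm// -sqrtr_sqr ler_wsqrtr// real_normK ?num_real// lerDl sqn_ge0.
Qed.

Lemma measurable_Eb_comp d (S : measurableType d) (b : S -> R) (w : S -> 'rV[R]_n) :
  measurable_fun setT b -> measurable_fun setT w -> measurable_fun setT (fun s => Eb (b s) (w s)).
Proof.
move=> mb mw; apply: (measurableT_comp (@measurable_Ek R n jj)).
exact: measurable_fun_cons.
Qed.

Lemma cvg_Eb (b : R) w : 0 <= b -> Eb (b + hrm m) w @[m --> \oo] --> Eb b w.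
Proof.
move=> b0; rewrite EbE; under eq_fun do rewrite EbE.
have [->|w0] := eqVneq w 0.
  by rewrite mxE mul0r; under eq_fun do rewrite mul0r; exact: cvg_cst.
apply: cvgM; first exact: cvg_cst.
have s0 : 0 < b ^+ 2 + sqn w by rewrite ltr_wpDl ?sqr_ge0// sqn_gt0.
have cs : (b + hrm m) ^+ 2 + sqn w @[m --> \oo] --> (b + 0) ^+ 2 + sqn w.
  apply: cvgD; last exact: cvg_cst.
  have cb : b + hrm m @[m --> \oo] --> b + 0 by apply: cvgD; [exact: cvg_cst|exact: cvg_hrm].
  by apply: cvgM.
have c0 : {for (b + 0) ^+ 2 + sqn w, continuous (pw n (0 : R))}.
  apply: (is_derive_continuous_at (df := pw' n 0 ((b + 0) ^+ 2 + sqn w))); apply: is_derive_pw.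
  by rewrite add0r addr0.
by have := @cvg_comp _ _ _ (fun m => (b + hrm m) ^+ 2 + sqn w) (pw n 0) _ _ _ cs c0; rewrite addr0.
Qed.

Definition Qf (b : R) u x : R := \int[leb]_z (Eb b (x - z) * u z).

(** The principal value as an absolutely convergent integral, by pairing [w] with [- w] under the
    odd kernel; [cvg_trunc_pv] identifies it with the limit of the truncations. *)
Definition pv u x : R := \int[leb]_w (Eb 0 w * ((u (x - w) - u (x + w)) / 2)).

Let head w : R := (enorm w <= 1)%R%:R * (enorm w)^-1 ^+ n.-1.

Let head_ge0 w : 0 <= head w.
Proof. by rewrite mulr_ge0// exprn_ge0// invr_ge0 enorm_ge0. Qed.

Lemma intg_head : intg leb (fun w => (enorm w <= 1)%R%:R * (enorm w)^-1 ^+ n.-1).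
Proof.
have iE : (fun w : 'rV[R]_n => (enorm w <= 1)%R%:R : R) = \1_[set w : 'rV[R]_n | enorm w <= 1].
  by apply/funext => w; rewrite indicE; congr (nat_of_bool _)%:R; apply/idP/idP; rewrite inE.
have mi : measurable_fun setT (fun w : 'rV[R]_n => (enorm w <= 1)%R%:R : R).
  rewrite iE; apply: measurable_indic; exact: measurable_enorm_le.
have me : measurable_fun setT (fun w : 'rV[R]_n => (enorm w)^-1 ^+ n.-1).
  by apply: measurable_funX; exact: measurable_enormV.
apply: ge0_intg; [exact: measurable_funM|exact: head_ge0|].
have E w : (((enorm w <= 1)%R%:R * (enorm w)^-1 ^+ n.-1)%:E =
   ((fun w => ((enorm w)^-1 ^+ n.-1)%:E) \_ [set w : 'rV[R]_n | (enorm w <= 1)%R]) w)%E.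
  rewrite patchE; have [h|h] := boolP (enorm w <= 1); first by rewrite mem_set//= mul1r.
  by rewrite memNset/= ?mul0r//; exact/negP.
under eq_integral do rewrite E.
rewrite -integral_mkcond.
by case: n n2 => // -[//|k] _; exact: enormV_head_lty.
Qed.

Section nice_function.
Variable u : 'rV[R]_n -> R.
Hypothesis un : nice u.

Lemma nice_intg : intg leb u. Proof. by case: un. Qed.

Lemma nice_measurable : measurable_fun setT u.
Proof. exact: intg_measurable nice_intg. Qed.

Let dom (L : R) x w : R := L * head w + (`|u (x - w)| + `|u (x + w)|).

Let int_dom (L : R) : 0 <= L -> forall x, intg leb (dom L x) /\
  \int[leb]_w dom L x w <= L * \int[leb]_w head w + 2 * \int[leb]_w `|u w|.
Proof.
move=> L0 x; have iu := intg_norm nice_intg.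
have i1 : intg leb (fun w => `|u (x - w)|) by exact: (intg_subl x iu).
have i2 : intg leb (fun w => `|u (x + w)|).
  by under eq_fun do rewrite addrC; exact: (intg_addr x iu).
have i0 := intgZ L intg_head; have i12 := intgD i1 i2.
split; first exact: (intgD i0 i12).
rewrite /dom (RintegralD measurableT i0 i12) (RintegralD measurableT i1 i2).
rewrite RintegralZl//; last exact: intg_head.
rewrite (Rintegral_subl x iu) (_ : \int[leb]_w `|u (x + w)| = \int[leb]_w `|u w|).
  by rewrite -mulr2n mulr_natl.
by rewrite -(Rintegral_addr x iu); apply: eq_Rintegral => w _; rewrite addrC.
Qed.

(** One majorant for all heights. Near the origin the Lipschitz bound gains a factor |w| over the
    kernel, leaving |w|^(1-n), which is integrable in dimension n; outside the unit ball the kernel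
    is at most 1. *)
Let sym_le : exists2 L, 0 <= L & forall b x w,
  `|Eb b w * ((u (x - w) - u (x + w)) / 2)| <= dom L x w.
Proof.
case: un => _ _ [L L0 hL]; exists L => // b x w.
apply: (@le_trans _ _ (`|Eb 0 w| * `|(u (x - w) - u (x + w)) / 2|)).
  by rewrite normrM ler_wpM2r// Eb_le0.
have tri : `|(u (x - w) - u (x + w)) / 2| <= `|u (x - w)| + `|u (x + w)|.
  rewrite normrM [`|2^-1|]ger0_norm ?invr_ge0// ler_pdivrMr//.
  apply: (le_trans (ler_normB _ _)); rewrite ler_peMr ?addr_ge0//.
  by rewrite (_ : 2 = 1 + 1)// lerDl.
have un0 : 0 <= `|u (x - w)| + `|u (x + w)| by rewrite addr_ge0.
rewrite /dom /head; have [w1|w1] := leP (enorm w) 1; last first.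
  rewrite mul0r mulr0 add0r -[leRHS]mul1r; apply: ler_pM => //.
  apply: (le_trans (Eb0_le w)); rewrite exprn_ile1 ?invr_ge0 ?enorm_ge0//.
  by rewrite invf_le1 ?ltW// (lt_trans ltr01).
rewrite mul1r; apply: ler_wpDr => //.
have [->|w0] := eqVneq w 0.
  by rewrite EbE mxE mul0r normr0 mul0r mulr_ge0// exprn_ge0// invr_ge0 enorm_ge0.
have e0 : 0 < enorm w by rewrite enorm_gt0.
apply: (@le_trans _ _ ((enorm w)^-1 ^+ n * (L * enorm w))).
  apply: ler_pM => //; first exact: Eb0_le.
  rewrite normrM [`|2^-1|]ger0_norm ?invr_ge0// ler_pdivrMr//.
  apply: (le_trans (hL x w)); rewrite ler_peMr ?mulr_ge0 ?(ltW e0)//.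
  by rewrite (_ : 2 = 1 + 1)// lerDl.
rewrite mulrCA ler_wpM2l//.
have nE : n = n.-1.+1 by case: n n2.
have -> : (enorm w)^-1 ^+ n = (enorm w)^-1 ^+ n.-1 * (enorm w)^-1 by rewrite -exprSr -nE.
by rewrite mulfVK// gt_eqF.
Qed.

Lemma pv_dominated x : exists D, intg leb D /\
  forall w, `|Eb 0 w * ((u (x - w) - u (x + w)) / 2)| <= D w.
Proof.
have [L L0 hL] := sym_le; exists (dom L x); split; last exact: hL.
by have [] := int_dom L0 x.
Qed.

Let msym b x : measurable_fun setT (fun w => Eb b w * ((u (x - w) - u (x + w)) / 2)).
Proof.
have mu := nice_measurable.
apply: measurable_funM; first exact: measurable_Eb_comp.
apply: measurable_funM => //; apply: measurable_funB; apply: (measurableT_comp mu).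
  exact: measurable_subl_rV.
by apply: measurable_fun_addrV.
Qed.

Lemma Eb_intg b x : b != 0 -> intg leb (fun z => Eb b (x - z) * u z).
Proof.
move=> b0; apply: (le_intg _ _ (intgZ (`|b|^-1 ^+ n) (intg_norm nice_intg))).
  apply: measurable_funM; last exact: nice_measurable.
  by apply: measurable_Eb_comp => //; exact: measurable_subl_rV.
by move=> z; rewrite normrM ler_wpM2r// Eb_le.
Qed.

Lemma Qf_sym b x : b != 0 -> Qf b u x = \int[leb]_w (Eb b w * ((u (x - w) - u (x + w)) / 2)).
Proof.
move=> b0; pose f w := Eb b w * u (x - w).
have fi : intg leb f.
  have := intg_subl x (Eb_intg x b0); rewrite /intg; congr (integrable _ _ _).
  by apply/funext => w /=; rewrite /f subKr.
have fiN : intg leb (fun w => f (- w)).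
  by have := intg_subl 0 fi; under eq_fun do rewrite sub0r.
have e1 : \int[leb]_w f w = Qf b u x.
  rewrite -(Rintegral_subl x fi); apply: eq_Rintegral => z _; rewrite /f.
  by rewrite subKr.
have e2 : \int[leb]_w f (- w) = Qf b u x.
  by rewrite -e1 -(Rintegral_subl 0 fi); apply: eq_Rintegral => z _; rewrite sub0r.
transitivity (2^-1 * (\int[leb]_w f w + \int[leb]_w f (- w))).
  by rewrite e1 e2; field.
rewrite -(RintegralD measurableT fi fiN) -RintegralZl//; last exact: intgD.
by apply: eq_Rintegral => w _; rewrite /f EbN opprK; field.
Qed.

Lemma Qf_pv_le : exists C, (forall x, `|pv u x| <= C) /\ forall b x, b != 0 -> `|Qf b u x| <= C.
Proof.
have [L L0 hL] := sym_le; exists (L * \int[leb]_w head w + 2 * \int[leb]_w `|u w|).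
have le b x : `|\int[leb]_w (Eb b w * ((u (x - w) - u (x + w)) / 2))| <=
    L * \int[leb]_w head w + 2 * \int[leb]_w `|u w|.
  have [id hd] := int_dom L0 x; apply: le_trans hd.
  have ii := le_intg (msym b x) (hL b x) id.
  apply: (le_trans (le_normr_Rintegral measurableT ii)).
  by apply: le_Rintegral => //; exact: intg_norm.
by split => [x|b x b0]; [exact: le|rewrite Qf_sym].
Qed.

Lemma cvg_Qf_pv x : Qf (hrm m) u x @[m --> \oo] --> pv u x.
Proof.
have [L L0 hL] := sym_le; have [id _] := int_dom L0 x.
have E m : Qf (hrm m) u x = \int[leb]_w (Eb (0 + hrm m) w * ((u (x - w) - u (x + w)) / 2)).
  by rewrite add0r Qf_sym// gt_eqF// hrm_gt0.
under eq_fun do rewrite E.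
have [|||_ //] := @dominated_cvg_Rint _ _ _ leb
  (fun m w => Eb (0 + hrm m) w * ((u (x - w) - u (x + w)) / 2)) (fun w => Eb 0 w * ((u (x - w) - u (x + w)) / 2)) _ _ _ id.
- by move=> m; exact: msym.
- by move=> w; apply: cvgM; [exact: cvg_Eb|exact: cvg_cst].
- by move=> m w; exact: hL.
Qed.

Lemma cvg_Qf b x : 0 < b -> Qf (b + hrm m) u x @[m --> \oo] --> Qf b u x.
Proof.
move=> b0; have [|||_ //] := @dominated_cvg_Rint _ _ _ leb
  (fun m z => Eb (b + hrm m) (x - z) * u z) (fun z => Eb b (x - z) * u z) _ _ _
  (intgZ (`|b|^-1 ^+ n) (intg_norm nice_intg)).
- move=> m; apply: measurable_funM; last exact: nice_measurable.
  by apply: measurable_Eb_comp => //; exact: measurable_subl_rV.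
- by move=> z; apply: cvgM; [apply: cvg_Eb; exact: ltW|exact: cvg_cst].
move=> m z; rewrite normrM ler_wpM2r//.
have bm : 0 < b + hrm m by rewrite addr_gt0// hrm_gt0.
apply: (le_trans (Eb_le _ (lt0r_neq0 bm))).
rewrite lerXn2r ?nnegrE ?invr_ge0// lef_pV2 ?posrE ?normr_gt0 ?gt_eqF//.
by rewrite !gtr0_norm// lerDl ltW// hrm_gt0.
Qed.

Lemma measurable_pv : measurable_fun setT (pv u).
Proof.
apply: (@measurable_Rint R _ _ _ _ leb (fun x w => Eb 0 w * ((u (x - w) - u (x + w)) / 2))).
have mu := nice_measurable.
apply: measurable_funM; first exact: measurable_Eb_comp.
apply: measurable_funM => //; apply: measurable_funB; apply: (measurableT_comp mu).
  exact: measurable_fun_subrV.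
exact: measurable_fun_addrV.
Qed.

Lemma measurable_Qf b : measurable_fun setT (Qf b u).
Proof.
apply: (@measurable_Rint R _ _ _ _ leb (fun x z => Eb b (x - z) * u z)).
have mu := nice_measurable.
apply: measurable_funM; last exact: (measurableT_comp mu).
by apply: measurable_Eb_comp => //; exact: measurable_fun_subrV.
Qed.

End nice_function.
End conjugate_poisson.

(** * The averaging kernels applied to principal values *)

Section kern_pv.
Context {R : realType}.
Variable n : nat.
Hypothesis n2 : (2 <= n)%N.
Variable j : 'I_n.
Local Notation leb := (@lebesgue_rV R n).
Local Notation leb1 := (@lebesgue_rV R n.+1).
Local Notation jj := (lift ord0 j : 'I_n.+1).
Local Notation Eb := (Eb j).
Local Notation Qf := (Qf j).
Local Notation pv := (pv j).
Variable u : 'rV[R]_n -> R.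
Hypothesis un : nice u.
Implicit Types (x w z v : 'rV[R]_n) (V : 'rV[R]_n.+1).

Let k0 : 0 < kappa n :> R := @kappa_gt0 R n.

Lemma intg_PK_slice y x : intg leb (fun z => PK (rV_cons (y, x - z))).
Proof.
apply: (@intg_subl R n x (fun z => PK (rV_cons (y, z)))); apply: ge0_intg.
- by apply/measurable_EFinP; exact: measurable_PK_slice.
- by move=> z; exact: PK_ge0.
- by apply: le_lt_trans (int_PK n2 y) _; rewrite ltry.
Qed.

(** A tangential component of the reproducing formula: the Poisson kernel at height [a] sends the
    conjugate kernel at height [b] to the one at height [a + b]. *)
Lemma PK_Eb (a b : R) x v : 0 < a -> 0 < b ->
  \int[leb]_z (PK (rV_cons (a, x - z)) * Eb b (z - v)) = kappa n / 2 * Eb (a + b) (x - v).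
Proof.
move=> a0 b0; pose A : 'rV[R]_n.+1 := rV_cons (a, x); pose B : 'rV[R]_n.+1 := rV_cons (- b, v).
have hA : 0 < hd A by rewrite hd_cons.
have hB : hd B < 0 by rewrite hd_cons oppr_lt0.
have [i e] := poisson_reproduction n2 jj hA hB.
have E z : PK (rV_cons (a, x - z)) * Eb b (z - v) = a * (pw n 0 (sqn (A - pl z)) * Ek jj (pl z - B)).
  rewrite PK_cons /A /B /pl !rV_consB subr0 sqn_cons sub0r opprK gtr0_norm//.
  by rewrite mulrA.
under eq_Rintegral do rewrite E.
rewrite RintegralZl//.
have -> : Eb (a + b) (x - v) = Ek jj (A - B) by rewrite /A /B rV_consB opprK.
by move: e; rewrite hd_cons => e; rewrite mulrAC e; field.
Qed.

(** At positive height [Eb b] is bounded, so Fubini's theorem lets [PK_Eb] act under the integral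
    over [v]; the boundary case is reached by a limit in [PK_pv]. *)
Lemma PK_Qf (a b : R) x : 0 < a -> 0 < b ->
  \int[leb]_z (PK (rV_cons (a, x - z)) * Qf b u z) = kappa n / 2 * Qf (a + b) u x.
Proof.
move=> a0 b0; have iu := nice_intg un; have mu := nice_measurable un.
pose f z v := PK (rV_cons (a, x - z)) * (Eb b (z - v) * u v).
have iP := intg_PK_slice a x.
have bn0 : b != 0 by rewrite gt_eqF.
have mf : measurable_fun setT (fun p : 'rV[R]_n * 'rV[R]_n => f p.1 p.2).
  apply: measurable_funM.
    by apply: (measurableT_comp (@measurable_PK R n)); apply: measurable_fun_cons => //; exact: measurable_fun_subrV.
  apply: measurable_funM; last exact: (measurableT_comp mu).
  by apply: measurable_Eb_comp => //; exact: measurable_fun_subrV.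
have f1 z : intg leb (f z) by apply: intgZ; exact: Eb_intg.
have f2 v : intg leb (f^~ v).
  apply: (le_intg _ _ (intgZ (`|b|^-1 ^+ n * `|u v|) iP)).
    exact: (measurableT_comp mf (measurable_pair2 v)).
  move=> z; rewrite /f normrM ger0_norm ?PK_ge0// [leRHS]mulrC ler_wpM2l ?PK_ge0//.
  by rewrite normrM ler_wpM2r// Eb_le.
have iB := intgZ (`|b|^-1 ^+ n * \int[leb]_v `|u v|) iP.
have fB z : \int[leb]_v `|f z v| <= `|b|^-1 ^+ n * (\int[leb]_v `|u v|) * PK (rV_cons (a, x - z)).
  have -> : \int[leb]_v `|f z v| = PK (rV_cons (a, x - z)) * \int[leb]_v `|Eb b (z - v) * u v|.
    rewrite -RintegralZl//; last by apply: intg_norm; exact: Eb_intg.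
    by apply: eq_Rintegral => v _; rewrite /f normrM ger0_norm ?PK_ge0.
  rewrite [leRHS]mulrC ler_wpM2l ?PK_ge0// -RintegralZl//; last exact: intg_norm.
  apply: le_Rintegral => //.
  - by apply: intg_norm; exact: Eb_intg.
  - by apply: intgZ; exact: intg_norm.
  - by move=> v _; rewrite normrM ler_wpM2r// Eb_le.
have := fubini_Rint mf f1 f2 iB fB.
have -> : \int[leb]_z \int[leb]_v f z v = \int[leb]_z (PK (rV_cons (a, x - z)) * Qf b u z).
  by apply: eq_Rintegral => z _; rewrite /f RintegralZl//; exact: Eb_intg.
move=> ->; rewrite -RintegralZl//; last by apply: Eb_intg; rewrite // gt_eqF// addr_gt0.
apply: eq_Rintegral => v _; rewrite mulrA -PK_Eb//.
rewrite -RintegralZr//; last first.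
  apply: (le_intg _ _ (intgZ (`|b|^-1 ^+ n) iP)).
    apply: measurable_funM; first exact: intg_measurable iP.
    by apply: measurable_Eb_comp => //; exact: measurable_addr_rV.
  move=> z; rewrite normrM ger0_norm ?PK_ge0// [leRHS]mulrC ler_wpM2l ?PK_ge0//.
  exact: Eb_le.
by apply: eq_Rintegral => z _; rewrite /f mulrA.
Qed.

(** Up to constants, the harmonic extension of the Riesz transform of [u] is the conjugate Poisson
    integral of [u]. The lower height in [PK_Qf] tends to 0, where [Qf] has the boundary value [pv];
    the bound of [Qf_pv_le], uniform in the height, dominates. *)
Lemma PK_pv (a : R) x : 0 < a ->
  \int[leb]_z (PK (rV_cons (a, x - z)) * pv u z) = kappa n / 2 * Qf a u x.
Proof.
move=> a0; have [C [h1 h2]] := Qf_pv_le n2 j un; have iP := intg_PK_slice a x.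
have [|||_ c1] := @dominated_cvg_Rint _ _ _ leb
  (fun m z => PK (rV_cons (a, x - z)) * Qf (hrm m) u z) (fun z => PK (rV_cons (a, x - z)) * pv u z)
  _ _ _ (intgZ C iP).
- by move=> m; apply: measurable_funM; [exact: intg_measurable iP|exact: measurable_Qf].
- by move=> z; apply: cvgM; [exact: cvg_cst|exact: cvg_Qf_pv].
- move=> m z; rewrite normrM ger0_norm ?PK_ge0// mulrC ler_wpM2r ?PK_ge0//.
  by apply: h2; rewrite gt_eqF// hrm_gt0.
have c2 : \int[leb]_z (PK (rV_cons (a, x - z)) * Qf (hrm m) u z) @[m --> \oo] --> kappa n / 2 * Qf a u x.
  under eq_fun do rewrite (PK_Qf _ a0 (hrm_gt0 _)).
  by apply: cvgM; [exact: cvg_cst|exact: cvg_Qf].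
by rewrite -(cvg_lim (@Rhausdorff R) c1) -(cvg_lim (@Rhausdorff R) c2).
Qed.

Section density.
Variables (r : 'rV[R]_n.+1 -> R) (m : R -> R).
Hypothesis rN : newtonian r m.
Let r0 := newtonian_ge0 rN.
Let mr := measurable_newtonian rN.

Lemma intg_kern x : intg leb (fun z => kern r (x - z)).
Proof.
apply: (@intg_subl R n x (kern r)); apply: ge0_intg.
- exact: measurable_kern rN.
- by move=> z; exact: kern_ge0 rN _.
- by apply: le_lt_trans (kern_mass n2 rN) _; rewrite ltry.
Qed.

Let PKshift x z V : PK (pl (x - z) + V) = PK (rV_cons (`|hd V|, x + tl V - z)).
Proof. by rewrite PK_norm_hd -{1}(rV_cons_eta V) /pl rV_consD add0r addrAC. Qed.

Let Ekshift x z V : Ek jj (pl (x - z) + V) = Eb `|hd V| (x + tl V - z).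
Proof. by rewrite Eb_norm -{1}(rV_cons_eta V) /pl rV_consD add0r addrAC. Qed.

Let g x z V : R := u z * ((hd V != 0)%R%:R * (r V * Ek jj (pl (x - z) + V))).

Let mnz : measurable_fun setT (fun V : 'rV[R]_n.+1 => (hd V != 0)%R%:R : R).
Proof.
rewrite (_ : (fun _ => _) = \1_(~` [set V : 'rV[R]_n.+1 | hd V = 0])).
  by apply: measurable_indic; apply: measurableC; exact: measurable_hd0.
apply/funext => V; rewrite indicE; congr (nat_of_bool _)%:R.
by apply/idP/idP; [move=> h; rewrite in_setC notin_setE /=; exact/eqP|rewrite in_setC notin_setE/= => /eqP].
Qed.

Let mg x : measurable_fun setT (fun p : 'rV[R]_n * 'rV[R]_n.+1 => g x p.1 p.2).
Proof.
apply: measurable_funM; first exact: (measurableT_comp (nice_measurable un)).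
apply: measurable_funM; first exact: (measurableT_comp mnz).
apply: measurable_funM; first exact: (measurableT_comp mr).
apply: (measurableT_comp (@measurable_Ek R n jj)); apply: measurable_fun_addrV => //.
by apply: measurable_fun_pl; exact: measurable_fun_subrV.
Qed.

Let ind_intg X : intg leb1 (fun V => (hd V != 0)%R%:R * (r V * Ek jj (X + V))).
Proof.
apply: (le_intg _ _ (intg_norm (newtonian_Ek_intg n2 rN X jj))).
  by apply: measurable_funM => //; exact: intg_measurable (newtonian_Ek_intg n2 rN X jj).
by move=> V; rewrite normrM; case: (hd V != 0); rewrite ?normr1 ?normr0 ?mul1r ?mul0r.
Qed.

Let g1 x z : intg leb1 (g x z).
Proof. by apply: intgZ; exact: ind_intg. Qed.

Let g2 x V : intg leb ((g x)^~ V).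
Proof.
apply: (le_intg _ _ (intgZ ((hd V != 0)%R%:R * (r V * `|hd V|^-1 ^+ n)) (intg_norm (nice_intg un)))).
  exact: (measurableT_comp (mg x) (measurable_pair2 V)).
move=> z; rewrite /g normrM mulrC ler_wpM2r//.
have [h|h] := eqVneq (hd V) 0; first by rewrite /= !mul0r normr0.
rewrite /= !mul1r normrM ger0_norm// ler_wpM2l// Ekshift -[X in _ <= X^-1 ^+ _]normr_id.
by rewrite Eb_le// normr_eq0.
Qed.

Let gB : exists C, forall x z, \int[leb1]_V `|g x z V| <= C * `|u z|.
Proof.
have [C hC] := newtonian_riesz n2 rN; exists C => x z.
have [iX eX] := hC (- pl (x - z)).
apply: (@le_trans _ _ (`|u z| * \int[leb1]_V (r V * (enorm (- pl (x - z) - V))^-1 ^+ n))); last first.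
  by rewrite mulrC ler_wpM2r.
rewrite -RintegralZl//; apply: le_Rintegral => //.
- by apply: intg_norm; exact: g1.
- exact: intgZ.
move=> V _; rewrite /g normrM ler_wpM2l// normrM (normrM (r V)) (ger0_norm (r0 V)).
rewrite -[leRHS]mul1r; apply: ler_pM => //; first by rewrite mulr_ge0.
  by case: (hd V != 0); rewrite ?normr1 ?normr0.
by rewrite ler_wpM2l// -opprD enormN Ek_le.
Qed.

(** [kern r] averages Poisson kernels of heights [|hd V|], and [PK_pv] turns each Poisson average of
    [pv u] into a convolution of [u] with the horizontal field at that height. The average of these
    fields with weight [r] is given by the field equation in [newtonian], evaluated on the
    hyperplane. Fubini's theorem is applied before and after the substitution, to [f] and to [g]. *)
Lemma kern_pv x : \int[leb]_z (kern r (x - z) * pv u z) =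
  \int[leb]_z (m (sqn (x - z)) * Eb 0 (x - z) * u z).
Proof.
have [C [hC _]] := Qf_pv_le n2 j un; have mpv := measurable_pv j un.
pose f z V := r V * PK (pl (x - z) + V) * pv u z.
have mf : measurable_fun setT (fun p : 'rV[R]_n * 'rV[R]_n.+1 => f p.1 p.2).
  apply: measurable_funM; last exact: (measurableT_comp mpv).
  apply: measurable_funM; first exact: (measurableT_comp mr).
  apply: (measurableT_comp (@measurable_PK R n)); apply: measurable_fun_addrV => //.
  by apply: measurable_fun_pl; exact: measurable_fun_subrV.
have iPX X := newtonian_intg_PK n2 rN X.
have f1 z : intg leb1 (f z).
  rewrite /f; under eq_fun do rewrite mulrC; exact: intgZ.
have f2 V : intg leb (f^~ V).
  apply: (le_intg _ _ (intgZ (r V * C) (intg_PK_slice `|hd V| (x + tl V)))).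
    exact: (measurableT_comp mf (measurable_pair2 V)).
  move=> z; rewrite /f PKshift !normrM (ger0_norm (r0 V)) ger0_norm ?PK_ge0//.
  by rewrite -mulrA -mulrA ler_wpM2l// mulrC ler_wpM2r ?PK_ge0.
have C0 : 0 <= C by exact: le_trans (normr_ge0 _) (hC 0).
have iB := intgZ (kappa n / 2 * C) (intg_kern x).
have kE z : \int[leb1]_V (r V * PK (pl (x - z) + V)) = kappa n / 2 * kern r (x - z).
  by rewrite /kern; field; rewrite gt_eqF.
have fB z : \int[leb1]_V `|f z V| <= kappa n / 2 * C * kern r (x - z).
  have -> : \int[leb1]_V `|f z V| = \int[leb1]_V (`|pv u z| * (r V * PK (pl (x - z) + V))).
    apply: eq_Rintegral => V _; rewrite /f normrM mulrC [X in _ * X]ger0_norm//.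
    by rewrite mulr_ge0 ?PK_ge0.
  rewrite RintegralZl//; last exact: iPX.
  rewrite kE mulrCA mulrA ler_wpM2r ?(kern_ge0 rN)//.
  by rewrite ler_wpM2l// divr_ge0// ltW.
have e1 := fubini_Rint mf f1 f2 iB fB.
have [D hD] := gB; have iD := intgZ D (intg_norm (nice_intg un)).
have c20 : 0 <= kappa n / 2 :> R by rewrite divr_ge0// ltW.
have e2 : \int[leb]_z \int[leb1]_V (kappa n / 2 * g x z V) = \int[leb1]_V \int[leb]_z (kappa n / 2 * g x z V).
  apply: (@fubini_Rint R _ _ _ _ leb leb1 (fun z V => kappa n / 2 * g x z V) _ _ _ _ (intgZ (kappa n / 2) iD)).
  - by apply: measurable_funM => //; exact: mg.
  - by move=> z; apply: intgZ; exact: g1.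
  - by move=> V; apply: intgZ; exact: g2.
  - move=> z; apply: (@le_trans _ _ (kappa n / 2 * \int[leb1]_V `|g x z V|)); last by rewrite ler_wpM2l.
    rewrite -RintegralZl//; last by apply: intg_norm; exact: g1.
    apply: le_Rintegral => //.
    + by apply: intg_norm; apply: intgZ; exact: g1.
    + by apply: intgZ; apply: intg_norm; exact: g1.
    + by move=> V _; rewrite normrM (ger0_norm c20).
have -> : \int[leb]_z (kern r (x - z) * pv u z) = 2 / kappa n * \int[leb]_z \int[leb1]_V f z V.
  rewrite -RintegralZl//; last exact: (intg_Rint mf f1 iB fB).
  apply: eq_Rintegral => z _; rewrite /f RintegralZr//; last exact: iPX.
  by rewrite kE; field; rewrite gt_eqF.
rewrite e1.
have -> : \int[leb1]_V \int[leb]_z f z V = \int[leb1]_V \int[leb]_z (kappa n / 2 * g x z V).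
  apply: eq_Rintegral => V _; rewrite [in RHS]RintegralZl//; last exact: g2.
  transitivity (r V * \int[leb]_z (PK (rV_cons (`|hd V|, x + tl V - z)) * pv u z)).
    rewrite -RintegralZl//; first by apply: eq_Rintegral => z _; rewrite /f PKshift mulrA.
    apply: (le_intg _ _ (intgZ C (intg_PK_slice `|hd V| (x + tl V)))).
      by apply: measurable_funM => //; exact: intg_measurable (intg_PK_slice _ _).
    by move=> z; rewrite normrM ger0_norm ?PK_ge0// mulrC ler_wpM2r ?PK_ge0.
  (* [PK_pv] concerns positive heights; on the hyperplane both sides are 0. *)
  have [h|h] := eqVneq (hd V) 0.
    rewrite [X in r V * X](_ : _ = 0); last first.
      by rewrite /Rintegral integral0_eq// => z _; rewrite h PK_cons !normr0 !mul0r.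
    rewrite (_ : \int[leb]_z g x z V = 0) ?mulr0//.
    by rewrite /Rintegral integral0_eq// => z _; rewrite /g h eqxx mul0r mulr0.
  rewrite PK_pv ?normr_gt0// mulrCA; congr (_ * _).
  rewrite /Qf -RintegralZl//; last by apply: Eb_intg; rewrite // normr_eq0.
  by apply: eq_Rintegral => z _; rewrite /g h mul1r Ekshift; ring.
rewrite -e2 -RintegralZl//; last first.
  apply: (@intg_Rint R _ _ _ _ leb leb1 (fun z V => kappa n / 2 * g x z V) _ _ _ (intgZ (kappa n / 2) iD)).
  - by apply: measurable_funM => //; exact: mg.
  - by move=> z; apply: intgZ; exact: g1.
  - move=> z; apply: (@le_trans _ _ (kappa n / 2 * \int[leb1]_V `|g x z V|)); last by rewrite ler_wpM2l.
    rewrite -RintegralZl//; last by apply: intg_norm; exact: g1.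
    apply: le_Rintegral => //.
    + by apply: intg_norm; apply: intgZ; exact: g1.
    + by apply: intgZ; apply: intg_norm; exact: g1.
    + by move=> V _; rewrite normrM (ger0_norm c20).
apply: eq_Rintegral => z _; rewrite RintegralZl//; last exact: g1.
rewrite mulrA (_ : 2 / kappa n * (kappa n / 2) = 1) ?mul1r; last first.
  by field; rewrite gt_eqF.
rewrite /g RintegralZl//; last exact: ind_intg.
rewrite (Rintegral_hd_neq0 (newtonian_Ek_intg n2 rN (pl (x - z)) jj)) (newtonian_add n2 rN).
by rewrite sqn_cons expr0n add0r mulrC.
Qed.

End density.
End kern_pv.

(** * Truncations *)

Section truncation.
Context {R : realType}.
Variable n : nat.
Hypothesis n2 : (2 <= n)%N.
Variable j : 'I_n.
Local Notation leb := (@lebesgue_rV R n).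
Local Notation Eb := (Eb j).
Local Notation pv := (pv j).
Implicit Types (x w z v : 'rV[R]_n).

Lemma nmE k (T s : R) : nm n k T s = (Num.sqrt s ^+ n.+1 * pw n (hrm k) s) * chi k T s.
Proof. by rewrite /nm /nW mulrA. Qed.

Lemma nm_le_chi k (T s : R) : 0 < T -> 0 <= s -> nm n k T s <= chi k T s.
Proof.
move=> T0 s0; rewrite nmE ler_piMl ?chi_ge0//.
rewrite /pw -exprMn exprn_ile1 ?mulr_ge0 ?invr_ge0 ?sqrtr_ge0//.
rewrite ler_pdivrMr ?mul1r ?sqrtr_gt0 ?ltr_pwDl ?hrm_gt0//.
by rewrite ler_wsqrtr// lerDr ltW// hrm_gt0.
Qed.

Lemma chi_le_geometric k (T s : R) : 0 < T -> 0 <= s -> chi k T s <= (s / T) ^+ k.+1.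
Proof.
move=> T0 s0; rewrite /chi expr_div_n ler_wpM2l ?exprn_ge0//.
by rewrite lef_pV2 ?posrE ?exprn_gt0 ?ltr_wpDr ?exprn_ge0 ?exprn_gt0// lerDl exprn_ge0.
Qed.

(** Uniform in [k]. Beyond squared distance [T] the kernel itself obeys the bound; below it,
    (s/T)^(k+1) <= (s/T)^n compensates the singularity of order s^(-n/2). The assumption
    [(n <= k.+1)%N] is why cut-offs of index [k + n] are used from here on. *)
Lemma nm_Eb_le k (T : R) w : 0 < T -> (n <= k.+1)%N ->
  `|nm n k T (sqn w) * Eb 0 w| <= (Num.sqrt T)^-1 ^+ n.
Proof.
move=> T0 nk; have s0 := sqn_ge0 w; have e0 := enorm_ge0 w.
have q0 : 0 < Num.sqrt T by rewrite sqrtr_gt0.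
rewrite normrM ger0_norm ?nm_ge0//.
apply: (@le_trans _ _ (nm n k T (sqn w) * (enorm w)^-1 ^+ n)).
  by rewrite ler_wpM2l ?nm_ge0// Eb0_le.
have i0 : 0 <= (enorm w)^-1 ^+ n by rewrite exprn_ge0// invr_ge0.
have [h|h] := leP T (sqn w).
  rewrite -[leRHS]mul1r; apply: ler_pM; rewrite ?nm_ge0 ?nm_le1//.
  rewrite lerXn2r ?nnegrE ?invr_ge0// ?(ltW q0)// lef_pV2 ?posrE//.
    by rewrite enormE ler_wsqrtr.
  by rewrite enormE sqrtr_gt0 (lt_le_trans T0).
have sT : 0 <= sqn w / T <= 1 by rewrite divr_ge0 ?(ltW T0)//= ler_pdivrMr// mul1r ltW.
apply: (@le_trans _ _ ((sqn w / T) ^+ n * (enorm w)^-1 ^+ n)).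
  rewrite ler_wpM2r// (le_trans (nm_le_chi _ T0 s0))// (le_trans (chi_le_geometric _ T0 s0))//.
  by have /andP[a b] := sT; rewrite ler_wiXn2l.
have sTe : 0 <= sqn w / T / enorm w by rewrite mulr_ge0 ?invr_ge0//; case/andP: sT.
rewrite -exprMn lerXn2r ?nnegrE ?invr_ge0 ?(ltW q0)//.
have [->|w0] := eqVneq (enorm w) 0; first by rewrite invr0 mulr0 invr_ge0 ltW.
rewrite -sqr_enorm (_ : enorm w ^+ 2 / T / enorm w = enorm w / T); last by field; rewrite w0 gt_eqF.
rewrite ler_pdivrMr// -{2}(sqr_sqrtr (ltW T0)) expr2 mulrA mulVf ?gt_eqF// mul1r.
by rewrite enormE ler_wsqrtr// ltW.
Qed.

(* Pointwise limit of [nm n k T] as [k] grows: the indicator of [s > T], with value 1/2 at [T]. *)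
Definition mT (T s : R) : R := (T < s)%R%:R + 2^-1 * (s == T)%:R.

(** Written as 1 / (1 + (T/s)^(k+1)), the cut-off is governed by a geometric sequence; at [s = T] it
    is constantly 1/2. For [s < T] the bound (s/T)^(k+1) is enough, and it also covers [s = 0]. *)
Lemma cvg_nm (T s : R) : 0 < T -> 0 <= s -> nm n (k + n) T s @[k --> \oo] --> mT T s.
Proof.
move=> T0 s0; rewrite /mT.
have hs : hrm (k + n) @[k --> \oo] --> (0 : R).
  by have := @cvg_hrm R; rewrite -(cvg_shiftn n).
have A1 : 0 < s -> Num.sqrt s ^+ n.+1 * pw n (hrm (k + n)) s @[k --> \oo] --> (1 : R).
  move=> sp; have -> : 1 = Num.sqrt s ^+ n.+1 * pw n 0 (0 + s) :> R.
    by rewrite /pw !add0r -exprMn mulfV ?expr1n// gt_eqF// sqrtr_gt0.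
  apply: cvgM; first exact: cvg_cst.
  have cs : hrm (k + n) + s @[k --> \oo] --> 0 + s by apply: cvgD => //; exact: cvg_cst.
  have c0 : {for 0 + s, continuous (pw n (0 : R))}.
    apply: (is_derive_continuous_at (df := pw' n 0 (0 + s))); apply: is_derive_pw.
    by rewrite !add0r.
  have pwE k : pw n (hrm (k + n)) s = pw n 0 (hrm (k + n) + s) by rewrite /pw add0r.
  under eq_fun do rewrite pwE.
  exact: (@cvg_comp _ _ _ (fun k => hrm (k + n) + s) (pw n 0) _ _ _ cs c0).
have chE k : 0 < s -> chi k T s = ((T / s) ^+ k.+1 + 1)^-1.
  move=> sp; rewrite /chi expr_div_n.
  have a0 : 0 < T ^+ k.+1 by rewrite exprn_gt0.
  have b0 : 0 < s ^+ k.+1 by rewrite exprn_gt0.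
  by field; rewrite !gt_eqF// addr_gt0.
have nE : (fun k => nm n (k + n) T s) =
    fun k => (Num.sqrt s ^+ n.+1 * pw n (hrm (k + n)) s) * chi (k + n) T s.
  by apply/funext => k; rewrite nmE.
have [sT|sT|sT] := ltgtP s T.
- rewrite mulr0 addr0.
  have r01 : `|s / T| < 1 by rewrite ger0_norm ?divr_ge0 ?(ltW T0)// ltr_pdivrMr// mul1r.
  have hg : (s / T) ^+ (k + n).+1 @[k --> \oo] --> (0 : R).
    have := cvg_expr r01; rewrite -(cvg_shiftn n.+1) => h.
    by under eq_fun do rewrite -addnS.
  apply: (squeeze_cvgr _ (cvg_cst (0 : R)) hg); apply: nearW => k.
  by rewrite nm_ge0//= (le_trans (nm_le_chi _ T0 s0))// chi_le_geometric.
- have sp : 0 < s by exact: lt_trans sT.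
  rewrite nE mulr0 addr0 -[X in _ --> X]mulr1; apply: cvgM; first exact: A1.
  rewrite (_ : (fun k => chi (k + n) T s) = fun k => ((T / s) ^+ (k + n).+1 + 1)^-1); last first.
    by apply/funext => k; rewrite chE.
  rewrite [X in _ --> X](_ : 1 = (0 + 1)^-1 :> R); last by rewrite add0r invr1.
  apply: cvgV; first by rewrite add0r oner_eq0.
  apply: cvgD; last exact: cvg_cst.
  have r01 : `|T / s| < 1 by rewrite ger0_norm ?divr_ge0 ?(ltW T0)// ltr_pdivrMr// mul1r.
  have := cvg_expr r01; rewrite -(cvg_shiftn n.+1) => h.
  by under eq_fun do rewrite -addnS.
- have sp : 0 < s by rewrite sT.
  rewrite nE add0r mulr1 -[X in _ --> X]mul1r; apply: cvgM; first exact: A1.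
  rewrite (_ : (fun k => chi (k + n) T s) = fun=> 2^-1); first exact: cvg_cst.
  by apply/funext => k; rewrite chE// sT divff ?gt_eqF// expr1n.
Qed.

Lemma measurable_nm k (T : R) : 0 < T -> measurable_fun setT (nm n k T).
Proof.
move=> T0; have [K ok] := @nW_radial_ok R n k T T0; case: ok => _ mW _ _.
apply: measurable_funM => //; apply: measurable_funX; exact: measurable_sqrtr.
Qed.

Lemma measurable_mT (T : R) : 0 < T -> measurable_fun setT (fun w => mT T (sqn w)).
Proof.
move=> T0; apply: (@measurable_fun_cvg _ _ _ setT (fun k w => nm n (k + n) T (sqn w))).
  move=> k; apply: (measurableT_comp (measurable_nm (k + n) T0)); exact: measurable_sqn.
by move=> w _; exact: cvg_nm T0 (sqn_ge0 w).
Qed.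

Section limits.
Variable u : 'rV[R]_n -> R.
Hypothesis un : nice u.
Let mu := nice_measurable un.
Let iu := nice_intg un.

Definition trunc (t : R) x : R := \int[leb]_z ((t < enorm (x - z))%R%:R * Eb 0 (x - z) * u z).

Lemma measurable_gt_enorm (t : R) : measurable_fun setT (fun w : 'rV[R]_n => (t < enorm w)%R%:R : R).
Proof.
rewrite (_ : (fun _ => _) = \1_[set w : 'rV[R]_n | t < enorm w]).
  by apply: measurable_indic; exact: measurable_enorm_lt.
by apply/funext => w; rewrite indicE; congr (nat_of_bool _)%:R; apply/idP/idP; rewrite inE.
Qed.

Let measE (a : 'rV[R]_n -> R) x : measurable_fun setT a ->
  measurable_fun setT (fun z => a (x - z) * Eb 0 (x - z) * u z).
Proof.
move=> ma; apply: measurable_funM => //; apply: measurable_funM.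
  by apply: (measurableT_comp ma); exact: measurable_subl_rV.
by apply: measurable_Eb_comp => //; exact: measurable_subl_rV.
Qed.

Lemma cvg_smooth_cutoff (T : R) x : 0 < T ->
  \int[leb]_z (nm n (k + n) T (sqn (x - z)) * Eb 0 (x - z) * u z) @[k --> \oo] -->
  \int[leb]_z (mT T (sqn (x - z)) * Eb 0 (x - z) * u z).
Proof.
move=> T0; have [|||_ //] := @dominated_cvg_Rint _ _ _ leb
  (fun k z => nm n (k + n) T (sqn (x - z)) * Eb 0 (x - z) * u z)
  (fun z => mT T (sqn (x - z)) * Eb 0 (x - z) * u z) _ _ _ (intgZ ((Num.sqrt T)^-1 ^+ n) (intg_norm iu)).
- move=> k; apply: (measE (a := fun w => nm n (k + n) T (sqn w))).
  apply: (measurableT_comp (measurable_nm (k + n) T0)); exact: measurable_sqn.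
- move=> z; apply: cvgM; last exact: cvg_cst.
  by apply: cvgM; [exact: cvg_nm T0 (sqn_ge0 _)|exact: cvg_cst].
- move=> k z; rewrite normrM ler_wpM2r// nm_Eb_le//.
  by rewrite (leq_trans (leq_addl k n)).
Qed.

(** The levels approach t^2 strictly from above. The cut-offs therefore vanish on the sphere
    [enorm (x - z) = t], as the strict inequality in the truncation demands, and the value 1/2 of
    [mT] survives in no limit. *)
Lemma cvg_sharp_cutoff (t : R) (T : nat -> R) x : 0 < t -> (forall l, t ^+ 2 < T l) ->
  T l @[l --> \oo] --> t ^+ 2 ->
  \int[leb]_z (mT (T l) (sqn (x - z)) * Eb 0 (x - z) * u z) @[l --> \oo] --> trunc t x.
Proof.
move=> t0 tT cT; have T0 l : 0 < T l by rewrite (lt_trans _ (tT l))// exprn_gt0.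
have [|||_ //] := @dominated_cvg_Rint _ _ _ leb
  (fun l z => mT (T l) (sqn (x - z)) * Eb 0 (x - z) * u z)
  (fun z => (t < enorm (x - z))%R%:R * Eb 0 (x - z) * u z) _ _ _ (intgZ (t^-1 ^+ n) (intg_norm iu)).
- move=> l; apply: (measE (a := fun w => mT (T l) (sqn w))); exact: measurable_mT.
- move=> z; apply: cvgM; last exact: cvg_cst.
  apply: cvgM; last exact: cvg_cst.
  have tE : (t < enorm (x - z)) = (t ^+ 2 < sqn (x - z)).
    by rewrite -sqr_enorm ltr_pXn2r ?nnegrE ?enorm_ge0// ltW.
  rewrite tE; have [h|h] := ltP (t ^+ 2) (sqn (x - z)).
    have c1 : (fun=> 1 : R) (l : nat) @[l --> \oo] --> (1 : R) by exact: cvg_cst.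
    apply: cvg_trans c1; apply: near_eq_cvg.
    have /cvgr_lt/(_ _ h) := cT; apply: filterS => l hl.
    by rewrite /mT hl gt_eqF// mulr0 addr0.
  have E l : mT (T l) (sqn (x - z)) = 0.
    by rewrite /mT ltNge (le_trans h (ltW (tT l)))/= lt_eqF ?mulr0 ?addr0// (le_lt_trans h).
  by under eq_fun do rewrite E; exact: cvg_cst.
- move=> l z; rewrite normrM ler_wpM2r//.
  have i0 : 0 <= t^-1 ^+ n by rewrite exprn_ge0// invr_ge0 ltW.
  have [h|h] := ltP (sqn (x - z)) (T l).
    by rewrite /mT ltNge (ltW h)/= lt_eqF// mulr0 addr0 mul0r normr0.
  have te : t < enorm (x - z).
    rewrite -(@ltr_pXn2r _ 2) ?nnegrE ?enorm_ge0 ?(ltW t0)// sqr_enorm.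
    exact: lt_le_trans h.
  rewrite normrM -[leRHS]mul1r; apply: ler_pM => //.
    rewrite /mT; case: ltgtP h => // h _; rewrite ?mulr0 ?addr0 ?normr1//.
    by rewrite add0r mulr1 ger0_norm ?invr_ge0// invf_le1// ler1n.
  apply: (le_trans (Eb0_le _ _)); rewrite lerXn2r ?nnegrE ?invr_ge0 ?enorm_ge0 ?(ltW t0)//.
  by rewrite lef_pV2 ?posrE ?ltW// (lt_trans t0).
Qed.

Lemma trunc_intg (t : R) x : 0 < t -> intg leb (fun z => (t < enorm (x - z))%R%:R * Eb 0 (x - z) * u z).
Proof.
move=> t0; apply: (le_intg _ _ (intgZ (t^-1 ^+ n) (intg_norm iu))).
  exact: (measE (a := fun w => (t < enorm w)%R%:R) x (measurable_gt_enorm t)).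
move=> z; rewrite normrM ler_wpM2r//.
have i0 : 0 <= t^-1 ^+ n by rewrite exprn_ge0// invr_ge0 ltW.
have [h|h] := ltP t (enorm (x - z)); last by rewrite mul0r normr0.
rewrite mul1r (le_trans (Eb0_le _ _))// lerXn2r ?nnegrE ?invr_ge0 ?enorm_ge0 ?(ltW t0)//.
by rewrite lef_pV2 ?posrE ?ltW// (lt_trans t0).
Qed.

Lemma trunc_sym (t : R) x : 0 < t -> trunc t x =
  \int[leb]_w ((t < enorm w)%R%:R * (Eb 0 w * ((u (x - w) - u (x + w)) / 2))).
Proof.
move=> t0; pose f w := (t < enorm w)%R%:R * Eb 0 w * u (x - w).
have fi : intg leb f.
  have := intg_subl x (trunc_intg x t0); rewrite /intg; congr (integrable _ _ _).
  by apply/funext => w /=; rewrite /f subKr.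
have fiN : intg leb (fun w => f (- w)).
  by have := intg_subl 0 fi; under eq_fun do rewrite sub0r.
have e1 : \int[leb]_w f w = trunc t x.
  rewrite -(Rintegral_subl x fi); apply: eq_Rintegral => z _; rewrite /f.
  by rewrite subKr.
have e2 : \int[leb]_w f (- w) = trunc t x.
  by rewrite -e1 -(Rintegral_subl 0 fi); apply: eq_Rintegral => z _; rewrite sub0r.
transitivity (2^-1 * (\int[leb]_w f w + \int[leb]_w f (- w))).
  by rewrite e1 e2; field.
rewrite -(RintegralD measurableT fi fiN) -RintegralZl//; last exact: intgD.
by apply: eq_Rintegral => w _; rewrite /f EbN opprK enormN; field.
Qed.

Lemma cvg_trunc_pv x : trunc t x @[t --> 0^'+] --> pv u x.
Proof.
apply/cvg_at_rightP => t [t0 ct].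
have [D [iD hD]] := pv_dominated n2 j un x.
under eq_fun do rewrite (trunc_sym _ (t0 _)).
have [|||_ //] := @dominated_cvg_Rint _ _ _ leb
  (fun i w => (t i < enorm w)%R%:R * (Eb 0 w * ((u (x - w) - u (x + w)) / 2)))
  (fun w => Eb 0 w * ((u (x - w) - u (x + w)) / 2)) D _ _ iD.
- move=> i; apply: measurable_funM; first exact: measurable_gt_enorm.
  apply: measurable_funM; first exact: measurable_Eb_comp.
  apply: measurable_funM => //; apply: measurable_funB; apply: (measurableT_comp mu).
    exact: measurable_subl_rV.
  by apply: measurable_fun_addrV.
- move=> w; have [->|w0] := eqVneq w 0.
    rewrite EbE mxE !mul0r; under eq_fun do rewrite mulr0; exact: cvg_cst.
  rewrite -[X in _ --> X]mul1r; apply: cvgM; last exact: cvg_cst.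
  have c1 : (fun=> 1 : R) (i : nat) @[i --> \oo] --> (1 : R) by exact: cvg_cst.
  apply: cvg_trans c1; apply: near_eq_cvg.
  have /cvgr_lt/(_ _ (_ : 0 < enorm w)) := ct; rewrite enorm_gt0 w0 => /(_ isT).
  by apply: filterS => i ->.
- move=> i w; apply: le_trans (hD w); rewrite normrM ler_piMl//.
  by case: (_ < _); rewrite ?normr1 ?normr0.
Qed.

End limits.
End truncation.

(** * Moduli of complex values through their real and imaginary parts *)

Section hypot.
Context {R : realType}.
Implicit Types a b : R.

Definition hypot a b : R := Num.sqrt (a ^+ 2 + b ^+ 2).

Lemma hypot_ge0 a b : 0 <= hypot a b. Proof. exact: sqrtr_ge0. Qed.

Lemma sqr_hypot a b : hypot a b ^+ 2 = a ^+ 2 + b ^+ 2.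
Proof. by rewrite sqr_sqrtr// addr_ge0 ?sqr_ge0. Qed.

Lemma hypotZ (c a b : R) : hypot (c * a) (c * b) = `|c| * hypot a b.
Proof. by rewrite /hypot !exprMn -mulrDr sqrtrM ?sqr_ge0// sqrtr_sqr. Qed.

Lemma hypot_le a b : hypot a b <= `|a| + `|b|.
Proof.
rewrite -(@ler_pXn2r _ 2) ?nnegrE ?hypot_ge0 ?addr_ge0//.
rewrite sqr_hypot sqrrD !real_normK ?num_real// -addrA [_ *+ _ + _]addrC addrA lerDl.
by rewrite mulrn_wge0// mulr_ge0.
Qed.

Lemma norm_le_hypot a b : `|a| <= hypot a b /\ `|b| <= hypot a b.
Proof. by split; rewrite -sqrtr_sqr ler_wsqrtr// ?lerDl ?lerDr ?sqr_ge0. Qed.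

Lemma hypot_cauchy a b (s t : R) : a * s + b * t <= hypot a b * hypot s t.
Proof.
rewrite (le_trans (ler_norm _))// -sqrtr_sqr -sqrtrM ?addr_ge0 ?sqr_ge0// ler_wsqrtr//.
by have := sqr_ge0 (a * t - b * s); nra.
Qed.

Lemma cvg_hypot {T : Type} (F : set_system T) {FF : Filter F} (f g : T -> R) a b :
  f t @[t --> F] --> a -> g t @[t --> F] --> b -> hypot (f t) (g t) @[t --> F] --> hypot a b.
Proof.
move=> fa gb; rewrite /hypot.
apply: (@cvg_comp _ _ _ (fun t => f t ^+ 2 + g t ^+ 2) Num.sqrt); last exact: sqrt_continuous.
by apply: cvgD; under eq_fun do rewrite expr2; rewrite expr2; exact: cvgM.
Qed.

Lemma hypot_lim_le (f g : nat -> R) (a b c s : R) :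
  f t @[t --> \oo] --> a -> g t @[t --> \oo] --> b ->
  (forall t, c * hypot (f t) (g t) <= s) -> c * hypot a b <= s.
Proof.
move=> fa gb h; have c1 : c * hypot (f t) (g t) @[t --> \oo] --> c * hypot a b.
  by apply: cvgM; [exact: cvg_cst|exact: cvg_hypot].
by apply: (cvgr_to_le c1); exact: nearW.
Qed.

Lemma measurable_hypot d (T : measurableType d) (f g : T -> R) :
  measurable_fun setT f -> measurable_fun setT g -> measurable_fun setT (fun x => hypot (f x) (g x)).
Proof.
move=> mf mg; apply: (measurableT_comp (@measurable_sqrtr R)).
by apply: measurable_funD; exact: measurable_funX.
Qed.

Lemma normc_real (c a b : R) : Normc.normc (c%:C * (a +i* b))%C = `|c| * hypot a b.
Proof.
rewrite -hypotZ /hypot; congr Num.sqrt; rewrite /=.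
by rewrite !mul0r subr0 addr0.
Qed.

(** The vector of the two integrals is paired with itself and Cauchy's inequality is used under the
    integral sign. Estimating the two parts separately would lose a constant factor for
    complex-valued functions. *)
Lemma hypot_Rint d (T : measurableType d) (mu : {measure set T -> \bar R}) (f g : T -> R) :
  intg mu f -> intg mu g ->
  hypot (\int[mu]_x f x) (\int[mu]_x g x) <= \int[mu]_x hypot (f x) (g x).
Proof.
move=> fi gi.
have hi : intg mu (fun x => hypot (f x) (g x)).
  apply: (le_intg _ _ (intgD (intg_norm fi) (intg_norm gi))).
    by apply: measurable_hypot; apply: intg_measurable; eassumption.
  by move=> x; rewrite ger0_norm ?hypot_ge0// hypot_le.
set A := \int[mu]_x f x; set B := \int[mu]_x g x; set I := \int[mu]_x hypot _ _.
have I0 : 0 <= I by apply: Rintegral_ge0 => x _; exact: hypot_ge0.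
have [h0|h0] := eqVneq (hypot A B) 0; first by rewrite h0.
have hp : 0 < hypot A B by rewrite lt_neqAle eq_sym h0 hypot_ge0.
rewrite -(ler_pM2l hp) -expr2 sqr_hypot !expr2.
rewrite -RintegralZl// -RintegralZl// -RintegralZl//.
rewrite -RintegralD//; [|exact: intgZ|exact: intgZ].
apply: le_Rintegral => //; [by apply: intgD; exact: intgZ|exact: intgZ|].
by move=> x _; exact: hypot_cauchy.
Qed.

End hypot.

(** * The countable family of kernels *)

Section kernel_family.
Context {R : realType}.
Variable n : nat.
Hypothesis n2 : (2 <= n)%N.
Local Notation leb := (@lebesgue_rV R n).
Implicit Types (x y z : 'rV[R]_n).

(** The positive rationals: countably many levels approach every t^2 from above. *)
Definition level (a l : nat) : R := a.+1%:R / l.+1%:R.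

Lemma level_gt0 a l : 0 < level a l.
Proof. by rewrite divr_gt0 ?ltr0n. Qed.

(** Indexing by [nat] is what the maximal inequality expects; a number that is not the code of a
    triple falls back on a fixed one. *)
Definition fam_code (i : nat) : nat * nat * nat := odflt (0%N, 0%N, 0%N) (unpickle i).

Definition fam_rho (i : nat) : 'rV[R]_n.+1 -> R :=
  let: (k, a, l) := fam_code i in rho (k + n) (level a l).

Definition fam (i : nat) x z : R := kern (fam_rho i) (x - z).

Lemma fam_newtonian i : exists m, newtonian (fam_rho i) m.
Proof.
rewrite /fam_rho; case: (fam_code i) => -[k a] l.
by exists (nm n (k + n) (level a l)); apply: rho_newtonian => //; exact: level_gt0.
Qed.

Lemma fam_pickle k a l : fam_rho (pickle (k, a, l)) = rho (k + n) (level a l).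
Proof. by rewrite /fam_rho /fam_code pickleK. Qed.

Lemma fam_markov i : markov_kernel leb (fam i).
Proof.
have [m rN] := fam_newtonian i; split.
- rewrite /fam; apply: (measurableT_comp (measurable_kern n2 rN)).
  by apply: measurable_fun_subrV; [exact: measurable_fst|exact: measurable_snd].
- by move=> x y; exact: kern_ge0 rN _.
- by move=> x y; rewrite /fam -(kernN n2 rN) opprB.
- move=> x; rewrite /fam.
  rewrite (@ge0_integral_subl R n x (fun w => (kern (fam_rho i) w)%:E)).
  + exact: (kern_mass n2 rN).
  + by apply/measurable_EFinP; exact: (measurable_kern n2 rN).
  + by move=> w; rewrite lee_fin; exact: kern_ge0 rN _.
Qed.

Lemma fam_conv i l x y :
  (\int[leb]_z (fam i x z * fam l z y)%:E <= (fam i x y + fam l x y)%:E)%E.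
Proof.
have [m rN] := fam_newtonian i; have [m' rN'] := fam_newtonian l.
apply: le_trans (kern_conv n2 rN rN' (x - y)).
have mK : measurable_fun setT (fun z => (kern (fam_rho i) (x - y - z) * kern (fam_rho l) z)%:E).
  apply/measurable_EFinP; apply: measurable_funM; last exact: (measurable_kern n2 rN').
  by apply: (measurableT_comp (measurable_kern n2 rN)); exact: measurable_subl_rV.
have K0 z : (0 <= (kern (fam_rho i) (x - y - z) * kern (fam_rho l) z)%:E)%E.
  by rewrite lee_fin mulr_ge0 ?(kern_ge0 rN) ?(kern_ge0 rN').
have e := @ge0_integral_addr R n (- y) _ mK K0.
rewrite le_eqVlt; apply/orP; left; apply/eqP; apply: etrans e; apply: eq_integral => z _.
by rewrite /fam opprD opprK addrACA addNr addr0.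
Qed.

End kernel_family.

(** * Pointwise domination of the truncated transforms *)

Section riesz_bound.
Context {R : realType}.
Variable n : nat.
Hypothesis n2 : (2 <= n)%N.
Variable j : 'I_n.
Local Notation leb := (@lebesgue_rV R n).
Local Notation Eb := (Eb j).
Local Notation pv := (pv j).
Implicit Types (x y z : 'rV[R]_n) (f : 'rV[R]_n -> R[i]).

Definition riesz_cst : R := Gamma (n.+1%:R / 2) / pi `^ (n.+1%:R / 2).

Lemma riesz_truncE t f x : riesz_trunc j t f x =
  (riesz_cst%:C * (trunc j (fun y => complex.Re (f y)) t x +i* trunc j (fun y => complex.Im (f y)) t x))%C.
Proof.
rewrite /riesz_trunc /cintegral; congr (_ * (_ +i* _))%C.
all: rewrite Rintegral_mkcond; apply: eq_Rintegral => y _; rewrite patchE.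
all: have E : (x ord0 j - y ord0 j) / enorm (x - y) ^+ n.+1 = Eb 0 (x - y)
  by rewrite EbE !mxE /pw expr0n !add0r enormE exprVn.
all: have [h|h] := ltP t (enorm (x - y)).
1,3: by rewrite mem_set// E; case: (f y) => a b /=; rewrite ?mul0r ?subr0 ?addr0 ?mul1r.
all: by rewrite memNset ?mul0r//= ltNge h.
Qed.

Section schwartz.
Variable f : 'rV[R]_n -> R[i].
Hypothesis sf : schwartz f.
Let u y := complex.Re (f y).
Let v y := complex.Im (f y).
Let un : nice u. Proof. by apply: schwartz_nice; case: sf. Qed.
Let vn : nice v. Proof. by apply: schwartz_nice; case: sf. Qed.

Lemma riesz_pvE x : riesz_pv j f x = (riesz_cst%:C * (pv u x +i* pv v x))%C.
Proof.
rewrite /riesz_pv /clim.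
have cl w : nice w -> lim (riesz_cst * trunc j w t x @[t --> 0^'+]) = riesz_cst * pv w x.
  move=> wn; apply: (cvg_lim (@Rhausdorff R)); apply: cvgM; first exact: cvg_cst.
  exact: cvg_trunc_pv.
have RE : (fun t => complex.Re (riesz_trunc j t f x)) = fun t => riesz_cst * trunc j u t x.
  by apply/funext => t; rewrite riesz_truncE /= mul0r subr0.
have IE : (fun t => complex.Im (riesz_trunc j t f x)) = fun t => riesz_cst * trunc j v t x.
  by apply/funext => t; rewrite riesz_truncE /= mul0r addr0.
by rewrite RE IE !cl//; simpc.
Qed.

Lemma normc_riesz_pv x : Normc.normc (riesz_pv j f x) = `|riesz_cst| * hypot (pv u x) (pv v x).
Proof. by rewrite riesz_pvE normc_real. Qed.

Lemma bdd_riesz_pv : bdd (fun x => Normc.normc (riesz_pv j f x)).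
Proof.
under eq_fun do rewrite normc_riesz_pv.
have [C [hC _]] := Qf_pv_le n2 j un; have [D [hD _]] := Qf_pv_le n2 j vn.
split.
  apply: measurable_funM => //; apply: measurable_hypot; exact: measurable_pv.
exists (`|riesz_cst| * (C + D)) => x; rewrite mulr_ge0 ?hypot_ge0//= ler_wpM2l//.
by rewrite (le_trans (hypot_le _ _))// lerD.
Qed.

(** A supremum of increasing finite maxima, the form in which a bound for finitely many kernels
    passes to the whole family by monotone convergence. *)
Definition riesz_sup x : \bar R := ereal_sup (range (fun N =>
  (run_max (fun i => op leb (fam i) (fun z => Normc.normc (riesz_pv j f z)) x) N)%:E)).

(** [kern_pv] for the real and the imaginary part, combined by [hypot_Rint]; the kernel is
    non-negative and so comes out of the modulus. *)
Lemma smooth_cutoff_le k (T : R) x : 0 < T ->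
  `|riesz_cst| * hypot (\int[leb]_z (nm n (k + n) T (sqn (x - z)) * Eb 0 (x - z) * u z))
     (\int[leb]_z (nm n (k + n) T (sqn (x - z)) * Eb 0 (x - z) * v z)) <=
  op leb (fun x z => kern (rho (k + n) T) (x - z)) (fun z => Normc.normc (riesz_pv j f z)) x.
Proof.
move=> T0; have rN := @rho_newtonian R n n2 (k + n) T T0.
have ki := @intg_kern R n n2 _ _ rN x.
have ipv w : nice w -> intg leb (fun z => kern (rho (k + n) T) (x - z) * pv w z).
  move=> wn; have [C [hC _]] := Qf_pv_le n2 j wn.
  apply: (le_intg _ _ (intgZ C ki)).
    by apply: measurable_funM; [exact: intg_measurable ki|exact: measurable_pv].
  by move=> z; rewrite normrM ger0_norm ?(kern_ge0 rN)// mulrC ler_wpM2r ?(kern_ge0 rN).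
rewrite -!(kern_pv n2 j _ rN)//.
apply: (@le_trans _ _ (`|riesz_cst| * \int[leb]_z (kern (rho (k + n) T) (x - z) * hypot (pv u z) (pv v z)))).
  rewrite ler_wpM2l// (le_trans (hypot_Rint (ipv _ un) (ipv _ vn)))//.
  rewrite le_eqVlt; apply/orP; left; apply/eqP; apply: eq_Rintegral => z _.
  by rewrite hypotZ ger0_norm// (kern_ge0 rN).
have [C [hC _]] := Qf_pv_le n2 j un; have [D [hD _]] := Qf_pv_le n2 j vn.
rewrite -RintegralZl//; last first.
  apply: (le_intg _ _ (intgZ (C + D) ki)).
    apply: measurable_funM; first exact: intg_measurable ki.
    by apply: measurable_hypot; exact: measurable_pv.
  move=> z; rewrite normrM ger0_norm ?(kern_ge0 rN)// mulrC ler_wpM2r ?(kern_ge0 rN)//.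
  by rewrite ger0_norm ?hypot_ge0// (le_trans (hypot_le _ _))// lerD.
rewrite /op le_eqVlt; apply/orP; left; apply/eqP; apply: eq_Rintegral => z _.
by rewrite normc_riesz_pv mulrCA.
Qed.

Lemma run_max_ge (a : nat -> R) i : a i <= run_max a i.+1.
Proof. by rewrite /= le_max lexx orbT. Qed.

Lemma run_max_ge0 (a : nat -> R) i : 0 <= run_max a i.
Proof. by elim: i => //= i h; rewrite le_max h. Qed.

(** Two limits in a row: at a fixed rational level the smooth cut-offs tend to [mT], then the levels
    descend to t^2. Every approximant is bounded by a single kernel of the family. *)
Lemma riesz_trunc_le_sup t x : 0 < t -> ((Normc.normc (riesz_trunc j t f x))%:E <= riesz_sup x)%E.
Proof.
move=> t0; case ES : (riesz_sup x) => [s| |]; [|by rewrite leey|]; last first.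
  have : (0%:E <= riesz_sup x)%E by apply: ereal_sup_ubound; exists 0%N.
  by rewrite ES.
have hs k a l : op leb (fun x z => kern (rho (k + n) (level a l)) (x - z))
    (fun z => Normc.normc (riesz_pv j f z)) x <= s.
  rewrite -lee_fin -ES; apply: (@le_trans _ _ (run_max (fun i => op leb (fam i)
     (fun z => Normc.normc (riesz_pv j f z)) x) (pickle (k, a, l)).+1)%:E); last first.
    by apply: ereal_sup_ubound; eexists.
  rewrite lee_fin; apply: le_trans (run_max_ge _ _).
  by rewrite /fam fam_pickle.
have h2 a l : `|riesz_cst| * hypot (\int[leb]_z (mT (level a l) (sqn (x - z)) * Eb 0 (x - z) * u z))
     (\int[leb]_z (mT (level a l) (sqn (x - z)) * Eb 0 (x - z) * v z)) <= s.
  have T0 := @level_gt0 R a l.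
  apply: (hypot_lim_le (@cvg_smooth_cutoff R n j u un _ x T0) (@cvg_smooth_cutoff R n j v vn _ x T0)).
  move=> k; exact: le_trans (smooth_cutoff_le k x T0) (hs k a l).
(* [level (a l) l] is the least multiple of 1/(l+1) exceeding t^2: strictly above it, and within
   [hrm l] of it. *)
pose a l := Num.trunc (t ^+ 2 * l.+1%:R).
have aP l : (a l)%:R <= t ^+ 2 * l.+1%:R < (a l).+1%:R.
  by apply: truncn_itv; rewrite mulr_ge0 ?ler0n// exprn_ge0// ltW.
have tT l : t ^+ 2 < level (a l) l.
  by rewrite /level ltr_pdivlMr ?ltr0n//; case/andP: (aP l).
have cT : level (a l) l @[l --> \oo] --> t ^+ 2.
  apply: (@squeeze_cvgr _ _ _ _ (fun=> t ^+ 2) (fun l => t ^+ 2 + hrm l)).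
  - apply: nearW => l; rewrite (ltW (tT l))/= /level ler_pdivrMr ?ltr0n//.
    rewrite mulrDl /hrm mulVf ?pnatr_eq0// -natr1 lerD2r; by case/andP: (aP l).
  - exact: cvg_cst.
  - rewrite -[X in _ --> X]addr0; apply: cvgD; [exact: cvg_cst|exact: cvg_hrm].
rewrite riesz_truncE normc_real lee_fin.
apply: (hypot_lim_le (@cvg_sharp_cutoff R n j u un _ _ x t0 tT cT)
  (@cvg_sharp_cutoff R n j v vn _ _ x t0 tT cT)).
by move=> l; exact: h2.
Qed.

End schwartz.
End riesz_bound.

(** * Passage to the limit in L^p *)

Section extended_powers.
Context {R : realType}.
Local Open Scope ereal_scope.
Implicit Types (x y c : \bar R) (p : R) (u v : nat -> \bar R).

Lemma le_poweR p x y : (0 < p)%R -> 0 <= x -> x <= y -> x `^ p <= y `^ p.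
Proof.
by move=> p0 x0 xy; apply: gt0_ler_poweR; rewrite ?(ltW p0)// in_itv/= leey andbT// (le_trans x0).
Qed.

Lemma poweRK p x : (0 < p)%R -> 0 <= x -> (x `^ p) `^ p^-1 = x.
Proof. by move=> p0 x0; rewrite -poweRrM mulfV ?gt_eqF// poweRe1. Qed.

Lemma poweRVK p x : (0 < p)%R -> 0 <= x -> (x `^ p^-1) `^ p = x.
Proof. by move=> p0 x0; rewrite -poweRrM mulVf ?gt_eqF// poweRe1. Qed.

Lemma poweR_le_root p x y : (0 < p)%R -> 0 <= x -> 0 <= y -> (x `^ p <= y) = (x <= y `^ p^-1).
Proof.
move=> p0 x0 y0; apply/idP/idP => h.
  by rewrite -(poweRK p0 x0); apply: le_poweR => //; rewrite ?invr_gt0// poweR_ge0.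
by rewrite -(poweRVK p0 y0); exact: le_poweR.
Qed.

Lemma poweR_ereal_sup p u : (0 < p)%R -> (forall k, 0 <= u k) ->
  ereal_sup (range u) `^ p = ereal_sup (range (fun k => u k `^ p)).
Proof.
move=> p0 u0; apply/eqP; rewrite eq_le; apply/andP; split; last first.
  apply: ge_ereal_sup => _ [k _ <-]; apply: le_poweR => //.
  by apply: ereal_sup_ubound; exists k.
have s0 : 0 <= ereal_sup (range u) by apply: (le_trans (u0 0%N)); apply: ereal_sup_ubound; exists 0%N.
have t0 : 0 <= ereal_sup (range (fun k => u k `^ p)).
  by apply: (le_trans (poweR_ge0 (u 0%N) p)); apply: ereal_sup_ubound; exists 0%N.
rewrite poweR_le_root//; apply: ge_ereal_sup => _ [k _ <-].
by rewrite -poweR_le_root//; apply: ereal_sup_ubound; exists k.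
Qed.

Lemma einfs_le_limn_einf u k : einfs u k <= limn_einf u.
Proof.
rewrite limn_einf_lim; apply: lime_ge; first exact: is_cvg_einfs.
by near=> l; apply: nondecreasing_einfs; near: l; exact: nbhs_infty_ge.
Unshelve. all: by end_near.
Qed.

Lemma einfs_le u k l : (k <= l)%N -> einfs u k <= u l.
Proof. by move=> kl; apply: ereal_inf_lbound; exists l. Qed.

Lemma limn_einf_le u c : (forall k, u k <= c) -> limn_einf u <= c.
Proof.
move=> h; rewrite limn_einf_lim; apply: lime_le; first exact: is_cvg_einfs.
by apply: nearW => k; exact: le_trans (einfs_le u (leqnn k)) (h k).
Qed.

Lemma le_limn_einf u v : (forall k, u k <= v k) -> limn_einf u <= limn_einf v.
Proof.
move=> h; rewrite [leLHS]limn_einf_lim; apply: lime_le; first exact: is_cvg_einfs.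
apply: nearW => k; apply: le_trans (einfs_le_limn_einf v k).
by apply: le_ereal_inf_tmp => _ [l kl <-]; exact: le_trans (einfs_le _ kl) (h l).
Qed.

Lemma limn_einf_ge0 u : (forall k, 0 <= u k) -> 0 <= limn_einf u.
Proof.
move=> h; apply: le_trans (einfs_le_limn_einf u 0).
by apply: le_ereal_inf_tmp => _ [l _ <-].
Qed.

Lemma poweR_limn_einf p u : (0 < p)%R -> (forall k, 0 <= u k) ->
  limn_einf u `^ p <= limn_einf (fun k => u k `^ p).
Proof.
move=> p0 u0; rewrite poweR_le_root ?limn_einf_ge0// => [|k]; last exact: poweR_ge0.
rewrite [leLHS]limn_einf_lim; apply: lime_le; first exact: is_cvg_einfs.
apply: nearW => k; have e0 : 0 <= einfs u k by apply: le_ereal_inf_tmp => _ [l _ <-].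
rewrite -poweR_le_root ?limn_einf_ge0// => [|l]; last exact: poweR_ge0.
apply: le_trans (einfs_le_limn_einf _ k); apply: le_ereal_inf_tmp => _ [l kl <-].
by apply: le_poweR => //; exact: einfs_le.
Qed.

End extended_powers.

Section norms.
Context d (T : measurableType d) {R : realType} (mu : {measure set T -> \bar R}).
Local Open Scope ereal_scope.

(** Directly from the supremum over simple functions below. It is meant for [riesz_max j f], a
    supremum over uncountably many radii whose measurability is not established. *)
Lemma ge0_le_integralT (f g : T -> \bar R) : (forall x, 0 <= f x) -> (forall x, f x <= g x) ->
  \int[mu]_x f x <= \int[mu]_x g x.
Proof.
move=> f0 fg; rewrite !ge0_integralTE// => [|x]; last exact: le_trans (f0 x) (fg x).
by apply: le_ereal_sup => _ [h fh <-]; exists h => // x; exact: le_trans (fh x) (fg x).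
Qed.

Lemma LnormE (p : R) (f : T -> \bar R) : 'N[mu]_p%:E[f] = (\int[mu]_x `|f x| `^ p) `^ p^-1.
Proof. by rewrite Lnorm.unlock. Qed.

Lemma le_LnormT (p : R) (f g : T -> \bar R) : (0 < p)%R -> (forall x, `|f x| <= `|g x|) ->
  'N[mu]_p%:E[f] <= 'N[mu]_p%:E[g].
Proof.
move=> p0 fg; rewrite !LnormE; apply: le_poweR; rewrite ?invr_gt0//.
  by apply: integral_ge0 => x _; exact: poweR_ge0.
by apply: ge0_le_integralT => x; [exact: poweR_ge0|exact: le_poweR].
Qed.

Lemma integral_sup_powR_le (p : R) (u : nat -> T -> R) c : (0 < p)%R ->
  (forall k, measurable_fun setT (u k)) -> (forall k x, (0 <= u k x)%R) ->
  (forall k x, (u k x <= u k.+1 x)%R) ->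
  (forall k, \int[mu]_x (u k x `^ p)%:E <= c) ->
  measurable_fun setT (fun x => ereal_sup (range (fun k => (u k x)%:E)) `^ p) /\
  \int[mu]_x (ereal_sup (range (fun k => (u k x)%:E)) `^ p) <= c.
Proof.
move=> p0 mu_ u0 uS h.
have E : (fun x => ereal_sup (range (fun k => (u k x)%:E)) `^ p) =
    fun x => limn (fun k => (u k x `^ p)%:E).
  apply/funext => x; rewrite poweR_ereal_sup// => [|k]; last by rewrite lee_fin.
  apply/esym; apply: cvg_lim => //.
  apply: ereal_nondecreasing_cvgn; apply/nondecreasing_seqP => k.
  by rewrite lee_fin ge0_ler_powR ?nnegrE// ltW.
have mp k : measurable_fun setT (fun x => (u k x `^ p)%:E).
  by apply/measurable_EFinP; apply: (measurableT_comp (@measurable_powR R p)).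
have nd x : {homo (fun k => (u k x `^ p)%:E) : k l / (k <= l)%N >-> k <= l}.
  by apply/nondecreasing_seqP => k; rewrite lee_fin ge0_ler_powR ?nnegrE// ltW.
have cv x : cvgn (fun k => (u k x `^ p)%:E) by apply: ereal_nondecreasing_is_cvgn; exact: nd.
rewrite E; split.
  apply: (@emeasurable_fun_cvg _ _ _ setT (fun k x => (u k x `^ p)%:E)) => // x _; exact: cv.
rewrite (@monotone_convergence _ _ _ mu setT measurableT (fun k x => (u k x `^ p)%:E))//.
- apply: lime_le; last exact: nearW.
  apply: ereal_nondecreasing_is_cvgn; apply/nondecreasing_seqP => k.
  apply: ge0_le_integralT => x; first by rewrite lee_fin powR_ge0.
  by rewrite lee_fin ge0_ler_powR ?nnegrE// ltW.
- by move=> k x _; rewrite lee_fin powR_ge0.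
Qed.

End norms.

Lemma integral_subl_eq {R : realType} n (x : 'rV[R]_n) (F G : 'rV[R]_n -> \bar R) :
  measurable_fun setT G -> (forall w, 0 <= G w)%E -> (forall z, F z = G (x - z)) ->
  (\int[@lebesgue_rV R n]_z F z = \int[@lebesgue_rV R n]_w G w)%E.
Proof.
move=> mG G0 FG; rewrite -(ge0_integral_subl x mG G0).
by apply: eq_integral => z _; exact: FG.
Qed.

(** * Continuity of the truncations on L^p *)

Section Lp.
Context {R : realType}.
Variable n : nat.
Local Notation leb := (@lebesgue_rV R n).
Variable p : R.
Hypothesis p1 : 1 < p.
Let p0 : 0 < p. Proof. exact: lt_trans p1. Qed.
Implicit Types (f g h : 'rV[R]_n -> R[i]).

Lemma normc_hypot (z : R[i]) : Normc.normc z = hypot (complex.Re z) (complex.Im z).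
Proof. by case: z. Qed.

Lemma measurable_normc f : cmeasurable f -> measurable_fun setT (fun x => Normc.normc (f x)).
Proof.
move=> [mr mi]; under eq_fun do rewrite normc_hypot.
exact: measurable_hypot.
Qed.

Lemma cmeasurableB f g : cmeasurable f -> cmeasurable g -> cmeasurable (fun x => f x - g x).
Proof.
move=> [fr fi] [gr gi]; split.
  by under eq_fun do rewrite raddfB; exact: measurable_funB.
by under eq_fun do rewrite raddfB; exact: measurable_funB.
Qed.

Lemma Lnorm_Re_le f : ('N[leb]_p%:E[(fun x => (complex.Re (f x))%:E)] <= cLnorm p f)%E.
Proof.
apply: le_LnormT => // x; rewrite !abse_EFin lee_fin normc_hypot [leRHS]ger0_norm ?hypot_ge0//.
by case: (norm_le_hypot (complex.Re (f x)) (complex.Im (f x))).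
Qed.

Lemma Lnorm_Im_le f : ('N[leb]_p%:E[(fun x => (complex.Im (f x))%:E)] <= cLnorm p f)%E.
Proof.
apply: le_LnormT => // x; rewrite !abse_EFin lee_fin normc_hypot [leRHS]ger0_norm ?hypot_ge0//.
by case: (norm_le_hypot (complex.Re (f x)) (complex.Im (f x))).
Qed.

Lemma cLnorm_le_add f g : cmeasurable f -> cmeasurable g ->
  (cLnorm p f <= cLnorm p (fun x => f x - g x)%R + cLnorm p g)%E.
Proof.
move=> mf mg; have mfg := cmeasurableB mf mg.
have := minkowski_EFin leb (measurable_normc mfg) (measurable_normc mg) (ltW p1).
apply: le_trans; apply: le_LnormT => // x; rewrite !abse_EFin lee_fin /=.
rewrite !ger0_norm ?addr_ge0 ?normc_hypot ?hypot_ge0//.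
by rewrite -!normc_hypot -{1}(subrK (g x) (f x)); exact: (@le_normcD R (f x - g x) (g x)).
Qed.

Variable j : 'I_n.
Hypothesis n0 : (0 < n)%N.

Definition cutoff (t : R) (x z : 'rV[R]_n) : R := (t < enorm (x - z))%R%:R * Eb j 0 (x - z).

Lemma measurable_cutoff t x : measurable_fun setT (cutoff t x).
Proof.
apply: measurable_funM.
  apply: (measurableT_comp (measurable_gt_enorm t)); exact: measurable_subl_rV.
by apply: measurable_Eb_comp => //; exact: measurable_subl_rV.
Qed.

Lemma cutoff_tail_le (t q : R) (w : 'rV[R]_n) : 0 < q ->
  ((`|(t < enorm w)%R%:R * Eb j 0 w| `^ q)%:E <=
   ((fun w : 'rV[R]_n => (((enorm w)^-1 ^+ n) `^ q)%:E) \_ [set w | (t < enorm w)%R]) w)%E.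
Proof.
move=> q0; rewrite patchE; have [h|h] := boolP (t < enorm w).
  rewrite mem_set; last exact: h.
  rewrite lee_fin mul1r; apply: ge0_ler_powR (ltW q0) _ _ _ _ (Eb0_le _ _); rewrite nnegrE//.
  by rewrite exprn_ge0// invr_ge0 enorm_ge0.
by rewrite memNset; [rewrite mul0r normr0 powR0// gt_eqF|exact/negP].
Qed.

Lemma cutoff_powR_lty (t q : R) : 0 < t -> 1 < q ->
  exists C, forall x, (\int[leb]_z (`|cutoff t x z| `^ q)%:E <= C%:E)%E.
Proof.
move=> t0 q1; have q0 : 0 < q by exact: lt_trans q1.
pose G (w : 'rV[R]_n) : R := `|(t < enorm w)%R%:R * Eb j 0 w| `^ q.
have mG : measurable_fun setT (fun w => (G w)%:E).
  apply/measurable_EFinP; apply: (measurableT_comp (@measurable_powR R q)).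
  apply: measurableT_comp => //; apply: measurable_funM; first exact: measurable_gt_enorm.
  by apply: measurable_Eb_comp.
have G0 w : (0 <= (G w)%:E)%E by rewrite lee_fin powR_ge0.
have E x : (\int[leb]_z (`|cutoff t x z| `^ q)%:E = \int[leb]_w (G w)%:E)%E.
  exact: (@integral_subl_eq R n x _ _ mG G0 (fun z => erefl)).
have le := ge0_le_integralT leb G0 (fun w => cutoff_tail_le t w q0).
have lt := enormV_powR_tail_lty t0 q1 n0; rewrite integral_mkcond in lt.
have {}lt := le_lt_trans le lt.
have I0 : (0 <= \int[leb]_w (G w)%:E)%E by apply: integral_ge0 => w _; exact: G0.
exists (fine (\int[leb]_w (G w)%:E)%E) => x; rewrite (E x) fineK; first exact: lexx.
by rewrite ge0_fin_numE.
Qed.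

(** Away from its singularity the Riesz kernel lies in L^q for the conjugate exponent
    [q = p / (p - 1)], with a norm bounded independently of [x]. *)
Lemma cutoff_hoelder (t : R) : 0 < t -> exists2 C, 0 <= C & forall x (h : 'rV[R]_n -> R),
  measurable_fun setT h ->
  (\int[leb]_z `|cutoff t x z * h z|%:E <= C%:E * 'N[leb]_p%:E[(fun z => (h z)%:E)])%E.
Proof.
move=> t0; pose q := p / (p - 1).
have d0 : 0 < p - 1 by rewrite subr_gt0.
have q1 : 1 < q by rewrite /q ltr_pdivlMr// mul1r ltrBlDr ltrDl.
have q0 : 0 < q by exact: lt_trans q1.
have pq : q^-1 + p^-1 = 1 by rewrite /q; field; rewrite !gt_eqF.
have [C hC] := cutoff_powR_lty t0 q1.
exists (C `^ q^-1) => [|x h mh]; first exact: powR_ge0.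
have := hoelder leb (measurable_cutoff t x) mh q0 p0 pq; rewrite Lnorm1 => H.
apply: (le_trans H); apply: lee_wpmul2r; first exact: Lnorm_ge0.
rewrite LnormE -poweR_EFin; apply: le_poweR; rewrite ?invr_gt0//.
  by apply: integral_ge0 => z _; exact: poweR_ge0.
by apply: le_trans (hC x); rewrite le_eqVlt; apply/orP; left.
Qed.

Lemma cutoff_intg (t : R) x (h : 'rV[R]_n -> R) : 0 < t -> measurable_fun setT h ->
  ('N[leb]_p%:E[(fun z => (h z)%:E)] < +oo)%E -> intg leb (fun z => cutoff t x z * h z).
Proof.
move=> t0 mh hlt; have [C C0 hC] := cutoff_hoelder t0.
have m : measurable_fun setT (fun z => cutoff t x z * h z).
  by apply: measurable_funM => //; exact: measurable_cutoff.
apply/integrableP; split; first exact/measurable_EFinP.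
apply: le_lt_trans (hC x h mh) _.
by rewrite lte_mul_pinfty// ?ge0_fin_numE ?Lnorm_ge0 ?lee_fin.
Qed.

End Lp.

Section maximal_Lp_bound.
Context {R : realType}.
Variable n : nat.
Hypothesis n2 : (2 <= n)%N.
Local Notation leb := (@lebesgue_rV R n).
Variables (p : R) (j : 'I_n).
Hypothesis p2 : 2 <= p.
Let p1 : 1 < p. Proof. by apply: lt_le_trans p2; rewrite ltr1n. Qed.
Let p0 : 0 < p. Proof. exact: lt_trans p1. Qed.
Let n0 : (0 < n)%N. Proof. exact: ltn_trans n2. Qed.

Lemma cvg_trunc_Lp t x (u : nat -> 'rV[R]_n -> R) (v : 'rV[R]_n -> R) : 0 < t ->
  (forall k, nice (u k)) -> measurable_fun setT v ->
  ('N[leb]_p%:E[(fun z => (v z)%:E)] < +oo)%E ->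
  'N[leb]_p%:E[(fun z => (u k z - v z)%:E)]%E @[k --> \oo] --> 0%E ->
  trunc j (u k) t x @[k --> \oo] --> trunc j v t x.
Proof.
move=> t0 un mv vlt /fine_cvgP[fin0 cv].
have [C C0 hC] := cutoff_hoelder p1 j n0 t0.
(* [C] may be 0, hence the division by [C + 1]. *)
have C1 : 0 < C + 1 by rewrite ltr_wpDl.
have iv := cutoff_intg p1 j n0 x t0 mv vlt.
have iu k : intg leb (fun z => cutoff j t x z * u k z) by exact: trunc_intg.
have le k : 'N[leb]_p%:E[(fun z => (u k z - v z)%:E)]%E \is a fin_num ->
    `|trunc j v t x - trunc j (u k) t x| <= C * fine ('N[leb]_p%:E[(fun z => (u k z - v z)%:E)])%E.
  move=> fk; have iD := intgB (iu k) iv.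
  have D : trunc j (u k) t x - trunc j v t x = \int[leb]_z (cutoff j t x z * u k z - cutoff j t x z * v z).
    exact: esym (RintegralB measurableT (iu k) iv).
  rewrite distrC D (le_trans (le_normr_Rintegral measurableT iD))// -lee_fin.
  rewrite (Rint_intg (intg_norm iD)) EFinM fineK//.
  have mD : measurable_fun setT (fun z => u k z - v z).
    by apply: measurable_funB => //; exact: nice_measurable (un k).
  apply: le_trans (hC x _ mD); rewrite le_eqVlt; apply/orP; left; apply/eqP.
  by apply: eq_integral => z _; rewrite mulrBr.
apply/cvgrPdist_le => e e0.
have /cvgrPdist_le/(_ _ (divr_gt0 e0 C1)) cv' := cv.
near=> k; apply: le_trans (le k _) _; first by near: k.
have : `|0 - (fine \o (fun k => 'N[leb]_p%:E[(fun z => (u k z - v z)%:E)]%E)) k| <= e / (C + 1) by near: k.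
rewrite sub0r normrN /= ger0_norm ?fine_ge0 ?Lnorm_ge0// => h.
apply: (le_trans (ler_wpM2l C0 h)); rewrite mulrCA ler_piMr ?(ltW e0)//.
by rewrite ler_pdivrMr// mul1r lerDl.
Unshelve. all: by end_near. Qed.

Lemma cmeasurable_riesz_pv (f : 'rV[R]_n -> R[i]) : schwartz f -> cmeasurable (riesz_pv j f).
Proof.
move=> sf; have [su sv] := sf.
have RE : (fun x => complex.Re (riesz_pv j f x)) = fun x => @riesz_cst R n * pv j (fun y => complex.Re (f y)) x.
  by apply/funext => x; rewrite riesz_pvE//= mul0r subr0.
have IE : (fun x => complex.Im (riesz_pv j f x)) = fun x => @riesz_cst R n * pv j (fun y => complex.Im (f y)) x.
  by apply/funext => x; rewrite riesz_pvE//= mul0r addr0.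
split; rewrite ?RE ?IE; apply: measurable_funM => //; apply: measurable_pv; exact: schwartz_nice.
Qed.

Lemma riesz_sup_Lp (f : 'rV[R]_n -> R[i]) B : schwartz f -> 0 <= B -> (cLnorm p (riesz_pv j f) <= B%:E)%E ->
  measurable_fun setT (fun x => riesz_sup j f x `^ p)%E /\
  (\int[leb]_x (riesz_sup j f x `^ p) <= (4 * B `^ p)%:E)%E.
Proof.
move=> sf B0 hB; have bg := bdd_riesz_pv n2 j sf.
set g := fun x => Normc.normc (riesz_pv j f x) in bg.
have bu N : bdd (fun x => run_max (fun i => op leb (fam i) g x) N).
  exact: (bdd_run_max N (@fam_markov R n n2) bg).
apply: (@integral_sup_powR_le _ _ R leb p (fun N x => run_max (fun i => op leb (fam i) g x) N)) => //.
- by move=> N; exact: bdd_measurable (bu N).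
- by move=> N x; exact: run_max_ge0.
- by move=> N x; rewrite /= le_max lexx.
move=> N; apply: le_trans (@maximal_Lp _ _ _ _ _ N (@fam_markov R n n2) (@fam_conv R n n2) _ _ p2 bg) _.
rewrite EFinM; apply: lee_wpmul2l; first by rewrite lee_fin.
have -> : (\int[leb]_x (g x `^ p)%:E = cLnorm p (riesz_pv j f) `^ p)%E.
  rewrite /cLnorm poweR_Lnorm ?gt_eqF//; apply: eq_integral => x _.
  by rewrite abse_EFin ger0_norm// normc_hypot hypot_ge0.
by rewrite -poweR_EFin; apply: le_poweR => //; exact: Lnorm_ge0.
Qed.

Lemma riesz_max_ge0 f x : (0 <= @riesz_max R n j f x)%E.
Proof.
apply: (@le_trans _ _ (Normc.normc (riesz_trunc j 1 f x))%:E).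
  by rewrite lee_fin normc_hypot hypot_ge0.
by apply: ereal_sup_ubound; exists 1 => //=.
Qed.

Section limit.
Variables (f : 'rV[R]_n -> R[i]) (fn : nat -> 'rV[R]_n -> R[i]).
Hypotheses (fp : in_Lp p f) (sfn : forall k, schwartz (fn k)) (cfn : cvg_Lp p fn f).

Let cvg_part (P : R[i] -> R) (t : R) x : 0 < t -> {morph P : a b / a - b} ->
  (forall k, nice (fun y => P (fn k y))) -> measurable_fun setT (fun y => P (f y)) ->
  (forall h, 'N[leb]_p%:E[(fun y => (P (h y))%:E)] <= cLnorm p h)%E ->
  trunc j (fun y => P (fn k y)) t x @[k --> \oo] --> trunc j (fun y => P (f y)) t x.
Proof.
move=> t0 PB nP mP leP; apply: cvg_trunc_Lp => //.
  by apply: le_lt_trans (leP f) _; case: fp.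
apply: (squeeze_cvge _ (cvg_cst 0%E) cfn); apply: nearW => k; rewrite Lnorm_ge0/=.
apply: le_trans (leP _); rewrite le_eqVlt; apply/orP; left; apply/eqP; congr Lnorm.body.
by apply/funext => y; rewrite PB.
Qed.

Lemma cvg_riesz_trunc (t : R) x : 0 < t ->
  Normc.normc (riesz_trunc j t (fn k) x) @[k --> \oo] --> Normc.normc (riesz_trunc j t f x).
Proof.
move=> t0; under eq_fun do rewrite riesz_truncE normc_real.
rewrite riesz_truncE normc_real; apply: cvgM; first exact: cvg_cst.
have [[mr mi] _] := fp.
apply: cvg_hypot; apply: cvg_part => //.
- exact: raddfB.
- by move=> k; apply: schwartz_nice; case: (sfn k).
- by move=> h; apply: Lnorm_Re_le.
- exact: raddfB.
- by move=> k; apply: schwartz_nice; case: (sfn k).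
- by move=> h; apply: Lnorm_Im_le.
Qed.

(** At a fixed radius the truncations of [fn k] converge pointwise and each is at most
    [riesz_sup j (fn k) x]; the supremum over radii is taken only after the limit in [k]. *)
Lemma riesz_max_le_liminf x : (riesz_max j f x <= limn_einf (fun k => riesz_sup j (fn k) x))%E.
Proof.
apply: ge_ereal_sup => _ [t t0 <-].
have c : (Normc.normc (riesz_trunc j t (fn k) x))%:E @[k --> \oo] --> (Normc.normc (riesz_trunc j t f x))%:E.
  by apply: cvg_EFin; [exact: nearW|exact: cvg_riesz_trunc].
have [<- _] := cvg_limn_einf_sup c.
by apply: le_limn_einf => k; exact: riesz_trunc_le_sup.
Qed.

Lemma riesz_max_Lp B : 0 <= B -> (forall k, (cLnorm p (riesz_pv j (fn k)) <= B%:E)%E) ->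
  ('N[leb]_p%:E[riesz_max j f] <= (4 `^ p^-1 * B)%:E)%E.
Proof.
move=> B0 hB.
have -> : (4 `^ p^-1 * B)%:E = ((4 * B `^ p)%:E `^ p^-1)%E.
  rewrite poweR_EFin powRM ?powR_ge0//; congr (_ * _)%:E.
  by rewrite -powRrM mulfV ?gt_eqF// powRr1.
have i0 : (0 <= \int[leb]_x (`|riesz_max j f x| `^ p))%E.
  by apply: integral_ge0 => x _; exact: poweR_ge0.
rewrite LnormE; apply: le_poweR => //; first by rewrite invr_gt0.
have S0 k x : (0 <= riesz_sup j (fn k) x)%E by apply: ereal_sup_ubound; exists 0%N.
apply: (@le_trans _ _ (\int[leb]_x limn_einf (fun k => riesz_sup j (fn k) x `^ p))%E).
  apply: ge0_le_integralT => x; first exact: poweR_ge0.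
  apply: le_trans (poweR_limn_einf p0 (S0 ^~ x)); rewrite gee0_abs ?riesz_max_ge0//.
  by apply: le_poweR => //; [exact: riesz_max_ge0|exact: riesz_max_le_liminf].
apply: (le_trans (@fatou _ _ _ leb setT measurableT (fun k x => riesz_sup j (fn k) x `^ p)%E _ _)).
- by move=> k; case: (riesz_sup_Lp (sfn k) B0 (hB k)).
- by move=> k x _; exact: poweR_ge0.
- by apply: limn_einf_le => k; case: (riesz_sup_Lp (sfn k) B0 (hB k)).
Qed.

End limit.
End maximal_Lp_bound.

Theorem theorem4 (R : realType) (d : nat) (hd : (2 <= d)%N) (p : R)
  (hp : 2 <= p) (j : 'I_d) (f : 'rV[R]_d -> R[i]) (hf : in_Lp p f)
  (Rjf : 'rV[R]_d -> R[i]) (hRjf : riesz_transform p j f Rjf) :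
  ('N[@lebesgue_rV R d]_(p%:E)[riesz_max j f] <=
     ((2 + 1 / Num.sqrt 2) `^ (2 / p))%:E * cLnorm p Rjf)%E.
Proof.
have p1 : 1 < p by apply: lt_le_trans hp; rewrite ltr1n.
have p0 : 0 < p by exact: lt_trans p1.
have [_ [[mR RL] [fn [sfn cfn cR]]]] := hRjf.
have R0 : (0 <= cLnorm p Rjf)%E by exact: Lnorm_ge0.
have Rfin : cLnorm p Rjf \is a fin_num by rewrite ge0_fin_numE.
pose A := fine (cLnorm p Rjf); have A0 : 0 <= A by exact: fine_ge0.
have AE : cLnorm p Rjf = A%:E by rewrite fineK.
pose c := 4 `^ p^-1 : R; have c0 : 0 < c by rewrite powR_gt0.
have cle : c <= (2 + 1 / Num.sqrt 2) `^ (2 / p).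
  (* As 4^(1/p) = 2^(2/p), it remains to compare the bases 2 and 2 + 1 / sqrt 2. *)
  rewrite /c (_ : 4 = 2 `^ 2 :> R); last by rewrite powR_mulrn// -natrX.
  rewrite -powRrM ge0_ler_powR ?nnegrE ?divr_ge0 ?addr_ge0 ?invr_ge0 ?sqrtr_ge0 ?(ltW p0)//.
  by rewrite lerDl divr_ge0 ?sqrtr_ge0.
apply: (@le_trans _ _ (c * A)%:E); last by rewrite AE -EFinM lee_fin ler_wpM2r.
(* The norms of the approximating transforms are at most that of [Rjf] only up to a slack [e / c],
   and only from some index [N] on; the sequence is therefore shifted by [N]. *)
apply/lee_addgt0Pr => e e0; rewrite -EFinD.
have [N hN] : exists N, forall k, (cLnorm p (riesz_pv j (fn (k + N)%N)) <= (A + e / c)%:E)%E.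
  have /fine_cvgP[fin0 /cvgrPdist_le/(_ _ (divr_gt0 e0 c0)) cv] := cR.
  have [N _ hN] := filterI fin0 cv; exists N => k.
  have [fk] := hN (k + N)%N (leq_addl k N).
  rewrite sub0r normrN /= ger0_norm ?fine_ge0 ?Lnorm_ge0// => h.
  apply: le_trans (cLnorm_le_add p1 (cmeasurable_riesz_pv hd j (sfn _)) mR) _.
  by rewrite AE addrC EFinD leeD2l// -(fineK fk) lee_fin.
have -> : c * A + e = c * (A + e / c) by rewrite mulrDr mulrCA divff ?mulr1// gt_eqF.
apply: (riesz_max_Lp hd hp (fn := fun k => fn (k + N)%N)) => //.
  by have := cfn; rewrite /cvg_Lp -(cvg_shiftn N).
by rewrite addr_ge0// divr_ge0// ltW.
Qed.
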